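(* A homogeneous Lagrangian foliation on a complex space form is holomorphically congruent to a Lagrangian affine subspace foliation on $\mathbb{C}^n$ or to a Lagrangian horocycle foliation on $\mathbb{C}\mathrm{H}^n$.
   Context: A complex space form is a complete simply connected Kähler manifold with constant holomorphic sectional curvature: a complex Euclidean space $\mathbb{C}^n$ (curvature $0$), a complex projective space $\mathbb{C}\mathrm{P}^n$ (positive curvature), or a complex hyperbolic space $\mathbb{C}\mathrm{H}^n$ (negative curvature); $n$ is the complex dimension. A submanifold $N$ of a Kähler manifold $(M,g,J)$ is Lagrangian if the symplectic form $\omega(X,Y)=g(X,JY)$ vanishes on $TN$ and the dimension of $N$ is half the (real) dimension of $M$; equivalently, $J T_pN=\nu_pN$ for all $p\in N$, where $\nu_pN$ is the normal space (orthogonal complement of $T_pN$ in $T_pM$). A real subspace $W$ of a Hermitian vector space with complex structure $J$ is Lagrangian if $JW=W^\perp$ with respect to the underlying real inner product. A foliation on a Kähler manifold $M$ is homogeneous if it is the family of orbits of an action on $M$ of a connected Lie group of automorphisms of the Kähler structure of $M$, that is, of holomorphic isometries of $M$. It is Lagrangian if all its leaves are Lagrangian submanifolds. Two foliations are holomorphically congruent if some holomorphic isometry between the ambient spaces maps the leaves of one onto the leaves of the other. A Lagrangian affine subspace foliation on $\mathbb{C}^n$ is the orbit foliation of the action of the group of translations of $\mathbb{C}^n$ by the vectors of a Lagrangian subspace $V\cong\mathbb{R}^n$ of $\mathbb{C}^n$. Lagrangian horocycle foliation on $\mathbb{C}\mathrm{H}^n$: write $\mathbb{C}\mathrm{H}^n=G/K$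 with $G=\mathsf{SU}(1,n)$ and $K=\mathsf{S}(\mathsf{U}(1)\times\mathsf{U}(n))\cong\mathsf{U}(n)$ the isotropy group at a point $o$. Let $\mathfrak{g}=\mathfrak{su}(1,n)=\mathfrak{k}\oplus\mathfrak{p}$ be the corresponding Cartan decomposition ($\mathfrak{k}$ is the Lie algebra of $K$ and $\mathfrak{p}$ is the orthogonal complement of $\mathfrak{k}$ in $\mathfrak{g}$ for the Killing form), let $\mathfrak{a}$ be a maximal abelian subspace of $\mathfrak{p}$ (it is 1-dimensional), and let $\mathfrak{g}=\mathfrak{g}_{-2\alpha}\oplus\mathfrak{g}_{-\alpha}\oplus\mathfrak{g}_0\oplus\mathfrak{g}_\alpha\oplus\mathfrak{g}_{2\alpha}$ be the restricted root space decomposition, where $\mathfrak{g}_\lambda=\{X\in\mathfrak{g}:[A,X]=\lambda(A)X\text{ for all }A\in\mathfrak{a}\}$ for $\lambda\in\mathfrak{a}^*$. Put $\mathfrak{n}=\mathfrak{g}_\alpha\oplus\mathfrak{g}_{2\alpha}$. The connected subgroup $AN$ of $G$ with Lie algebra $\mathfrak{a}\oplus\mathfrak{n}$ acts simply transitively on $\mathbb{C}\mathrm{H}^n$, so $X\mapsto \frac{d}{dt}|_{t=0}\exp(tX)(o)$ is a linear isomorphism $\mathfrak{a}\oplus\mathfrak{n}\cong T_o\mathbb{C}\mathrm{H}^n$, by which the inner product and the complex structure $J$ of $T_o\mathbb{C}\mathrm{H}^n$ are transported to $\mathfrak{a}\oplus\mathfrak{n}$. The subspace $\mathfrak{g}_\alpha$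 is then $J$-invariant, a complex vector space of dimension $n-1$. Let $\mathfrak{l}$ be a Lagrangian subspace of $\mathfrak{g}_\alpha\cong\mathbb{C}^{n-1}$ (that is, $J\mathfrak{l}$ is the orthogonal complement of $\mathfrak{l}$ in $\mathfrak{g}_\alpha$), define $\mathfrak{h}=\mathfrak{l}\oplus\mathfrak{g}_{2\alpha}$, and let $H$ be the connected Lie subgroup of $\mathsf{SU}(1,n)$ with Lie algebra $\mathfrak{h}$. The foliation induced by $H$ on $\mathbb{C}\mathrm{H}^n$ (by the orbits of $H$) is called the Lagrangian horocycle foliation.
   Formalization: The complex dimension n is assumed at least 1, and at least 2 for complex hyperbolic space: on CH^1 the claim fails, since the orbits of the transvections along a geodesic form a homogeneous Lagrangian foliation not congruent to a horocycle foliation. *)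

(* Defs.v *)
From HB Require Import structures.
From mathcomp Require Import all_boot all_order all_algebra.
From mathcomp Require Import complex spectral.
From mathcomp Require Import all_classical all_reals all_analysis.

Set Implicit Arguments.
Unset Strict Implicit.
Unset Printing Implicit Defensive.

Import Order.TTheory GRing.Theory Num.Theory.
Import numFieldNormedType.Exports.

Local Open Scope classical_set_scope.
Local Open Scope ring_scope.
Local Open Scope sesquilinear_scope.

(** * Smooth maps and submanifolds of normed spaces

    All normed spaces below are finite-dimensional.  There, for [k > 0], a map
    is C^k on an open set iff its directional derivatives exist and are
    C^(k-1). *)

Fixpoint Ck (R : realType) (E F : normedModType R) (k : nat) (U : set E)
    (f : E -> F) : Prop :=
  if k is k'.+1 then
    forall v : E, (forall x, U x -> derivable f x v) /\ Ck k' U ('D_v f)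
  else forall x, U x -> {for x, continuous f}.

Definition smooth_on (R : realType) (E F : normedModType R) (U : set E)
    (f : E -> F) : Prop :=
  open U /\ forall k, Ck k U f.

(* Smoothness on an arbitrary subset: local existence of smooth extensions. *)
Definition smooth_map (R : realType) (E F : normedModType R) (A : set E)
    (f : E -> F) : Prop :=
  forall a, A a -> exists (U : set E) (g : E -> F),
    [/\ U a, smooth_on U g & forall x, U x -> A x -> g x = f x].

Definition submanifold (R : realType) (E : normedModType R) (d : nat)
    (A : set E) : Prop :=
  forall a, A a -> exists (U : set E) (W : set 'rV[R]_d)
      (phi : 'rV[R]_d -> E) (psi : E -> 'rV[R]_d),
    [/\ U a, smooth_on W phi, smooth_on U psi,
        forall x, W x -> [/\ U (phi x), A (phi x) & psi (phi x) = x]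
      & forall y, U y -> A y -> W (psi y) /\ phi (psi y) = y].

(* Germ at time 0 of a smooth curve of [A] issued from [p]. *)
Definition curve (R : realType) (E : normedModType R) (A : set E) (p : E)
    (gamma : R -> E) : Prop :=
  gamma 0 = p /\ exists U : set R^o,
    [/\ U 0, smooth_on U (gamma : R^o -> E) & forall t, U t -> A (gamma t)].

Definition tangent (R : realType) (E : normedModType R) (A : set E) (p : E) :
    set E :=
  [set derive1 gamma 0 | gamma in curve A p].

(** * Lie groups

    By Whitney's theorem there is no loss of generality in taking the
    underlying manifold inside some R^N. *)

Record lie_group (R : realType) := LieGroup {
  lg_amb : nat;
  lg_dim : nat;
  lg_set : set 'rV[R]_lg_amb;
  lg_one : 'rV[R]_lg_amb;
  lg_mul : 'rV[R]_lg_amb -> 'rV[R]_lg_amb -> 'rV[R]_lg_amb;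
  lg_inv : 'rV[R]_lg_amb -> 'rV[R]_lg_amb;
  lg_submanifold : submanifold lg_dim lg_set;
  lg_one_in : lg_set lg_one;
  lg_mul_in : forall x y, lg_set x -> lg_set y -> lg_set (lg_mul x y);
  lg_inv_in : forall x, lg_set x -> lg_set (lg_inv x);
  lg_mulA : forall x y z, lg_set x -> lg_set y -> lg_set z ->
    lg_mul x (lg_mul y z) = lg_mul (lg_mul x y) z;
  lg_mul1 : forall x, lg_set x -> lg_mul lg_one x = x;
  lg_mulV : forall x, lg_set x -> lg_mul (lg_inv x) x = lg_one;
  lg_mul_smooth :
    smooth_map (lg_set `*` lg_set) (fun xy => lg_mul xy.1 xy.2);
  lg_inv_smooth : smooth_map lg_set lg_inv
}.

(** * Kähler manifolds embedded in a normed space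

    Only the data are recorded; [metric p] and [cstr p] are meaningful on
    [tangent pts p]. *)

Record kahler (R : realType) := Kahler {
  amb : normedModType R;
  pts : set amb;
  metric : amb -> amb -> amb -> R;
  cstr : amb -> amb -> amb
}.

(* The values of the differential of [f] are computed along curves. *)
Record holomorphic_isometry_with (R : realType) (M N : kahler R)
    (f : amb M -> amb N) (f' : amb N -> amb M) : Prop := {
  hi_smooth : smooth_map (@pts R M) f;
  hi_inv_smooth : smooth_map (@pts R N) f';
  hi_fun : forall p, pts p -> pts (f p) /\ f' (f p) = p;
  hi_inv : forall q, pts q -> pts (f' q) /\ f (f' q) = q;
  hi_metric : forall p gamma delta, pts p ->
    curve (@pts R M) p gamma -> curve (@pts R M) p delta ->
    metric (f p) (derive1 (f \o gamma) 0) (derive1 (f \o delta) 0) =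
    metric p (derive1 gamma 0) (derive1 delta 0);
  hi_cstr : forall p gamma delta, pts p ->
    curve (@pts R M) p gamma -> curve (@pts R M) p delta ->
    derive1 delta 0 = cstr p (derive1 gamma 0) ->
    derive1 (f \o delta) 0 = cstr (f p) (derive1 (f \o gamma) 0)
}.

Definition holomorphic_isometry (R : realType) (M N : kahler R)
    (f : amb M -> amb N) : Prop :=
  exists f', holomorphic_isometry_with f f'.

(* A family of leaves is a set of subsets of the manifold. *)
Definition holomorphically_congruent (R : realType) (M N : kahler R)
    (F : set (set (amb M))) (F' : set (set (amb N))) : Prop :=
  exists f : amb M -> amb N,
    holomorphic_isometry f /\ [set f @` L | L in F] = F'.

(* [V] is Lagrangian in [W]: J V is the orthogonal complement of V in W.  When
   [g] is an inner product and [J] an orthogonal complex structure on [W], such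
   a [V] is a real linear subspace of [W]. *)
Definition lagrangian_in (R : realType) (E : lmodType R) (g : E -> E -> R)
    (J : E -> E) (W V : set E) : Prop :=
  V `<=` W /\ J @` V = [set w | W w /\ forall v, V v -> g v w = 0].

Record action_by_holomorphic_isometries (R : realType) (G : lie_group R)
    (M : kahler R) (act : 'rV[R]_(lg_amb G) -> amb M -> amb M) : Prop := {
  act_isometry : forall x, lg_set x -> holomorphic_isometry (act x);
  act_one : forall p, pts p -> act (lg_one G) p = p;
  act_mul : forall x y p, lg_set x -> lg_set y -> pts p ->
    act (lg_mul x y) p = act x (act y p);
  act_smooth : smooth_map (@lg_set R G `*` @pts R M)
    (fun xp : 'rV[R]_(lg_amb G) * amb M => act xp.1 xp.2)
}.

Definition orbit_of (R : realType) (G : lie_group R) (M : kahler R)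
    (act : 'rV[R]_(lg_amb G) -> amb M -> amb M) (p : amb M) : set (amb M) :=
  [set act x p | x in @lg_set R G].

(* An orbit is an immersed submanifold through the orbit map G -> M; its
   tangent space at [p] is the image of the differential of that map at 1. *)
Definition orbit_tangent (R : realType) (G : lie_group R) (M : kahler R)
    (act : 'rV[R]_(lg_amb G) -> amb M -> amb M) (p : amb M) : set (amb M) :=
  [set derive1 (fun t : R => act (gamma t) p) 0
     | gamma in curve (@lg_set R G) (lg_one G)].

(* Lagrangian orbits all have the same dimension, so that they do form a
   (regular) foliation. *)
Definition homogeneous_lagrangian_foliation (R : realType) (M : kahler R)
    (F : set (set (amb M))) : Prop :=
  exists (G : lie_group R) (act : 'rV[R]_(lg_amb G) -> amb M -> amb M),
    [/\ connected (@lg_set R G),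
        action_by_holomorphic_isometries act,
        F = [set orbit_of act p | p in @pts R M]
      & forall p, pts p ->
          lagrangian_in (metric p) (cstr p) (tangent (@pts R M) p)
            (orbit_tangent act p)].

(** * Complex matrices as a real normed vector space *)

Notation cmat R m n := ('M[R]_(m, n) * 'M[R]_(m, n))%type.

Definition toC (R : realType) (m n : nat) (X : cmat R m n) : 'M[R[i]]_(m, n) :=
  \matrix_(i, j) (X.1 i j +i* X.2 i j)%C.

Definition ofC (R : realType) (m n : nat) (A : 'M[R[i]]_(m, n)) : cmat R m n :=
  (map_mx (@complex.Re R) A, map_mx (@complex.Im R) A).

(** * Complex space forms *)

Definition flat_space (R : realType) (n : nat) : kahler R :=
  @Kahler R (cmat R n 1) setT
    (fun _ v w => complex.Re (\tr ((toC v)^t* *m toC w)))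
    (fun _ v => ofC ('i%C *: toC v)).

Definition hform (R : realType) (m : nat) (D : 'M[R[i]]_m) (v : 'cV[R[i]]_m) :
    R[i] :=
  (v^t* *m D *m v) 0 0.

(* A complex line is encoded by the [D]-orthogonal projector onto it. *)
Definition line_of (R : realType) (m : nat) (D : 'M[R[i]]_m)
    (v : 'cV[R[i]]_m) : cmat R m m :=
  ofC ((hform D v)^-1 *: (v *m v^t* *m D)).

(* The space of complex lines on which the Hermitian form [D] has the sign of
   [c].  A tangent vector X at (the projector onto) a line P satisfies
   X = X P + P X, and X |-> X P identifies the tangent space with
   Hom(P, P^perp), where the complex structure is multiplication by i.  If v
   spans P with [hform D v = +-1] and w = X v, then tr (X X) = +- 2 hform D w,
   so that the metric below is 4 / |c| times the one which makes v |-> P a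
   (semi-)Riemannian submersion: its holomorphic sectional curvature is c. *)
Definition line_space (R : realType) (m : nat) (D : 'M[R[i]]_m) (c : R) :
    kahler R :=
  @Kahler R (cmat R m m)
    [set line_of D v | v in [set v | 0 < (c%:C)%C * hform D v]]
    (fun _ X Y => 2 / c * complex.Re (\tr (toC X *m toC Y)))
    (fun P X => ofC ('i%C *: (toC X *m toC P - toC P *m toC X))).

Definition I1n (R : realType) (n : nat) : 'M[R[i]]_n.+1 :=
  diag_mx (\row_j (if j == 0 then -1 else 1)).

Definition CP (R : realType) (n : nat) (c : R) : kahler R :=
  line_space (1%:M : 'M[R[i]]_n.+1) c.

Definition CH (R : realType) (n : nat) (c : R) : kahler R :=
  line_space (I1n R n) c.

(* The complex space form of complex dimension [n] and constant holomorphic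
   sectional curvature [c]. *)
Definition space_form (R : realType) (n : nat) (c : R) : kahler R :=
  if c == 0 then flat_space R n else if 0 < c then CP n c else CH n c.

(** * Lagrangian affine subspace foliations *)

Definition lagrangian_affine_subspace_foliation (R : realType) (n : nat)
    (F : set (set (amb (flat_space R n)))) : Prop :=
  exists V : {vspace cmat R n 1},
    lagrangian_in (@metric R (flat_space R n) 0) (@cstr R (flat_space R n) 0)
      setT [set` V] /\
    F = [set [set z + v | v in [set` V]] | z in setT].

(** * Lagrangian horocycle foliations *)

Definition expm (R : realType) (m : nat) (A : 'M[R[i]]_m.+1) :
    'M[R[i]]_m.+1 :=
  limn (series (fun k => (k`!%:R)^-1 *: A ^+ k)).

(* The line g P, encoded by the projector g P g^-1 when g is [D]-unitary. *)
Definition mx_act (R : realType) (m : nat) (g : 'M[R[i]]_m) (P : cmat R m m) :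
    cmat R m m :=
  ofC (g *m toC P *m invmx g).

Definition ad (R : realType) (m : nat) (X : cmat R m m) : 'End(cmat R m m) :=
  linfun (fun Y : cmat R m m => ofC (toC X *m toC Y - toC Y *m toC X)).

Definition su1n (R : realType) (n : nat) : {vspace cmat R n.+1 n.+1} :=
  (lker (linfun (fun X : cmat R n.+1 n.+1 =>
           ofC ((toC X)^t* *m I1n R n + I1n R n *m toC X))) :&:
   lker (linfun (fun X : cmat R n.+1 n.+1 =>
           ofC ((\tr (toC X))%:M : 'M[R[i]]_1))))%VS.

(* Trace of (ad X)(ad Y) on the real vector space su(1,n). *)
Definition killing (R : realType) (n : nat) (X Y : cmat R n.+1 n.+1) : R :=
  let b := vbasis (su1n R n) in
  \sum_(i < \dim (su1n R n)) coord b i (ad X (ad Y b`_i)).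

(* The Lie algebra of the isotropy group of [o]. *)
Definition isotropy_algebra (R : realType) (n : nat) (o : cmat R n.+1 n.+1) :
    {vspace cmat R n.+1 n.+1} :=
  (su1n R n :&: lker (ad o))%VS.

Definition cartan_p (R : realType) (n : nat) (o : cmat R n.+1 n.+1) :
    set (cmat R n.+1 n.+1) :=
  [set X | X \in su1n R n /\
           forall Y, Y \in isotropy_algebra o -> killing X Y = 0].

Definition abelian_in (R : realType) (m : nat) (p : set (cmat R m m))
    (a : {vspace cmat R m m}) : Prop :=
  [set` a] `<=` p /\ forall X Y, X \in a -> Y \in a -> ad X Y = 0.

Definition maximal_abelian_in (R : realType) (m : nat) (p : set (cmat R m m))
    (a : {vspace cmat R m m}) : Prop :=
  abelian_in p a /\ forall b, abelian_in p b -> (a <= b)%VS -> b = a.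

(* Elements X of su(1,n) with [A, X] = lambda(A) X for all A in a, the
   condition being imposed on a basis of a. *)
Definition root_space (R : realType) (n : nat)
    (a : {vspace cmat R n.+1 n.+1}) (lambda : 'Hom(cmat R n.+1 n.+1, R^o)) :
    {vspace cmat R n.+1 n.+1} :=
  (su1n R n :&:
   \bigcap_(i < \dim a)
     passmx.leigenspace (ad (vbasis a)`_i) (lambda (vbasis a)`_i))%VS.

(* su(1,n) is the direct sum of the root spaces for -2 alpha, - alpha, 0,
   alpha, 2 alpha. *)
Definition root_decomposition (R : realType) (n : nat)
    (a : {vspace cmat R n.+1 n.+1}) (alpha : 'Hom(cmat R n.+1 n.+1, R^o)) :
    Prop :=
  let g_ (k : 'I_5) := root_space a ((k%:R - 2) *: alpha) in
  directv (\sum_k g_ k)%VS /\ su1n R n = (\sum_k g_ k)%VS.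

(* d/dt (exp (tX) o) at t = 0. *)
Definition fundamental_vector (R : realType) (n : nat)
    (o X : cmat R n.+1 n.+1) : cmat R n.+1 n.+1 :=
  derive1 (fun t : R => mx_act (expm (toC (t *: X))) o) 0.

(* The connected Lie subgroup with Lie algebra [h] is generated by exp h. *)
Definition connected_subgroup (R : realType) (n : nat)
    (h : {vspace cmat R n.+1 n.+1}) : set 'M[R[i]]_n.+1 :=
  [set \prod_(X <- s) expm (toC X)
     | s in [set s : seq (cmat R n.+1 n.+1) | {subset s <= h}]].

(* The inner product and the complex structure of T_o CH^n are transported to
   a + n by the isomorphism [fundamental_vector o]; hence [l] is Lagrangian in
   g_alpha iff its image is Lagrangian in the image of g_alpha. *)
Definition lagrangian_horocycle_foliation (R : realType) (n : nat) (c : R)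
    (F : set (set (amb (CH n c)))) : Prop :=
  exists (o : amb (CH n c)) (a : {vspace cmat R n.+1 n.+1})
      (alpha : 'Hom(cmat R n.+1 n.+1, R^o)) (l : {vspace cmat R n.+1 n.+1}),
    [/\ pts o,
        maximal_abelian_in (cartan_p o) a,
        root_decomposition a alpha,
        (l <= root_space a alpha)%VS /\
        lagrangian_in (@metric R (CH n c) o) (@cstr R (CH n c) o)
          (fundamental_vector o @` [set` root_space a alpha])
          (fundamental_vector o @` [set` l])
      & F = [set [set mx_act g p | g in
                    connected_subgroup (l + root_space a (2 *: alpha))%VS]
               | p in @pts R (CH n c)]].

(* Main.v *)
(** The projective and hyperbolic spaces are treated together, as spaces of
    projectors P onto the lines on which a Hermitian form has a given sign.  Comparing
    tr (P Q) with a (hyperbolic) cosine along geodesics shows that isometries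
    preserve tr (P Q); they therefore extend linearly to the matrix algebra,
    multiplicatively because they are holomorphic.  So the action has
    infinitesimal generators A, with velocity [A, P] at P.  The symplectic form
    vanishes on the orbits, which means that tr ([A, B] P) = 0 for all P: the
    generators commute, and have a common eigenvector e.  If e spanned a point P
    of the space, all velocities would vanish at P.  This rules out CP^n, and on
    CH^n it forces e to be a null vector, unique up to scaling, and the generators
    to be nilpotent; the Lagrangian condition at one point then shows that they
    form l + g_(2 alpha), with l Lagrangian in g_alpha.  The functions
    P |-> tr (A P) are constant on the orbits of the group and separate the orbits
    of exp (l + g_(2 alpha)), so that the former are contained in the latter.  The
    converse is a contraction argument: a subgroup of R^m containing smooth curves
    through 0 in all coordinate directions is R^m.

    On C^n, isometries are affine and the generators are fields z |-> A z + b with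
    commuting skew-Hermitian A.  A common eigenvector in the image of a nonzero A
    contradicts the Lagrangian condition at some point, so that the group acts by
    translations. *)
From HB Require Import structures.
From mathcomp Require Import all_boot all_order all_algebra.
From mathcomp Require Import ring lra.
From mathcomp Require Import complex spectral.
From mathcomp Require Import all_classical all_reals all_analysis.
Require Import Defs.

Set Implicit Arguments.
Unset Strict Implicit.
Unset Printing Implicit Defensive.

Import Order.TTheory GRing.Theory Num.Theory.
Import numFieldNormedType.Exports.

Local Open Scope classical_set_scope.
Local Open Scope ring_scope.
Local Open Scope sesquilinear_scope.

(** The hypotheses provide no Lie algebra and no one-parameter subgroups. A generator is only the
    velocity at 1 of a smooth curve of the group: it is not given that generators form a vector
    space, nor that their exponentials stay in the orbits. This structure comes from the Lagrangian
    condition, which is an equality of sets: a tangent vector orthogonal to all velocities at a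
    point is J times a velocity there. Testing it on chosen vectors both excludes eigenvectors and
    produces generators, among them all of g_(2 alpha).

    The bound n > 1 on CH^n serves to show that two common null eigenvectors are proportional. Every
    curve of CH^1 is Lagrangian, and the translations along a geodesic, which have two null
    eigenvectors, foliate CH^1 by equidistant curves.

    In the flat and hyperbolic cases F is itself a model foliation, so that the congruence is the
    identity: the definitions leave a and the Lagrangian subspace free, and both are read off from
    the generators, with o the line of the first basis vector. *)

Module DerivableMaps.

(** * Smooth maps between finite-dimensional normed spaces *)

(** Finite dimension enters through these data: continuous linear coordinates make every linear map
    continuous and reduce smoothness to that of scalar functions. *)
Record coordinates (R : realType) (E : normedModType R) := Coordinates {
  coord_idx : finType;
  coord_vec : coord_idx -> E;
  coord_fun : coord_idx -> {linear E -> R^o};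
  coord_cont : forall i, continuous (coord_fun i);
  coord_expand : forall x, x = \sum_i coord_fun i x *: coord_vec i
}.

Arguments coord_idx {R E} c.
Arguments coord_vec {R E} c i.
Arguments coord_fun {R E} c i.
Arguments coord_cont {R E} c i.
Arguments coord_expand {R E} c x.

Section Derive.
Context {R : realType}.
Implicit Types (E F V : normedModType R).

Lemma is_deriveP V E (f : V -> E) x v df :
  is_derive x v f df <->
  (fun h => h^-1 *: (f (h *: v + x) - f x)) @ 0^' --> df.
Proof.
split=> [[fd <-]|fd]; first exact: fd.
by apply: DeriveDef; [apply/cvg_ex; exists df | exact/cvg_lim].
Qed.

Lemma is_derive_linear V E F (L : {linear E -> F}) (f : V -> E) x v df :
  continuous L -> is_derive x v f df -> is_derive x v (L \o f) (L df).
Proof.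
move=> Lc /is_deriveP fd; apply/is_deriveP.
rewrite [X in X @ _ --> _](_ : _ =
    L \o (fun h => h^-1 *: (f (h *: v + x) - f x))).
  by apply: continuous_cvg => //; exact: Lc.
rewrite funeqE => h; rewrite /comp [RHS]linearZ /=.
by rewrite (linearB L).
Qed.

Lemma is_derive_unique V E (f : V -> E) x v df df' :
  is_derive x v f df -> is_derive x v f df' -> df = df'.
Proof. by move=> [_ <-] [_ <-]. Qed.

Lemma derivable_is_derive V E (f : V -> E) x v df :
  is_derive x v f df -> derivable f x v.
Proof. by case. Qed.

Lemma is_derive_sum_fin V E (I : finType) (f : I -> V -> E) (df : I -> E) x v :
  (forall i, is_derive x v (f i) (df i)) ->
  is_derive x v (fun y => \sum_i f i y) (\sum_i df i).
Proof.
move=> fd; rewrite [fun y => _](_ : _ = \sum_i f i); last first.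
  by apply/funext => y; rewrite fct_sumE.
elim/big_ind2 : _ => [|? ? ? ? ? ?|//]; first exact: is_derive_cst.
exact: is_deriveD.
Qed.

Definition scale_at E (e : E) (r : R^o) : E := r *: e.

Lemma scale_at_linear E (e : E) : linear (scale_at e).
Proof. by move=> a b c; rewrite /scale_at scalerDl scalerA. Qed.

HB.instance Definition _ E (e : E) :=
  GRing.isLinear.Build R R^o E _ (scale_at e) (scale_at_linear e).

Lemma scale_at_continuous E (e : E) : continuous (scale_at e).
Proof. exact: scalel_continuous. Qed.

Lemma is_derive_coord V E (cE : coordinates E) (f : V -> E) x v df :
  (forall i, is_derive x v (coord_fun cE i \o f) (coord_fun cE i df)) ->
  is_derive x v f df.
Proof.
move=> fd; rewrite (coord_expand cE df).
rewrite (_ : f = fun y => \sum_i coord_fun cE i (f y) *: coord_vec cE i); last first.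
  by apply/funext => y; rewrite -coord_expand.
apply: is_derive_sum_fin => i.
exact: (is_derive_linear (L := scale_at (coord_vec cE i))
  (@scale_at_continuous _ _) (fd i)).
Qed.

Lemma linear_cont E F (cE : coordinates E) (L : {linear E -> F}) : continuous L.
Proof.
rewrite (_ : (L : E -> F) =
    fun x => \sum_i coord_fun cE i x *: L (coord_vec cE i)); last first.
  apply/funext => x; rewrite [in LHS](coord_expand cE x) linear_sum.
  by apply: eq_bigr => i _; rewrite linearZ.
rewrite (_ : (fun x => _) =
    \sum_i (scale_at (L (coord_vec cE i)) \o coord_fun cE i)); last first.
  by apply/funext => x; rewrite fct_sumE.
elim/big_ind : _ => [x|f g fc gc x|i _ x]; first exact: cvg_cst.
  exact: continuousD (fc x) (gc x).
apply: continuous_comp; first exact: coord_cont.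
exact: scale_at_continuous.
Qed.

(** [Num.min] and [Num.max] admit [b < a], so that increments of either sign are covered at once. *)
Lemma MVT_norm (f df : R -> R) (a b e : R) :
  (forall x, x \in `[Num.min a b, Num.max a b] -> is_derive x 1 f (df x)) ->
  (forall x, x \in `[Num.min a b, Num.max a b] -> `|df x| <= e) ->
  `|f b - f a| <= e * `|b - a|.
Proof.
wlog ab : a b / a <= b => [th fd dfe|].
  have [/th->//|/ltW ba] := leP a b.
  rewrite -normrN opprB -[X in _ * X]normrN opprB.
  have Em : Num.min b a = Num.min a b by rewrite /Num.min; case: ltgtP.
  have EM : Num.max b a = Num.max a b by rewrite /Num.max; case: ltgtP.
  rewrite -Em -EM in fd dfe; exact: (th b a ba fd dfe).
rewrite (min_idPl ab) (max_idPr ab) => fd dfe.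
have fd' x : x \in `]a, b[ -> is_derive x 1 f (df x).
  by move=> xab; apply/fd/subset_itv_oo_cc.
have fc : {within `[a, b], continuous f}.
  by apply: derivable_within_continuous => x /fd[].
have [c cab ->] := MVT_segment ab fd' fc.
by rewrite normrM ler_wpM2r ?normr_ge0 ?dfe.
Qed.

Lemma is_derive_line V E (f : V -> E) x v t df :
  is_derive (x + t *: v) v f df ->
  is_derive t 1 (fun s : R => f (x + s *: v)) df.
Proof.
move=> /is_deriveP fd; apply/is_deriveP; apply: cvg_trans fd.
apply/near_eq_cvg/nearW => h; congr (_ *: (f _ - _)).
by rewrite [h%:A]mulr1 scalerDl addrCA.
Qed.

(** Mean value inequality for [s |-> g (q + s *: e) - s * 'D_e g p], whose derivative is small on
    the ball. The base point [q] differs from [p] so that coordinates can be changed one after the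
    other. *)
Lemma line_increment E (g : E -> R) (e p q : E) (a eps r : R) :
  (forall x, `|x - p| < r -> derivable g x e) ->
  (forall x, `|x - p| < r -> `|'D_e g x - 'D_e g p| <= eps) ->
  `|q - p| + `|a| * `|e| < r ->
  `|g (q + a *: e) - g q - a * 'D_e g p| <= eps * `|a|.
Proof.
move=> gd ge qr.
have seg s : s \in `[Num.min 0 a, Num.max 0 a] -> `|q + s *: e - p| < r.
  move=> sa; apply: le_lt_trans qr; rewrite addrAC (le_trans (ler_normD _ _))//.
  rewrite lerD2l normrZ ler_wpM2r ?normr_ge0//.
  move: sa; rewrite in_itv /= ler_norml ge_min le_max.
  case: (ltrgt0P a) => [a0|a0|->]; rewrite ?oppr0; lra.
have := @MVT_norm (fun s => g (q + s *: e) - s * 'D_e g p)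
  (fun s => 'D_e g (q + s *: e) - 'D_e g p) 0 a eps.
rewrite scale0r addr0 mul0r !subr0 (addrAC _ _ (- g q)); apply.
  move=> s /seg sr; apply: is_deriveB.
    by apply: is_derive_line; apply/derivableP/gd.
  rewrite -[X in is_derive _ _ _ X]mulr1.
  rewrite (_ : (fun _ => _) = ('D_e g p \*: id)).
    by rewrite -[_ * 1]/(_ *: 1); apply: is_deriveZ.
  by apply/funext => y /=; rewrite mulrC.
by move=> s /seg /ge.
Qed.

(** The coordinates of the argument are moved one at a time along the list [s], each move being
    controlled by [line_increment]; [q] is general because the induction hypothesis is used after
    the first move. *)
Lemma C1_increment E (cE : coordinates E) (g : E -> R) (p : E) :
  (forall i, \forall x \near p, derivable g x (coord_vec cE i)) ->
  (forall i, {for p, continuous ('D_(coord_vec cE i) g)}) ->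
  forall (s : seq (coord_idx cE)) (eps : R), 0 < eps ->
  exists2 del : R, 0 < del & forall q h, `|q - p| < del -> `|h| < del ->
    `|g (q + \sum_(i <- s) coord_fun cE i h *: coord_vec cE i) - g q -
      \sum_(i <- s) coord_fun cE i h * 'D_(coord_vec cE i) g p| <= eps * `|h|.
Proof.
move=> gd gc; elim=> [|i s IH] eps eps0.
  exists 1 => // q h _ _; rewrite !big_nil addr0 subrr subr0 normr0.
  by rewrite mulr_ge0 // ltW.
have [K K0 Kc] := linear_lipschitz (coord_cont cE i).
set e := coord_vec cE i.
have [d1 d10 Hd1] := IH (eps / 2) (divr_gt0 eps0 (ltr0Sn _ 1)).
have e2K : 0 < eps / 2 / K by rewrite !divr_gt0.
have : \forall x \near p, derivable g x e /\
    `|'D_e g x - 'D_e g p| <= eps / 2 / K.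
  near=> x; split; first by near: x; exact: gd.
  near: x; have /cvgrPdist_le /(_ _ e2K) := gc i.
  by apply: filterS => x; rewrite distrC.
move=> /nbhs_normP [r /= r0 Hr].
have Hr' x : `|x - p| < r -> derivable g x e /\
    `|'D_e g x - 'D_e g p| <= eps / 2 / K.
  by move=> xr; apply: Hr; rewrite /ball_ /= distrC.
set m := 1 + K * `|e|.
have m1 : 1 <= m by rewrite lerDl mulr_ge0 // ltW.
have m0 : 0 < m by apply: lt_le_trans m1.
exists (Num.min (d1 / 2 / m) (r / 2 / m)).
  by rewrite lt_min !divr_gt0.
move=> q h; rewrite !lt_min => /andP[q1 qr] /andP[h1 hr].
rewrite !big_cons.
set a := coord_fun cE i h.
have ah : `|a| * `|e| <= K * `|e| * `|h|.
  by rewrite mulrAC ler_wpM2r ?normr_ge0 // Kc.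
have small (d : R) : `|q - p| < d / 2 / m -> `|h| < d / 2 / m ->
    `|q - p| + `|a| * `|e| < d.
  rewrite !ltr_pdivlMr // => qd hd.
  have : `|q - p| <= `|q - p| * m by rewrite ler_peMr.
  have : K * `|e| * `|h| <= `|h| * m by rewrite mulrC ler_wpM2l // lerDr.
  lra.
have hd (d : R) : `|h| < d / 2 / m -> `|h| < d.
  rewrite !ltr_pdivlMr // => hd1; have : `|h| <= `|h| * m by rewrite ler_peMr.
  have := normr_ge0 h; lra.
have H1 := line_increment (fun x xr => proj1 (Hr' x xr))
  (fun x xr => proj2 (Hr' x xr)) (small _ qr hr).
have H2 : `|q + a *: e - p| < d1.
  rewrite addrAC (le_lt_trans (ler_normD _ _))// normrZ; exact: small.
have {}H2 := Hd1 _ _ H2 (hd _ h1).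
have H3 : eps / 2 / K * `|a| <= eps / 2 * `|h|.
  rewrite -mulrA ler_pM2l ?divr_gt0 // ler_pdivrMl //.
  exact: Kc.
rewrite addrA.
set A := \sum_(j <- s) _ in H2 *; set B := \sum_(j <- s) _ in H2 *.
rewrite (_ : _ - _ = (g (q + a *: e + A) - g (q + a *: e) - B) +
   (g (q + a *: e) - g q - a * 'D_e g p)); last by ring.
rewrite (le_trans (ler_normD _ _))//; lra.
Unshelve. all: by end_near. Qed.

Lemma C1_differentiable E (cE : coordinates E) (g : E -> R) (p : E) :
  (forall i, \forall x \near p, derivable g x (coord_vec cE i)) ->
  (forall i, {for p, continuous ('D_(coord_vec cE i) g)}) ->
  differentiable g p.
Proof.
move=> gd gc.
pose dg (h : E) : R^o :=
  \sum_i coord_fun cE i h * 'D_(coord_vec cE i) g p.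
have dgl : linear dg.
  move=> a x y; rewrite /dg scaler_sumr -big_split; apply: eq_bigr => i _ /=.
  by rewrite linearP mulrDl -mulrA.
pose dgL : {linear E -> R^o} := HB.pack dg (GRing.isLinear.Build R E R^o _ dg dgl).
have dgc : continuous dgL by exact: linear_cont cE dgL.
have Hg : g \o shift p = cst (g p) + (dgL : E -> R) +o_ (0 : E) id.
  apply/eqaddoP => eps eps0.
  have [d d0 Hd] := C1_increment gd gc (index_enum _) eps0.
  apply/nbhs_normP; exists d => //= h; rewrite /ball_ /= sub0r normrN => hd.
  have := Hd p h; rewrite subrr normr0 => /(_ d0 hd).
  by rewrite -coord_expand fctE /= [h + p]addrC fctE opprD addrA.
have dgE := diff_unique dgc Hg.
by apply/diff_locallyP; rewrite dgE.
Qed.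

(** [f] is only derivable along [v], so the chain rule is applied to its restriction to the line
    through [x]. *)
Lemma is_derive_comp V E F (g : E -> F) (f : V -> E) x v df :
  differentiable g (f x) -> is_derive x v f df ->
  is_derive x v (g \o f) ('D_df g (f x)).
Proof.
move=> gd fd; have [/derivable1P/derivable1_diffP fd1 fv] := fd.
have f0 : f (0 *: v + x) = f x by rewrite scale0r add0r.
rewrite deriveE //.
have gd' : differentiable g (f (0 *: v + x)) by rewrite f0.
have h1 : is_derive (x : V) v (fun y => y) v by exact: is_derive_id.
have h2 := differentiable_comp fd1 gd'.
apply: DeriveDef; first by apply/derivable1P/derivable1_diffP.
have dE (W : normedModType R) (k : V -> W) : 'D_v k x = 'D_1 (fun h : R => k (h *: v + x)) 0.
  rewrite /derive; set g1 := fun h => h^-1 *: _; set g2 := fun h => h^-1 *: _.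
  suff -> : g1 = g2 by []. 
  rewrite funeqE /g1 /g2 => h /=.
  by rewrite addr0 scale0r add0r [h%:A]mulr1.
rewrite dE -[fun h : R => _]/(g \o (fun h : R => f (h *: v + x))).
rewrite deriveE // diff_comp //= f0 -fv dE deriveE //.
Qed.

End Derive.

End DerivableMaps.
Import DerivableMaps.

(** * Calculus of C^k maps: sums, products, composition *)

Module CkMaps.

Section CkTheory.
Context {R : realType}.
Implicit Types (E F V : normedModType R) (k : nat).

Lemma is_derive_near V E (f g : V -> E) (U : set V) x v df :
  open U -> U x -> (forall y, U y -> f y = g y) ->
  is_derive x v f df -> is_derive x v g df.
Proof.
move=> Uo Ux fg; apply: near_eq_is_derive.
by apply: filterS (open_nbhs_nbhs (conj Uo Ux)).
Qed.

Lemma Ck_ext V E k (U : set V) (f g : V -> E) :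
  open U -> (forall x, U x -> f x = g x) -> Ck k U f -> Ck k U g.
Proof.
move=> Uo; elim: k f g => [|k IH] f g fg /=.
  move=> fc x Ux; rewrite /prop_for /continuous_at -(fg x Ux).
  apply: cvg_trans (fc x Ux); apply: near_eq_cvg.
  by apply: filterS (open_nbhs_nbhs (conj Uo Ux)) => y /fg.
move=> fk v; have [fd fDk] := fk v; split=> [x Ux|].
  exact: derivable_is_derive (is_derive_near Uo Ux fg (derivableP (fd x Ux))).
apply: IH fDk => x Ux.
by have [_ ->] := is_derive_near Uo Ux fg (derivableP (fd x Ux)).
Qed.

Lemma Ck_sub V E k (U U' : set V) (f : V -> E) :
  U' `<=` U -> Ck k U f -> Ck k U' f.
Proof.
move=> U'U; elim: k f => [|k IH] f /= fk; first by move=> x /U'U /fk.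
by move=> v; have [fd fD] := fk v; split=> [x /U'U /fd//|]; exact: IH.
Qed.

Lemma Ck_cst V E k (U : set V) (e : E) : open U -> Ck k U (cst e : V -> E).
Proof.
move=> Uo; elim: k e => [|k IH] e /=; first by move=> x _; exact: cvg_cst.
move=> v; split=> [x _|]; first exact: derivable_cst.
by apply: Ck_ext (IH 0) => // x _ /=; rewrite derive_cst.
Qed.

Lemma Ck_linear V E F k (U : set V) (L : {linear E -> F}) (f : V -> E) :
  open U -> continuous L -> Ck k U f -> Ck k U (L \o f).
Proof.
move=> Uo Lc; elim: k f => [|k IH] f fk.
  by move=> x Ux; apply: continuous_comp; [exact: fk | exact: Lc].
move=> v; have [fd fD] := fk v; split=> [x Ux|].
  exact: derivable_is_derive (is_derive_linear Lc (derivableP (fd x Ux))).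
apply: Ck_ext (IH _ fD) => // x Ux.
by have [_ ->] := is_derive_linear Lc (derivableP (fd x Ux)).
Qed.

Lemma CkD V E k (U : set V) (f g : V -> E) :
  open U -> Ck k U f -> Ck k U g -> Ck k U (fun x => f x + g x).
Proof.
move=> Uo; elim: k f g => [|k IH] f g fk gk.
  by move=> x Ux; apply: continuousD; [exact: fk | exact: gk].
move=> v; have [fd fD] := fk v; have [gd gD] := gk v.
have fgd x : U x -> is_derive x v (fun x => f x + g x) ('D_v f x + 'D_v g x).
  by move=> Ux; apply: is_deriveD; apply/derivableP; [exact: fd | exact: gd].
split=> [x /fgd[]//|].
by apply: Ck_ext (IH _ _ fD gD) => // x /fgd[_ ->].
Qed.

Lemma Ck_sum V E (I : finType) k (U : set V) (f : I -> V -> E) :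
  open U -> (forall i, Ck k U (f i)) -> Ck k U (fun x => \sum_i f i x).
Proof.
move=> Uo fk; elim: (index_enum I) => [|i s IH].
  by apply: Ck_ext (Ck_cst k 0 Uo) => // x _; rewrite big_nil.
by apply: Ck_ext (CkD Uo (fk i) IH) => // x _; rewrite big_cons.
Qed.

Lemma Ck_coord V E (cE : coordinates E) k (U : set V) (f : V -> E) :
  open U -> (forall i, Ck k U (coord_fun cE i \o f)) -> Ck k U f.
Proof.
move=> Uo fk.
have H i : Ck k U (scale_at (coord_vec cE i) \o (coord_fun cE i \o f)).
  exact: (Ck_linear Uo (scale_at_continuous (e := coord_vec cE i)) (fk i)).
by apply: Ck_ext (Ck_sum Uo H) => // x _; rewrite [RHS](coord_expand cE).
Qed.

Lemma Ck_differentiable V (cV : coordinates V) k (U : set V) (f : V -> R) x :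
  open U -> Ck k.+1 U (f : V -> R^o) -> U x -> Ck 1 U (f : V -> R^o) ->
  differentiable f x.
Proof.
move=> Uo fk Ux f1; apply: (C1_differentiable (cE := cV)) => i.
  by apply: filterS (open_nbhs_nbhs (conj Uo Ux)) => y; apply: (f1 _).1.
exact: (f1 _).2.
Qed.

(** [Ck k.+1] says nothing about the continuity of [f] itself, only about its derivatives; the base
    case recovers it from differentiability of C^1 functions. *)
Lemma Ck_pred_scalar V (cV : coordinates V) k (U : set V) (f : V -> R) :
  open U -> Ck k.+1 U (f : V -> R^o) -> Ck k U (f : V -> R^o).
Proof.
move=> Uo; elim: k f => [|k IH] f fk.
  move=> x Ux; apply: differentiable_continuous.
  exact: (Ck_differentiable cV Uo fk Ux fk).
by move=> v; have [fd fD] := fk v; split=> //; exact: IH.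
Qed.

Lemma Ck1_scalar V (cV : coordinates V) k (U : set V) (f : V -> R) :
  open U -> Ck k.+1 U (f : V -> R^o) -> Ck 1 U (f : V -> R^o).
Proof. by move=> Uo; elim: k => // k IH /(Ck_pred_scalar cV Uo). Qed.

Lemma Ck_pred V E (cV : coordinates V) (cE : coordinates E) k (U : set V)
    (f : V -> E) :
  open U -> Ck k.+1 U f -> Ck k U f.
Proof.
move=> Uo fk; apply: (Ck_coord (cE := cE)) => // i.
by apply: Ck_pred_scalar => //; apply: Ck_linear => //; exact: coord_cont.
Qed.

Lemma CkM V (cV : coordinates V) k (U : set V) (f g : V -> R) :
  open U -> Ck k U (f : V -> R^o) -> Ck k U (g : V -> R^o) ->
  Ck k U ((fun x => f x * g x) : V -> R^o).
Proof.
move=> Uo; elim: k f g => [|k IH] f g fk gk.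
  by move=> x Ux; apply: continuousM; [exact: fk | exact: gk].
move=> v; have [fd fD] := fk v; have [gd gD] := gk v.
have fgd x : U x -> is_derive x v ((fun x => f x * g x) : V -> R^o)
    (f x * 'D_v g x + g x * 'D_v f x).
  by move=> Ux; apply: is_deriveM; apply/derivableP; [exact: fd | exact: gd].
split=> [x /fgd[]//|].
have fk' := Ck_pred_scalar cV Uo fk; have gk' := Ck_pred_scalar cV Uo gk.
by apply: Ck_ext (CkD Uo (IH _ _ fk' gD) (IH _ _ gk' fD)) => // x /fgd[_ ->].
Qed.

(** The derivative along [v] is a sum of products of coordinates of ['D_v f] with partial
    derivatives of [g] composed with [f]. The induction applies to the latter with one order of
    smoothness less, hence [Ck_pred] for [f]. *)
Lemma Ck_comp_scalar V E (cV : coordinates V) (cE : coordinates E) k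
    (U : set V) (W : set E) (g : E -> R) (f : V -> E) :
  open U -> open W -> (forall x, U x -> W (f x)) ->
  Ck k W (g : E -> R^o) -> Ck k U f -> Ck k U ((g \o f) : V -> R^o).
Proof.
move=> Uo Wo fUW; elim: k g f fUW => [|k IH] g f fUW gk fk.
  by move=> x Ux; apply: continuous_comp; [exact: fk | exact/gk/fUW].
move=> v; have [fd fD] := fk v.
have gf x : U x -> is_derive x v ((g \o f) : V -> R^o)
    (\sum_i coord_fun cE i ('D_v f x) * 'D_(coord_vec cE i) g (f x)).
  move=> Ux; have gd : differentiable g (f x).
    exact: (Ck_differentiable cE Wo gk (fUW _ Ux) (Ck1_scalar cE Wo gk)).
  rewrite [X in is_derive _ _ _ X](_ : _ = 'D_('D_v f x) g (f x)).
    exact: is_derive_comp gd (derivableP (fd x Ux)).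
  set w := 'D_v f x; rewrite deriveE // {2}(coord_expand cE w) linear_sum.
  by apply: eq_bigr => i _; rewrite linearZ deriveE.
split=> [x /gf[]//|].
have H i : Ck k U ((fun x => coord_fun cE i ('D_v f x) *
    'D_(coord_vec cE i) g (f x)) : V -> R^o).
  apply: (CkM cV Uo).
    by apply: Ck_linear => //; exact: coord_cont.
  by apply: IH (gk _).2 (Ck_pred cV cE Uo fk).
by apply: Ck_ext (Ck_sum Uo H) => // x /gf[_ ->].
Qed.

Lemma Ck_comp V E F (cV : coordinates V) (cE : coordinates E)
    (cF : coordinates F) k (U : set V) (W : set E) (g : E -> F) (f : V -> E) :
  open U -> open W -> (forall x, U x -> W (f x)) ->
  Ck k W g -> Ck k U f -> Ck k U (g \o f).
Proof.
move=> Uo Wo fUW gk fk; apply: (Ck_coord (cE := cF)) => // i.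
apply: (Ck_comp_scalar cV cE (g := coord_fun cF i \o g) Uo Wo fUW) => //.
by apply: Ck_linear => //; exact: coord_cont.
Qed.

Lemma pair_inl_linear E F : linear (fun x : E => (x, 0 : F)).
Proof. by move=> a x y; rewrite /GRing.add /GRing.scale /= /add_pair /scale_pair /= scaler0 addr0. Qed.
Lemma pair_inr_linear E F : linear (fun x : F => (0 : E, x)).
Proof. by move=> a x y; rewrite /GRing.add /GRing.scale /= /add_pair /scale_pair /= scaler0 addr0. Qed.

Lemma Ck_pair V E F (cE : coordinates E) (cF : coordinates F) k (U : set V)
    (f : V -> E) (g : V -> F) :
  open U -> Ck k U f -> Ck k U g -> Ck k U (fun x => (f x, g x)).
Proof.
move=> Uo fk gk.
pose L1 : {linear E -> (E * F)%type} := HB.pack (fun x : E => (x, 0 : F))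
  (GRing.isLinear.Build R E (E * F)%type _ _ (@pair_inl_linear E F)).
pose L2 : {linear F -> (E * F)%type} := HB.pack (fun x : F => (0 : E, x))
  (GRing.isLinear.Build R F (E * F)%type _ _ (@pair_inr_linear E F)).
have c1 := linear_cont cE (L := L1); have c2 := linear_cont cF (L := L2).
apply: Ck_ext (CkD Uo (Ck_linear Uo c1 fk) (Ck_linear Uo c2 gk)) => // x _ /=.
by rewrite /GRing.add /= /add_pair /= addr0 add0r.
Qed.

Definition coord_mx_fun m n (ij : 'I_m * 'I_n) (M : 'M[R]_(m, n)) : R^o :=
  M ij.1 ij.2.

Lemma coord_mx_fun_linear m n (ij : 'I_m * 'I_n) : linear (coord_mx_fun ij).
Proof. by move=> a x y; rewrite /coord_mx_fun !mxE. Qed.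

HB.instance Definition _ m n (ij : 'I_m * 'I_n) :=
  GRing.isLinear.Build R 'M[R]_(m, n) R^o _ (coord_mx_fun ij)
    (coord_mx_fun_linear ij).

Definition coordinates_mx m n : coordinates 'M[R]_(m, n).
Proof.
apply: (@Coordinates R _ ('I_m * 'I_n)%type
  (fun ij => delta_mx ij.1 ij.2) (fun ij => coord_mx_fun ij)).
  by move=> ij; exact: coord_continuous.
move=> M; rewrite {1}[M]matrix_sum_delta pair_bigA.
by apply: eq_bigr.
Defined.

Definition coord_prod_fun E F (I J : Type) (c : I -> {linear E -> R^o})
    (d : J -> {linear F -> R^o}) (k : (I + J)%type) (x : E * F) : R^o :=
  match k with inl i => c i x.1 | inr j => d j x.2 end.

Lemma coord_prod_fun_linear E F (I J : Type) (c : I -> {linear E -> R^o})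
  (d : J -> {linear F -> R^o}) (k : (I + J)%type) : linear (coord_prod_fun c d k).
Proof. by case: k => i a x y; rewrite /= linearP. Qed.

HB.instance Definition _ E F (I J : Type) (c : I -> {linear E -> R^o})
  (d : J -> {linear F -> R^o}) (k : (I + J)%type) :=
  GRing.isLinear.Build R (E * F)%type R^o _ (coord_prod_fun c d k)
    (coord_prod_fun_linear c d k).

Definition coordinates_prod E F :
  coordinates E -> coordinates F -> coordinates (E * F)%type.
Proof.
move=> cE cF.
pose vec (k : (coord_idx cE + coord_idx cF)%type) : (E * F)%type :=
  match k with inl i => (coord_vec cE i, 0) | inr j => (0, coord_vec cF j) end.
pose fc (k : (coord_idx cE + coord_idx cF)%type) :
  {linear (E * F)%type -> R^o} := coord_prod_fun (coord_fun cE) (coord_fun cF) k.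
apply: (@Coordinates R (E * F)%type (coord_idx cE + coord_idx cF)%type vec fc).
  case=> i x /=.
    by apply: (@continuous_comp _ _ _ fst); [exact: cvg_fst | exact: coord_cont].
  by apply: (@continuous_comp _ _ _ snd); [exact: cvg_snd | exact: coord_cont].
move=> [x y]; rewrite big_sumType /= {1}(coord_expand cE x) {1}(coord_expand cF y).
have H1 (I : finType) (a : I -> R) (b : I -> E) :
    \sum_i a i *: (b i, 0 : F) = (\sum_i a i *: b i, 0).
  elim/big_ind2 : _ => // [? x1 ? x2 -> ->|i _].
    by rewrite /GRing.add /= /add_pair /= addr0.
  by rewrite /GRing.scale /= /scale_pair /= scaler0.
have H2 (I : finType) (a : I -> R) (b : I -> F) :
    \sum_i a i *: (0 : E, b i) = (0, \sum_i a i *: b i).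
  elim/big_ind2 : _ => // [? x1 ? x2 -> ->|i _].
    by rewrite /GRing.add /= /add_pair /= addr0.
  by rewrite /GRing.scale /= /scale_pair /= scaler0.
by rewrite H1 H2 /GRing.add /= /add_pair /= addr0 add0r.
Defined.

Definition coordinates_R : coordinates R^o.
Proof.
apply: (@Coordinates R R^o unit (fun _ => 1) (fun _ => idfun)).
  by move=> _ x; exact: cvg_id.
by move=> x; rewrite (big_pred1 tt) /= ?[_%:A]mulr1 //; case.
Defined.

End CkTheory.

End CkMaps.
Import CkMaps.

(** * Curves, connected Lie groups and their smooth actions *)

Module CurvesAndActions.

HB.instance Definition _ (R : realType) m n := Complete.on 'M[R]_(m, n).

Section Curves.
Context {R : realType}.
Implicit Types (E F V : normedModType R) (k : nat).

Definition coordinates_cmat m n : coordinates (cmat R m n) :=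
  coordinates_prod (coordinates_mx m n) (coordinates_mx m n).

Lemma smooth_comp V E F (cV : coordinates V) (cE : coordinates E)
    (cF : coordinates F) (U : set V) (W : set E) (g : E -> F) (f : V -> E) :
  smooth_on W g -> smooth_on U f -> smooth_on (U `&` f @^-1` W) (g \o f).
Proof.
move=> [Wo gs] [Uo fs].
have UWo : open (U `&` f @^-1` W).
  rewrite openE => x [Ux Wfx]; rewrite /interior.
  apply: filterI; first exact: open_nbhs_nbhs.
  by apply: (fs 0%N x Ux); exact: open_nbhs_nbhs.
split=> // k; apply: (@Ck_comp _ _ _ _ cV cE cF k _ W) => //.
  by move=> x [].
by apply: Ck_sub (fs k) => x [].
Qed.

Lemma smooth_affine E (a u : E) : smooth_on setT ((fun t : R^o => a + t *: u)).
Proof.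
split; first exact: openT.
have D (b v : E) (t w : R^o) :
    is_derive t w (fun t : R^o => b + t *: v) (0 + w *: v).
  apply: is_deriveD.
  apply: (@is_derive_linear _ _ _ _ (scale_at v) id).
  exact: scale_at_continuous.
case=> [|k] /=.
  move=> t _; have [d _] := D a u t 1.
  by apply: differentiable_continuous; apply/derivable1_diffP.
move=> w; split=> [t _|]; first by have [] := D a u t w.
apply: (Ck_ext (f := cst (w *: u))); first exact: openT.
  by move=> t _; have [_ ->] := D a u t w; rewrite add0r.
by apply: Ck_cst; exact: openT.
Qed.

Lemma smooth_map_curve E F (cE : coordinates E) (cF : coordinates F)
    (A : set E) (B : set F) (f : E -> F) gamma p :
  smooth_map A f -> (forall x, A x -> B (f x)) ->
  curve A p gamma -> curve B (f p) (f \o gamma).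
Proof.
move=> fs fAB [g0 [U [U0 gU UA]]]; split; first by rewrite /= g0.
have [W [g [Wp gs gf]]] := fs _ (UA 0 U0).
have := smooth_comp coordinates_R cE cF gs gU.
set I := _ `&` _ => ggs; exists I; split.
- by split.
- have [Io gk] := ggs; split=> // k; apply: Ck_ext (gk k) => // t [Ut Wt].
  by rewrite /= gf //; exact: UA.
- by move=> t [Ut _]; apply/fAB/UA.
Qed.

Lemma curve_is_derive E (A : set E) p gamma :
  curve A p gamma -> is_derive (0 : R) 1 gamma (derive1 gamma 0).
Proof.
move=> [_ [U [U0 [_ gs] _]]]; rewrite derive1E; apply/derivableP.
exact: (gs 1%N 1).1.
Qed.

Lemma curve_shift E (cE : coordinates E) (A : set E) (U : set R^o)
    (gamma : R -> E) t0 :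
  smooth_on U (gamma : R^o -> E) -> (forall t, U t -> A (gamma t)) -> U t0 ->
  curve A (gamma t0) (fun s => gamma (t0 + s)).
Proof.
move=> gs UA Ut0; split; first by rewrite addr0.
have := smooth_comp coordinates_R coordinates_R cE gs (smooth_affine (t0 : R^o) 1).
have -> : (gamma : R^o -> E) \o (fun t : R^o => (t0 : R^o) + t *: 1) =
    (fun s => gamma (t0 + s)).
  by apply/funext => s /=; rewrite [s%:A]mulr1.
set I := _ `&` _ => Is; exists I; split=> //.
  by split=> //=; rewrite scale0r addr0.
by move=> t [_ /=]; rewrite [t%:A]mulr1 => /UA.
Qed.

Lemma curve_cst E (A : set E) p : A p -> curve A p (cst p).
Proof.
move=> Ap; split=> //; exists setT; split=> //; split; first exact: openT.
by move=> k; apply: Ck_cst; exact: openT.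
Qed.

Lemma curve_pair E F (cE : coordinates E) (cF : coordinates F)
    (A : set E) (B : set F) p q gamma delta :
  curve A p gamma -> curve B q delta ->
  curve (A `*` B) (p, q) (fun t => (gamma t, delta t)).
Proof.
move=> [<- [U [U0 [Uo gs] UA]]] [<- [U' [U'0 [U'o ds] U'B]]]; split=> //.
exists (U `&` U'); split=> //.
  split; first exact: openI.
  move=> k; apply: Ck_pair => //; first exact: openI.
    by apply: Ck_sub (gs k) => t [].
  by apply: Ck_sub (ds k) => t [].
by move=> t [Ut U't]; split; [exact: UA | exact: U'B].
Qed.

Lemma curve_line E (p u : E) : curve setT p (fun t => p + t *: u).
Proof.
split; first by rewrite scale0r addr0.
by exists setT; split=> //; exact: smooth_affine.
Qed.

Lemma is_derive_affine E (p u : E) (t : R) :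
  is_derive t 1 (fun t => p + t *: u) u.
Proof.
rewrite -[X in is_derive _ _ _ X]add0r -[X in _ + X]scale1r.
apply: is_deriveD.
apply: (@is_derive_linear _ _ _ _ (scale_at u) id).
exact: scale_at_continuous.
Qed.

(** The level set through [a] is both relatively open and relatively closed in [A]. *)
Lemma connected_locally_constant E (T : Type) (A : set E) (f : E -> T) :
  connected A -> (forall a, A a -> \forall y \near a, A y -> f y = f a) ->
  forall a b, A a -> A b -> f a = f b.
Proof.
move=> Ac fl a b Aa Ab.
pose B := [set y | A y /\ f y = f a].
suff BA : B = A by have [] : B b by rewrite BA.
apply: Ac; first by exists a.
- exists ([set y | A y -> f y = f a]°); first exact: open_interior.
  rewrite /B eqEsubset; split=> y.
    move=> [Ay fy]; split=> //; rewrite /interior.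
    by apply: filterS (fl y Ay) => z Hz Az; rewrite Hz // fy.
  by move=> [Ay /interior_subset /= Hy]; split=> //; exact: Hy.
- exists (~` [set y | A y -> f y <> f a]°).
    by apply: open_closedC; exact: open_interior.
  rewrite /B eqEsubset; split=> y.
    by move=> [Ay fy]; split=> // /interior_subset /= /(_ Ay).
  move=> [Ay /= Hy]; split=> //; apply: contrapT => fy; apply: Hy.
  rewrite /interior; apply: filterS (fl y Ay) => z Hz Az.
  by rewrite (Hz Az).
Qed.

(** In a chart whose domain contains a ball around [psi a], the image of the segment from [psi a] to
    [psi y] is such a path. *)
Lemma submanifold_path E (cE : coordinates E) d (A : set E) a :
  submanifold d A -> A a ->
  \forall y \near a, A y -> exists (U : set R^o) (xi : R -> E),
    [/\ smooth_on U (xi : R^o -> E), forall t, U t -> A (xi t),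
        forall t, 0 <= t <= 1 -> U t & xi 0 = a /\ xi 1 = y].
Proof.
move=> As Aa; have [U [W [phi [psi [Ua phis psis Wphi Uy]]]]] := As _ Aa.
have [Wpa phipa] := Uy _ Ua Aa.
have [Wo _] := phis; have [Uo psik] := psis.
have /nbhs_normP [r /= r0 Wr] := open_nbhs_nbhs (conj Wo Wpa).
have /cvgrPdist_lt /(_ _ r0) psic := psik 0%N a Ua.
near=> y; move=> Ay.
have Uy' : U y by near: y; exact: open_nbhs_nbhs.
have [Wpy phipy] := Uy _ Uy' Ay.
have pr : `|psi a - psi y| < r by near: y; exact: psic.
pose l := fun t : R^o => psi a + t *: (psi y - psi a).
have := smooth_comp coordinates_R (coordinates_mx 1 d) cE phis
  (smooth_affine (psi a) (psi y - psi a)).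
set I := _ `&` _ => Is.
exists I, (phi \o l); split=> //.
- by move=> t [_ /= Wt]; have [] := Wphi _ Wt.
- move=> t /andP[t0 t1]; split=> //=; apply: Wr; rewrite /ball_ /=.
  rewrite opprD addNKr normrN normrZ distrC (ger0_norm t0).
  by apply: le_lt_trans pr; rewrite ler_piMl.
- by rewrite /l /= scale0r addr0 scale1r subrKC.
Unshelve. all: by end_near. Qed.

End Curves.

Section LieGroups.
Context {R : realType}.

Lemma is_derive_shift0 (E : normedModType R) (h : R -> E) t0 df :
  is_derive (0 : R) 1 (fun s => h (t0 + s)) df -> is_derive t0 1 h df.
Proof.
move=> /is_deriveP hd; apply/is_deriveP.
apply: cvg_trans hd; apply/near_eq_cvg/nearW => s.
by rewrite !addr0 (addrC t0).
Qed.

Variable G : lie_group R.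

Lemma lg_mulrV x : lg_set x -> lg_mul x (lg_inv x) = lg_one G.
Proof.
move=> Gx; have Gy := lg_inv_in Gx; have Gz := lg_inv_in Gy.
have Gxy := lg_mul_in Gx Gy.
rewrite -[LHS]lg_mul1 // -(lg_mulV Gy) -lg_mulA //.
by rewrite [X in lg_mul _ X]lg_mulA // lg_mulV // lg_mul1.
Qed.

(** Right translation moves any piece of curve to the identity, the only point where velocities of
    the action are controlled. *)
Lemma lg_curve_translate (U : set R^o) (xi : R -> 'rV[R]_(lg_amb G)) t0 :
  smooth_on U (xi : R^o -> _) -> (forall t, U t -> lg_set (xi t)) -> U t0 ->
  curve (@lg_set R G) (lg_one G) (fun s => lg_mul (xi (t0 + s)) (lg_inv (xi t0))).
Proof.
move=> xs UG Ut0; have Gx := UG _ Ut0.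
have c1 := curve_shift (coordinates_mx 1 _) xs UG Ut0.
have c2 := curve_cst (lg_inv_in Gx).
have c := curve_pair (coordinates_mx 1 _) (coordinates_mx 1 _) c1 c2.
have := smooth_map_curve (coordinates_prod (coordinates_mx 1 _) (coordinates_mx 1 _))
  (coordinates_mx 1 _) (@lg_mul_smooth _ G) _ c.
rewrite /= lg_mulrV //; apply.
by move=> [x y] [/= Hx Hy]; exact: lg_mul_in.
Qed.

Variables (M : kahler R) (cM : coordinates (amb M)).
Variable act : 'rV[R]_(lg_amb G) -> amb M -> amb M.
Hypothesis actP : action_by_holomorphic_isometries act.

Lemma act_pts x p : lg_set x -> pts p -> pts (act x p).
Proof.
by move=> Gx Mp; have [f' /hi_fun/(_ p Mp)[]] := act_isometry actP Gx.
Qed.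

Lemma act_curve gamma p : curve (@lg_set R G) (lg_one G) gamma -> pts p ->
  curve (@pts R M) p (fun t => act (gamma t) p).
Proof.
move=> Gg Mp; rewrite -{1}(act_one actP Mp).
have c := curve_pair (coordinates_mx 1 _) cM Gg (curve_cst Mp).
apply: (smooth_map_curve (coordinates_prod (coordinates_mx 1 _) cM) cM
  (act_smooth actP) _ c) => -[x q] [/= Gx Mq]; exact: act_pts.
Qed.

Lemma orbit_tangent_tangent p : pts p ->
  orbit_tangent act p `<=` tangent (@pts R M) p.
Proof.
move=> Mp _ [gamma Gg <-]; exists (fun t => act (gamma t) p) => //.
exact: act_curve.
Qed.

Hypothesis Gc : connected (@lg_set R G).

(** Along a path [xi] of the group, the derivative of [phi (act (xi t) p)] at any time is one at
    time 0 for the translated curve and the point [act (xi t) p]; it vanishes. Thus [phi (act x p)]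
    is locally constant in [x], and connectedness concludes. *)
Lemma action_invariant (phi : amb M -> R) :
  (forall gamma q, curve (@lg_set R G) (lg_one G) gamma -> pts q ->
     is_derive (0 : R) 1 (fun t => phi (act (gamma t) q)) 0) ->
  forall x p, lg_set x -> pts p -> phi (act x p) = phi p.
Proof.
move=> phi0 x p Gx Mp; rewrite -[in RHS](act_one actP Mp).
apply: (connected_locally_constant (f := fun x => phi (act x p)) Gc) => //;
  last exact: lg_one_in.
move=> a Ga.
have := submanifold_path (coordinates_mx 1 _) (@lg_submanifold _ G) Ga.
apply: filterS => y Hy Gy; have [U [xi [xs UG U01 [xi0 xi1]]]] := Hy Gy.
have xid t : U t -> is_derive t 1 (fun t => phi (act (xi t) p)) 0.
  move=> Ut; apply: is_derive_shift0.
  have := phi0 _ (act (xi t) p) (lg_curve_translate xs UG Ut)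
    (act_pts (UG _ Ut) Mp).
  apply: near_eq_is_derive.
  have [Uo _] := xs.
  have : \forall s \near (0 : R), U (t + s).
    have : (fun s : R => t + s) @ (0 : R) --> t + 0.
      by apply: cvgD; [exact: cvg_cst | exact: cvg_id].
    rewrite addr0; apply; exact: open_nbhs_nbhs.
  apply: filterS => s Us.
  have Gt := UG _ Ut; have Gs := UG _ Us; have Gi := lg_inv_in Gt.
  rewrite -(act_mul actP) //; last exact: lg_mul_in.
  rewrite -lg_mulA // lg_mulV // (act_mul actP) ?(act_one actP) //.
  exact: lg_one_in.
have m01 : Num.min (0 : R) 1 = 0 by rewrite /Num.min ltr01.
have M01 : Num.max (0 : R) 1 = 1 by rewrite /Num.max ltr01.
have H1 t : t \in `[Num.min (0 : R) 1, Num.max 0 1] ->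
    is_derive t 1 (fun t => phi (act (xi t) p)) (cst 0 t).
  by rewrite m01 M01 in_itv /= => /U01 /xid.
have H2 t : t \in `[Num.min (0 : R) 1, Num.max 0 1] -> `|cst (0 : R) t| <= 0.
  by rewrite normr0.
have := MVT_norm H1 H2; rewrite mul0r normr_le0 subr_eq0 => /eqP.
by rewrite xi0 xi1.
Qed.

End LieGroups.

Section Subgroup.
Context {R : realType}.

(* The equation [sum_i psi_i (t_i) = y] is solved for small [y] by the
   contraction principle. *)
Lemma additive_subgroup_full n (H : set 'rV[R]_n) :
  H 0 -> (forall x y, H x -> H y -> H (x + y)) ->
  (forall i : 'I_n, exists psi : R -> 'rV[R]_n, curve H 0 psi /\ derive1 psi 0 = delta_mx 0 i) ->
  forall x, H x.
Proof.
move=> H0 HD Hpsi.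
have [psi psiP] : exists psi : 'I_n -> R -> 'rV[R]_n, forall i,
    curve H 0 (psi i) /\ derive1 (psi i) 0 = delta_mx 0 i by have [psi psiP] := choice Hpsi; exists psi.
(* The deviation of [psi i] from its tangent line: its derivative at 0 vanishes, so it has a small
   Lipschitz constant near 0. *)
pose g (i : 'I_n) (t : R) : 'rV[R]_n := psi i t - t *: delta_mx 0 i.
(* The sum of [n] maps of Lipschitz constant [eps] then has constant at most 1/2; the successor
   keeps the denominator nonzero when [n = 0]. *)
pose eps : R := (2 * n.+1%:R)^-1.
have eps0 : 0 < eps by rewrite invr_gt0 mulr_gt0.
have gd i (j : 'I_n) : \forall t \near (0 : R), H (psi i t) /\
    exists2 d, is_derive t 1 (fun t => g i t 0 j) d & `|d| <= eps.
  have [[p0 [U [U0 [Uo Us] UH]]] pd] := psiP i.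
  have [pder pcont] := Us 1%N 1.
  have /cvgrPdist_le /(_ _ eps0) pc := pcont 0 U0.
  near=> t; have Ut : U t by near: t; exact: open_nbhs_nbhs.
  split; first exact: UH.
  exists (('D_1 (psi i : R^o -> _) t - delta_mx 0 i) 0 j).
    have gE : is_derive t 1 (g i) ('D_1 (psi i : R^o -> _) t - delta_mx 0 i).
      apply: is_deriveB; first exact/derivableP/pder.
      have := is_derive_affine 0 (delta_mx 0 i : 'rV[R]_n) t.
      by under [X in is_derive _ _ X]eq_fun do rewrite add0r.
    exact: (is_derive_linear (L := coord_mx_fun (0, j))
      (@coord_continuous _ _ _ 0 j) gE).
  have : `|'D_1 (psi i : R^o -> _) 0 - 'D_1 (psi i : R^o -> _) t| <= eps.
    by near: t.
  rewrite -[X in X - _]derive1E pd distrC; apply: le_trans.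
  rewrite {2}/Num.norm /= mx_normrE.
  exact: (le_bigmax _ (fun ij => `|_ ij.1 ij.2|) (0, j)).
pose P (i j : 'I_n) (t : R) := H (psi i t) /\
    exists2 d, is_derive t 1 (fun t => g i t 0 j) d & `|d| <= eps.
have : \forall t \near (0 : R), forall i j : 'I_n, P i j t.
  apply: (@filter_forall R 'I_n (fun i t => forall j, P i j t) (nbhs (0 : R)) _).
  move=> i; apply: (@filter_forall R 'I_n (P i) (nbhs (0 : R)) _) => j.
  exact: gd.
move=> /nbhs_normP [r0 /= r00 Hr0].
pose r := r0 / 2.
have r_gt0 : 0 < r by rewrite divr_gt0.
have Hr t : `|t| <= r -> forall i j, H (psi i t) /\
    exists2 d, is_derive t 1 (fun t => g i t 0 j) d & `|d| <= eps.
  move=> tr; apply: Hr0; rewrite /ball_ /= sub0r normrN.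
  apply: le_lt_trans tr _; rewrite /r; lra.
have glip i j t s : `|t| <= r -> `|s| <= r ->
    `|g i t 0 j - g i s 0 j| <= eps * `|t - s|.
  move=> tr sr.
  have between u : u \in `[Num.min s t, Num.max s t] -> `|u| <= r.
    move: tr sr; rewrite in_itv /= !ler_norml ge_min le_max; lra.
  have /choice [d dP] : forall u : R, exists d : R, `|u| <= r ->
      is_derive u 1 (fun t => g i t 0 j) d /\ `|d| <= eps.
    move=> u; have [ur|] := boolP (`|u| <= r); last by exists 0.
    by have [_ [d d1 d2]] := Hr _ ur i j; exists d.
  have H1 u : u \in `[Num.min s t, Num.max s t] ->
      is_derive u 1 (fun t => g i t 0 j) (d u) by move=> /between /dP [].
  have H2 u : u \in `[Num.min s t, Num.max s t] -> `|d u| <= eps.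
    by move=> /between /dP [].
  exact: (MVT_norm H1 H2).
pose B : set 'rV[R]_n := closed_ball_ Num.norm 0 r.
have entry (x : 'rV[R]_n) j : `|x 0 j| <= `|x|.
  rewrite {2}/Num.norm /= mx_normrE.
  exact: (le_bigmax _ (fun ij => `|_ ij.1 ij.2|) (0, j)).
have BE x : B x -> forall j, `|x 0 j| <= r.
  by rewrite /B /closed_ball_ /= sub0r normrN => xr j; exact: le_trans (entry x j) xr.
have nle (x : 'rV[R]_n) a : 0 <= a -> (forall j, `|x 0 j| <= a) -> `|x| <= a.
  move=> a0 xa; rewrite {1}/Num.norm /= mx_normrE; apply: bigmax_le => // -[i j] _ /=.
  by rewrite ord1.
(* [t] is a fixed point of [Phi y] exactly when [\sum_i psi i (t 0 i) = y]. *)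
pose Phi (y t : 'rV[R]_n) : 'rV[R]_n := y - \sum_i g i (t 0 i).
have Philip y t s : B t -> B s -> `|Phi y t - Phi y s| <= 2^-1 * `|t - s|.
  move=> tB sB; apply: nle => [|j]; first by rewrite mulr_ge0.
  have -> : Phi y t - Phi y s = \sum_i (g i (s 0 i) - g i (t 0 i)).
    have AB (a b c : 'rV[R]_n) : a - b - (a - c) = c - b.
      by rewrite opprB addrC addrA subrK.
    by rewrite /Phi AB; rewrite -sumrB.
  rewrite summxE (le_trans (ler_norm_sum _ _ _)) //.
  apply: (@le_trans _ _ (\sum_(i < n) eps * `|t - s|)).
    apply: ler_sum => i _.
    have := glip i j (s 0 i) (t 0 i) (BE _ sB i) (BE _ tB i).
    rewrite (_ : (g i (s 0 i) - g i (t 0 i)) 0 j =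
      g i (s 0 i) 0 j - g i (t 0 i) 0 j); last by rewrite !mxE.
    move=> /le_trans; apply.
    apply: ler_wpM2l; first exact: ltW.
    by have := entry (t - s) i; rewrite !mxE distrC.
  rewrite sumr_const card_ord.
  have en : eps * n%:R <= 2^-1.
    rewrite /eps invfM -mulrA ler_piMr // mulrC ler_pdivrMr // mul1r.
    by rewrite ler_nat.
  have eu (u : R) : 0 <= u -> eps * u *+ n <= 2^-1 * u.
    by move=> u0; rewrite -mulr_natr mulrAC ler_wpM2r.
  exact: eu.
have g0 i : g i 0 = 0.
  by rewrite /g scale0r subr0; have [[]] := psiP i.
have B0 : B 0 by rewrite /B /closed_ball_ /= subrr normr0 ltW.
have Hsmall y : `|y| <= r / 2 -> H y.
  move=> yr.
  have PhiB t : B t -> B (Phi y t).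
    move=> tB; rewrite /B /closed_ball_ /= sub0r normrN.
    have := Philip y t 0 tB B0.
    have -> : Phi y 0 = y by rewrite /Phi big1 ?subr0 // => i _; rewrite mxE g0.
    rewrite subr0 => H1.
    have tr : `|t| <= r by move: tB; rewrite /B /closed_ball_ /= sub0r normrN.
    have := ler_normD (Phi y t - y) y; rewrite subrK; lra.
  pose f : {fun B >-> B} := mkfun PhiB.
  have ctr : is_contraction f.
    exists (NngNum (ltW (divr_gt0 ltr01 (ltr0Sn R 1)))); split=> /=; first lra.
    move=> -[t s] [/= tB sB]; rewrite mul1r; exact: Philip.
  have [|t tB tE] := banach_fixed_point ctr _ (ex_intro _ 0 B0).
    exact: closed_closed_ball_.
  have -> : y = \sum_i psi i (t 0 i).
    have : t = y - \sum_i g i (t 0 i) by exact: tE.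
    rewrite /g sumrB -row_sum_delta.
    set S := \sum_i _ => tyS; rewrite -[y](addrNK (S - t)) -tyS.
    by rewrite addrC subrK.
  elim/big_ind : _ => // i _.
  by have [] := Hr _ (BE _ tB i) i i.
(* An arbitrary [x] is [k] times a vector of norm at most [r / 2]. *)
move=> x; pose k := Num.bound (`|x| / (r / 2)).
have r2 : 0 < r / 2 by rewrite divr_gt0.
have kx : `|x| / (r / 2) < k%:R by apply: archi_boundP; rewrite divr_ge0 // ltW.
have k0 : 0 < k%:R :> R by apply: le_lt_trans kx; rewrite divr_ge0 // ltW.
have HM m y : H y -> H (y *+ m).
  by move=> Hy; elim: m => [|m IH]; rewrite ?mulr0n // mulrS; exact: HD.
have -> : x = (k%:R^-1 *: x) *+ k.
  by rewrite -scaler_nat scalerA divff ?scale1r // gt_eqF.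
apply/HM/Hsmall; rewrite normrZ normfV ger0_norm ?ler0n //.
by rewrite ler_pdivrMl // -ler_pdivrMr // ltW.
Unshelve. all: by end_near. Qed.

End Subgroup.

End CurvesAndActions.
Import CurvesAndActions.

Module HermitianForms.

(** * Hermitian linear algebra *)

Section ComplexMatrices.
Context {R : realType}.
Local Notation C := R[i].
Implicit Types m n p : nat.

Lemma conjcE (z : C) : Num.conj z = (z^*)%C. Proof. by []. Qed.

Lemma Re_conj (z : C) : complex.Re (Num.conj z) = complex.Re z.
Proof. by rewrite conjcE; case: z. Qed.

Lemma ReD (a b : C) : complex.Re (a + b) = complex.Re a + complex.Re b.
Proof. by case: a b => a1 a2 [b1 b2]. Qed.

Lemma ReN (a : C) : complex.Re (- a) = - complex.Re a.
Proof. by case: a. Qed.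

Lemma ReB (a b : C) : complex.Re (a - b) = complex.Re a - complex.Re b.
Proof. by rewrite ReD ReN. Qed.

Lemma ReM (a b : C) : complex.Re (a * b) =
  complex.Re a * complex.Re b - complex.Im a * complex.Im b.
Proof. by case: a b => a1 a2 [b1 b2]. Qed.

Lemma ReZ (r : R) (a : C) : complex.Re ((r%:C)%C * a) = r * complex.Re a.
Proof. by case: a => a1 a2 /=; rewrite mul0r subr0. Qed.

Lemma ReMi (a : C) : complex.Re ('i%C * a) = - complex.Im a.
Proof. by case: a => a1 a2 /=; rewrite mul0r mul1r sub0r. Qed.

Lemma Re_sum (I : finType) (F : I -> C) :
  complex.Re (\sum_i F i) = \sum_i complex.Re (F i).
Proof. by elim/big_rec2 : _ => // i x y _ <-; rewrite ReD. Qed.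

Lemma conj_real (r : R) : Num.conj (r%:C)%C = (r%:C)%C.
Proof. by rewrite conjcE; apply: conjc_real. Qed.

Lemma conj_i : Num.conj ('i%C : C) = - 'i%C.
Proof. by rewrite conjcE /=; apply/eqP; rewrite eq_complex /= oppr0 !eqxx. Qed.

Lemma i_neq0 : ('i%C : C) != 0.
Proof. by rewrite eq_complex /= oner_eq0 andbF. Qed.

Lemma ii : 'i%C * 'i%C = -1 :> C.
Proof. by rewrite -expr2 sqr_i. Qed.

Lemma realC_neq0 (r : R) : r != 0 -> (r%:C)%C != 0 :> C.
Proof. by move=> r0; rewrite eq_complex /= eqxx andbT. Qed.

Lemma complex_real_conj (z : C) : Num.conj z = z -> z = ((complex.Re z)%:C)%C.
Proof.
case: z => a b; rewrite conjcE => /eqP; rewrite eq_complex /= eqxx /=.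
by move=> /eqP h; apply/eqP; rewrite eq_complex /= eqxx /=; lra.
Qed.

Lemma complex_eq_Re (z : C) : complex.Re z = 0 -> complex.Re ('i%C * z) = 0 ->
  z = 0.
Proof.
rewrite ReMi => h1 h2; apply/eqP; rewrite eq_complex h1 eqxx /=.
by rewrite -oppr_eq0 h2.
Qed.

Lemma toCK m n : cancel (@toC R m n) (@ofC R m n).
Proof.
by move=> [A B]; congr pair; apply/matrixP => i j; rewrite !mxE.
Qed.

Lemma ofCK m n : cancel (@ofC R m n) (@toC R m n).
Proof.
by move=> A; apply/matrixP => i j; rewrite !mxE /=; case: (A i j).
Qed.

Lemma toC_inj m n : injective (@toC R m n).
Proof. exact: can_inj (@toCK m n). Qed.

Lemma ofC_inj m n : injective (@ofC R m n).
Proof. exact: can_inj (@ofCK m n). Qed.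

Lemma toCD m n (X Y : cmat R m n) : toC (X + Y) = toC X + toC Y.
Proof.
by apply/matrixP => i j; rewrite !mxE; apply/eqP; rewrite eq_complex /= !eqxx.
Qed.

Lemma toCZ m n (r : R) (X : cmat R m n) : toC (r *: X) = (r%:C)%C *: toC X.
Proof.
apply/matrixP => i j; rewrite !mxE; apply/eqP.
by rewrite eq_complex /= !mul0r subr0 addr0 !eqxx.
Qed.

Lemma toC0 m n : toC (0 : cmat R m n) = 0.
Proof. by apply/matrixP => i j; rewrite !mxE. Qed.

Lemma toCN m n (X : cmat R m n) : toC (- X) = - toC X.
Proof. by apply/eqP; rewrite -addr_eq0 -toCD addNr toC0. Qed.

Lemma toCB m n (X Y : cmat R m n) : toC (X - Y) = toC X - toC Y.
Proof. by rewrite toCD toCN. Qed.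

Lemma ofCD m n (A B : 'M[C]_(m, n)) : ofC (A + B) = ofC A + ofC B.
Proof. by apply: toC_inj; rewrite toCD !ofCK. Qed.

Lemma ofCN m n (A : 'M[C]_(m, n)) : ofC (- A) = - ofC A.
Proof. by apply: toC_inj; rewrite toCN !ofCK. Qed.

Lemma ofCB m n (A B : 'M[C]_(m, n)) : ofC (A - B) = ofC A - ofC B.
Proof. by rewrite ofCD ofCN. Qed.

Lemma ofC0 m n : ofC (0 : 'M[C]_(m, n)) = 0.
Proof. by apply: toC_inj; rewrite toC0 ofCK. Qed.

Lemma ofCZ m n (r : R) (A : 'M[C]_(m, n)) : ofC ((r%:C)%C *: A) = r *: ofC A.
Proof. by apply: toC_inj; rewrite toCZ !ofCK. Qed.

Lemma toC_sum m n (I : finType) (F : I -> cmat R m n) :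
  toC (\sum_i F i) = \sum_i toC (F i).
Proof. by elim/big_rec2 : _ => [|i x y _ <-]; rewrite ?toC0 ?toCD. Qed.

Lemma adj_entry m n (A : 'M[C]_(m, n)) i j : A^t* i j = Num.conj (A j i).
Proof. by rewrite !mxE. Qed.

Lemma adjM m n p (A : 'M[C]_(m, n)) (B : 'M[C]_(n, p)) :
  (A *m B)^t* = B^t* *m A^t*.
Proof. by rewrite trmx_mul map_mxM. Qed.

Lemma adjD m n (A B : 'M[C]_(m, n)) : (A + B)^t* = A^t* + B^t*.
Proof. by rewrite linearD /= map_mxD. Qed.

Lemma adjZ m n a (A : 'M[C]_(m, n)) : (a *: A)^t* = Num.conj a *: A^t*.
Proof. by rewrite linearZ /= map_mxZ. Qed.

Lemma adjK m n (A : 'M[C]_(m, n)) : A^t*^t* = A.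
Proof. exact: trmxCK. Qed.

Lemma adj1 n : (1%:M : 'M[C]_n)^t* = 1%:M.
Proof. by rewrite trmx1 map_mx1. Qed.

Lemma tr_adj n (A : 'M[C]_n) : \tr (A^t*) = Num.conj (\tr A).
Proof.
by rewrite /mxtrace rmorph_sum; apply: eq_bigr => i _; rewrite !mxE.
Qed.

Lemma is_derive_lin (V E F : normedModType R) (cE : coordinates E) (L : E -> F)
    (f : V -> E) x v df :
  linear L -> is_derive x v f df -> is_derive x v (fun y => L (f y)) (L df).
Proof.
move=> Ll fd.
pose L' : {linear E -> F} := HB.pack L (GRing.isLinear.Build R E F _ L Ll).
exact: (is_derive_linear (L := L') (linear_cont cE (L := L')) fd).
Qed.

Lemma is_derive_cmatM m n p (f : R -> cmat R m n) (g : R -> cmat R n p)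
    (t : R) (df : cmat R m n) (dg : cmat R n p) :
  is_derive t 1 f df -> is_derive t 1 g dg ->
  is_derive t 1 (fun s => ofC (toC (f s) *m toC (g s)))
    (ofC (toC df *m toC (g t) + toC (f t) *m toC dg)).
Proof.
move=> fd gd.
have co i j : (linear (fun X : cmat R m n => X.1 i j : R^o)) *
              (linear (fun X : cmat R m n => X.2 i j : R^o)).
  by split=> a x y /=; rewrite !mxE.
have co' i j : (linear (fun X : cmat R n p => X.1 i j : R^o)) *
              (linear (fun X : cmat R n p => X.2 i j : R^o)).
  by split=> a x y /=; rewrite !mxE.
have f1 i j := is_derive_lin (coordinates_cmat m n) (co i j).1 fd.
have f2 i j := is_derive_lin (coordinates_cmat m n) (co i j).2 fd.
have g1 i j := is_derive_lin (coordinates_cmat n p) (co' i j).1 gd.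
have g2 i j := is_derive_lin (coordinates_cmat n p) (co' i j).2 gd.
have mulD (a b : R -> R) da db : is_derive t 1 a da -> is_derive t 1 b db ->
    is_derive t 1 (fun s => a s * b s) (da * b t + a t * db).
  move=> ad bd; have := @is_deriveM _ _ a b t 1 da db ad bd.
  by rewrite -[_ *: da]/(_ * da) -[_ *: db]/(_ * db) addrC (mulrC (b t)).
apply: (is_derive_coord (cE := coordinates_cmat m p)).
case=> -[i j].
  rewrite (_ : _ \o _ = fun s => \sum_k ((f s).1 i k * (g s).1 k j -
      (f s).2 i k * (g s).2 k j)); last first.
    apply/funext => s; rewrite /= /coord_prod_fun /= /coord_mx_fun /= !mxE Re_sum.
    by apply: eq_bigr => k _; rewrite !mxE ReM.
  rewrite (_ : coord_fun _ _ _ = \sum_k ((df.1 i k * (g t).1 k j + (f t).1 i k * dg.1 k j) -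
      (df.2 i k * (g t).2 k j + (f t).2 i k * dg.2 k j))); last first.
    rewrite /= /coord_prod_fun /= /coord_mx_fun /= !mxE ReD !Re_sum -big_split.
    by apply: eq_bigr => k _; rewrite !mxE !ReM /=; ring.
  by apply: is_derive_sum_fin => k; apply: is_deriveB; apply: mulD.
rewrite (_ : _ \o _ = fun s => \sum_k ((f s).1 i k * (g s).2 k j +
      (f s).2 i k * (g s).1 k j)); last first.
  apply/funext => s; rewrite /= /coord_prod_fun /= /coord_mx_fun /= !mxE.
  rewrite -[LHS]opprK -ReMi mulr_sumr Re_sum -sumrN; apply: eq_bigr => k _.
  by rewrite !mxE ReMi /= opprK.
rewrite (_ : coord_fun _ _ _ = \sum_k ((df.1 i k * (g t).2 k j + (f t).1 i k * dg.2 k j) +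
      (df.2 i k * (g t).1 k j + (f t).2 i k * dg.1 k j))); last first.
  rewrite /= /coord_prod_fun /= /coord_mx_fun /= !mxE.
  rewrite -[LHS]opprK -ReMi mulrDr ReD !mulr_sumr !Re_sum opprD -!sumrN -big_split.
  by apply: eq_bigr => k _; rewrite !mxE !ReMi /= !opprK; ring.
by apply: is_derive_sum_fin => k; apply: is_deriveD; apply: mulD.
Qed.

End ComplexMatrices.

Section HermitianForm.
Context {R : realType} {N : nat}.
Local Notation C := R[i].
Variable D : 'M[C]_N.
Implicit Types (x y z : 'cV[C]_N) (A B : 'M[C]_N).

Definition ip x y : C := (x^t* *m D *m y) 0 0.
(** The rank-one endomorphism [z |-> ip y z *: x]. *)
Definition outer x y : 'M[C]_N := x *m y^t* *m D.
(** The adjoint for the form [D], that is D^-1 A^* D with D^-1 = D for the forms considered. *)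
Definition dag A : 'M[C]_N := D *m A^t* *m D.

Lemma ipE x y : x^t* *m D *m y = (ip x y)%:M.
Proof. exact: mx11_scalar. Qed.

Lemma ipDr x y z : ip x (y + z) = ip x y + ip x z.
Proof. by rewrite /ip mulmxDr mxE. Qed.
Lemma ipDl x y z : ip (x + y) z = ip x z + ip y z.
Proof. by rewrite /ip adjD !mulmxDl mxE. Qed.
Lemma ipZr a x y : ip x (a *: y) = a * ip x y.
Proof. by rewrite /ip -scalemxAr mxE. Qed.
Lemma ipZl a x y : ip (a *: x) y = Num.conj a * ip x y.
Proof. by rewrite /ip adjZ -!scalemxAl mxE. Qed.
Lemma ipNr x y : ip x (- y) = - ip x y.
Proof. by rewrite -scaleN1r ipZr mulN1r. Qed.
Lemma ipNl x y : ip (- x) y = - ip x y.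
Proof. by rewrite -scaleN1r ipZl rmorphN1 mulN1r. Qed.
Lemma ipBr x y z : ip x (y - z) = ip x y - ip x z.
Proof. by rewrite ipDr ipNr. Qed.
Lemma ipBl x y z : ip (x - y) z = ip x z - ip y z.
Proof. by rewrite ipDl ipNl. Qed.
Lemma ip0r x : ip x 0 = 0.
Proof. by rewrite /ip mulmx0 mxE. Qed.
Lemma ip0l x : ip 0 x = 0.
Proof. by rewrite -(scale0r 0) ipZl rmorph0 mul0r. Qed.

Lemma outerDl x y z : outer (x + y) z = outer x z + outer y z.
Proof. by rewrite /outer !mulmxDl. Qed.
Lemma outerDr x y z : outer x (y + z) = outer x y + outer x z.
Proof. by rewrite /outer adjD mulmxDr mulmxDl. Qed.
Lemma outerZl a x y : outer (a *: x) y = a *: outer x y.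
Proof. by rewrite /outer -!scalemxAl. Qed.
Lemma outerZr a x y : outer x (a *: y) = Num.conj a *: outer x y.
Proof. by rewrite /outer adjZ -scalemxAr -scalemxAl. Qed.
Lemma outerNl x y : outer (- x) y = - outer x y.
Proof. by rewrite -scaleN1r outerZl scaleN1r. Qed.
Lemma outerNr x y : outer x (- y) = - outer x y.
Proof. by rewrite -scaleN1r outerZr rmorphN1 scaleN1r. Qed.
Lemma outer0l x : outer 0 x = 0.
Proof. by rewrite /outer !mul0mx. Qed.
Lemma outer0r x : outer x 0 = 0.
Proof. by rewrite -(scale0r 0) outerZr rmorph0 scale0r. Qed.

Lemma outer_mulv x y z : outer x y *m z = ip y z *: x.
Proof. by rewrite /outer -!mulmxA (mulmxA _ D) ipE mul_mx_scalar. Qed.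
Lemma mul_outer A x y : A *m outer x y = outer (A *m x) y.
Proof. by rewrite /outer !mulmxA. Qed.
Lemma tr_outer x y : \tr (outer x y) = ip y x.
Proof. by rewrite /outer -mulmxA mxtrace_mulC ipE mxtrace_scalar. Qed.

Lemma hformE x : hform D x = ip x x. Proof. by []. Qed.
Lemma line_ofE x : line_of D x = ofC ((ip x x)^-1 *: outer x x). Proof. by []. Qed.

Lemma tr_outer_mul A x y : \tr (outer x y *m A) = ip y (A *m x).
Proof. by rewrite mxtrace_mulC mul_outer tr_outer. Qed.

Lemma tr_outer_sym a r y :
  \tr ((outer a r + outer r a) *m (outer y r + outer r y)) =
  ip r a * ip r y + ip y a * ip r r + (ip r r * ip a y + ip y r * ip a r).
Proof. by rewrite mulmxDl mxtraceD !tr_outer_mul !mulmxDl !outer_mulv !ipDr !ipZr. Qed.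

Hypothesis (D_herm : D^t* = D) (D_inv : D *m D = 1%:M).

Lemma ipC x y : ip y x = Num.conj (ip x y).
Proof.
rewrite /ip.
rewrite -adj_entry.
by rewrite !adjM adjK D_herm mulmxA.
Qed.

Lemma ip_real x : ip x x = ((complex.Re (ip x x))%:C)%C.
Proof. by apply: complex_real_conj; rewrite -ipC. Qed.

Lemma dagK : involutive dag.
Proof.
move=> A; rewrite /dag !adjM adjK D_herm !mulmxA D_inv mul1mx -mulmxA D_inv.
by rewrite mulmx1.
Qed.
Lemma dagD A B : dag (A + B) = dag A + dag B.
Proof. by rewrite /dag adjD mulmxDr mulmxDl. Qed.
Lemma dagZ a A : dag (a *: A) = Num.conj a *: dag A.
Proof. by rewrite /dag adjZ -scalemxAr -scalemxAl. Qed.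
Lemma dagN A : dag (- A) = - dag A.
Proof. by rewrite -scaleN1r dagZ rmorphN1 scaleN1r. Qed.
Lemma dagB A B : dag (A - B) = dag A - dag B.
Proof. by rewrite dagD dagN. Qed.
Lemma dagM A B : dag (A *m B) = dag B *m dag A.
Proof.
rewrite /dag adjM !mulmxA -(mulmxA _ D D) D_inv mulmx1.
by rewrite -!mulmxA.
Qed.
Lemma dag1 : dag 1%:M = 1%:M.
Proof. by rewrite /dag adj1 mulmx1. Qed.
Lemma tr_dag A : \tr (dag A) = Num.conj (\tr A).
Proof. by rewrite /dag -mulmxA mxtrace_mulC -mulmxA D_inv mulmx1 tr_adj. Qed.

Lemma ip_dagr A x y : ip x (A *m y) = ip (dag A *m x) y.
Proof.
rewrite /ip /dag !adjM adjK D_herm !mulmxA.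
by congr ((_ *m _) 0 0); rewrite -!mulmxA D_inv mulmx1.
Qed.
Lemma ip_dagl A x y : ip (A *m x) y = ip x (dag A *m y).
Proof. by rewrite ip_dagr dagK. Qed.

Lemma dag_outer x y : dag (outer x y) = outer y x.
Proof.
by rewrite /dag /outer !adjM adjK D_herm !mulmxA D_inv mul1mx.
Qed.
Lemma outer_mul A x y : outer x y *m A = outer x (dag A *m y).
Proof.
by rewrite -[LHS]dagK dagM dag_outer mul_outer dag_outer.
Qed.
Lemma outerM x y z w : outer x y *m outer z w = ip y z *: outer x w.
Proof. by rewrite mul_outer outer_mulv outerZl. Qed.

Lemma outer_ext A : (forall x, A *m x = 0) -> A = 0.
Proof.
move=> Ax; apply/matrixP => i j.
have := Ax (delta_mx j 0); rewrite -colE => /matrixP /(_ i 0).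
by rewrite !mxE.
Qed.

End HermitianForm.

End HermitianForms.
Import HermitianForms.

Module CosineComparison.

(** * Comparison with circular and hyperbolic cosines *)

Section Comparison.
Context {R : realType}.
Implicit Types (W dW : R -> R) (T : R).

Lemma is_derive_ext (V E : normedModType R) (f g : V -> E) x v df :
  f =1 g -> is_derive x v f df -> is_derive x v g df.
Proof. by move=> /funext ->. Qed.

Lemma MVT_norm0 (f df : R -> R) (T e : R) : 0 <= T ->
  (forall x : R, is_derive x 1 f (df x)) -> (forall x, `|df x| <= e) ->
  `|f T - f 0| <= e * T.
Proof.
move=> T0 fd dfe.
have H1 x : x \in `[Num.min 0 T, Num.max 0 T] -> is_derive x 1 f (df x) by [].
have H2 x : x \in `[Num.min 0 T, Num.max 0 T] -> `|df x| <= e by [].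
by have := MVT_norm H1 H2; rewrite subr0 (ger0_norm T0).
Qed.

Lemma norm_le_sqr (x y : R) : 0 <= y -> x ^+ 2 <= y ^+ 2 -> `|x| <= y.
Proof. by move=> y0 xy; rewrite ler_norml; apply/andP; split; nra. Qed.

Lemma norm_div_sqrt_le (x s : R) : 0 < s -> x ^+ 2 <= 4 * s ->
  `|x / Num.sqrt s| <= 2.
Proof.
move=> s0 xs; have q0 : 0 < Num.sqrt s by rewrite sqrtr_gt0.
rewrite normrM normfV (gtr0_norm q0) ler_pdivrMr //.
apply: norm_le_sqr; first by rewrite mulr_ge0 // ltW.
have e (u : R) : (2 * u) ^+ 2 = 4 * u ^+ 2 by ring.
by rewrite e sqr_sqrtr // ltW.
Qed.

(* [acos (W * cos d)] is 2-Lipschitz for every [d] in ]0, pi/2[; then [d]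
   tends to 0. *)
Lemma cos_comparison W dW T : 0 <= T -> 2 * T <= pi -> W 0 = 1 ->
  (forall t : R, is_derive t 1 W (dW t)) ->
  (forall t, (dW t) ^+ 2 <= 4 * (1 - (W t) ^+ 2)) -> cos (2 * T) <= W T.
Proof.
move=> T0 Tpi W0 Wd dWle.
have W1 t : (W t) ^+ 2 <= 1 by have := dWle t; have := sqr_ge0 (dW t); lra.
have WN1 t : -1 <= W t by have := W1 t; nra.
have Wle1 t : W t <= 1 by have := W1 t; nra.
move: Tpi; rewrite le_eqVlt => /orP[/eqP ->|Tpi]; first by rewrite cospi.
have pi0 := pi_gt0 R.
have key d : 0 < d -> d < pi / 2 -> d + 2 * T <= pi ->
    cos (d + 2 * T) <= W T * cos d.
  move=> d0 d2 dT.
  have c0 : 0 < cos d by apply: cos_gt0_pihalf; lra.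
  have c1 : cos d < 1.
    rewrite -cos0; rewrite ltr_cos ?in_itv /=; lra.
  (* The factor [cos d < 1] keeps the argument of [acos] in the open interval where it is
     differentiable, even when [W t] is 1 or -1. *)
  have Wc t : -1 < W t * cos d < 1.
    have := WN1 t; have := Wle1 t; move: c0 c1.
    set w := W t; set c := cos d => c0 c1 w1 wN1; apply/andP; split; nra.
  have Wc2 t : 0 < 1 - (W t * cos d) ^+ 2 by have := Wc t; nra.
  pose f t := acos (W t * cos d).
  pose df t := - (dW t * cos d / Num.sqrt (1 - (W t * cos d) ^+ 2)).
  have fd (t : R) : is_derive t 1 f (df t).
    have h1 : is_derive t 1 (fun t => W t * cos d) (dW t * cos d).
      have := is_deriveZ (cos d) (Wd t).
      rewrite -[_ *: dW t]/(_ * dW t) mulrC; apply: is_derive_ext => s.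
      by rewrite mulrC.
    have := @is_derive1_comp R acos (fun t => W t * cos d) t _ _
      (is_derive1_acos (Wc t)) h1.
    by rewrite mulNr mulrC.
  have dfle t : `|df t| <= 2.
    rewrite normrN; apply: norm_div_sqrt_le => //.
    have := dWle t; have := W1 t; move: c0 c1; set c := cos d; set w := W t.
    move: (dW t) => x c0 c1 w1 xw; rewrite !exprMn.
    have c21 : c ^+ 2 <= 1 by nra.
    have : x ^+ 2 * c ^+ 2 <= 4 * (1 - w ^+ 2) * c ^+ 2 by rewrite ler_wpM2r // sqr_ge0.
    nra.
  have := MVT_norm0 T0 fd dfle; rewrite /f W0 mul1r cosK ?in_itv /=; last lra.
  move=> /ler_normlP[_ h].
  have [/andP[a0 api] aE] := acos_def (x := W T * cos d) (ltac:(have := Wc T; lra)).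
  rewrite -aE leNgt ltr_cos ?in_itv /= -?leNgt; lra.
rewrite leNgt; apply/negP => lt.
pose g (d : R) : R := cos (d + 2 * T) - W T * cos d.
have gc : {for 0, continuous g}.
  apply: continuousB; last first.
    by apply: continuousM; [exact: cst_continuous | exact: continuous_cos].
  apply: (@continuous_comp _ _ _ (fun d => d + 2 * T) cos).
    by apply: continuousD; [exact: cvg_id|exact: cst_continuous].
  exact: continuous_cos.
have g0 : 0 < g 0 by rewrite /g cos0 add0r mulr1 subr_gt0.
have /nbhs_normP[e /= e0 he] : \forall d \near (0 : R), 0 < g d.
  exact: cvgr_gt gc _ g0.
pose d : R := Num.min (e / 2) (Num.min (pi / 4) (pi - 2 * T)).
have d0 : 0 < d by rewrite !lt_min; apply/and3P; split; lra.
have : d <= Num.min (pi / 4) (pi - 2 * T) by rewrite ge_min lexx orbT.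
rewrite le_min => /andP[d4 dT].
have de : d <= e / 2 by rewrite ge_min lexx.
have := he d; rewrite /ball_ /= sub0r normrN gtr0_norm // => /(_ (ltac:(lra))).
by rewrite /g subr_gt0 ltNge key //; lra.
Qed.

(* [ln (W + sqrt (W^2 - 1 + d^2))] is 2-Lipschitz for every [d] in ]0, 1[;
   then [d] tends to 0. *)
Lemma cosh_comparison W dW T : 0 <= T -> W 0 = 1 ->
  (forall t : R, is_derive t 1 W (dW t)) ->
  (forall t, (dW t) ^+ 2 <= 4 * ((W t) ^+ 2 - 1)) -> (forall t, 1 <= W t) ->
  W T <= (expR (2 * T) + expR (- (2 * T))) / 2.
Proof.
move=> T0 W0 Wd dWle W1.
set E := expR (2 * T).
have E1 : 1 <= E by rewrite -expR0 ler_expR mulr_ge0.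
have key d : 0 < d -> W T + Num.sqrt ((W T) ^+ 2 - 1) <= (1 + d) * E.
  move=> d0.
  have s0 t : 0 < (W t) ^+ 2 - (1 - d ^+ 2) by have := W1 t; nra.
  have q0 t : 0 < Num.sqrt ((W t) ^+ 2 - (1 - d ^+ 2)) by rewrite sqrtr_gt0.
  pose s t := W t + Num.sqrt ((W t) ^+ 2 - (1 - d ^+ 2)).
  have sgt0 t : 0 < s t by have := W1 t; have := q0 t; rewrite /s; lra.
  pose df t := dW t / Num.sqrt ((W t) ^+ 2 - (1 - d ^+ 2)).
  have fd (t : R) : is_derive t 1 (fun t => ln (s t)) (df t).
    have h1 : is_derive t 1 (fun t => (W t) ^+ 2 - (1 - d ^+ 2)) (2 * W t * dW t).
      have := is_deriveB (is_deriveM (Wd t) (Wd t)) (is_derive_cst (1 - d ^+ 2) t 1).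
      rewrite subr0 -[_ *: dW t]/(_ * dW t) => h.
      rewrite (_ : 2 * W t * dW t = W t * dW t + W t * dW t); last by ring.
      by apply: is_derive_ext h => u; rewrite expr2.
    have h2 := @is_derive1_comp R Num.sqrt
      (fun t => (W t) ^+ 2 - (1 - d ^+ 2)) t _ _ (is_derive1_sqrt (s0 t)) h1.
    have h3 := is_deriveD (Wd t) h2.
    have := @is_derive1_comp R (@ln R) s t _ _ (is_derive1_ln (sgt0 t)) h3.
    rewrite [X in is_derive _ _ _ X](_ : _ = df t) //.
    have := q0 t; have := sgt0 t; rewrite /df /s.
    set q := Num.sqrt _ => h4 h5; field.
    by rewrite !gt_eqF.
  have dfle t : `|df t| <= 2.
    by apply: norm_div_sqrt_le => //; have := dWle t; have := sqr_ge0 d; lra.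
  have := MVT_norm0 T0 fd dfle => /ler_normlP[_].
  rewrite lerBlDl -ler_expR expRD !lnK ?posrE ?sgt0 // -/E.
  rewrite /s W0 expr1n (_ : 1 - (1 - d ^+ 2) = d ^+ 2); last by lra.
  rewrite sqrtr_sqr (gtr0_norm d0).
  apply: le_trans; rewrite lerD2l; apply: ler_wsqrtr.
  by have := sqr_ge0 d; lra.
have z1 : W T + Num.sqrt ((W T) ^+ 2 - 1) <= E.
  apply/ler_addgt0Pr => e e0.
  have E0 : 0 < E by lra.
  by have := key (e / E) (divr_gt0 e0 E0); rewrite mulrDl mul1r divfK ?gt_eqF.
have W2 : 0 <= (W T) ^+ 2 - 1 by have := W1 T; nra.
have [q [q0 q2 zE]] : exists q : R, [/\ 0 <= q, q ^+ 2 = W T ^+ 2 - 1 & W T + q <= E].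
  exists (Num.sqrt (W T ^+ 2 - 1)); split=> //.
  exact: sqr_sqrtr.
have := W1 T; move: q2 zE; move: (W T) => w q2 zE w1.
(* With z = w + q one has w = (z + 1/z) / 2, an increasing function of z for z >= 1. *)
have zz : (w + q) * (w - q) = 1 by nra.
have EI : E * expR (- (2 * T)) = 1 by exact: expRxMexpNx_1.
move: (expR (- (2 * T))) EI => E' EI.
have E'0 : 0 < E' by nra.
(* The product expands to [E + E' - 2 * w], because [E * E' = 1] and [(w + q) * (w - q) = 1]. *)
have : (E - (w + q)) * (1 - E' * (w - q)) >= 0.
  apply: mulr_ge0; first lra.
  nra.
nra.
Qed.

Lemma acos_exists (c : R) : 0 <= c <= 1 ->
  exists T, [/\ 0 <= T, 2 * T <= pi & cos T = c].
Proof.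
move=> c01; exists (acos c).
have pi0 := pi_gt0 R.
have [/andP[a0 api] aE] := acos_def (x := c) (ltac:(lra)).
split=> //; rewrite leNgt; apply/negP => h.
have : cos (acos c) < cos (pi / 2) by rewrite ltr_cos ?in_itv /=; lra.
rewrite aE cos_pihalf; lra.
Qed.

Lemma acosh_exists (c : R) : 1 <= c ->
  exists T, 0 <= T /\ (expR T + expR (- T)) / 2 = c.
Proof.
move=> c1; have c2 : 0 <= c ^+ 2 - 1 by nra.
have := sqr_sqrtr c2; have := sqrtr_ge0 (c ^+ 2 - 1).
set q := Num.sqrt _ => q0 qE; exists (ln (c + q)).
have cq : 0 < c + q by lra.
split; first by rewrite ln_ge0 //; lra.
rewrite expRN lnK ?posrE //.
have -> : (c + q)^-1 = c - q.
  have cq0 : c + q != 0 by rewrite gt_eqF.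
  by apply: (mulfI cq0); rewrite divff //; nra.
lra.
Qed.

Definition gcos (k t : R) : R :=
  if k == 1 then cos t else (expR t + expR (- t)) / 2.
Definition gsin (k t : R) : R :=
  if k == 1 then sin t else (expR t - expR (- t)) / 2.

Lemma is_derive_expRN (t : R) : is_derive t 1 (fun t => expR (- t)) (- expR (- t)).
Proof.
have := is_derive1_comp (is_derive_expR (- t)) (is_deriveNid t 1).
by rewrite mulrN1.
Qed.

Section Gtrig.
Variables (k : R) (k1 : k = 1 \/ k = -1).

Lemma N1_neq1 : (-1 == 1 :> R) = false.
Proof. by apply/negP => /eqP; lra. Qed.

Lemma is_derive_gcos (t : R) : is_derive t 1 (gcos k) (- k * gsin k t).
Proof.
rewrite /gcos /gsin; case: k1 => ->; rewrite ?eqxx ?N1_neq1.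
  by rewrite mulN1r; exact: is_derive_cos.
have := is_deriveZ (2^-1) (is_deriveD (is_derive_expR t) (is_derive_expRN t)).
rewrite -[_ *: (_ + _)]/(_ * (_ + _)) opprK mul1r mulrC.
by apply: is_derive_ext => s; rewrite [RHS]mulrC.
Qed.

Lemma is_derive_gsin (t : R) : is_derive t 1 (gsin k) (gcos k t).
Proof.
rewrite /gcos /gsin; case: k1 => ->; rewrite ?eqxx ?N1_neq1.
  exact: is_derive_sin.
have := is_deriveZ (2^-1) (is_deriveB (is_derive_expR t) (is_derive_expRN t)).
rewrite -[_ *: (_ - _)]/(_ * (_ - _)) opprK mulrC.
by apply: is_derive_ext => s; rewrite [RHS]mulrC.
Qed.

Lemma gcos0 : gcos k 0 = 1.
Proof.
rewrite /gcos; case: k1 => ->; rewrite ?eqxx ?N1_neq1 ?cos0 //.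
by rewrite oppr0 expR0; lra.
Qed.

Lemma gsin0 : gsin k 0 = 0.
Proof.
rewrite /gsin; case: k1 => ->; rewrite ?eqxx ?N1_neq1 ?sin0 //.
by rewrite oppr0 expR0; lra.
Qed.

Lemma gcos2Dgsin2 t : gcos k t ^+ 2 + k * gsin k t ^+ 2 = 1.
Proof.
rewrite /gcos /gsin; case: k1 => ->; rewrite ?eqxx ?N1_neq1.
  by rewrite mul1r cos2Dsin2.
by have := expRxMexpNx_1 t; set a := expR t; set b := expR (- t); nra.
Qed.

(** Used with W = 2 tr (P Q) - 1 along a geodesic of length T, at the end of which tr (P Q) = c^2.
    As 2 c^2 - 1 is the circular or hyperbolic cosine of 2 T, both comparison results become the
    same sign condition, multiplied by [k]. *)
Lemma g_exists (c : R) : 0 <= c -> 0 <= k * (1 - c ^+ 2) ->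
  exists T, [/\ 0 <= T, gcos k T = c &
    forall W dW : R -> R, W 0 = 1 -> (forall t : R, is_derive t 1 W (dW t)) ->
      (forall t, (dW t) ^+ 2 <= 4 * (k * (1 - (W t) ^+ 2))) ->
      (forall t, 0 <= k * (1 - W t)) ->
      0 <= k * (W T - (2 * c ^+ 2 - 1))].
Proof.
rewrite /gcos; case: k1 => ->; rewrite ?eqxx ?N1_neq1 => c0 kc.
  have [|T [T0 Tpi cT]] := @acos_exists c; first nra.
  exists T; split=> // W dW W0 Wd dWle W1.
  have dWle' t : (dW t) ^+ 2 <= 4 * (1 - (W t) ^+ 2).
    by have := dWle t; rewrite mul1r.
  have := cos_comparison T0 Tpi W0 Wd dWle'.
  by rewrite mul1r subr_ge0 !mulr_natl cos_mulr2n cT.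
have [|T [T0 cT]] := @acosh_exists c; first nra.
exists T; split=> // W dW W0 Wd dWle W1.
have := cosh_comparison T0 W0 Wd.
have -> : (expR (2 * T) + expR (- (2 * T))) / 2 = 2 * c ^+ 2 - 1.
  rewrite -cT (_ : 2 * T = T + T); last by lra.
  rewrite opprD !expRD.
  by have := expRxMexpNx_1 T; set a := expR T; set b := expR (- T); nra.
move=> h; rewrite mulN1r oppr_ge0 subr_le0; apply: h => t.
  by have := dWle t; lra.
by have := W1 t; lra.
Qed.

End Gtrig.
End Comparison.

End CosineComparison.
Import CosineComparison.

Module LineSpaces.

Lemma is_derive_dir (R : realType) (E : normedModType R) (h : R^o -> E)
    (t w : R^o) d : is_derive t 1 h d -> is_derive t w h (w *: d).
Proof.
move=> [hd <-]; have dd : differentiable h t by apply/derivable1_diffP.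
apply: DeriveDef; first exact: diff_derivable.
by rewrite !deriveE // -linearZ /= [w%:A]mulr1.
Qed.

Lemma Ck_lin (R : realType) (V E F : normedModType R) (cE : coordinates E) n
    (U : set V) (L : E -> F) (f : V -> E) :
  open U -> linear L -> Ck n U f -> Ck n U (fun x => L (f x)).
Proof.
move=> Uo Ll fk.
pose L' : {linear E -> F} := HB.pack L (GRing.isLinear.Build R E F _ L Ll).
exact: (Ck_linear (L := L') Uo (linear_cont cE (L := L')) fk).
Qed.

Definition cscale (R : realType) N (M : 'M[R[i]]_N) (a : R^o) : cmat R N N :=
  ofC ((a%:C)%C *: M).

Lemma cscale_linear (R : realType) N (M : 'M[R[i]]_N) : linear (cscale M).
Proof.
by move=> a x y; rewrite /cscale rmorphD rmorphM /= scalerDl ofCD -scalerA ofCZ.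
Qed.

Lemma ofCD3 (R : realType) N (A B E : 'M[R[i]]_N) :
  ofC (A + (B + E)) = ofC A + (ofC B + ofC E).
Proof. by rewrite ofCD ofCD. Qed.

Lemma scale_swap (K : comNzRingType) (V : lmodType K) (a b : K) (X : V) :
  a *: (b *: X) = b *: (a *: X).
Proof. by rewrite !scalerA mulrC. Qed.

Lemma scale_square_mx (K : comNzRingType) N (k a b : K) (X Y Z W : 'M[K]_N) :
  k *: (a *: (a *: X) + a *: (b *: Y) + (b *: (a *: Z) + b *: (b *: W))) =
  (a * a) *: (k *: X) + ((a * b) *: (k *: (Y + Z)) + (b * b) *: (k *: W)).
Proof. by apply/matrixP => i j; rewrite !mxE; ring. Qed.

Lemma scale_square_deriv_mx (K : comNzRingType) N (k l a b : K)
    (X Y Z W : 'M[K]_N) :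
  (l * (- k * b) * a + a * (l * (- k * b))) *: (k *: X) +
  ((l * (- k * b) * b + a * (l * a)) *: (k *: (Y + Z)) +
   (l * a * b + b * (l * a)) *: (k *: W)) =
  l *: (k *:
   ((- k * b) *: (a *: X) + (- k * b) *: (b *: Y) +
    (a *: (a *: Z) + a *: (b *: W)) +
    (a *: ((- k * b) *: X) + a *: (a *: Y) +
     (b *: ((- k * b) *: Z) + b *: (a *: W))))).
Proof. by apply/matrixP => i j; rewrite !mxE; ring. Qed.

Opaque real_complex_def toC ofC ip outer dag gcos gsin line_of.

(** * Spaces of lines *)

(* The sign [k] is that of the curvature; the form is definite positive on the
   orthogonal of a vector representing a point. *)
Definition line_form (R : realType) N (D : 'M[R[i]]_N) (k c : R) :=
  [/\ D^t* = D, D *m D = 1%:M, k = 1 \/ k = -1, 0 < k * c &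
    forall v y, 0 < k * complex.Re (ip D v v) -> ip D v y = 0 -> y != 0 ->
      0 < complex.Re (ip D y y)].

Section LineSpace.
Context {R : realType} {N : nat}.
Local Notation C := R[i].
Variables (D : 'M[C]_N) (k c : R).
Hypothesis lf : line_form D k c.
Let D_herm : D^t* = D. Proof. by case: lf. Qed.
Let D_inv : D *m D = 1%:M. Proof. by case: lf. Qed.
Let k1 : k = 1 \/ k = -1. Proof. by case: lf. Qed.
Let kc : 0 < k * c. Proof. by case: lf. Qed.
Let D_pos v y : 0 < k * complex.Re (ip D v v) -> ip D v y = 0 -> y != 0 ->
  0 < complex.Re (ip D y y).
Proof. by case: lf => _ _ _ _; apply. Qed.
Local Notation ip := (ip D).
Local Notation outer := (outer D).
Local Notation dag := (dag D).
Local Notation kC := ((k%:C)%C).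
Local Notation dag_outer := (dag_outer D_herm D_inv).
Local Notation outer_mul := (outer_mul D_herm D_inv).
Local Notation ip_dagr := (ip_dagr D_herm D_inv).
Local Notation ip_dagl := (ip_dagl D_herm D_inv).
Local Notation dagK := (dagK D_herm D_inv).
Local Notation dagM := (dagM D_inv).
Implicit Types (x y z r v w : 'cV[C]_N) (A B P Q X Y : 'M[C]_N).

Definition normsq (z : C) : R := complex.Re (z * Num.conj z).

Lemma normsqE (z : C) : z * Num.conj z = ((normsq z)%:C)%C.
Proof.
by apply: complex_real_conj; rewrite rmorphM /= conjCK mulrC.
Qed.

Lemma normsq_ge0 (z : C) : 0 <= normsq z.
Proof. by rewrite /normsq; case: z => a b; rewrite conjcE /=; nra. Qed.

Lemma normsqM (z w : C) : normsq (z * w) = normsq z * normsq w.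
Proof. by rewrite /normsq; case: z w => a b [d e]; rewrite !conjcE /=; ring. Qed.

Lemma normsq_conj (z : C) : normsq (Num.conj z) = normsq z.
Proof. by rewrite /normsq conjCK mulrC. Qed.

Lemma sqr_Re_le (z : C) : complex.Re z ^+ 2 <= normsq z.
Proof. by rewrite /normsq; case: z => a b; rewrite !conjcE /=; nra. Qed.

Lemma normsq_eq0 (z : C) : normsq z = 0 -> z = 0.
Proof.
rewrite /normsq; case: z => a b; rewrite !conjcE /= => h.
by apply/eqP; rewrite eq_complex /=; apply/andP; split; apply/eqP; nra.
Qed.

Lemma kk : k * k = 1.
Proof. by case: k1 => ->; ring. Qed.

Lemma kCkC : kC * kC = 1.
Proof. by rewrite -rmorphM /= kk. Qed.

Lemma c_neq0 : c != 0.
Proof. by apply/eqP => c0; move: kc; rewrite c0 mulr0 ltxx. Qed.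

(** Representatives of a point are normalised to have square [k], which is -1 in the hyperbolic
    case; hence the factor [k] in the projector. *)
Definition unitv r := ip r r = kC.
Definition proj r := kC *: outer r r.
Definition cpt P := exists r, unitv r /\ P = proj r.

Lemma ptsE (X : cmat R N N) : pts (k := line_space D c) X <-> cpt (toC X).
Proof.
split=> [[v /= Hv <-]|[r [r1 XE]]].
  move: Hv; rewrite hformE (ip_real D_herm) -rmorphM ltcR.
  set a := complex.Re _ => ca.
  have ka : 0 < k * a.
    have : 0 < (k * c) * (c * a) by rewrite mulr_gt0.
    rewrite (_ : k * c * (c * a) = c ^+ 2 * (k * a)); last by ring.
    by rewrite pmulr_rgt0 // exprn_even_gt0 // c_neq0.
  have a0 : a != 0 by apply: contraTneq ka => ->; rewrite mulr0 ltxx.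
  pose s := Num.sqrt (k * a).
  have s2 : s ^+ 2 = k * a by rewrite sqr_sqrtr // ltW.
  have s0 : s != 0 by apply: contraTneq ka => s0; rewrite -s2 s0 expr0n ltxx.
  exists (((s^-1)%:C)%C *: v); split.
    rewrite /unitv ipZl ipZr conj_real (ip_real D_herm) -/a -!rmorphM.
    congr (real_complex _ _); have := kk.
    have -> : s^-1 * (s^-1 * a) = a / s ^+ 2 by field.
    rewrite s2 => kk1.
    by rewrite invfM mulrCA divff // mulr1; case: k1 => ->; rewrite ?invrN invr1.
  rewrite line_ofE ofCK /proj outerZl outerZr conj_real !scalerA.
  rewrite (ip_real D_herm) -/a -!rmorphM -fmorphV; congr (real_complex _ _ *: _).
  have -> : k * s^-1 * s^-1 = k / s ^+ 2 by field.
  by rewrite s2 invfM mulrA divff ?mul1r //; case: k1 => ->; rewrite ?oppr_eq0 oner_eq0.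
exists r; last first.
  rewrite line_ofE r1; apply: toC_inj; rewrite ofCK XE /proj.
  congr (_ *: _); rewrite -fmorphV; congr (real_complex _ _).
  by case: k1 => ->; rewrite ?invrN invr1.
by rewrite /= hformE r1 -rmorphM ltcR mulrC.
Qed.

Lemma unitv_pos r : unitv r -> 0 < k * complex.Re (ip r r).
Proof. by move=> ->; rewrite /= kk. Qed.

Lemma unitv_neq0 r : unitv r -> r != 0.
Proof.
move=> /unitv_pos; apply: contraTneq => ->; rewrite ip0r /=.
by rewrite mulr0 ltxx.
Qed.

Lemma ip_perp_ge0 r y : unitv r -> ip r y = 0 -> 0 <= complex.Re (ip y y).
Proof.
move=> /unitv_pos r1 ry; have [->|y0] := eqVneq y 0; first by rewrite ip0r.
exact/ltW/(D_pos r1).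
Qed.

Lemma proj_idem r : unitv r -> proj r *m proj r = proj r.
Proof.
move=> r1; rewrite /proj -scalemxAl -scalemxAr outerM r1 !scalerA.
by rewrite -mulrA kCkC mulr1.
Qed.

Lemma dag_proj r : dag (proj r) = proj r.
Proof. by rewrite /proj dagZ conj_real dag_outer. Qed.

Lemma tr_proj r : unitv r -> \tr (proj r) = 1.
Proof. by move=> r1; rewrite /proj mxtraceZ tr_outer r1 kCkC. Qed.

Lemma proj_mulv r x : proj r *m x = (kC * ip r x) *: r.
Proof. by rewrite /proj -scalemxAl outer_mulv scalerA. Qed.

Lemma proj_id r : unitv r -> proj r *m r = r.
Proof. by move=> r1; rewrite proj_mulv r1 kCkC scale1r. Qed.

Lemma tr_proj_mul r A : \tr (A *m proj r) = kC * ip r (A *m r).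
Proof. by rewrite /proj -scalemxAr mxtraceZ mul_outer tr_outer. Qed.

Lemma proj_sandwich r A : proj r *m A *m proj r = \tr (A *m proj r) *: proj r.
Proof.
rewrite tr_proj_mul /proj -!scalemxAl -!scalemxAr outer_mul outerM.
rewrite -ip_dagr !scalerA; congr (_ *: _).
by rewrite -mulrA mulrC.
Qed.

(** The form is positive definite on the orthogonal of [r] only, where the usual argument applies:
    the vector [z] has nonnegative square. *)
Lemma cauchy_schwarz r x y : unitv r -> ip r x = 0 -> ip r y = 0 ->
  normsq (ip x y) <= complex.Re (ip x x) * complex.Re (ip y y).
Proof.
move=> r1 rx ry.
have [->|y0] := eqVneq y 0.
  by rewrite !ip0r /normsq mul0r /= mulr0.
have yy : 0 < complex.Re (ip y y) by apply: D_pos (unitv_pos r1) ry y0.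
pose z := ip y y *: x - ip y x *: y.
have rz : ip r z = 0 by rewrite /z ipBr !ipZr rx ry !mulr0 subr0.
have := ip_perp_ge0 r1 rz.
have -> : ip z z = ip y y * (ip x x * ip y y - ip x y * ip y x).
  have cyy : Num.conj (ip y y) = ip y y := esym (ipC D_herm y y).
  have cyx : Num.conj (ip y x) = ip x y := esym (ipC D_herm y x).
  rewrite /z !(ipBr, ipBl, ipZl, ipZr) cyy cyx.
  move: (ip y y) (ip y x) (ip x y) (ip x x) => a b d e; ring.
rewrite (ipC D_herm x y) normsqE (ip_real D_herm y) (ip_real D_herm x).
rewrite -!rmorphM -rmorphB -rmorphM /= => h.
have : 0 <= complex.Re (ip x x) * complex.Re (ip y y) - normsq (ip x y).
  by rewrite -(pmulr_rge0 _ yy).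
lra.
Qed.

(** The equations [dag P = P] and [P *m P = P] linearised at [P]. *)
Definition tangent_at P X := dag X = X /\ X *m P + P *m X = X.

Lemma tangent_at_perp r X : unitv r -> tangent_at (proj r) X ->
  ip r (X *m r) = 0.
Proof.
move=> r1 [_ XE]; have := congr1 (fun Z => Z *m r) XE.
rewrite /= mulmxDl -!mulmxA proj_id // => /eqP; rewrite -subr_eq0 addrAC.
rewrite subrr add0r proj_mulv scaler_eq0 (negPf (unitv_neq0 r1)) orbF.
have kC0 : kC != 0 by apply: realC_neq0; case: k1 => ->; rewrite ?oppr_eq0 oner_eq0.
by rewrite mulf_eq0 (negPf kC0) => /eqP.
Qed.

(** A tangent vector is determined by [X *m r], which is orthogonal to [r]: this is the
    identification of the tangent space with Hom(P, P^perp). *)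
Lemma tangent_atE r X : unitv r -> tangent_at (proj r) X ->
  X = kC *: (outer (X *m r) r + outer r (X *m r)).
Proof.
move=> r1 [dX XE]; rewrite -{1}XE /proj -scalemxAr -scalemxAl mul_outer.
by rewrite outer_mul dX -scalerDr.
Qed.

Lemma proj_perp r y : ip r y = 0 -> proj r *m y = 0.
Proof. by move=> ry; rewrite proj_mulv ry mulr0; exact: scale0r. Qed.

Lemma outer_proj r x y : outer x y *m proj r = outer x (proj r *m y).
Proof. by rewrite outer_mul dag_proj. Qed.

Lemma ip_perpC r y : ip r y = 0 -> ip y r = 0.
Proof. by move=> ry; rewrite (ipC D_herm r) ry; exact: rmorph0. Qed.

Lemma tangent_at_outer r y : unitv r -> ip r y = 0 ->
  tangent_at (proj r) (kC *: (outer y r + outer r y)).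
Proof.
move=> r1 ry.
split; first by rewrite dagZ conj_real dagD !dag_outer [outer r y + _]addrC.
rewrite (_ : _ + _ = kC *: ((outer y r + outer r y) *m proj r +
  proj r *m (outer y r + outer r y))); last first.
  by rewrite [RHS]scalerDr [in RHS]scalemxAl [in RHS]scalemxAr.
congr (_ *: _).
rewrite mulmxDl mulmxDr !outer_proj !mul_outer proj_id // proj_perp //.
by rewrite outer0l outer0r addr0 add0r.
Qed.

Lemma tr_sqr_outer r y : unitv r -> ip r y = 0 ->
  \tr ((kC *: (outer y r + outer r y)) *m (kC *: (outer y r + outer r y))) =
  ((2 * k)%:C)%C * ip y y.
Proof.
move=> r1 ry; have yr := ip_perpC ry.
rewrite -scalemxAl -scalemxAr scalerA kCkC scale1r.
rewrite tr_outer_sym ry yr r1 rmorphM /= rmorph_nat; move: (ip y y) => a; ring.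
Qed.

(** * Geodesics *)

Section Geodesic.
Variables (r y : 'cV[C]_N) (lam : R).
Hypotheses (r1 : unitv r) (ry : ip r y = 0) (y1 : ip y y = 1).

Local Notation cs t := (gcos k (lam * t)).
Local Notation sn t := (gsin k (lam * t)).

Definition geov (t : R) := ((cs t)%:C)%C *: r + ((sn t)%:C)%C *: y.
Definition geov' (t : R) := ((- k * sn t)%:C)%C *: r + ((cs t)%:C)%C *: y.
Definition geo (t : R) : cmat R N N := ofC (proj (geov t)).

Lemma ip_yr : ip y r = 0.
Proof. exact: ip_perpC. Qed.

Lemma geov_unit t : unitv (geov t).
Proof.
rewrite /unitv /geov !(ipDl, ipDr, ipZl, ipZr) !conj_real ry ip_yr r1 y1.
rewrite !mulr0 addr0 add0r mulr1 -!rmorphM -rmorphD; congr (real_complex _ _).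
rewrite -[RHS]mulr1 -(gcos2Dgsin2 k1 (lam * t)) mulrDr mulrA kk; ring.
Qed.

Lemma geov_perp t : ip (geov t) (geov' t) = 0.
Proof.
rewrite /geov /geov' !(ipDl, ipDr, ipZl, ipZr) !conj_real ry ip_yr r1 y1.
rewrite !mulr0 addr0 add0r mulr1 -!rmorphM -rmorphD /=.
set a := gcos _ _; set b := gsin _ _.
have -> : a * (- k * b * k) + b * a = a * b * (1 - k * k) by ring.
by rewrite kk subrr mulr0.
Qed.

Lemma geov'_unit t : ip (geov' t) (geov' t) = 1.
Proof.
rewrite /geov' !(ipDl, ipDr, ipZl, ipZr) !conj_real ry ip_yr r1 y1.
rewrite !mulr0 addr0 add0r mulr1 -!rmorphM -rmorphD /=.
have := gcos2Dgsin2 k1 (lam * t); set a := gcos _ _; set b := gsin _ _ => ab.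
have -> : - k * b * (- k * b * k) + a * a = a ^+ 2 + (k * k) * (k * b ^+ 2).
  by ring.
by rewrite kk mul1r ab.
Qed.

Let M1 : 'M[C]_N := kC *: outer r r.
Let M2 : 'M[C]_N := kC *: (outer r y + outer y r).
Let M3 : 'M[C]_N := kC *: outer y y.

(** The geodesic is a quadratic polynomial in [cs] and [sn] with constant matrix coefficients, from
    which its derivative and its smoothness are read. *)
Lemma geoE t : geo t =
  cscale M1 (cs t * cs t) + (cscale M2 (cs t * sn t) + cscale M3 (sn t * sn t)).
Proof.
rewrite /cscale -ofCD3; congr ofC.
rewrite /proj /geov !(outerDl, outerDr) !(outerZl, outerZr) !conj_real /M1 /M2 /M3.
move: (outer r r) (outer r y) (outer y r) (outer y y) => X Y Z W.
rewrite (rmorphM _ (cs t)) (rmorphM _ (cs t) (sn t)) (rmorphM _ (sn t)) /=.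
exact: scale_square_mx.
Qed.

Lemma is_derive_lam (f : R -> R) df (t : R) : is_derive (lam * t) 1 f df ->
  is_derive t 1 (fun t => f (lam * t)) (lam * df).
Proof.
move=> fd; have h : is_derive t 1 (fun t => lam * t) lam.
  by have := is_deriveZ lam (is_derive_id t 1); rewrite -[_ *: 1]/(_ * 1) mulr1.
by have := is_derive1_comp fd h; rewrite mulrC.
Qed.

Lemma is_derive_geo (t : R) : is_derive t 1 geo
  (cscale (kC *: (outer (geov' t) (geov t) + outer (geov t) (geov' t))) lam).
Proof.
have dc := is_derive_lam (is_derive_gcos k1 (lam * t)).
have ds := is_derive_lam (is_derive_gsin k1 (lam * t)).
have mulD (a b : R -> R) da db : is_derive t 1 a da -> is_derive t 1 b db ->
    is_derive t 1 ((fun s => a s * b s) : R -> R^o) (da * b t + a t * db).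
  move=> ad bd; have := @is_deriveM _ _ a b t 1 da db ad bd.
  by rewrite -[_ *: da]/(_ * da) -[_ *: db]/(_ * db) addrC (mulrC (b t)).
have sc (M : 'M[C]_N) (a : R -> R^o) (da : R^o) := @is_derive_lin _ _ _ _ coordinates_R (cscale M) a t 1 da (cscale_linear M).
have := is_deriveD (sc M1 _ _ (mulD _ _ _ _ dc dc))
  (is_deriveD (sc M2 _ _ (mulD _ _ _ _ dc ds)) (sc M3 _ _ (mulD _ _ _ _ ds ds))).
set d1 := (X in is_derive _ _ _ X -> _); set d2 := (X in _ -> is_derive _ _ _ X).
have -> : d1 = d2.
  rewrite /d1 /d2 /cscale -ofCD3; congr ofC; rewrite /geov /geov'.
  rewrite !(outerDl, outerDr) !(outerZl, outerZr) !conj_real /M1 /M2 /M3.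
  move: (outer r r) (outer r y) (outer y r) (outer y y) => X Y Z W.
  move: (gcos _ _) (gsin _ _) => a b.
  rewrite !(rmorphD (real_complex R)) !(rmorphM (real_complex R)) (rmorphN (real_complex R)) /=.
  exact: scale_square_deriv_mx.
by apply: is_derive_ext => s; rewrite geoE.
Qed.

(** The span of [cs] and [sn] is stable under derivation, so the induction is on arbitrary
    combinations. *)
Lemma Ck_gtrig n (a b : R) :
  Ck n setT ((fun t : R => a * cs t + b * sn t) : R^o -> R^o).
Proof.
have d (a' b' : R) (t w : R) : is_derive t w ((fun t : R => a' * cs t + b' * sn t) : R^o -> R^o)
   (w *: (b' * lam * cs t + (- a' * lam * k) * sn t)).
  apply: is_derive_dir.
  have h1 := is_deriveZ a' (is_derive_lam (is_derive_gcos k1 (lam * t))).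
  have h2 := is_deriveZ b' (is_derive_lam (is_derive_gsin k1 (lam * t))).
  have := is_deriveD h1 h2.
  rewrite (_ : _ + _ = b' * lam * cs t + - a' * lam * k * sn t) //.
  rewrite -[a' *: _]/(a' * _) -[b' *: _]/(b' * _); ring.
elim: n a b => [|n IH] a b /=.
  move=> t _; have [dd _] := d a b t 1.
  by apply: differentiable_continuous; apply/derivable1_diffP.
move=> w; split=> [t _|]; first by have [] := d a b t w.
apply: Ck_ext (IH (w * (b * lam)) (w * (- a * lam * k))); first exact: openT.
move=> t _; have [_ ->] := d a b t w.
by rewrite -[_ *: _]/(_ * _) mulrDr !mulrA.
Qed.

Lemma geo_smooth : smooth_on setT (geo : R^o -> cmat R N N).
Proof.
split; first exact: openT.
move=> n.
have Cc : Ck n setT ((fun t : R => cs t) : R^o -> R^o).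
  apply: Ck_ext (Ck_gtrig n 1 0); first exact: openT.
  by move=> t _; rewrite mul1r mul0r addr0.
have Cs : Ck n setT ((fun t : R => sn t) : R^o -> R^o).
  apply: Ck_ext (Ck_gtrig n 0 1); first exact: openT.
  by move=> t _; rewrite mul1r mul0r add0r.
have M (f g : R -> R) := CkM (coordinates_R (R := R)) (f := f) (g := g) (k := n) openT.
have sc (M : 'M[C]_N) (a : R -> R^o) := @Ck_lin _ _ _ _ (coordinates_R (R := R)) n setT (cscale M) a openT (cscale_linear M).
have := CkD openT (sc M1 _ (M _ _ Cc Cc)) (CkD openT (sc M2 _ (M _ _ Cc Cs)) (sc M3 _ (M _ _ Cs Cs))).
by apply: Ck_ext; [exact: openT | move=> t _; rewrite geoE].
Qed.

Lemma geo_pts t : pts (k := line_space D c) (geo t).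
Proof.
by apply/ptsE; exists (geov t); rewrite ofCK; split=> //; exact: geov_unit.
Qed.

Lemma geo_curve t : curve (@pts R (line_space D c)) (geo t) (fun s => geo (t + s)).
Proof.
apply: (curve_shift (U := setT) (coordinates_cmat N N) geo_smooth) => // s _.
exact: geo_pts.
Qed.

Lemma geo_curve0 : curve (@pts R (line_space D c)) (geo 0) geo.
Proof.
split=> //; exists setT; split=> //; first exact: geo_smooth.
by move=> t _; exact: geo_pts.
Qed.

End Geodesic.

Lemma realC_inj_scale (s : R) : s != 0 -> (s%:C)%C * (s^-1%:C)%C = 1 :> C.
Proof. by move=> s0; rewrite -rmorphM divff. Qed.

Lemma geov0 r y lam : geov r y lam 0 = r.
Proof.
rewrite /geov mulr0 gcos0 // gsin0 // -[RHS]addr0; congr (_ + _).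
  by rewrite -[RHS]scale1r.
exact: scale0r.
Qed.

Lemma geov'0 r y lam : geov' r y lam 0 = y.
Proof.
rewrite /geov' mulr0 gcos0 // gsin0 // mulr0 -[RHS]add0r; congr (_ + _).
  exact: scale0r.
by rewrite -[RHS]scale1r.
Qed.

Local Notation M := (line_space D c).

Lemma curve_near (E : normedModType R) (A : set E) p gamma :
  curve A p gamma -> \forall t \near (0 : R), A (gamma t).
Proof.
move=> [_ [U [U0 [Uo _] UA]]].
by apply: filterS (open_nbhs_nbhs (conj Uo U0)) => t /UA.
Qed.

Lemma curve_tangent_at (P : cmat R N N) gamma : curve (@pts R M) P gamma ->
  tangent_at (toC P) (toC (derive1 gamma 0)).
Proof.
move=> Mg; have gd := curve_is_derive Mg; have g0 : gamma 0 = P by case: Mg.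
have near0 := curve_near Mg.
set X := derive1 gamma 0 in gd *.
have dagl : linear (fun Y : cmat R N N => ofC (dag (toC Y))).
  by move=> a Y Z; rewrite toCD toCZ dagD dagZ conj_real ofCD ofCZ.
split.
  apply: ofC_inj; rewrite toCK.
  apply: (is_derive_unique _ gd).
  have := is_derive_lin (coordinates_cmat N N) dagl gd.
  apply: near_eq_is_derive; apply: filterS near0 => t /ptsE [r [_ E]].
  by rewrite E dag_proj -E toCK.
apply: ofC_inj; rewrite toCK -g0.
apply: (is_derive_unique _ gd).
have := is_derive_cmatM gd gd.
apply: near_eq_is_derive; apply: filterS near0 => t /ptsE [r [r1 E]].
by rewrite E proj_idem // -E toCK.
Qed.

(** Conversely, a solution [X] of the linearised equations is the initial velocity of a geodesic,
    with direction [X *m r] normalised and speed [s] its length; the constant curve serves for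
    [X = 0]. *)
Lemma tangentE (P X : cmat R N N) : pts (k := M) P ->
  tangent (@pts R M) P X <-> tangent_at (toC P) (toC X).
Proof.
move=> MP; split=> [[gamma Mg <-]|]; first exact: curve_tangent_at.
have /ptsE [r [r1 PE]] := MP; rewrite PE => TX.
have XE := tangent_atE r1 TX; have ry := tangent_at_perp r1 TX.
set y0 := toC X *m r in XE ry.
have [y00|y0N0] := eqVneq y0 0.
  exists (cst P); first exact: curve_cst.
  have -> : X = 0.
    apply: toC_inj; rewrite XE y00 outer0l outer0r addr0 toC0; exact: scaler0.
  by rewrite derive1E derive_cst.
have s20 : 0 < complex.Re (ip y0 y0) by apply: D_pos (unitv_pos r1) ry y0N0.
pose s := Num.sqrt (complex.Re (ip y0 y0)).
have s0 : s != 0 by rewrite gt_eqF // sqrtr_gt0.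
have ss : s * s = complex.Re (ip y0 y0) by rewrite -expr2 sqr_sqrtr // ltW.
pose y := ((s^-1)%:C)%C *: y0.
have ry' : ip r y = 0 by rewrite /y ipZr ry; exact: mulr0.
have yy : ip y y = 1.
  rewrite /y ipZl ipZr conj_real (ip_real D_herm) -ss -!rmorphM.
  by rewrite (_ : s^-1 * _ = 1) ?rmorph1 //; field.
exists (geo r y s).
  have := geo_curve0 s r1 ry' yy.
  by rewrite {1}/geo geov0 -PE toCK.
rewrite derive1E; have [_ ->] := is_derive_geo r y s 0.
rewrite geov0 geov'0 /cscale -[RHS]toCK XE; congr ofC.
have y0E : y0 = (s%:C)%C *: y by rewrite /y scalerA realC_inj_scale // scale1r.
clearbody y; have -> : outer y0 r = (s%:C)%C *: outer y r by rewrite y0E outerZl.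
have -> : outer r y0 = (s%:C)%C *: outer r y.
  refine (etrans (congr1 (outer r) y0E) (etrans (outerZr _ _ _ _) _)).
  by rewrite conj_real.
by rewrite scale_swap scalerDr.
Qed.

End LineSpace.

End LineSpaces.
Import LineSpaces.

Module LineIsometries.

Opaque real_complex_def toC ofC ip outer dag gcos gsin line_of.

Lemma is_derive_shift (R : realType) (E : normedModType R) (h : R -> E) (t : R) d :
  is_derive t 1 h d -> is_derive (0 : R) 1 (fun s => h (t + s)) d.
Proof.
move=> /is_deriveP hd; apply/is_deriveP.
apply: cvg_trans hd; apply/near_eq_cvg/nearW => s.
by rewrite !addr0 (addrC t).
Qed.

(** * Isometries of spaces of lines *)

Section TracePreservation.
Context {R : realType} {N : nat}.
Local Notation C := R[i].
Variables (D : 'M[C]_N) (k c : R).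
Hypothesis lf : line_form D k c.
Let D_herm : D^t* = D. Proof. by case: lf. Qed.
Let D_inv : D *m D = 1%:M. Proof. by case: lf. Qed.
Let k1 : k = 1 \/ k = -1. Proof. by case: lf. Qed.
Local Notation ip := (ip D).
Local Notation outer := (outer D).
Local Notation dag := (dag D).
Local Notation kC := ((k%:C)%C).
Local Notation M := (line_space D c).
Local Notation unitv := (unitv D k).
Local Notation proj := (proj D k).
Implicit Types (x y z r v w : 'cV[C]_N) (A B : 'M[C]_N).

Lemma tr_projM r w : \tr (proj r *m proj w) = ((normsq (ip r w))%:C)%C.
Proof.
rewrite tr_proj_mul proj_mulv ipZr mulrA mulrA (kCkC lf) mul1r.
by rewrite (ipC D_herm r) normsqE.
Qed.

Definition retr (X Y : cmat R N N) : R := complex.Re (\tr (toC X *m toC Y)).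

Lemma retr_real (P Q : cmat R N N) : pts (k := M) P -> pts (k := M) Q ->
  \tr (toC P *m toC Q) = ((retr P Q)%:C)%C.
Proof.
move=> /(ptsE lf) [r [_ rE]] /(ptsE lf) [w [_ wE]].
by rewrite /retr rE wE tr_projM.
Qed.

Lemma normsqZ (a : R) (z : C) : normsq ((a%:C)%C * z) = a ^+ 2 * normsq z.
Proof. by rewrite normsqM; congr (_ * _); rewrite /normsq conj_real -rmorphM. Qed.

Lemma ip_perp_part r w : unitv r -> ip r (w - (kC * ip r w) *: r) = 0.
Proof.
move=> r1; rewrite ipBr ipZr r1 mulrAC (kCkC lf) mul1r; exact: subrr.
Qed.

Lemma ip_perp_norm r w : unitv r -> unitv w ->
  ip (w - (kC * ip r w) *: r) (w - (kC * ip r w) *: r) =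
  ((k * (1 - normsq (ip r w)))%:C)%C.
Proof.
move=> r1 w1; rewrite {1}ipBl ipZl (ip_perp_part _ r1) mulr0 subr0.
rewrite ipBr w1 ipZr (ipC D_herm r) -mulrA normsqE -rmorphM -rmorphB.
by rewrite mulrBr mulr1.
Qed.

Lemma normsq_bound r w : unitv r -> unitv w -> 0 <= k * (1 - normsq (ip r w)).
Proof.
move=> r1 w1; have := ip_perp_ge0 lf r1 (ip_perp_part w r1).
by rewrite ip_perp_norm.
Qed.

Lemma phase (z : C) : exists u : C, normsq u = 1 /\
  exists a : R, 0 <= a /\ u * z = (a%:C)%C.
Proof.
have [->|z0] := eqVneq z 0.
  by exists 1; split; [rewrite /normsq rmorph1 mulr1 | exists 0; rewrite mulr0].
pose a := Num.sqrt (normsq z).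
have n0 : 0 < normsq z.
  by rewrite lt_def normsq_ge0 andbT; apply: contra_neq z0 => /normsq_eq0.
have a2 : a ^+ 2 = normsq z by rewrite sqr_sqrtr // ltW.
have a0 : a != 0 by rewrite gt_eqF // sqrtr_gt0.
exists ((a^-1%:C)%C * Num.conj z); split.
  by rewrite normsqZ normsq_conj -a2 exprVn mulVf // expf_neq0.
exists a; split; first exact: sqrtr_ge0.
rewrite -mulrA (mulrC _ z) normsqE -a2 -rmorphM expr2 mulKf //.
Qed.

Lemma projZ (u : C) w : normsq u = 1 -> proj (u *: w) = proj w.
Proof.
move=> u1; rewrite /LineSpaces.proj outerZl outerZr (scalerA u) normsqE u1.
by congr (_ *: _); exact: scale1r.
Qed.

Lemma unitvZ (u : C) w : normsq u = 1 -> unitv w -> unitv (u *: w).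
Proof.
move=> u1 w1; rewrite /unitv ipZl ipZr w1 mulrA (mulrC _ u) normsqE u1.
exact: mul1r.
Qed.

Lemma normsq_kC : normsq kC = 1.
Proof. by rewrite /normsq conj_real (kCkC lf). Qed.

(** The geodesic joining two points: a unit complex factor makes the product of the representatives
    equal to [k * gcos k T], and [y] is the normalised component of the rotated [w] orthogonal to
    [r], whose square is [gsin k T ^+ 2]. *)
Lemma unit_geodesic r w (T : R) : unitv r -> unitv w -> proj r != proj w ->
  gcos k T = Num.sqrt (normsq (ip r w)) ->
  exists y, [/\ ip r y = 0, ip y y = 1 & proj (geov k r y 1 T) = proj w].
Proof.
move=> r1 w1 rw cT; have [u [u1 [a [a0 ua]]]] := phase (ip r w).
have aE : a = gcos k T.
  rewrite cT -[normsq (ip r w)]mul1r -u1 -normsqM ua -[X in normsq X]mulr1.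
  by rewrite normsqZ /normsq rmorph1 mulr1 /= mulr1 sqrtr_sqr ger0_norm.
have ku1 : normsq (kC * u) = 1 by rewrite normsqM normsq_kC u1 mulr1.
set w' := (kC * u) *: w.
have w'1 : unitv w' by exact: unitvZ.
have rw' : kC * ip r w' = (a%:C)%C by rewrite /w' ipZr -mulrA ua mulrA (kCkC lf) mul1r.
have nrw : normsq (ip r w') = a ^+ 2.
  rewrite -[LHS]mul1r -normsq_kC -normsqM rw' /normsq conj_real -rmorphM /=.
  by rewrite expr2.
have pw' : proj w' = proj w by exact: projZ.
have := ip_perp_part w' r1; have := ip_perp_norm r1 w'1.
rewrite rw' nrw; set y0 := w' - _ => y0n ry0.
have s2 : gsin k T ^+ 2 = k * (1 - a ^+ 2).
  have := gcos2Dgsin2 k1 T; rewrite -aE => <-.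
  by rewrite addrAC subrr add0r mulrA (kk lf) mul1r.
have s0 : gsin k T != 0.
  apply: contra_neq rw => s0; rewrite -pw'; have y00 : y0 = 0.
    have [//|y00] := eqVneq y0 0.
    have [_ _ _ _ pos] := lf; have := pos r y0 (unitv_pos lf r1) ry0 y00.
    by rewrite y0n -s2 s0 expr0n /= ltxx.
  have w'E : w' = (a%:C)%C *: r by apply/eqP; rewrite -subr_eq0 -/y0 y00.
  have a1 : a ^+ 2 = 1.
    have : k * (1 - a ^+ 2) = 0 by rewrite -s2 s0 expr0n.
    by case: k1 => -> ?; lra.
  rewrite w'E; symmetry; apply: projZ.
  by rewrite -[X in normsq X]mulr1 normsqZ a1 mul1r /normsq rmorph1 mulr1.
exists (((gsin k T)^-1%:C)%C *: y0); split.
- by rewrite ipZr ry0; exact: mulr0.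
- rewrite ipZl ipZr conj_real y0n -s2 -!rmorphM.
  by rewrite (_ : _ * _ = 1) ?rmorph1 //; field.
- rewrite -pw'; congr (LineSpaces.proj D k _).
  rewrite /geov mul1r -aE scalerA (realC_inj_scale s0).
  have -> : 1 *: y0 = y0 by exact: scale1r.
  by rewrite /y0 addrC subrK.
Qed.

Section OneSided.
Variable f : cmat R N N -> cmat R N N.
Hypotheses (fs : smooth_map (@pts R M) (f : amb M -> amb M))
  (fM : forall P, pts (k := M) P -> pts (k := M) (f P))
  (fg : forall P gamma delta, pts (k := M) P ->
    curve (@pts R M) P gamma -> curve (@pts R M) P delta ->
    retr (derive1 (f \o gamma) 0) (derive1 (f \o delta) 0) =
    retr (derive1 gamma 0) (derive1 delta 0)).

Lemma retr_proj (P Q : cmat R N N) r w : toC P = proj r -> toC Q = proj w ->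
  retr P Q = normsq (ip r w).
Proof. by rewrite /retr => -> ->; rewrite tr_projM. Qed.

Lemma retr_pts P : pts (k := M) P -> retr P P = 1.
Proof.
move=> /(ptsE lf) [r [r1 PE]]; rewrite (retr_proj PE PE) /normsq r1 conj_real.
by rewrite (kCkC lf).
Qed.

(* If [X] is a unit tangent vector at [P], the derivative of [retr _ Q] in the
   direction of [X] is controlled by [retr P Q]. *)
Lemma retr_derive_bound (P Q X : cmat R N N) : pts (k := M) P ->
  pts (k := M) Q -> tangent_at D (toC P) (toC X) -> retr X X = 2 * k ->
  (2 * retr X Q) ^+ 2 <= 4 * (k * (1 - (2 * retr P Q - 1) ^+ 2)).
Proof.
move=> /(ptsE lf) [r [r1 PE]] /(ptsE lf) [w [w1 QE]]; rewrite PE => TX XX.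
rewrite (retr_proj PE QE).
have XE := tangent_atE lf r1 TX; have ry := tangent_at_perp lf r1 TX.
set y := toC X *m r in XE ry.
have y1 : complex.Re (ip y y) = 1.
  move: XX; rewrite /retr XE (tr_sqr_outer lf r1 ry) ReZ.
  by case: k1 => ->; lra.
pose z := ip r w; pose w' := w - (kC * z) *: r.
have rw' : ip r w' = 0 by exact: ip_perp_part.
have w'n := ip_perp_norm r1 w1.
have XQ : retr X Q = 2 * complex.Re (ip w' y * z).
  rewrite /retr QE tr_proj_mul XE -scalemxAl ipZr mulrA (kCkC lf) mul1r.
  rewrite mulmxDl !outer_mulv ipDr !ipZr -/z.
  have -> : ip w' y = ip w y by rewrite /w' ipBl ipZl ry mulr0 subr0.
  rewrite (ipC D_herm w y) (ipC D_herm r w) -/z.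
  rewrite (mulrC z) -rmorphM ReD Re_conj /=; ring.
have cs := cauchy_schwarz lf r1 rw' ry.
rewrite -/w' w'n y1 /= mulr1 -/z in cs.
have := sqr_Re_le (ip w' y * z); rewrite normsqM.
have nz := normsq_ge0 z; rewrite XQ -/z.
(* With b = |z|^2, the bound 16 k b (1 - b) is 4 k (1 - (2 b - 1)^2). *)
move: (complex.Re _) (normsq (ip w' y)) (normsq z) cs nz => u a b.
move=> /= h1 h2 h3; have h4 : a * b <= k * (1 - b) * b by exact: ler_wpM2r.
by have := le_trans h3 h4; rewrite !exprMn; case: k1 => ->; lra.
Qed.

(** [f] turns the unit speed geodesic from [P] to [Q] into a unit speed curve between the images,
    and along such a curve tr (P Q) cannot vary faster than along a geodesic. Only one inequality
    results; the other needs the inverse isometry. *)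
Lemma retr_mono P Q : pts (k := M) P -> pts (k := M) Q ->
  0 <= k * (retr (f P) (f Q) - retr P Q).
Proof.
move=> MP MQ; have /(ptsE lf) [r [r1 PE]] := MP.
have /(ptsE lf) [w [w1 QE]] := MQ.
have [PQ|PQ] := eqVneq P Q.
  by rewrite -PQ (retr_pts (fM MP)) (retr_pts MP) subrr mulr0.
have rw : proj r != proj w.
  by apply: contra_neq PQ; rewrite -PE -QE => /toC_inj.
have nb := normsq_bound r1 w1; have nge := normsq_ge0 (ip r w).
have [|T [T0 cT HT]] := @g_exists _ k k1 (Num.sqrt (normsq (ip r w))) (sqrtr_ge0 _).
  by rewrite sqr_sqrtr.
have [y [ry y1 yT]] := unit_geodesic r1 w1 rw cT.
pose g := geo D k r y 1.
have gM t : pts (k := M) (g t) by exact: geo_pts.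
have gc t := geo_curve lf 1 r1 ry y1 t.
have gP : g 0 = P by rewrite /g /geo (geov0 lf) -PE toCK.
have gQ : g T = Q by rewrite /g /geo yT -QE toCK.
pose X t := derive1 (fun s => f (g (t + s))) 0.
have fc t : curve (@pts R M) (f (g t)) (fun s => f (g (t + s))).
  exact: (smooth_map_curve (coordinates_cmat N N) (coordinates_cmat N N) fs fM (gc t)).
have fd (t : R) : is_derive t 1 (fun t => f (g t)) (X t).
  by apply: is_derive_shift0; exact: curve_is_derive (fc t).
have lin : linear ((fun Y : cmat R N N => retr Y (f P)) : _ -> R^o).
  move=> a Y Z; rewrite /retr toCD toCZ mulmxDl mxtraceD -scalemxAl mxtraceZ.
  by rewrite ReD ReZ.
have Wd (t : R) : is_derive t 1 (fun t => 2 * retr (f (g t)) (f P) - 1)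
    (2 * retr (X t) (f P)).
  have h := is_derive_lin (coordinates_cmat N N) lin (fd t).
  have := is_deriveB (is_deriveZ (2 : R) h) (is_derive_cst (1 : R^o) t 1).
  by rewrite subr0.
have fPP := retr_pts (fM MP).
have W0 : 2 * retr (f (g 0)) (f P) - 1 = 1 by rewrite gP fPP; ring.
have dW t : (2 * retr (X t) (f P)) ^+ 2 <=
    4 * (k * (1 - (2 * retr (f (g t)) (f P) - 1) ^+ 2)).
  apply: retr_derive_bound; [exact: fM | exact: fM | |].
    exact: (curve_tangent_at lf (fc t)).
  rewrite /X (fg (gM t) (gc t) (gc t)).
  have gd : is_derive (0 : R) 1 (fun s => g (t + s)) _ := curve_is_derive (gc t).
  have -> : derive1 (fun s => g (t + s)) 0 = cscale (kC *: (outer (geov' k r y 1 t) (geov k r y 1 t) +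
      outer (geov k r y 1 t) (geov' k r y 1 t))) 1.
    exact: is_derive_unique gd (is_derive_shift (is_derive_geo lf r y 1 t)).
  rewrite /retr /cscale ofCK scale1r.
  rewrite (tr_sqr_outer lf (geov_unit lf 1 r1 ry y1 t) (geov_perp lf 1 r1 ry y1 t)).
  by rewrite ReZ (geov'_unit lf 1 r1 ry y1 t) mulr1.
have Wk t : 0 <= k * (1 - (2 * retr (f (g t)) (f P) - 1)).
  have /(ptsE lf) [r' [r'1 E']] := fM (gM t).
  have /(ptsE lf) [w' [w'1 F']] := fM MP.
  by rewrite (retr_proj E' F'); have := normsq_bound r'1 w'1; case: k1 => ->; lra.
have := HT _ _ W0 Wd dW Wk.
rewrite gQ sqr_sqrtr // (retr_proj PE QE).
have -> : retr (f Q) (f P) = retr (f P) (f Q) by rewrite /retr mxtrace_mulC.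
move: (retr _ _) (normsq _) => a b.
by case: k1 => ->; lra.
Qed.

End OneSided.

Lemma isometry_retr f f' P Q : holomorphic_isometry_with (M := M) (N := M) f f' ->
  pts (k := M) P -> pts (k := M) Q -> retr (f P) (f Q) = retr P Q.
Proof.
move=> fi MP MQ; have c0 := c_neq0 lf.
have fM q (Mq : pts (k := M) q) := (hi_fun fi Mq).1.
have f'M q (Mq : pts (k := M) q) := (hi_inv fi Mq).1.
have scK (a b : R) : 2 / c * a = 2 / c * b -> a = b.
  by apply: mulfI; rewrite mulf_neq0 // invr_neq0.
have fg (q : cmat R N N) g d (Mq : pts (k := M) q)
    (gg : curve (@pts R M) q g) (dd : curve (@pts R M) q d) :
    retr (derive1 (f \o g) 0) (derive1 (f \o d) 0) =
    retr (derive1 g 0) (derive1 d 0).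
  exact: scK (hi_metric fi Mq gg dd).
have h1 := retr_mono (hi_smooth fi) fM fg MP MQ.
(* The isometry condition is given for [f]; applied to the curves [f' \o g], whose images under [f]
   are the original ones near 0, it gives the condition for [f']. *)
have f'g (q : cmat R N N) g d (Mq : pts (k := M) q)
    (gg : curve (@pts R M) q g) (dd : curve (@pts R M) q d) :
    retr (derive1 (f' \o g) 0) (derive1 (f' \o d) 0) =
    retr (derive1 g 0) (derive1 d 0).
  apply/esym.
  have gc := smooth_map_curve (coordinates_cmat N N) (coordinates_cmat N N) (hi_inv_smooth fi) f'M gg.
  have dc := smooth_map_curve (coordinates_cmat N N) (coordinates_cmat N N) (hi_inv_smooth fi) f'M dd.
  have ff' g' : curve (@pts R M) q g' ->
      derive1 (f \o (f' \o g')) 0 = derive1 g' 0.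
    move=> gg'; rewrite derive1E; apply: derive_val.
    have := curve_is_derive gg'; apply: near_eq_is_derive.
    by apply: filterS (curve_near gg') => t /(hi_inv fi) [_ E]; exact/esym.
  have := hi_metric fi (f'M _ Mq) gc dc.
  by rewrite (ff' _ gg) (ff' _ dd); exact: scK.
have h2 := retr_mono (hi_inv_smooth fi) f'M f'g (fM _ MP) (fM _ MQ).
move: h2; rewrite (hi_fun fi MP).2 (hi_fun fi MQ).2 => h2.
move: (retr _ _) (retr P Q) h1 h2 => a b.
by case: k1 => ->; lra.
Qed.

End TracePreservation.

End LineIsometries.
Import LineIsometries.

(** * Extension of isometries to automorphisms of the matrix algebra *)

Module MatrixExtensions.

Lemma outer_delta (R : realType) N (D : 'M[R[i]]_N) (i j : 'I_N) :
  D^t* = D -> D *m D = 1%:M ->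
  delta_mx i j = outer D (delta_mx i 0) (D *m delta_mx j 0).
Proof.
move=> D_herm D_inv; rewrite /outer adjM D_herm -!mulmxA D_inv mulmx1 trmx_delta.
by rewrite map_delta_mx mul_delta_mx.
Qed.

Opaque real_complex_def toC ofC ip outer dag gcos gsin line_of.

Ltac mx_linear :=
  repeat (let Z := fresh "Z" in generalize (mulmx _ _) as Z);
  let i := fresh "i" in let j := fresh "j" in
  apply/matrixP => i j; rewrite !mxE; ring.
Ltac mx_expand := rewrite ?(mulmxBl, mulmxBr, mulmxDl, mulmxDr, mulNmx, mulmxN,
  =^~ scalemxAl, =^~ scalemxAr, mulmxA).

Lemma tan_part_lin (K : comNzRingType) m a (P Y Z : 'M[K]_m) :
  (a *: Y + Z) *m P + P *m (a *: Y + Z) - (P *m (a *: Y + Z) *m P + P *m (a *: Y + Z) *m P) =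
  a *: (Y *m P + P *m Y - (P *m Y *m P + P *m Y *m P)) +
  (Z *m P + P *m Z - (P *m Z *m P + P *m Z *m P)).
Proof. mx_expand; mx_linear. Qed.

Lemma tan_part_trace (K : comNzRingType) m (P Y Z : 'M[K]_m) :
  \tr ((Y *m P + P *m Y - (P *m Y *m P + P *m Y *m P)) *m Z) =
  \tr (Y *m (Z *m P + P *m Z - (P *m Z *m P + P *m Z *m P))).
Proof.
mx_expand; rewrite !raddfB !raddfD /= -!mulmxA.
rewrite [\tr (P *m (Y *m Z))]mxtrace_mulC [\tr (P *m (Y *m (P *m Z)))]mxtrace_mulC.
by rewrite -!mulmxA; congr (_ + _); exact: addrC.
Qed.

Section Conj.
Variable R : realType.
Implicit Types a b : R[i].
Lemma conjM a b : Num.conj (a * b) = Num.conj a * Num.conj b.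
Proof. exact: rmorphM. Qed.
Lemma conjN a : Num.conj (- a) = - Num.conj a.
Proof. exact: rmorphN. Qed.
Lemma conjN1 : Num.conj (-1 : R[i]) = -1.
Proof. exact: rmorphN1. Qed.
End Conj.

Lemma polar_mx (K : comNzRingType) N (e e' j : K) (X Y Z W : 'M[K]_N) :
  j * j = -1 ->
  X + e' *: Y + (e *: Z + e *: (e' *: W)) +
  (j *: (X + (e' * - j) *: Y + ((e * j) *: Z + (e * j) *: ((e' * - j) *: W))) +
   (-1 *:
    (X + (e' * -1) *: Y + ((e * -1) *: Z + (e * -1) *: ((e' * -1) *: W))) +
    - j *:
    (X + (e' * - - j) *: Y +
     ((e * - j) *: Z + (e * - j) *: ((e' * - - j) *: W))))) =
  (4 * e') *: Y.
Proof.
move=> i2; have j0 : j * j + 1 = 0 by rewrite i2 addNr.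
apply/matrixP => a b; rewrite !mxE.
(* The two sides differ by a multiple of [j * j + 1]; the factor supplied here is the quotient. *)
rewrite -[RHS]addr0 -(mul0r (2 * e * Z a b - 2 * e' * Y a b)) -j0; ring.
Qed.

Lemma Re_perturb (R : realType) (x z w u : R[i]) (e : R) : normsq u = 1 ->
  complex.Re (x + (e%:C)%C * u * z + ((e%:C)%C * Num.conj u * Num.conj z +
     (e%:C)%C * Num.conj u * ((e%:C)%C * u * w))) =
  complex.Re x + (2 * e * complex.Re (u * z) + e ^+ 2 * complex.Re w).
Proof.
move=> u1; rewrite !ReD.
have -> : (e%:C)%C * Num.conj u * ((e%:C)%C * u * w) =
   (e%:C)%C * ((e%:C)%C * ((u * Num.conj u) * w)) by ring.
rewrite normsqE u1 mul1r -(mulrA _ u z) -(mulrA _ (Num.conj u)).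
rewrite -(conjM u z) !ReZ Re_conj.
ring.
Qed.

Section Span.
Context {R : realType} {N : nat}.
Local Notation C := R[i].
Variables (D : 'M[C]_N) (k c : R).
Hypothesis lf : line_form D k c.
Let D_herm : D^t* = D. Proof. by case: lf. Qed.
Let D_inv : D *m D = 1%:M. Proof. by case: lf. Qed.
Let k1 : k = 1 \/ k = -1. Proof. by case: lf. Qed.
Local Notation ip := (ip D).
Local Notation outer := (outer D).
Local Notation kC := ((k%:C)%C).
Local Notation unitv := (unitv D k).
Local Notation proj := (proj D k).
Implicit Types (x y z r v w : 'cV[C]_N) (A B : 'M[C]_N).

Definition pos_vec v := 0 < k * complex.Re (ip v v).

Lemma pos_vec_unit v : pos_vec v ->
  exists s r, unitv r /\ outer v v = s *: proj r.
Proof.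
rewrite /pos_vec; set a := complex.Re _ => ka.
pose s := Num.sqrt (k * a).
have s2 : s ^+ 2 = k * a by rewrite sqr_sqrtr // ltW.
have s0 : s != 0 by rewrite gt_eqF // sqrtr_gt0.
have vE : v = (s%:C)%C *: ((s^-1%:C)%C *: v).
  by rewrite scalerA (realC_inj_scale s0); apply/esym; exact: scale1r.
exists ((k * s ^+ 2)%:C)%C, ((s^-1%:C)%C *: v); split.
  rewrite /LineSpaces.unitv ipZl ipZr conj_real (ip_real D_herm) -/a -!rmorphM.
  congr (real_complex _ _).
  have -> : s^-1 * (s^-1 * a) = a / s ^+ 2 by field.
  have ka0 : k * a != 0 by rewrite gt_eqF.
  apply: (mulIf ka0); rewrite s2 mulfVK // mulrA (kk lf) mul1r //.
rewrite {1 2}vE outerZl outerZr conj_real /LineSpaces.proj !scalerA -!rmorphM.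
congr (real_complex _ _ *: _).
by have := kk lf; move=> kk1; rewrite mulrAC kk1 mul1r expr2.
Qed.

(** The cone of vectors representing points is open; [e] is uniform in [u] so that one choice serves
    for the four powers of i in the polarisation. *)
Lemma pos_vec_perturb v w : pos_vec v -> exists e : R, 0 < e /\
  forall u : C, normsq u = 1 -> pos_vec (v + ((e%:C)%C * u) *: w).
Proof.
rewrite /pos_vec; set m := k * _ => m0.
pose n := normsq (ip v w); pose d := complex.Re (ip w w).
have n0 : 0 <= n by exact: normsq_ge0.
have d0 : 0 <= `|d| by [].
pose q := m + 2 * (1 + n) + `|d| + 1.
have q0 : 0 < q by rewrite /q; lra.
exists (m / q); split=> [|u u1]; first by rewrite divr_gt0.
set e := m / q.
have e0 : 0 < e by rewrite divr_gt0.
have eq1 : e * q = m by rewrite /e mulfVK // gt_eqF.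
have e1 : e < 1 by rewrite /e ltr_pdivrMr // mul1r /q; lra.
clearbody e.
have -> : complex.Re (ip (v + ((e%:C)%C * u) *: w) (v + ((e%:C)%C * u) *: w)) =
    complex.Re (ip v v) + (2 * e * complex.Re (u * ip v w) + e ^+ 2 * d).
  rewrite ipDl !ipDr !ipZl !ipZr (ipC D_herm v w) conjM conj_real.
  exact: Re_perturb.
have := sqr_Re_le (u * ip v w); rewrite normsqM u1 mul1r -/n.
set x := complex.Re _ => xn.
have x1 : - (1 + n) <= k * x.
  by case: k1 => ->; nra.
have d1 : - `|d| <= k * d.
  have := ler_norm d; have := ler_norm (- d); rewrite normrN.
  by case: k1 => ->; lra.
rewrite mulrDr -/m.
have h1 : - (2 * e * (1 + n)) <= k * (2 * e * x).
  by have := ler_wpM2l (ltW e0) x1; lra.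
have h2 : - (e * `|d|) <= k * (e ^+ 2 * d).
  have h3 : - (e ^+ 2 * `|d|) <= k * (e ^+ 2 * d).
    by have := ler_wpM2l (sqr_ge0 e) d1; lra.
  have h4 : e ^+ 2 * `|d| <= e * `|d|.
    by apply: ler_wpM2r => //; rewrite expr2 ler_piMr // ltW.
  lra.
move: eq1; rewrite /q; nra.
Qed.

(** Polarisation identity, with a coefficient [e] that will be small enough to keep the four vectors
    in the open cone. *)
Lemma outer_polar v w (e : C) :
  outer (v + e *: w) (v + e *: w) +
  ('i%C *: outer (v + (e * 'i%C) *: w) (v + (e * 'i%C) *: w) +
  (-1 *: outer (v + (e * -1) *: w) (v + (e * -1) *: w) +
   (- 'i%C) *: outer (v + (e * - 'i%C) *: w) (v + (e * - 'i%C) *: w))) =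
  (4 * Num.conj e) *: outer v w.
Proof.
have i2 : 'i%C * 'i%C = -1 :> C := @ii R.
rewrite !outerDl !outerDr !outerZl !outerZr !conjM conjN1 conjN conj_i.
move: (outer v v) (outer v w) (outer w v) (outer w w) => X Y Z W.
exact: polar_mx.
Qed.


(** The points span the whole matrix algebra over the complex numbers: polarisation in the open cone
    yields [outer v w] for [v] in the cone, and every vector is a combination of two vectors of the
    cone. *)
Lemma pts_ind r0 (Q : 'M[C]_N -> Prop) : unitv r0 ->
  (forall a A B, Q A -> Q B -> Q (a *: A + B)) ->
  (forall r, unitv r -> Q (proj r)) -> forall A, Q A.
Proof.
move=> r01 Qlin Qproj.
have Q0 : Q 0.
  have := Qlin (-1) _ _ (Qproj _ r01) (Qproj _ r01).
  by rewrite scaleN1r addNr.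
have QZ a A : Q A -> Q (a *: A) by move=> /(Qlin a _ _)/(_ Q0); rewrite addr0.
have QD A B : Q A -> Q B -> Q (A + B).
  by move=> QA QB; rewrite -[A]scale1r; exact: Qlin.
have Qcone v : pos_vec v -> Q (outer v v).
  by move=> /pos_vec_unit [s [r [r1 ->]]]; apply/QZ/Qproj.
have Qvw v w : pos_vec v -> Q (outer v w).
  move=> v0; have [e [e0 He]] := pos_vec_perturb w v0.
  have n1 : normsq (1 : C) = 1 by rewrite /normsq rmorph1 mulr1.
  have nN1 : normsq (-1 : C) = 1 by rewrite /normsq rmorphN rmorph1 mulrNN mulr1.
  have ni : normsq ('i%C : C) = 1.
    by rewrite /normsq conj_i mulrN ii opprK.
  have nNi : normsq (- 'i%C : C) = 1.
    by rewrite /normsq conjN conj_i opprK mulNr ii opprK.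
  have := outer_polar v w (e%:C)%C; rewrite conj_real => E.
  have e40 : 4 * (e%:C)%C != 0 :> C.
    rewrite mulf_neq0 ?pnatr_eq0 //; apply: realC_neq0; exact: lt0r_neq0.
  have -> : outer v w = (4 * (e%:C)%C)^-1 *: ((4 * (e%:C)%C) *: outer v w).
    by rewrite scalerA mulVf // scale1r.
  rewrite -E; apply: (QZ); apply: (QD).
    by apply: Qcone; have := He _ n1; rewrite mulr1.
  apply: (QD); first by apply/QZ/Qcone/He.
  apply: (QD); first by apply/QZ/Qcone/He.
  by apply/QZ/Qcone/He.
have Qall v w : Q (outer v w).
  have r0p : pos_vec r0 by exact: (unitv_pos lf).
  have [e [e0 He]] := pos_vec_perturb v r0p.
  have n1 : normsq (1 : C) = 1 by rewrite /normsq rmorph1 mulr1.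
  have eC : (e%:C)%C != 0 :> C by apply: realC_neq0; exact: lt0r_neq0.
  have -> : outer v w = ((e%:C)%C)^-1 *:
      (outer (r0 + ((e%:C)%C * 1) *: v) w + (-1) *: outer r0 w).
    rewrite mulr1 outerDl outerZl scaleN1r addrAC subrr add0r scalerA mulVf //.
    by rewrite scale1r.
  by apply/QZ/QD; [apply: Qvw; exact: He | apply/QZ/Qvw].
move=> A; rewrite [A]matrix_sum_delta.
elim/big_ind: _ => // i _; elim/big_ind: _ => // j _; apply: QZ.
rewrite (outer_delta _ _ D_herm D_inv).
exact: Qall.
Qed.

End Span.

Section Extension.
Context {R : realType} {N : nat}.
Local Notation C := R[i].
Variables (D : 'M[C]_N) (k c : R).
Hypothesis lf : line_form D k c.
Let D_herm : D^t* = D. Proof. by case: lf. Qed.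
Let D_inv : D *m D = 1%:M. Proof. by case: lf. Qed.
Local Notation dag := (dag D).
Local Notation M := (line_space D c).
Local Notation unitv := (unitv D k).
Local Notation proj := (proj D k).
Variable r0 : 'cV[C]_N.
Hypothesis r01 : unitv r0.
Implicit Types (A B X Y Z : 'M[C]_N).

Lemma cpt_ind (Q : 'M[C]_N -> Prop) :
  (forall a A B, Q A -> Q B -> Q (a *: A + B)) ->
  (forall P : cmat R N N, pts (k := M) P -> Q (toC P)) -> forall A, Q A.
Proof.
move=> Qlin Qpts; apply: (pts_ind lf r01 Qlin) => r r1.
by have := Qpts (ofC (proj r)); rewrite ofCK; apply; apply/(ptsE lf); exists r; rewrite ofCK.
Qed.

Lemma tr_ext A : (forall P : cmat R N N, pts (k := M) P -> \tr (A *m toC P) = 0) -> A = 0.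
Proof.
move=> AP; have AB B : \tr (A *m B) = 0.
  move: B; apply: cpt_ind => // a B1 B2 h1 h2.
  by rewrite mulmxDr -scalemxAr mxtraceD mxtraceZ h1 h2 addr0; exact: mulr0.
apply/matrixP => i j; rewrite [RHS]mxE.
have := AB (delta_mx j i); rewrite -(mul_delta_mx (0 : 'I_1)) mulmxA -colE.
by rewrite mxtrace_mulC -rowE trace_mx11 !mxE.
Qed.

Definition mx_extension (f : cmat R N N -> cmat R N N) (F : 'M[C]_N -> 'M[C]_N) :=
  [/\ linear F, forall P, pts (k := M) P -> F (toC P) = toC (f P) &
    forall Y Z, \tr (F Y *m F Z) = \tr (Y *m Z)].

(** [F Y] is characterised by tr (F Y f(P)) = tr (Y P) for all points P. Nondegeneracy of the trace
    form gives uniqueness, hence linearity; existence is an induction on the span of the points, the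
    case of a point being the preservation of tr (P Q). *)
Lemma isometry_mx_extension f f' :
  holomorphic_isometry_with (M := M) (N := M) f f' ->
  exists F, mx_extension f F.
Proof.
move=> fi.
have fM q (Mq : pts (k := M) q) := (hi_fun fi Mq).1.
pose rel Y Z := forall P, pts (k := M) P -> \tr (Z *m toC (f P)) = \tr (Y *m toC P).
have /choice [F FP] : forall Y, exists Z, rel Y Z.
  apply: cpt_ind => [a Y1 Y2 [Z1 h1] [Z2 h2]|P MP].
    exists (a *: Z1 + Z2) => P MP; have := h1 P MP; have := h2 P MP.
    by rewrite !mulmxDl -!scalemxAl !mxtraceD !(mxtraceZ a) => -> ->.
  exists (toC (f P)) => Q MQ.
  rewrite (retr_real lf (fM _ MP) (fM _ MQ)) (retr_real lf MP MQ).
  by rewrite (isometry_retr lf fi MP MQ).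
have rel_uniq Y Z Z' : rel Y Z -> rel Y Z' -> Z = Z'.
  move=> h h'; apply/eqP; rewrite -subr_eq0; apply/eqP; apply: tr_ext => Q MQ.
  have [MP E] := hi_inv fi MQ.
  by rewrite mulmxBl raddfB /= -E h // h' // subrr.
have Flin : linear F.
  move=> a Y1 Y2; apply: (rel_uniq (a *: Y1 + Y2)); first exact: FP.
  move=> P MP; have := FP Y1 P MP; have := FP Y2 P MP.
  by rewrite !mulmxDl -!scalemxAl !mxtraceD !(mxtraceZ a) => -> ->.
have Fpts P : pts (k := M) P -> F (toC P) = toC (f P).
  move=> MP; apply: (rel_uniq (toC P)); first exact: FP.
  move=> Q MQ; rewrite (retr_real lf (fM _ MP) (fM _ MQ)) (retr_real lf MP MQ).
  by rewrite (isometry_retr lf fi MP MQ).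
exists F; split=> // Y; apply: cpt_ind => [a Z1 Z2 h1 h2|P MP]; last first.
  by rewrite Fpts // FP.
rewrite Flin !mulmxDr -!scalemxAr !mxtraceD !(mxtraceZ a) h1 h2 //.
Qed.

Lemma mx_extension_dag f F : (forall P, pts (k := M) P -> pts (k := M) (f P)) ->
  mx_extension f F -> forall Y, F (dag Y) = dag (F Y).
Proof.
move=> fM [Fl FP _]; apply: cpt_ind => [a Y Z h1 h2|P MP].
  by rewrite dagD dagZ (Fl (Num.conj a)) h1 h2 (Fl a) dagD dagZ.
have cd Q : pts (k := M) Q -> dag (toC Q) = toC Q.
  by move=> /(ptsE lf) [r [_ ->]]; rewrite (dag_proj lf).
by rewrite cd // FP // cd //; exact: fM.
Qed.

Lemma tr_pts (P : cmat R N N) : pts (k := M) P -> \tr (toC P) = 1.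
Proof. by move=> /(ptsE lf) [r [r1 ->]]; rewrite (tr_proj lf). Qed.

Lemma mx_extension_inv f f' F :
  holomorphic_isometry_with (M := M) (N := M) f f' -> mx_extension f F ->
  exists F', [/\ mx_extension f' F', cancel F F' & cancel F' F].
Proof.
move=> fi [Fl FP Ftr].
have fM q (Mq : pts (k := M) q) := (hi_fun fi Mq).1.
have f'M q (Mq : pts (k := M) q) := (hi_inv fi Mq).1.
have Fsurj : forall Z, exists Y, F Y = Z.
  apply: cpt_ind => [a Z1 Z2 [Y1 E1] [Y2 E2]|Q MQ].
    by exists (a *: Y1 + Y2); rewrite Fl E1 E2.
  by exists (toC (f' Q)); rewrite FP ?(hi_inv fi MQ).2 //; exact: f'M.
have [F' F'K] := choice Fsurj.
have FK : cancel F F'.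
  move=> Y; apply/eqP; rewrite -subr_eq0; apply/eqP; apply: tr_ext => P MP.
  by rewrite mulmxBl raddfB /= -Ftr F'K Ftr subrr.
exists F'; split=> //; split.
- by move=> a Y Z; apply: (can_inj FK); rewrite F'K Fl !F'K.
- move=> Q MQ; apply: (can_inj FK); rewrite F'K FP; last exact: f'M.
  by rewrite (hi_inv fi MQ).2.
- by move=> Y Z; rewrite -Ftr !F'K.
Qed.

(* P Y (1 - P) + (1 - P) Y P *)
Definition tan_part P Y : 'M[C]_N := Y *m P + P *m Y - (P *m Y *m P + P *m Y *m P).

Lemma tan_part_tangent P Y : P *m P = P ->
  tan_part P Y *m P + P *m tan_part P Y = tan_part P Y.
Proof.
move=> PP; rewrite /tan_part; mx_expand; rewrite -!(mulmxA _ P P) !PP.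
mx_linear.
Qed.

Lemma tan_part_bracket P Y : P *m P = P ->
  tan_part P Y *m P - P *m tan_part P Y = Y *m P - P *m Y.
Proof.
move=> PP; rewrite /tan_part; mx_expand; rewrite -!(mulmxA _ P P) !PP.
mx_linear.
Qed.

Lemma tan_part_id P Y : P *m P = P -> Y *m P + P *m Y = Y -> tan_part P Y = Y.
Proof.
move=> PP YP; have : P *m Y *m P = P *m (Y *m P + P *m Y) *m P by rewrite YP.
mx_expand; rewrite -!(mulmxA _ P P) !PP => h.
have {h} : P *m Y *m P = 0.
  by move: h => /eqP; rewrite -subr_eq0 opprD addrA subrr add0r oppr_eq0 => /eqP.
by rewrite /tan_part YP => ->; rewrite addr0 subr0.
Qed.

Lemma tan_part_linear P : linear (tan_part P).
Proof. by move=> a Y Z; exact: tan_part_lin. Qed.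

Lemma tan_part_tr P Y Z : \tr (tan_part P Y *m Z) = \tr (Y *m tan_part P Z).
Proof.
exact: tan_part_trace.
Qed.

Lemma tan_part_dag P Y : dag P = P -> dag Y = Y -> dag (tan_part P Y) = tan_part P Y.
Proof.
move=> PE YE; rewrite /tan_part dagB !dagD !(dagM D_inv) PE YE mulmxA addrC.
by rewrite [X in X - _]addrC addrC.
Qed.

Lemma cpt_idem (P : cmat R N N) : pts (k := M) P -> toC P *m toC P = toC P.
Proof. by move=> /(ptsE lf) [r [r1 ->]]; exact: (proj_idem lf). Qed.

Lemma cpt_dag (P : cmat R N N) : pts (k := M) P -> dag (toC P) = toC P.
Proof. by move=> /(ptsE lf) [r [_ ->]]; exact: (dag_proj lf). Qed.

Lemma tan_part_cpt (P Q : cmat R N N) : pts (k := M) P -> pts (k := M) Q ->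
  tangent_at D (toC P) (tan_part (toC P) (toC Q)).
Proof.
move=> MP MQ; split; last exact/tan_part_tangent/cpt_idem.
by apply: tan_part_dag; exact: cpt_dag.
Qed.

Section Smooth.
Variable f : cmat R N N -> cmat R N N.
Hypotheses (fs : smooth_map (@pts R M) (f : amb M -> amb M))
  (fM : forall q, pts (k := M) q -> pts (k := M) (f q)).
Variable F : 'M[C]_N -> 'M[C]_N.
Hypothesis Fext : mx_extension f F.
Let Fl : linear F. Proof. by case: Fext. Qed.
Let FP P : pts (k := M) P -> F (toC P) = toC (f P). Proof. by case: Fext => _ + _; apply. Qed.

Lemma extension_derive P gamma : curve (@pts R M) P gamma ->
  F (toC (derive1 gamma 0)) = toC (derive1 (f \o gamma) 0).
Proof.
move=> Pg; have gd := curve_is_derive Pg.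
have Ll : linear (fun X : cmat R N N => ofC (F (toC X))).
  by move=> a X Y; rewrite toCD toCZ Fl ofCD ofCZ.
have Fg := is_derive_lin (coordinates_cmat N N) Ll gd.
have fg := curve_is_derive (smooth_map_curve (coordinates_cmat N N) (coordinates_cmat N N)
  fs fM Pg).
apply: ofC_inj; rewrite toCK; apply: is_derive_unique Fg _.
apply: near_eq_is_derive fg.
by apply: filterS (curve_near Pg) => t Mt; rewrite /= FP // toCK.
Qed.

Lemma extension_tangent (P : cmat R N N) X : pts (k := M) P ->
  tangent_at D (toC P) X -> tangent_at D (toC (f P)) (F X).
Proof.
move=> MP TX; have TX' : tangent_at D (toC P) (toC (ofC X)) by rewrite ofCK.
have [g Pg gX] := (tangentE lf (ofC X) MP).2 TX'.
have fPg := smooth_map_curve (coordinates_cmat N N) (coordinates_cmat N N) fs fM Pg.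
by have := curve_tangent_at lf fPg; rewrite -(extension_derive Pg) gX ofCK.
Qed.

(** [F] maps tangent matrices at [P] to tangent matrices at [f P]. For [Y] a point, [tan_part] is a
    true tangent vector, the velocity of a curve; the complexified statement follows by
    linearity. *)
Lemma extension_tan_part (P : cmat R N N) Y : pts (k := M) P ->
  tan_part (toC (f P)) (F (tan_part (toC P) Y)) = F (tan_part (toC P) Y).
Proof.
move=> MP; move: Y.
apply: cpt_ind => [a Y Z hY hZ|Q MQ].
  refine (etrans (congr1 (fun X => tan_part _ (F X)) (tan_part_linear (toC P) a Y Z)) _).
  rewrite Fl; refine (etrans (tan_part_linear _ _ _ _) (etrans (congr2 (fun X W => a *: X + W) hY hZ) _)).
  by rewrite tan_part_linear Fl.
apply: tan_part_id; first exact/cpt_idem/fM.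
by have [] := extension_tangent MP (tan_part_cpt MP MQ).
Qed.

End Smooth.

Lemma tangent_at_J (P X : 'M[C]_N) : P *m P = P -> dag P = P -> tangent_at D P X ->
  tangent_at D P ('i%C *: (X *m P - P *m X)).
Proof.
move=> PP dP [dX XP]; split.
  by rewrite dagZ conj_i dagB !(dagM D_inv) dP dX scaleNr -scalerN opprB.
rewrite -scalemxAl -scalemxAr -scalerDr; congr (_ *: _).
mx_expand; rewrite -!(mulmxA _ P P) !PP; mx_linear.
Qed.

Lemma linear_scale (F : 'M[C]_N -> 'M[C]_N) a Y : linear F -> F (a *: Y) = a *: F Y.
Proof.
move=> Fl; have := Fl a Y 0; have := Fl (-1) 0 0.
by rewrite scaler0 addr0 scaleN1r addNr => ->; rewrite !addr0.
Qed.

Lemma linear_add (F : 'M[C]_N -> 'M[C]_N) Y Z : linear F -> F (Y + Z) = F Y + F Z.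
Proof. by move=> Fl; have := Fl 1 Y Z; rewrite !scale1r. Qed.

Section Isometry.
Variables (f f' : cmat R N N -> cmat R N N).
Hypothesis fi : holomorphic_isometry_with (M := M) (N := M) f f'.
Let fM q (Mq : pts (k := M) q) := (hi_fun fi Mq).1.
Let f'M q (Mq : pts (k := M) q) := (hi_inv fi Mq).1.
Variable F : 'M[C]_N -> 'M[C]_N.
Hypothesis Fext : mx_extension f F.
Let Fl : linear F. Proof. by case: Fext. Qed.
Let FP P : pts (k := M) P -> F (toC P) = toC (f P). Proof. by case: Fext => _ + _; apply. Qed.
Let Ftr Y Z : \tr (F Y *m F Z) = \tr (Y *m Z). Proof. by case: Fext. Qed.

(** The complex structure is i times the bracket with [P], and i cancels. Holomorphy is essential:
    for an antiholomorphic isometry the bracket would change sign and [F] would reverse products. *)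
Lemma extension_J (P : cmat R N N) X : pts (k := M) P -> tangent_at D (toC P) X ->
  F (X *m toC P - toC P *m X) = F X *m toC (f P) - toC (f P) *m F X.
Proof.
move=> MP TX; have TX' : tangent_at D (toC P) (toC (ofC X)) by rewrite ofCK.
have [g Pg gX] := (tangentE lf (ofC X) MP).2 TX'.
have TJ : tangent_at D (toC P) (toC (ofC ('i%C *: (X *m toC P - toC P *m X)))).
  by rewrite ofCK; apply: (tangent_at_J (cpt_idem MP) (cpt_dag MP) TX).
have [d Pd dX] := (tangentE lf _ MP).2 TJ.
have Fg := extension_derive (hi_smooth fi) fM Fext Pg.
have Fd := extension_derive (hi_smooth fi) fM Fext Pd.
have dJ : derive1 d 0 = cstr (k := M) P (derive1 g 0) by rewrite dX gX /= ofCK.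
have := hi_cstr fi MP Pg Pd dJ.
move=> /(congr1 (@toC R N N)); rewrite -Fd dX /= !ofCK -Fg gX ofCK.
rewrite linear_scale //; exact: (scalerI i_neq0).
Qed.

Lemma extension_bracket (P : cmat R N N) Y : pts (k := M) P ->
  F (Y *m toC P - toC P *m Y) = F (tan_part (toC P) Y) *m toC (f P) -
     toC (f P) *m F (tan_part (toC P) Y).
Proof.
move=> MP; have PP := cpt_idem MP; move: Y.
apply: cpt_ind => [a Y Z hY hZ|Q MQ].
  rewrite tan_part_linear Fl.
  rewrite !mulmxDl !mulmxDr -!scalemxAl -!scalemxAr !opprD addrACA -scalerBr Fl.
  by rewrite hY hZ scalerBr addrACA.
by rewrite -(tan_part_bracket (toC Q) PP) extension_J //; exact: tan_part_cpt.
Qed.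

(** [tan_part] is self-adjoint for the trace form. Since [F] and its inverse preserve this form and
    respect tangent matrices, [F] commutes with the projections onto them. *)
Lemma extension_tan_partE (P : cmat R N N) Y : pts (k := M) P ->
  tan_part (toC (f P)) (F Y) = F (tan_part (toC P) Y).
Proof.
move=> MP; have [F' [F'ext FK F'K]] := mx_extension_inv fi Fext.
apply/eqP; rewrite -subr_eq0; apply/eqP; apply: tr_ext => Q MQ.
rewrite mulmxBl raddfB /=; apply/eqP; rewrite subr_eq0; apply/eqP.
rewrite tan_part_tr; set Z := tan_part _ (toC Q).
have := extension_tan_part (hi_inv_smooth fi) f'M F'ext (toC Q) (fM MP).
rewrite (hi_fun fi MP).2 -/Z => F'Z.
rewrite -[Z in LHS]F'K Ftr -F'Z -tan_part_tr -Ftr F'K /Z -tan_part_tr.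
by rewrite (extension_tan_part (hi_smooth fi) fM Fext).
Qed.

Lemma cpt_sandwich (P : cmat R N N) Y : pts (k := M) P ->
  toC P *m Y *m toC P = \tr (Y *m toC P) *: toC P.
Proof. by move=> /(ptsE lf) [r [_ ->]]; exact: (proj_sandwich lf). Qed.

(** 2 Y P = [Y, P] + tan_part P Y + 2 P Y P, and [F] respects each term: the bracket by holomorphy,
    the tangent part by the previous lemma, and P Y P because it equals tr (Y P) P. *)
Lemma extension_mulr (P : cmat R N N) Y : pts (k := M) P ->
  F (Y *m toC P) = F Y *m toC (f P).
Proof.
move=> MP; have fMP := fM MP.
have h1 := extension_bracket Y MP.
rewrite -(extension_tan_partE _ MP) (tan_part_bracket _ (cpt_idem fMP)) in h1.
have h2 : F (toC P *m Y *m toC P) = toC (f P) *m F Y *m toC (f P).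
  by rewrite !cpt_sandwich // linear_scale // -Ftr FP.
have h3 := extension_tan_partE Y MP; rewrite /tan_part in h3.
have F2 : F (2 *: (Y *m toC P)) = 2 *: (F Y *m toC (f P)).
  have -> : 2 *: (Y *m toC P) = (Y *m toC P - toC P *m Y) +
     ((Y *m toC P + toC P *m Y - (toC P *m Y *m toC P + toC P *m Y *m toC P)) +
      (toC P *m Y *m toC P + toC P *m Y *m toC P)) by mx_linear.
  move: h1 h2 h3; set U := _ - toC P *m Y; set W := toC P *m Y *m toC P.
  set V := Y *m toC P + toC P *m Y - (W + W) => h1 h2 h3.
  rewrite (linear_add U _ Fl) h1 (linear_add V _ Fl) -h3 (linear_add W W Fl) h2; mx_linear.
by move: F2; rewrite linear_scale //; apply: scalerI; rewrite pnatr_eq0.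
Qed.

Lemma extension_mul Y Z : F (Y *m Z) = F Y *m F Z.
Proof.
move: Z; apply: cpt_ind => [a Z1 Z2 h1 h2|P MP]; last by rewrite extension_mulr // FP.
by rewrite mulmxDr -scalemxAr !Fl h1 h2 mulmxDr -scalemxAr.
Qed.

End Isometry.

End Extension.

End MatrixExtensions.
Import MatrixExtensions.

(** * Infinitesimal generators of the action, their commutation and their moments *)

Module Generators.

Opaque real_complex_def toC ofC ip outer dag gcos gsin line_of.

Lemma conjB (R : realType) (a b : R[i]) : Num.conj (a - b) = Num.conj a - Num.conj b.
Proof. exact: rmorphB. Qed.

Lemma commute_all_tr0 (R : realType) N (B : 'M[R[i]]_N) :
  (forall Y, B *m Y = Y *m B) -> \tr B = 0 -> B = 0.
Proof.
move=> BC tB.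
have Bij i j l : B l i = B j j *+ (l == i).
  have := congr1 (fun Z : 'M[R[i]]_N => Z l j) (BC (delta_mx i j)).
  rewrite !mxE (bigD1 i) //= big1 ?addr0 => [|i' ii']; last first.
    by rewrite !mxE (negPf ii') mulr0.
  rewrite !mxE !eqxx mulr1 => ->.
  rewrite (bigD1 j) //= big1 ?addr0 => [|j' jj']; last first.
    by rewrite !mxE (negPf jj') andbF mul0r.
  by rewrite !mxE eqxx andbT mulr_natl.
apply/matrixP => l i; rewrite (Bij i l l) [RHS]mxE.
have Bii : B l l = 0.
  move: tB; rewrite /mxtrace (eq_bigr (fun _ => B l l)) => [|j _].
    rewrite sumr_const card_ord => /eqP; rewrite mulrn_eq0 => /orP[/eqP N0|/eqP //].
    by exfalso; have : (0 < N)%N := leq_ltn_trans (leq0n l) (ltn_ord l); rewrite N0.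
  by rewrite (Bij j l j) eqxx.
by rewrite Bii mul0rn.
Qed.

(** Derivations of a matrix algebra are inner: the sum of the d(E_(i,j0)) E_(j0,i) represents [d],
    and subtracting a scalar matrix makes it trace-free. The index [j0] witnesses that the size is
    nonzero. *)
Lemma derivation_inner (R : realType) N (j0 : 'I_N) (d : 'M[R[i]]_N -> 'M[R[i]]_N) :
  linear d -> (forall Y Z, d (Y *m Z) = d Y *m Z + Y *m d Z) ->
  exists A, \tr A = 0 /\ forall Y, d Y = A *m Y - Y *m A.
Proof.
move=> dl dM.
pose d' : {linear 'M[R[i]]_N -> 'M[R[i]]_N} :=
  HB.pack d (GRing.isLinear.Build _ _ _ _ d dl).
pose A := \sum_i d (delta_mx i j0) *m delta_mx j0 i.
have AE Y : d Y = A *m Y - Y *m A.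
  have : \sum_i d (Y *m delta_mx i j0) *m delta_mx j0 i = d Y + Y *m A.
    under eq_bigr do rewrite dM mulmxDl -!mulmxA mul_delta_mx.
    by rewrite big_split /= -!mulmx_sumr -mx1_sum_delta mulmx1.
  suff -> : \sum_i d (Y *m delta_mx i j0) *m delta_mx j0 i = A *m Y.
    by move=> ->; rewrite addrK.
  rewrite /A mulmx_suml.
  transitivity (\sum_i \sum_l Y l i *: (d (delta_mx l j0) *m delta_mx j0 i)).
    apply: eq_bigr => i _.
    have -> : Y *m delta_mx i j0 = \sum_l Y l i *: delta_mx l j0.
      rewrite [Y in LHS]matrix_sum_delta mulmx_suml; apply: eq_bigr => l _.
      rewrite mulmx_suml (bigD1 i) //= big1 ?addr0 => [|i' ii'].
        by rewrite -scalemxAl mul_delta_mx.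
      by rewrite -scalemxAl mul_delta_mx_0 ?scaler0.
    rewrite -[d _]/(d' _) linear_sum mulmx_suml; apply: eq_bigr => l _.
    by rewrite linearZ /= -scalemxAl.
  rewrite exchange_big; apply: eq_bigr => l _ /=.
  rewrite -mulmxA.
  have -> : delta_mx j0 l *m Y = \sum_i Y l i *: delta_mx j0 i.
    rewrite [Y in LHS]matrix_sum_delta mulmx_sumr (bigD1 l) //= [X in _ + X]big1 ?addr0 => [|l' ll'].
      by rewrite mulmx_sumr; apply: eq_bigr => i _; rewrite -scalemxAr mul_delta_mx.
    rewrite mulmx_sumr big1 // => i _.
    by rewrite -scalemxAr mul_delta_mx_0 ?scaler0 // eq_sym.
  by rewrite mulmx_sumr; apply: eq_bigr => i _; rewrite -scalemxAr.
exists (A - (\tr A / N%:R)%:M); split.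
  rewrite raddfB /= mxtrace_scalar -[X in _ - X]mulr_natr mulfVK ?subrr //.
  by rewrite pnatr_eq0; case: N j0 {d dl dM d' A AE} => // -[].
move=> Y; rewrite AE mulmxBl mulmxBr mul_scalar_mx mul_mx_scalar opprB.
by rewrite addrA subrK.
Qed.

Section Generators.
Context {R : realType} {N : nat}.
Local Notation C := R[i].
Variables (D : 'M[C]_N) (k c : R).
Hypothesis lf : line_form D k c.
Let D_herm : D^t* = D. Proof. by case: lf. Qed.
Let D_inv : D *m D = 1%:M. Proof. by case: lf. Qed.
Local Notation dag := (dag D).
Local Notation M := (line_space D c).
Variable r0 : 'cV[C]_N.
Hypothesis r01 : unitv D k r0.
Variables (G : lie_group R) (act : 'rV[R]_(lg_amb G) -> cmat R N N -> cmat R N N).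
Hypothesis actP : action_by_holomorphic_isometries (M := M) act.
Implicit Types (A B X Y Z : 'M[C]_N).

Local Notation cN := (coordinates_cmat N N).

Lemma act_extension x : lg_set x -> exists F : 'M[C]_N -> 'M[C]_N,
  [/\ mx_extension D c (act x) F, forall Y Z, F (Y *m Z) = F Y *m F Z &
      forall Y, F (dag Y) = dag (F Y)].
Proof.
move=> Gx; have [f' fi] := act_isometry actP Gx.
have [F Fext] := isometry_mx_extension lf r01 fi.
exists F; split=> // [Y Z|]; first exact: (extension_mul lf r01 fi Fext).
exact: (mx_extension_dag lf r01 (fun q Mq => (hi_fun fi Mq).1) Fext).
Qed.

(** The extensions along [gamma] form a family of automorphisms commuting with [dag]. Its derivative
    at 0 is a derivation, the bracket with a trace-free [A]; then [A + dag A] is central and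
    trace-free, hence zero. *)
Lemma action_generator gamma : curve (@lg_set R G) (lg_one G) gamma ->
  exists A, [/\ dag A = - A, \tr A = 0 &
    forall P : cmat R N N, pts (k := M) P ->
      is_derive (0 : R) 1 (fun t => act (gamma t) P)
        (ofC (A *m toC P - toC P *m A))].
Proof.
move=> Gg.
have [F FP] : exists F : 'rV[R]_(lg_amb G) -> 'M[C]_N -> 'M[C]_N,
    forall x, lg_set x -> [/\ mx_extension D c (act x) (F x),
      forall Y Z, F x (Y *m Z) = F x Y *m F x Z &
      forall Y, F x (dag Y) = dag (F x Y)].
  have ex (x : 'rV[R]_(lg_amb G)) : exists F : 'M[C]_N -> 'M[C]_N,
      lg_set x -> [/\ mx_extension D c (act x) F,
      forall Y Z, F (Y *m Z) = F Y *m F Z & forall Y, F (dag Y) = dag (F Y)].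
    have [Gx|nGx] := pselect (lg_set x); last by exists id.
    by have [F HF] := act_extension Gx; exists F.
  by have [F HF] := choice ex; exists F.
have nearG := curve_near Gg.
have F1 Y : F (gamma 0) Y = Y.
  have -> : gamma 0 = lg_one G by case: Gg.
  have [[Fl Fp _] _ _] := FP _ (lg_one_in G).
  move: Y; apply: (cpt_ind lf r01) => [a Y Z hY hZ|P MP]; first by rewrite Fl hY hZ.
  by rewrite Fp // (act_one actP).
have ptsD (P : cmat R N N) : pts (k := M) P -> is_derive (0 : R) 1 (fun t => ofC (F (gamma t) (toC P)))
    (derive1 (fun t => act (gamma t) P) 0).
  move=> MP; have := curve_is_derive (act_curve (M := M) cN actP Gg MP).
  apply: near_eq_is_derive; apply: filterS nearG => t /FP [[_ Fp _] _ _].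
  by rewrite Fp // toCK.
have lin2 a (u v : R -> cmat R N N) du dv :
    is_derive (0 : R) 1 u du -> is_derive (0 : R) 1 v dv ->
    is_derive (0 : R) 1 (fun t => ofC (a *: toC (u t) + toC (v t)))
      (ofC (a *: toC du + toC dv)).
  move=> ud vd.
  have Ll : linear (fun X : cmat R N N => ofC (a *: toC X)).
    by move=> b X Y; rewrite toCD toCZ scalerDr scalerA mulrC -scalerA ofCD ofCZ.
  have := is_deriveD (is_derive_lin cN Ll ud) vd.
  rewrite ofCD toCK; apply: is_derive_ext => t.
  by rewrite ofCD toCK.
have lin3 (a : C) Y Z dY dZ : is_derive (0 : R) 1 (fun t => ofC (F (gamma t) Y)) (ofC dY) ->
    is_derive (0 : R) 1 (fun t => ofC (F (gamma t) Z)) (ofC dZ) ->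
    is_derive (0 : R) 1 (fun t => ofC (F (gamma t) (a *: Y + Z))) (ofC (a *: dY + dZ)).
  move=> Yd Zd; have := lin2 a _ _ _ _ Yd Zd; rewrite !ofCK.
  apply: near_eq_is_derive; apply: filterS nearG => t /FP [[Fl _ _] _ _].
  by rewrite Fl !ofCK.
(* Differentiability in time is known for the images of points only; it extends to all matrices
   because the points span. *)
have dEx : forall Y, exists d, is_derive (0 : R) 1 (fun t => ofC (F (gamma t) Y)) (ofC d).
  apply: (cpt_ind lf r01) => [a Y Z [dY Yd] [dZ Zd]|P MP].
    by exists (a *: dY + dZ); exact: lin3.
  by exists (toC (derive1 (fun t => act (gamma t) P) 0)); rewrite toCK; exact: ptsD.
have [d dP] := choice dEx.
have dl : linear d.
  move=> a Y Z; apply: ofC_inj; exact: is_derive_unique (dP _) (lin3 a Y Z _ _ (dP Y) (dP Z)).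
have dM Y Z : d (Y *m Z) = d Y *m Z + Y *m d Z.
  apply: ofC_inj; apply: is_derive_unique (dP _) _.
  have := is_derive_cmatM (dP Y) (dP Z); rewrite !ofCK !F1.
  apply: near_eq_is_derive; apply: filterS nearG => t /FP [_ Fm _].
  by rewrite !ofCK Fm.
have dd Y : d (dag Y) = dag (d Y).
  apply: ofC_inj; apply: is_derive_unique (dP _) _.
  have dagl : linear (fun Y : cmat R N N => ofC (dag (toC Y))).
    by move=> a X Z; rewrite toCD toCZ dagD dagZ conj_real ofCD ofCZ.
  have := is_derive_lin cN dagl (dP Y); rewrite ofCK.
  apply: near_eq_is_derive; apply: filterS nearG => t /FP [_ _ Fd].
  by rewrite ofCK Fd.
have [j0 _] : exists j, r0 j 0 != 0.
  have /matrix0Pn [i [j h]] := unitv_neq0 lf r01.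
  by exists i; move: h; rewrite (ord1 j).
have [A [A0 AE]] := derivation_inner j0 dl dM.
exists A; split=> // [|P MP].
  apply/eqP; rewrite -addr_eq0 addrC; apply/eqP; apply: commute_all_tr0; last first.
    by rewrite raddfD /= (tr_dag D_inv) A0 rmorph0 addr0.
  move=> Y; rewrite -[Y](dagK D_herm D_inv); have := dd (dag Y).
  rewrite !AE dagB !(dagM D_inv).
  move=> /eqP; rewrite -subr_eq0 => /eqP h.
  apply/eqP; rewrite -subr_eq0; apply/eqP; rewrite -[RHS]h mulmxDl mulmxDr.
  by rewrite opprB opprD addrACA.
have := dP (toC P); rewrite AE; apply: near_eq_is_derive.
by apply: filterS nearG => t /FP [[_ Fp _] _ _]; rewrite Fp // toCK.
Qed.

(** Velocities of curves of the group at 1; linearity of this set is a consequence of the Lagrangian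
    condition and not of the definition. *)
Definition generator A := [/\ dag A = - A, \tr A = 0 &
  exists gamma, curve (@lg_set R G) (lg_one G) gamma /\
    forall P : cmat R N N, pts (k := M) P ->
      is_derive (0 : R) 1 (fun t => act (gamma t) P)
        (ofC (A *m toC P - toC P *m A))].

Lemma orbit_tangentE (P X : cmat R N N) : pts (k := M) P ->
  orbit_tangent (M := M) act P X <->
  exists A, generator A /\ toC X = A *m toC P - toC P *m A.
Proof.
move=> MP; split=> [[g Gg <-]|[A [[dA tA [g [Gg gP]]] XE]]].
  have [A [dA tA Ad]] := action_generator Gg.
  exists A; split; first by split=> //; exists g.
  have := Ad P MP; rewrite derive1E => -[_ E].
  by move: (congr1 (@toC R N N) E); rewrite ofCK.
exists g => //; rewrite derive1E; have [_ E] := gP P MP.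
by apply: (eq_trans E); rewrite -XE toCK.
Qed.

Lemma bracket_tr A B P :
  \tr ((A *m P - P *m A) *m B) = \tr (A *m (P *m B - B *m P)).
Proof.
mx_expand; rewrite !raddfB /= -!mulmxA (mxtrace_mulC P) -!mulmxA //.
Qed.

(** Up to the factor i, the left side is the Kähler form evaluated on the velocities of [A] and [B]
    at [P]. *)
Lemma bracket_J_tr A B P : P *m P = P ->
  \tr ((A *m P - P *m A) *m ((B *m P - P *m B) *m P - P *m (B *m P - P *m B))) =
  - \tr ((A *m B - B *m A) *m P).
Proof.
move=> PP; rewrite bracket_tr.
have -> : P *m ((B *m P - P *m B) *m P - P *m (B *m P - P *m B)) -
   ((B *m P - P *m B) *m P - P *m (B *m P - P *m B)) *m P =
   - (B *m P - P *m B).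
  by mx_expand; do 3!rewrite -?(mulmxA _ P P) ?PP; mx_linear.
rewrite mulmxN raddfN /=; congr (- _).
by mx_expand; rewrite !raddfB /= -!mulmxA (mxtrace_mulC B) -!mulmxA.
Qed.

Lemma dag_bracket A B P : dag A = - A -> dag B = - B -> dag P = P ->
  Num.conj (\tr ((A *m B - B *m A) *m P)) = - \tr ((A *m B - B *m A) *m P).
Proof.
move=> dA dB dP; rewrite -(tr_dag D_inv) (dagM D_inv) dagB !(dagM D_inv) dA dB dP.
by rewrite !mulNmx !mulmxN !opprK mxtrace_mulC -(opprB (A *m B)) mulNmx raddfN.
Qed.

Lemma tr_skew A P : dag A = - A -> dag P = P ->
  Num.conj (\tr (A *m P)) = - \tr (A *m P).
Proof.
move=> dA dP; rewrite -(tr_dag D_inv) (dagM D_inv) dA dP mulmxN raddfN /=.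
by rewrite mxtrace_mulC.
Qed.

Lemma imag_eq0 (z : C) : Num.conj z = - z -> complex.Re ('i%C * z) = 0 -> z = 0.
Proof.
case: z => a b; rewrite conjcE /= => /eqP; rewrite eq_complex /= => /andP[/eqP h _] h2.
by apply/eqP; rewrite eq_complex /=; apply/andP; split; apply/eqP; lra.
Qed.

Lemma act_pts_line x (P : cmat R N N) : lg_set x -> pts (k := M) P ->
  pts (k := M) (act x P).
Proof. by move=> Gx MP; exact: (act_pts (M := M) actP). Qed.

Hypothesis act_lagrangian : forall P : cmat R N N, pts (k := M) P ->
  lagrangian_in (metric (k := M) P) (cstr (k := M) P) (tangent (@pts R M) P)
    (orbit_tangent (M := M) act P).

Lemma lagrangian_bracket (P : cmat R N N) X : pts (k := M) P ->
  tangent_at D (toC P) X ->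
  (forall A, generator A ->
     complex.Re (\tr ((A *m toC P - toC P *m A) *m X)) = 0) <->
  exists B, generator B /\ X = 'i%C *: ((B *m toC P - toC P *m B) *m toC P -
     toC P *m (B *m toC P - toC P *m B)).
Proof.
move=> MP TX; have [VT VJ] := act_lagrangian MP.
have TX' : tangent (@pts R M) P (ofC X) by apply/(tangentE lf _ MP); rewrite ofCK.
have c0 := c_neq0 lf.
split=> [h|[B [SB XE]] A SA].
  have : (cstr (k := M) P @` orbit_tangent (M := M) act P) (ofC X).
    rewrite VJ; split=> // v /(orbit_tangentE _ MP) [A [SA vE]] /=.
    by rewrite vE ofCK h //; exact: mulr0.
  move=> [v /(orbit_tangentE _ MP) [B [SB vE]] vX]; exists B; split=> //.
  by have := congr1 (@toC R N N) vX; rewrite /= !ofCK vE => <-.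
have : [set w | tangent (@pts R M) P w /\ forall v, orbit_tangent (M := M) act P v ->
    metric (k := M) P v w = 0] (ofC X).
  rewrite -VJ; exists (ofC (B *m toC P - toC P *m B)).
    by apply/(orbit_tangentE _ MP); exists B; rewrite ofCK.
  by rewrite /= !ofCK XE.
move=> [_ /(_ (ofC (A *m toC P - toC P *m A)))] h.
have : metric (k := M) P (ofC (A *m toC P - toC P *m A)) (ofC X) = 0.
  by apply: h; apply/(orbit_tangentE _ MP); exists A; rewrite ofCK.
rewrite /= !ofCK => /eqP; rewrite mulf_eq0 => /orP[|/eqP //].
by rewrite mulf_eq0 invr_eq0 (negPf c0) pnatr_eq0.
Qed.

Lemma generator_tangent (P : cmat R N N) A : pts (k := M) P -> generator A ->
  tangent_at D (toC P) (A *m toC P - toC P *m A).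
Proof.
move=> MP SA; have : orbit_tangent (M := M) act P (ofC (A *m toC P - toC P *m A)).
  by apply/(orbit_tangentE _ MP); exists A; rewrite ofCK.
move=> /(orbit_tangent_tangent (M := M) cN actP MP).
by move/(tangentE lf _ MP); rewrite ofCK.
Qed.

(** The Lagrangian condition kills the real part of i tr ([A, B] P); as tr ([A, B] P) is imaginary,
    it vanishes at every point, and the points span. *)
Lemma generator_comm A B : generator A -> generator B -> A *m B = B *m A.
Proof.
move=> SA SB; have [dA _ _] := SA; have [dB _ _] := SB.
apply/eqP; rewrite -subr_eq0; apply/eqP; apply: (tr_ext lf r01) => P MP.
have PP := cpt_idem lf MP; have dP := cpt_dag lf MP.
have TB := generator_tangent MP SB.
have TJ := tangent_at_J lf PP dP TB.
have h := (lagrangian_bracket MP TJ).2 _ A SA.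
have {}h := h (ex_intro _ B (conj SB erefl)).
apply: imag_eq0; first exact: dag_bracket.
move: h; rewrite -scalemxAr mxtraceZ bracket_J_tr // mulrN ReN => /eqP.
by rewrite oppr_eq0 => /eqP.
Qed.

Hypothesis Gc : connected (@lg_set R G).

(** i tr (A P) is the moment of [A], and its derivative along [B] is i tr ([A, B] P) = 0. The
    invariance under the whole group, and not only infinitesimally, is where connectedness
    enters. *)
Lemma generator_moment A x (P : cmat R N N) : generator A -> lg_set x ->
  pts (k := M) P -> \tr (A *m toC (act x P)) = \tr (A *m toC P).
Proof.
move=> SA Gx MP; have [dA _ _] := SA.
pose phi := (fun X : cmat R N N => complex.Re ('i%C * \tr (A *m toC X))) : amb M -> R^o.
have philin : linear phi.
  move=> a X Y; rewrite /phi toCD toCZ mulmxDr -scalemxAr mxtraceD mxtraceZ.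
  by rewrite mulrDr ReD mulrCA ReZ.
have phi0 : phi (act x P) = phi P.
  have inv := @action_invariant R G M act actP Gc phi.
  apply: inv => // gamma q Gg Mq.
  have [B [dB tB Bd]] := action_generator Gg.
  have SB : generator B by split=> //; exists gamma.
  have := is_derive_lin cN philin (Bd q Mq).
  rewrite /phi ofCK mxtrace_mulC bracket_tr.
  rewrite (_ : \tr _ = 0) ?mulr0 //.
  have := generator_comm SA SB => AB.
  rewrite mulmxBr raddfB /= (mulmxA B _ A) (mxtrace_mulC _ A) (mulmxA A B) AB.
  by rewrite -mulmxA subrr.
have h (Q : cmat R N N) : pts (k := M) Q ->
    Num.conj (\tr (A *m toC Q)) = - \tr (A *m toC Q).
  by move=> MQ; apply: tr_skew => //; exact: (cpt_dag lf MQ).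
have h1 := h _ MP; have h2 := h _ (act_pts_line Gx MP).
apply/eqP; rewrite -subr_eq0; apply/eqP; apply: imag_eq0.
  by rewrite conjB h1 h2 opprB opprK addrC.
by rewrite mulrBr ReB -/(phi _) -/(phi _) phi0 subrr.
Qed.

(** The adjoint action of the group on its generators is trivial: by trace duality this is the
    invariance of the moments. *)
Lemma generator_fixed A x F : generator A -> lg_set x ->
  mx_extension D c (act x) F -> F A = A.
Proof.
move=> SA Gx [Fl FP Ftr]; have [f' fi] := act_isometry actP Gx.
apply/eqP; rewrite -subr_eq0; apply/eqP; apply: (tr_ext lf r01) => Q MQ.
have [MP E] := hi_inv fi MQ.
rewrite mulmxBl raddfB /= -E -[in X in X - _]FP // Ftr generator_moment //.
exact: subrr.
Qed.

End Generators.

End Generators.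
Import Generators.

Module CommutingMatrices.

(** * Commuting families of matrices *)

Section CommonEigenvector.
Variable K : numClosedFieldType.

Lemma stable_eigenvector n (U A : 'M[K]_n) : U != 0 -> stablemx U A ->
  exists a, (U :&: eigenspace A a)%MS != 0.
Proof.
move=> U0 UA; have rU : (0 < \rank U)%N by rewrite lt0n mxrank_eq0.
have [a] := eigenvalue_closed (restrictmx U A) rU.
rewrite /eigenvalue => Ea; exists a; apply: contraNneq Ea => UE0.
rewrite -nz_row_eq0; set u := nz_row _.
have uE : (u *m row_base U <= eigenspace A a)%MS.
  rewrite -sub_eigenspace_conjmx ?stablemx_row_base ?row_base_free //.
  exact: nz_row_sub.
have uU : (u *m row_base U <= U)%MS.
  by apply: submx_trans (submxMl _ _) _; rewrite eq_row_base.
have : (u *m row_base U <= (U :&: eigenspace A a))%MS by rewrite sub_capmx uU.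
by rewrite UE0 submx0 mulmx_free_eq0 // row_base_free.
Qed.

(** Induction on the rank of [U]: if some member is not scalar on [U], then [U] is replaced by its
    intersection with an eigenspace of that member, which is stable under the commuting family and
    strictly smaller. *)
Lemma common_eigenrow n (S : 'M[K]_n -> Prop) (U : 'M[K]_n) : U != 0 ->
  (forall A, S A -> stablemx U A) ->
  (forall A B, S A -> S B -> A *m B = B *m A) ->
  exists u : 'rV_n, [/\ u != 0, (u <= U)%MS &
    forall A, S A -> exists a, u *m A = a *: u].
Proof.
have [m] := ubnP (\rank U); elim: m U => // m IH U rU U0 US SS.
have [h|/existsNP [A /not_implyP [SA h]]] :=
    pselect (forall A, S A -> exists a, (U <= eigenspace A a)%MS).
  exists (nz_row U); split; rewrite ?nz_row_eq0 ?nz_row_sub // => A /h [a Ua].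
  by exists a; apply/eigenspaceP; apply: submx_trans Ua; exact: nz_row_sub.
have [a Ea] := stable_eigenvector U0 (US _ SA).
have [|B SB||u [u0 uU' uS]] := IH _ _ Ea.
- apply: leq_trans (_ : \rank U <= m)%N; last by rewrite -ltnS.
  rewrite ltn_neqAle mxrankS ?capmxSl // andbT; apply/negP => /eqP E.
  apply: h; exists a.
  have := geq_leqif (mxrank_leqif_sup (capmxSl U (eigenspace A a))).
  by rewrite E leqnn => /esym; rewrite sub_capmx submx_refl.
- rewrite sub_capmx; apply/andP; split.
    by apply: submx_trans (US _ SB); apply: submxMr; exact: capmxSl.
  apply: submx_trans (comm_mx_stable_eigenspace a (SS _ _ SA SB)).
  by apply: submxMr; exact: capmxSr.
- exact: SS.
exists u; split=> //; apply: submx_trans uU' _; exact: capmxSl.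
Qed.

Lemma common_eigenvector_in n (S : 'M[K]_n -> Prop) (U : 'M[K]_n) : U != 0 ->
  (forall A, S A -> forall x : 'cV_n, (x^T <= U)%MS -> ((A *m x)^T <= U)%MS) ->
  (forall A B, S A -> S B -> A *m B = B *m A) ->
  exists e : 'cV_n, [/\ e != 0, (e^T <= U)%MS &
    forall A, S A -> exists a, A *m e = a *: e].
Proof.
move=> U0 US SS.
have [A|A B SA SB|u [u0 uU uS]] := @common_eigenrow n (fun A => S A^T) U U0.
- move=> SA; apply/rV_subP => v /submxP [w ->]; rewrite mulmxA.
  have := US _ SA (w *m U)^T; rewrite trmxK submxMl => /(_ isT).
  by rewrite trmx_mul !trmxK.
- by apply: trmx_inj; rewrite !trmx_mul SS.
exists u^T; split; rewrite ?trmxK ?trmx_eq0 // => A SA.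
have [|a ua] := uS A^T; first by rewrite trmxK.
by exists a; apply: trmx_inj; rewrite trmx_mul trmxK ua linearZ /= trmxK.
Qed.

Lemma kermx_exists m n (B : 'M[K]_(n, m)) : (m < n)%N -> kermx B != 0.
Proof.
move=> mn; rewrite -mxrank_eq0 mxrank_ker -lt0n subn_gt0.
exact: leq_ltn_trans (rank_leq_col B) mn.
Qed.

(** All roots of the characteristic polynomial equal [a], so the trace is n + 1 times [a] and
    [a = 0]; Cayley-Hamilton then gives nilpotency. *)
Lemma single_eigenvalue n (A : 'M[K]_n.+1) a :
  (forall b (x : 'cV_n.+1), x != 0 -> A *m x = b *: x -> b = a) ->
  \tr A = 0 -> a = 0 /\ exists m, A ^+ m = 0.
Proof.
move=> Aa tA.
have [r rE] := closed_field_poly_normal (char_poly A).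
rewrite (monicP (char_poly_monic A)) scale1r in rE.
have ra : all (pred1 a) r.
  apply/allP => b br /=; apply/eqP.
  have : root (char_poly A) b by rewrite rE root_prod_XsubC.
  have -> : char_poly A = char_poly A^T.
    rewrite /char_poly -det_tr; congr (\det _).
    by rewrite /char_poly_mx linearB /= tr_scalar_mx map_trmx.
  rewrite -eigenvalue_root_char => /eigenvalueP [u uA u0].
  apply: (Aa b u^T); first by rewrite trmx_eq0.
  by apply: trmx_inj; rewrite trmx_mul trmxK uA linearZ /= trmxK.
have sr : size r = n.+1.
  by have := size_char_poly A; rewrite rE size_prod_XsubC => -[].
have rn : r = nseq n.+1 a by rewrite -sr; exact/all_pred1P.
have a0 : a = 0.
  have := char_poly_trace A isT; rewrite tA oppr0 rE -[n.+1.-1]/(n.+1.-1).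
  rewrite -{1}sr coefPn_prod_XsubC ?sr // => /eqP; rewrite oppr_eq0 rn.
  by rewrite big_nseq iter_addr addr0 mulrn_eq0 => /eqP.
split=> //; exists n.+1; have := Cayley_Hamilton A.
rewrite rE rn big_nseq a0 subr0.
have -> m : iter m ( *%R ('X : {poly K})) 1 = 'X^m.
  by elim: m => //= m ->; rewrite exprS.
by rewrite rmorphXn /= horner_mx_X.
Qed.

End CommonEigenvector.

(** A subspace of maximal dimension among those contained in [S] contains every element of [S],
    since otherwise it could be enlarged. *)
Lemma vspace_of_pred (K : fieldType) (V : vectType K) (S : V -> Prop) :
  S 0 -> (forall a x y, S x -> S y -> S (a *: x + y)) ->
  exists U : {vspace V}, forall x, x \in U <-> S x.
Proof.
move=> S0 Sl.
pose P d := `[< exists U : {vspace V}, \dim U = d /\ forall x, x \in U -> S x >].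
have P0 : exists d, P d.
  exists 0%N; apply/asboolP; exists 0%VS; split; first exact: dimv0.
  by move=> x; rewrite memv0 => /eqP ->.
have Pb d : P d -> (d <= \dim {:V})%N.
  by move=> /asboolP [U [<- _]]; apply: dimvS; exact: subvf.
case: (ex_maxnP P0 Pb) => d /asboolP [U [dU US]] dmax.
exists U => x; split; first exact: US.
move=> Sx; apply: contrapT => xU.
have : P (\dim (U + <[x]>)%VS).
  apply/asboolP; exists (U + <[x]>)%VS; split=> // y /memv_addP [u uU [_ /vlineP [a ->] ->]].
  by rewrite addrC; apply: Sl => //; exact: US.
move=> /dmax; rewrite -dU; apply/negP; rewrite -ltnNge.
rewrite ltn_neqAle dimvS ?addvSl // andbT; apply/negP => /eqP E.
apply: xU; have /eqP -> : (U == U + <[x]>)%VS.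
  by rewrite eqEdim addvSl E leqnn.
by rewrite memvE addvSr.
Qed.

End CommutingMatrices.
Import CommutingMatrices.

(** * The Lagrangian condition expressed on vectors instead of projectors *)

Module LagrangianFamilies.

Lemma addc_conj (R : realType) (z : R[i]) : z + Num.conj z = ((2 * complex.Re z)%:C)%C.
Proof.
case: z => a b; rewrite conjcE /=; apply/eqP; rewrite eq_complex /=.
by apply/andP; split; apply/eqP; [rewrite mulr_natl mulr2n | rewrite subrr].
Qed.

Opaque real_complex_def toC ofC ip outer dag gcos gsin line_of.

Lemma bracketZ (K : comNzRingType) N a (Z P : 'M[K]_N) :
  (a *: Z) *m P - P *m (a *: Z) = a *: (Z *m P - P *m Z).
Proof. by rewrite -scalemxAl -scalemxAr scalerBr. Qed.

(* The last clause says that the projections of the vectors B r to the orthogonal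
   of r, for B in S, form a Lagrangian subspace of it. *)
Definition lagrangian_family (R : realType) N (D : 'M[R[i]]_N) (k : R)
    (S : 'M[R[i]]_N -> Prop) : Prop :=
  [/\ forall A, S A -> dag D A = - A /\ \tr A = 0,
      forall A B, S A -> S B -> A *m B = B *m A &
      forall r y, unitv D k r -> ip D r y = 0 ->
        (forall A, S A -> complex.Re (ip D (A *m r) y) = 0) <->
        exists B, S B /\ y = 'i%C *: (B *m r - ((k%:C)%C * ip D r (B *m r)) *: r)].

Section FamilyOfAction.
Context {R : realType} {N : nat}.
Local Notation C := R[i].
Variables (D : 'M[C]_N) (k c : R).
Hypothesis lf : line_form D k c.
Let D_herm : D^t* = D. Proof. by case: lf. Qed.
Let D_inv : D *m D = 1%:M. Proof. by case: lf. Qed.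
Let k1 : k = 1 \/ k = -1. Proof. by case: lf. Qed.
Local Notation dag := (dag D).
Local Notation ip := (ip D).
Local Notation outer := (outer D).
Local Notation proj := (proj D k).
Local Notation kC := ((k%:C)%C).
Local Notation M := (line_space D c).
Implicit Types (A B X Y Z : 'M[C]_N) (r x y : 'cV[C]_N).

Lemma outer_inj r x y : unitv D k r -> outer x r = outer y r -> x = y.
Proof.
move=> r1 /(congr1 (fun Z : 'M[C]_N => Z *m r)); rewrite !outer_mulv r1.
apply: scalerI; apply: realC_neq0; by case: k1 => ->; rewrite ?oppr_eq0 oner_eq0.
Qed.

Lemma skew_proj_bracket A r : dag A = - A ->
  A *m proj r - proj r *m A = kC *: (outer (A *m r) r + outer r (A *m r)).
Proof.
move=> dA; rewrite /LineSpaces.proj -scalemxAr -scalemxAl mul_outer (outer_mul D_herm D_inv).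
by rewrite dA mulNmx outerNr scalerN opprK scalerDr.
Qed.

Lemma skew_ip A x y : dag A = - A -> ip (A *m x) y = - ip x (A *m y).
Proof. by move=> dA; rewrite (ip_dagl D_herm D_inv) dA mulNmx ipNr. Qed.

Lemma tr_bracket_outer A r y : dag A = - A -> unitv D k r -> ip r y = 0 ->
  \tr ((A *m proj r - proj r *m A) *m (kC *: (outer y r + outer r y))) =
  ((2 * k * complex.Re (ip (A *m r) y))%:C)%C.
Proof.
move=> dA r1 ry; have yr := ip_perpC lf ry.
rewrite skew_proj_bracket // -scalemxAl -scalemxAr scalerA (kCkC lf) scale1r.
rewrite tr_outer_sym ry yr r1.
rewrite (ipC D_herm (A *m r) y); move: (ip (A *m r) y) (ip (A *m r) r) (ip r _) => z z' z''.
have -> : z'' * 0 + Num.conj z * kC + (kC * z + 0 * z') = kC * (z + Num.conj z) by ring.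
rewrite addc_conj.
by rewrite -rmorphM; congr (real_complex _ _); ring.
Qed.

Variable r0 : 'cV[C]_N.
Hypothesis r01 : unitv D k r0.
Variables (G : lie_group R) (act : 'rV[R]_(lg_amb G) -> cmat R N N -> cmat R N N).
Hypothesis actP : action_by_holomorphic_isometries (M := M) act.
Hypothesis act_lagrangian : forall P : cmat R N N, pts (k := M) P ->
  lagrangian_in (metric (k := M) P) (cstr (k := M) P) (tangent (@pts R M) P)
    (orbit_tangent (M := M) act P).
Local Notation S := (generator D c act).

Lemma generator_lagrangian_family : lagrangian_family D k S.
Proof.
split=> [A [dA tA _] //|A B SA SB|r y r1 ry].
  exact: (generator_comm lf r01 actP act_lagrangian).
have MP : pts (k := M) (ofC (proj r)) by apply/(ptsE lf); exists r; rewrite ofCK.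
have TX := tangent_at_outer lf r1 ry; set X := kC *: _ in TX.
have TX' : tangent_at D (toC (ofC (proj r))) X by rewrite ofCK.
have := lagrangian_bracket lf r01 actP act_lagrangian MP TX'; rewrite ofCK => L.
have k2 : 2 * k != 0 by case: k1 => ->; rewrite mulf_neq0 ?oppr_eq0 ?oner_eq0 ?pnatr_eq0.
have kC0 : kC != 0 by apply: realC_neq0; case: k1 => ->; rewrite ?oppr_eq0 oner_eq0.
have LHS_E : (forall A, S A -> complex.Re (ip (A *m r) y) = 0) <->
    (forall A, S A -> complex.Re (\tr ((A *m proj r - proj r *m A) *m X)) = 0).
  split=> h A SA; have [dA _ _] := SA; have := h A SA.
    by rewrite tr_bracket_outer //= => ->; rewrite mulr0.
  by rewrite tr_bracket_outer //= => /eqP; rewrite mulf_eq0 (negPf k2) => /eqP.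
rewrite LHS_E L.
have JE B : dag B = - B -> 'i%C *: ((B *m proj r - proj r *m B) *m proj r -
     proj r *m (B *m proj r - proj r *m B)) =
   kC *: (outer ('i%C *: (B *m r - (kC * ip r (B *m r)) *: r)) r +
          outer r ('i%C *: (B *m r - (kC * ip r (B *m r)) *: r))).
  move=> dB; set z := B *m r - _.
  have rz : ip r z = 0 by rewrite /z ipBr ipZr r1 mulrAC (kCkC lf) mul1r; exact: subrr.
  have BE : B *m r = z + (kC * ip r (B *m r)) *: r by rewrite subrK.
  have BPE : B *m proj r - proj r *m B = kC *: (outer z r + outer r z).
    rewrite (skew_proj_bracket _ dB).
    suff -> : outer (B *m r) r + outer r (B *m r) = outer z r + outer r z by [].
    rewrite [in LHS]BE outerDl outerDr outerZl outerZr addrACA -scalerDl.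
    rewrite conjM conj_real -mulrDr.
    (* [ip r (B *m r)] is imaginary because [B] is skew, so the component of [B *m r] along [r] does
       not move the line. *)
    have -> : ip r (B *m r) + Num.conj (ip r (B *m r)) = 0.
      by rewrite -(ipC D_herm) skew_ip // subrr.
    by rewrite mulr0 scale0r addr0.
  rewrite BPE bracketZ scale_swap; congr (_ *: _).
  rewrite mulmxDl mulmxDr !(outer_proj lf) !mul_outer (proj_id lf r1) (proj_perp k rz).
  rewrite outer0l outer0r addr0 add0r outerZl outerZr conj_i scaleNr.
  by rewrite scalerBr.
split=> -[B [SB XE]]; exists B; split=> //; have [dB _ _] := SB; move: XE.
  rewrite (JE _ dB) => /(scalerI kC0); set z := 'i%C *: _ => E.
  have rz : ip r z = 0.
    by rewrite /z ipZr ipBr ipZr r1 mulrAC (kCkC lf) mul1r subrr mulr0.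
  apply: (outer_inj r1).
  (* Right multiplication by the projector isolates the first of the two outer products, which
     determines its left vector. *)
  have part u : ip r u = 0 -> (outer u r + outer r u) *m proj r = outer u r.
    move=> ru; rewrite mulmxDl !(outer_proj lf) (proj_id lf r1) (proj_perp k ru) outer0r.
    exact: addr0.
  have E2 := congr1 (fun Z : 'M[C]_N => Z *m proj r) E.
  exact: (etrans (esym (part _ ry)) (etrans E2 (part _ rz))).
by move=> yE; rewrite (JE _ dB) -yE.
Qed.

End FamilyOfAction.

End LagrangianFamilies.
Import LagrangianFamilies.

(** * Common eigenvectors and nilpotency of the generators *)

Module HyperbolicFamilies.

Lemma Re_real (R : realType) (a : R) : complex.Re (a%:C)%C = a.
Proof. by []. Qed.

Lemma imag_conj (R : realType) (z : R[i]) : Num.conj z = - z ->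
  z = 'i%C * ((complex.Im z)%:C)%C.
Proof.
case: z => a b; rewrite conjcE => /eqP; rewrite eq_complex /= => /andP[/eqP h _].
have a0 : a = 0 by lra.
by apply/eqP; rewrite eq_complex /= a0 !mul0r !mul1r subrr add0r !eqxx.
Qed.

Lemma real_Im (R : realType) (z : R[i]) : z = Num.conj z -> complex.Im z = 0.
Proof.
by case: z => a b; rewrite conjcE => /eqP; rewrite eq_complex /= eqxx /= => /eqP; lra.
Qed.

Lemma ip_tr (R : realType) N (D : 'M[R[i]]_N) (v x : 'cV[R[i]]_N) :
  x^T *m (v^t* *m D)^T = (ip D v x)%:M.
Proof. by apply: trmx_inj; rewrite trmx_mul !trmxK ipE tr_scalar_mx. Qed.

Lemma scalar11_eq0 (R : realType) (a : R[i]) : (a%:M : 'M[R[i]]_1) = 0 <-> a = 0.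
Proof.
split=> [/matrixP /(_ 0 0)|->]; first by rewrite !mxE.
by apply/matrixP => i j; rewrite !mxE mul0rn.
Qed.

Lemma perp1_kermx (R : realType) N (D : 'M[R[i]]_N) (v x : 'cV[R[i]]_N) :
  (x^T <= kermx (v^t* *m D)^T)%MS <-> ip D v x = 0.
Proof.
rewrite -scalar11_eq0 -ip_tr; split=> [/sub_kermxP //|h]; exact/sub_kermxP.
Qed.

Lemma sub_kermx_row (K : fieldType) m n p q (x : 'M[K]_(m, n)) (A : 'M[K]_(n, p)) (B : 'M[K]_(n, q)) :
  (x <= kermx (row_mx A B))%MS <-> (x <= kermx A)%MS /\ (x <= kermx B)%MS.
Proof.
split=> [/sub_kermxP|[/sub_kermxP h1 /sub_kermxP h2]]; last first.
  by apply/sub_kermxP; rewrite mul_mx_row h1 h2 row_mx0.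
rewrite mul_mx_row => /eqP; rewrite row_mx_eq0 => /andP[/eqP h1 /eqP h2].
by split; apply/sub_kermxP.
Qed.

Lemma perp2_kermx (R : realType) N (D : 'M[R[i]]_N) (v w x : 'cV[R[i]]_N) :
  (x^T <= kermx (row_mx (v^t* *m D)^T (w^t* *m D)^T))%MS <->
  ip D v x = 0 /\ ip D w x = 0.
Proof.
apply: (iff_trans (sub_kermx_row _ _ _)).
have pv := perp1_kermx D v x; have pw := perp1_kermx D w x.
by split=> -[h1 h2]; split; [exact: pv.1 h1|exact: pw.1 h2|exact: pv.2 h1|exact: pw.2 h2].
Qed.

Opaque real_complex_def toC ofC ip outer dag gcos gsin line_of.

Section LagrangianFamilies.
Context {R : realType} {N : nat}.
Local Notation C := R[i].
Variables (D : 'M[C]_N) (k c : R).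
Hypothesis lf : line_form D k c.
Let D_herm : D^t* = D. Proof. by case: lf. Qed.
Let D_inv : D *m D = 1%:M. Proof. by case: lf. Qed.
Let k1 : k = 1 \/ k = -1. Proof. by case: lf. Qed.
Local Notation dag := (dag D).
Local Notation ip := (ip D).
Local Notation outer := (outer D).
Local Notation kC := ((k%:C)%C).
Implicit Types (A B X Y Z : 'M[C]_N) (r x y e v : 'cV[C]_N).

Lemma pos_vec_scale v : pos_vec D k v -> exists s : C, s != 0 /\ unitv D k (s *: v).
Proof.
rewrite /pos_vec; set a := complex.Re _ => ka.
pose s := Num.sqrt (k * a).
have s2 : s ^+ 2 = k * a by rewrite sqr_sqrtr // ltW.
have s0 : s != 0 by rewrite gt_eqF // sqrtr_gt0.
clearbody s; exists ((s^-1)%:C)%C; split; first by apply: realC_neq0; rewrite invr_eq0.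
rewrite /LineSpaces.unitv ipZl ipZr conj_real (ip_real D_herm) -/a -!rmorphM.
congr (real_complex _ _).
have -> : s^-1 * (s^-1 * a) = a / s ^+ 2 by field.
have ka0 : k * a != 0 by rewrite gt_eqF.
by apply: (mulIf ka0); rewrite s2 mulfVK // mulrA (kk lf) mul1r.
Qed.

Lemma perp_exists v : (1 < N)%N -> exists y, y != 0 /\ ip v y = 0.
Proof.
move=> N1; have := kermx_exists (v^t* *m D)^T N1.
rewrite -nz_row_eq0; set u := nz_row _ => u0.
exists u^T; split; first by rewrite trmx_eq0.
by apply/perp1_kermx; rewrite trmxK; exact: nz_row_sub.
Qed.

Variable S : 'M[C]_N -> Prop.
Hypothesis LS : lagrangian_family D k S.
Let Sdag A : S A -> dag A = - A. Proof. by case: LS => h _ _ /h []. Qed.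
Let Str A : S A -> \tr A = 0. Proof. by case: LS => h _ _ /h []. Qed.
Let Scomm A B : S A -> S B -> A *m B = B *m A. Proof. by case: LS => _ h _; exact: h. Qed.
Let Slag r y : unitv D k r -> ip r y = 0 ->
  (forall A, S A -> complex.Re (ip (A *m r) y) = 0) <->
  exists B, S B /\ y = 'i%C *: (B *m r - (kC * ip r (B *m r)) *: r).
Proof. by case: LS => _ _ h; exact: h. Qed.

Definition common_eigen e := e != 0 /\ forall A, S A -> exists a, A *m e = a *: e.

Lemma family_skew A x y : S A -> ip (A *m x) y = - ip x (A *m y).
Proof. by move=> /Sdag; exact: (skew_ip lf). Qed.

(** At such a point the zero space would be Lagrangian, whereas a nonzero vector orthogonal to it
    exists as soon as [N > 1]. *)
Lemma eigen_not_pos_vec e : (1 < N)%N -> common_eigen e -> ~ pos_vec D k e.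
Proof.
move=> N1 [e0 eS] /pos_vec_scale [s [s0 r1]].
set r := s *: e in r1.
have rS A : S A -> exists a, A *m r = a *: r.
  by move=> /eS [a E]; exists a; rewrite /r -scalemxAr E scale_swap.
have [y [y0 ry]] := perp_exists r N1.
have [h _] := Slag r1 ry.
have [|B [SB yE]] := h.
  by move=> A /rS [a ->]; rewrite ipZl ry mulr0.
have [b bE] := rS _ SB.
move: y0; rewrite yE bE ipZr r1 mulrCA (kCkC lf) mulr1 subrr scaler0.
by rewrite eqxx.
Qed.

Lemma common_eigen_exists (U : 'M[C]_N) : U != 0 ->
  (forall A, S A -> forall x, (x^T <= U)%MS -> ((A *m x)^T <= U)%MS) ->
  exists e, common_eigen e /\ (e^T <= U)%MS.
Proof.
by move=> U0 US; have [e [e0 eU eS]] := common_eigenvector_in U0 US Scomm; exists e.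
Qed.

End LagrangianFamilies.

Section Hyperbolic.
Context {R : realType} {n : nat}.
Local Notation C := R[i].
Local Notation N := n.+1.
Variables (D : 'M[C]_N) (c : R).
Hypothesis lf : line_form D (-1) c.
Let D_herm : D^t* = D. Proof. by case: lf. Qed.
Let D_inv : D *m D = 1%:M. Proof. by case: lf. Qed.
Local Notation dag := (dag D).
Local Notation ip := (ip D).
Local Notation outer := (outer D).
Local Notation unitv := (unitv D (-1)).
Implicit Types (A B X Y Z : 'M[C]_N) (r x y e v w : 'cV[C]_N).
Variable r0 : 'cV[C]_N.
Hypothesis r01 : unitv r0.
Hypothesis n2 : (1 < n)%N.

Lemma neg_norm r : unitv r -> ip r r = -1.
Proof. by move=> ->; rewrite rmorphN1. Qed.

(* A null vector is not orthogonal to a negative one, so subtracting a multiple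
   of [v] moves [y] to the positive definite space orthogonal to [r0]. *)
Lemma null_perp v y : v != 0 -> ip v v = 0 -> ip v y = 0 ->
  0 <= complex.Re (ip y y) /\ (ip y y = 0 -> exists a, y = a *: v).
Proof.
move=> v0 vv vy.
have r0v : ip r0 v != 0.
  apply/eqP => h; have [_ _ _ _ pos] := lf.
  by have := pos r0 v (unitv_pos lf r01) h v0; rewrite vv ltxx.
pose z := y - (ip r0 y / ip r0 v) *: v.
have rz : ip r0 z = 0 by rewrite /z ipBr ipZr mulfVK // subrr.
have yv : ip y v = 0 by rewrite (ipC D_herm v) vy; exact: rmorph0.
have zz : ip z z = ip y y.
  by rewrite /z ipBr !ipBl !ipZr !ipZl yv vy vv !mulr0 !subr0.
split; first by rewrite -zz; exact: (ip_perp_ge0 lf r01).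
move=> yy; exists (ip r0 y / ip r0 v).
apply/eqP; rewrite -subr_eq0 -/z; apply/eqP; apply: contrapT => /eqP z0.
have [_ _ _ _ pos] := lf; have := pos r0 z (unitv_pos lf r01) rz z0.
by rewrite zz yy ltxx.
Qed.

Variable S : 'M[C]_N -> Prop.
Hypothesis LS : lagrangian_family D (-1) S.
Let Sdag A : S A -> dag A = - A. Proof. by case: LS => h _ _ /h []. Qed.
Let Str A : S A -> \tr A = 0. Proof. by case: LS => h _ _ /h []. Qed.
Let Scomm A B : S A -> S B -> A *m B = B *m A. Proof. by case: LS => _ h _; exact: h. Qed.
Let Slag r y : unitv r -> ip r y = 0 ->
  (forall A, S A -> complex.Re (ip (A *m r) y) = 0) <->
  exists B, S B /\ y = 'i%C *: (B *m r - ((((-1)%:C)%C) * ip r (B *m r)) *: r).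
Proof. by case: LS => _ _ h; exact: h. Qed.
Local Notation skew := (family_skew lf LS).

(** Suppose [e] has positive square. Some point [r] is orthogonal to [e], and all velocities at [r]
    are orthogonal to [e]; the Lagrangian condition then writes [e] as i times a velocity, which is
    orthogonal to [e], a contradiction. *)
Lemma eigen_null e : common_eigen S e -> ip e e = 0.
Proof.
move=> eS; have [e0 eA] := eS.
rewrite (ip_real D_herm); suff -> : complex.Re (ip e e) = 0 by exact: rmorph0.
have [h|h|//] := ltrgtP (complex.Re (ip e e)) 0.
  exfalso; apply: (eigen_not_pos_vec lf LS (leqW n2) eS).
  by rewrite /pos_vec mulN1r oppr_gt0.
have ee0 : ip e e != 0 by rewrite (ip_real D_herm); apply: realC_neq0; rewrite gt_eqF.
pose r' := r0 - (ip e r0 / ip e e) *: e.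
have er' : ip e r' = 0 by rewrite /r' ipBr ipZr mulfVK // subrr.
(* Removing from [r0] its component along a positive vector can only decrease its square. *)
have r'r' : complex.Re (ip r' r') < 0.
  have -> : ip r' r' = -1 - ip e r0 * Num.conj (ip e r0) / ip e e.
    rewrite {1}/r' ipBl ipZl er' mulr0 subr0 /r' ipBr ipZr (neg_norm r01).
    by rewrite (ipC D_herm e r0) mulrAC.
  rewrite normsqE (ip_real D_herm e) -fmorphV -rmorphM ReB ReN !Re_real.
  have := divr_ge0 (normsq_ge0 (ip e r0)) (ltW h); lra.
have [|s [s0 r1]] := pos_vec_scale lf (v := r'); first by rewrite /pos_vec mulN1r oppr_gt0.
set r := s *: r' in r1.
have er : ip e r = 0 by rewrite /r ipZr er' mulr0.
have re : ip r e = 0 by exact: (ip_perpC lf).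
have [|B [SB eE]] := (Slag r1 re).1.
  move=> A SA; have [a aE] := eA A SA.
  by rewrite skew // aE ipZr re mulr0 oppr0.
have [b bE] := eA _ SB.
suff E : ip e e = 0 by move: ee0; rewrite E eqxx.
rewrite {2}eE ipZr ipBr ipZr er mulr0 subr0.
have -> : ip e (B *m r) = 0.
  apply: oppr_inj; rewrite -skew // bE ipZl er oppr0; exact: mulr0.
exact: mulr0.
Qed.

(** The orthogonal of two non-proportional null eigenvectors is stable and, as n > 1, nonzero. It
    contains a common eigenvector, which must be null, although the form is positive definite
    there. *)
Lemma eigen_unique v e : common_eigen S v -> common_eigen S e ->
  exists a, e = a *: v.
Proof.
move=> vS eS; have vv := eigen_null vS; have ee := eigen_null eS.
have [v0 vA] := vS; have [e0 eA] := eS.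
have [ve|ve] := eqVneq (ip v e) 0; first by have [_ /(_ ee)] := null_perp v0 vv ve.
exfalso.
pose U := kermx (row_mx (v^t* *m D)^T (e^t* *m D)^T).
have UP x : (x^T <= U)%MS <-> ip v x = 0 /\ ip e x = 0 := perp2_kermx D v e x.
have U0 : U != 0 by apply: kermx_exists.
have [A SA x|x [xS /UP [vx ex]]] := common_eigen_exists LS U0.
  move=> /UP [vx ex]; apply/UP; have [a aE] := vA _ SA; have [b bE] := eA _ SA.
  split; apply: oppr_inj; rewrite -skew // ?aE ?bE ipZl ?vx ?ex oppr0; exact: mulr0.
have xx := eigen_null xS; have [x0 _] := xS.
have [_ /(_ xx) [a xE]] := null_perp v0 vv vx.
move: ex; rewrite xE ipZr => /eqP; rewrite mulf_eq0 => /orP[/eqP a0|/eqP ev].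
  by move: x0; rewrite xE a0 scale0r eqxx.
by move: ve; rewrite (ipC D_herm e) ev rmorph0 eqxx.
Qed.

Lemma null_line : exists v, [/\ v != 0, ip v v = 0,
  forall A, S A -> A *m v = 0 &
  forall A y, S A -> ip v y = 0 -> exists a, A *m y = a *: v].
Proof.
have [A SA x _|v [vS _]] := common_eigen_exists LS (U := 1%:M) (matrix_nonzero1 _ _).
  exact: submx1.
have vv := eigen_null vS; have [v0 vA] := vS.
have nilp A : S A -> A *m v = 0 /\ exists m, A ^+ m = 0.
  move=> SA; have [a aE] := vA _ SA.
  have [|a0 An] := single_eigenvalue (A := A) (a := a) _ (Str SA); last first.
    by split=> //; rewrite aE a0; exact: scale0r.
  (* Every eigenspace of [A] is stable under the family, so it contains a common eigenvector; this
     is a multiple of [v], hence every eigenvalue of [A] equals [a]. *)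
  move=> b x x0 xE.
  pose U := kermx (A - b%:M)^T.
  have UP y : (y^T <= U)%MS <-> A *m y = b *: y.
    rewrite sub_kermx -trmx_mul trmx_eq0 mulmxBl mul_scalar_mx subr_eq0.
    by split=> /eqP.
  have U0 : U != 0.
    apply: contraNneq x0 => U0; have /UP := xE; rewrite U0 submx0.
    by rewrite trmx_eq0.
  have [B SB y|e [eS /UP eE]] := common_eigen_exists LS U0.
    move=> /UP yE; apply/UP; rewrite mulmxA (Scomm SA SB) -mulmxA yE.
    by rewrite -scalemxAr.
  have [a' eE'] := eigen_unique vS eS; have [e0 _] := eS.
  have : b *: e = a *: e by rewrite -eE eE' -scalemxAr aE scale_swap.
  move=> /eqP; rewrite -subr_eq0 -scalerBl scaler_eq0 (negPf e0) orbF subr_eq0.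
  by move=> /eqP.
exists v; split=> // [A /nilp [] //|A y SA vy].
have [Av [m Am]] := nilp _ SA.
have vA' z : ip v (A *m z) = 0.
  by apply: oppr_inj; rewrite -skew // Av ip0l oppr0.
have vAk j : ip v (A ^+ j *m y) = 0.
  by case: j => [|j]; rewrite ?mul1mx // exprS -mulmxA vA'.
(* Descent on the power of [A], starting from a vanishing one. If A^(q+2) y is a multiple of v, then
   A^(q+1) y has square - ip (A^q y) (A^(q+2) y) = 0 and is orthogonal to v, hence is itself a
   multiple of v. *)
have vpow j : exists a, A ^+ (m - j).+1 *m y = a *: v.
  elim: j => [|j [a aE]].
    exists 0; rewrite subn0 exprS Am -mulmxA mul0mx mulmx0; apply/esym; exact: scale0r.
  have [mj|mj] := leqP m j.
    have /eqP E1 : (m - j == 0)%N by rewrite subn_eq0.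
    have /eqP E2 : (m - j.+1 == 0)%N by rewrite subn_eq0 leqW.
    by rewrite E1 in aE; exists a; rewrite E2.
  have E : (m - j = (m - j.+1).+1)%N by rewrite subnSK.
  rewrite E in aE; set q := (m - j.+1)%N in aE *.
  have [_] := null_perp v0 vv (vAk q.+1); apply.
  rewrite {1}exprS -mulmxA skew // mulmxA -[A *m A ^+ q.+1]/(A * A ^+ q.+1) -exprS aE.
  by rewrite ipZr (ip_perpC lf (vAk q)) mulr0 oppr0.
by have := vpow m; rewrite subnn expr1.
Qed.


(** * The generators of a Lagrangian action on complex hyperbolic space *)

Definition null_frame v w := [/\ ip v v = 0, ip w w = 0, ip v w = 1 & ip w v = 1].

Definition perp2 v w x := ip v x = 0 /\ ip w x = 0.

(* The elements of g_alpha + g_(2 alpha), for the Iwasawa decomposition defined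
   by the null vectors [v] and [w]. *)
Definition nil_mx v x (s : R) : 'M[C]_N :=
  outer x v - outer v x + ('i%C * (s%:C)%C) *: outer v v.

Lemma nil_mx_mulv v x s y : nil_mx v x s *m y =
  ip v y *: x + ('i%C * (s%:C)%C * ip v y - ip x y) *: v.
Proof.
rewrite /nil_mx mulmxDl mulmxBl -scalemxAl !outer_mulv scalerA scalerBl.
by rewrite -addrA [- _ + _]addrC.
Qed.

Definition perp_part v w y := y - (ip w y *: v + ip v y *: w).

Lemma perp_partP v w y : null_frame v w -> perp2 v w (perp_part v w y).
Proof.
move=> [vv ww vw wv]; rewrite /perp_part; split.
  rewrite ipBr ipDr !ipZr vv vw; move: (ip v y) (ip w y) => a b.
  by rewrite mulr0 add0r mulr1 subrr.
rewrite ipBr ipDr !ipZr ww wv; move: (ip v y) (ip w y) => a b.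
by rewrite mulr0 addr0 mulr1 subrr.
Qed.

Lemma perp_partK v w y : y = perp_part v w y + (ip w y *: v + ip v y *: w).
Proof. by rewrite subrK. Qed.

Lemma mx_ext A B : (forall y, A *m y = B *m y) -> A = B.
Proof.
move=> AB; apply/eqP; rewrite -subr_eq0; apply/eqP; apply: outer_ext => y.
by rewrite mulmxBl AB subrr.
Qed.

Lemma frame_ext v w A B : A *m v = B *m v -> A *m w = B *m w ->
  null_frame v w -> (forall y, perp2 v w y -> A *m y = B *m y) -> A = B.
Proof.
move=> Av Aw vw AB; apply: mx_ext => y; rewrite (perp_partK v w y).
have yP := perp_partP y vw; move: (perp_part v w y) yP => p pP.
by rewrite !mulmxDr -!scalemxAr Av Aw (AB _ pP).
Qed.

Lemma perp2C v w x : perp2 v w x -> ip x v = 0 /\ ip x w = 0.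
Proof. by move=> [vx wx]; split; exact: (ip_perpC lf). Qed.

Lemma nil_mx_w v w x s : null_frame v w -> perp2 v w x ->
  nil_mx v x s *m w = x + ('i%C * (s%:C)%C) *: v.
Proof.
move=> [_ _ vw _] /perp2C [_ xw]; rewrite nil_mx_mulv vw xw subr0 mulr1.
congr (_ + _); exact: scale1r.
Qed.

Lemma nil_mx_perp v w x s y : perp2 v w y -> nil_mx v x s *m y = (- ip x y) *: v.
Proof.
move=> [vy _]; rewrite nil_mx_mulv vy mulr0 sub0r.
by rewrite (_ : 0 *: x = 0) ?add0r //; exact: scale0r.
Qed.

Lemma nil_mx_v v w x s : null_frame v w -> perp2 v w x -> nil_mx v x s *m v = 0.
Proof.
move=> [vv _ _ _] /perp2C [xv _]; rewrite nil_mx_mulv vv xv mulr0 subr0.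
by rewrite !(_ : forall z, 0 *: z = 0) ?addr0 // => z; exact: scale0r.
Qed.

Lemma nil_mx_mul_w v w x s y t : null_frame v w -> perp2 v w x -> perp2 v w y ->
  nil_mx v x s *m (nil_mx v y t *m w) = (- ip x y) *: v.
Proof.
move=> vw xP yP; rewrite (nil_mx_w _ vw yP) mulmxDr -scalemxAr.
rewrite (nil_mx_perp x s yP) (nil_mx_v s vw xP).
by rewrite (_ : _ *: 0 = 0) ?addr0 //; exact: scaler0.
Qed.

(** Skewness makes [A] determined by [A *m w]: its component orthogonal to the frame is [x], and its
    component along [v] is imaginary, equal to i times [s]. *)
Lemma generator_nil v w A : null_frame v w -> S A ->
  A *m v = 0 -> (forall y, ip v y = 0 -> exists a, A *m y = a *: v) ->
  exists x s, perp2 v w x /\ A = nil_mx v x s.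
Proof.
move=> vw SA Av Ay; have [vv ww vw1 wv1] := vw.
pose x := perp_part v w (A *m w).
have xP : perp2 v w x := perp_partP (A *m w) vw.
have [xv xw] := perp2C xP.
have vAw : ip v (A *m w) = 0 by apply: oppr_inj; rewrite -skew // Av ip0l oppr0.
exists x, (complex.Im (ip w (A *m w))); split=> //.
have wAw : ip w (A *m w) = 'i%C * ((complex.Im (ip w (A *m w)))%:C)%C.
  have : Num.conj (ip w (A *m w)) = - ip w (A *m w) by rewrite -(ipC D_herm) skew.
  exact: imag_conj.
apply: (frame_ext (v := v) (w := w)) => // [||y [vy wy]].
- by rewrite Av nil_mx_mulv vv xv mulr0 subr0 !scale0r addr0.
- rewrite nil_mx_mulv vw1 xw subr0 mulr1 scale1r -wAw.
  by rewrite {1}(perp_partK v w (A *m w)) vAw scale0r addr0.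
- rewrite nil_mx_mulv vy scale0r add0r mulr0 sub0r.
  have [a aE] := Ay y vy; rewrite aE; congr (_ *: _).
  have : ip w (A *m y) = a by rewrite aE ipZr wv1 mulr1.
  move=> <-; apply: oppr_inj; rewrite -skew // opprK.
  by rewrite [A *m w](perp_partK v w) vAw scale0r addr0 ipDl ipZl vy mulr0 addr0.
Qed.


Definition lagrangian_in_perp v w (l : 'cV[C]_N -> Prop) :=
  (forall x, l x -> perp2 v w x) /\
  forall y, perp2 v w y -> (forall x, l x -> complex.Re (ip x y) = 0) <-> l ('i%C *: y).

Lemma hyperbolic_structure : exists v w l,
  [/\ null_frame v w, r0 = ((2^-1)%:C)%C *: v - w, lagrangian_in_perp v w l &
    forall A, S A <-> exists x s, l x /\ A = nil_mx v x s].
Proof.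
have [v' [v'0 v'v' Sv' Syv']] := null_line.
have r0v' : ip r0 v' != 0.
  apply/eqP => h; have [_ _ _ _ pos] := lf.
  by have := pos r0 v' (unitv_pos lf r01) h v'0; rewrite v'v' ltxx.
(* Normalised so that [ip r0 v = -1], which fixes both scale and phase of the null vector. *)
pose v := - (ip r0 v')^-1 *: v'.
have r0v : ip r0 v = -1 by rewrite /v ipZr mulNr mulVf.
have vr0 : ip v r0 = -1 by rewrite (ipC D_herm r0) r0v; exact: conjN1.
have vv : ip v v = 0 by rewrite /v ipZl ipZr v'v' mulr0; exact: mulr0.
have a0 : - (ip r0 v')^-1 != 0 by rewrite oppr_eq0 invr_eq0.
have Sv A : S A -> A *m v = 0 by move=> /Sv' h; rewrite /v -scalemxAr h; exact: scaler0.
have Syv A y : S A -> ip v y = 0 -> exists a, A *m y = a *: v.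
  move=> SA vy; have [|a aE] := Syv' A y SA.
    by move: vy; rewrite /v ipZl => /eqP; rewrite mulf_eq0 conjC_eq0 (negPf a0) => /eqP.
  exists (a / - (ip r0 v')^-1); rewrite aE /v scalerA mulfVK //.
have h2 : ((2^-1)%:C)%C + ((2^-1)%:C)%C = 1 :> C by rewrite -rmorphD -mulr2n -(mulr_natl 2^-1) divff ?pnatr_eq0 // rmorph1.
pose hf : C := ((2^-1)%:C)%C.
(* The other null direction of the plane spanned by [v] and [r0], scaled so that [ip v w = 1]. *)
pose w := hf *: v - r0.
have vw1 : ip v w = 1 by rewrite /w ipBr ipZr vv vr0 mulr0 sub0r opprK.
have wv1 : ip w v = 1 by rewrite (ipC D_herm v) vw1; exact: rmorph1.
have ww : ip w w = 0.
  rewrite {1}/w ipBl ipZl vw1 mulr1 conj_real /w ipBr ipZr r0v (neg_norm r01).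
  by rewrite mulrN1 opprK opprD opprK addrA h2 subrr.
have vw : null_frame v w by [].
have r0E : r0 = hf *: v - w by rewrite /w opprB addrCA subrr addr0.
pose Q x s := perp2 v w x /\ S (nil_mx v x s).
have r0x x : perp2 v w x -> ip x r0 = 0.
  by move=> xP; have [xv xw] := perp2C xP; rewrite r0E ipBr ipZr xv xw mulr0 subrr.
(* The unit vector of the plane of [v] and [r0] orthogonal to [r0]: tangent vectors at [r0] have a
   part along [u] and a part orthogonal to the frame. *)
pose u := v - r0.
have r0u : ip r0 u = 0 by rewrite /u ipBr r0v (neg_norm r01) subrr.
have vu : ip v u = 1 by rewrite /u ipBr vv vr0 sub0r opprK.
have xu x : perp2 v w x -> ip x u = 0.
  by move=> xP; have [xv _] := perp2C xP; rewrite /u ipBr xv r0x // subrr.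
have nil_r0 x s : perp2 v w x -> nil_mx v x s *m r0 = - x - ('i%C * (s%:C)%C) *: v.
  move=> xP; rewrite nil_mx_mulv vr0 r0x // subr0 scaleN1r mulrN1 scaleNr //.
(* The Lagrangian condition at [r0], in the coordinates of the frame. *)
have Qlag y : ip r0 y = 0 ->
   (forall x s, Q x s -> complex.Re (ip x y) + s * complex.Im (ip v y) = 0) <->
   exists x s, Q x s /\ y = - ('i%C *: x) + (s%:C)%C *: u.
  move=> r0y; have [L1 L2] := Slag r01 r0y.
  have ipE' x s : perp2 v w x -> complex.Re (ip (nil_mx v x s *m r0) y) =
      - (complex.Re (ip x y) + s * complex.Im (ip v y)).
    move=> xP; rewrite nil_r0 // ipBl ipNl ipZl conjM conj_i conj_real mulNr mulNr opprK.
    rewrite -mulrA ReD ReN ReMi opprD; congr (_ - _).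
    by rewrite -[LHS]opprK -ReMi mulrCA ReZ ReMi mulrN opprK.
  have JE x s : perp2 v w x -> 'i%C *: (nil_mx v x s *m r0 - (((-1)%:C)%C * ip r0 (nil_mx v x s *m r0)) *: r0) =
      - ('i%C *: x) + (s%:C)%C *: u.
    move=> xP; have r0x' : ip r0 x = 0 by exact: (ip_perpC lf (r0x _ xP)).
    rewrite nil_r0 // ipBr ipNr ipZr r0x' r0v oppr0 sub0r mulrN1 opprK.
    rewrite rmorphN rmorph1 mulN1r scaleNr opprK -addrA scalerDr scalerN; congr (_ + _).
    rewrite addrC -scalerBr scalerA mulrA ii mulN1r scaleNr -scalerN opprB.
    by congr (_ *: _).
  have SQ A : S A -> exists x s, Q x s /\ A = nil_mx v x s.
    move=> SA; have [x [s [xP AE]]] := generator_nil vw SA (Sv A SA) (fun y => Syv A y SA).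
    by exists x, s; split=> //; split=> //; rewrite -AE.
  split=> [h|[x [s [[xP Sx] yE]]]].
    have [|B [/SQ [x [s [[xP Sx] ->]]] yE]] := L1.
      by move=> A /SQ [x [s [[xP Sx] ->]]]; rewrite ipE' // h // oppr0.
    by exists x, s; split; [split|exact: (etrans yE (JE x s xP))].
  have {}L2 := L2 (ex_intro _ _ (conj Sx (eq_trans yE (esym (JE x s xP))))).
  move=> x1 s1 [x1P Sx1]; have := L2 _ Sx1; rewrite ipE' // => /eqP.
  by rewrite oppr_eq0 => /eqP.
(* Two generators commute only if [ip x y] is real; thus the vectors [x] occurring in generators
   span an isotropic space. *)
clearbody u w; clearbody v; have QC x s y t : Q x s -> Q y t -> complex.Im (ip x y) = 0.
  move=> [xP Sx] [yP Sy]; have E := congr1 (fun Z => Z *m w) (Scomm Sx Sy).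
  have /eqP : (- ip x y) *: v = (- ip y x) *: v.
    refine (etrans (esym (nil_mx_mul_w s t vw xP yP)) (etrans (mulmxA _ _ _) (etrans E _))).
    exact: (etrans (esym (mulmxA _ _ _)) (nil_mx_mul_w t s vw yP xP)).
  rewrite -subr_eq0 -scalerBl scaler_eq0.
  have -> : (v == 0) = false.
    by apply/eqP => v0; move: vw1; rewrite v0 ip0l => /esym/eqP; rewrite oner_eq0.
  rewrite orbF subr_eq0 => /eqP /oppr_inj; rewrite (ipC D_herm x).
  exact: real_Im.
have Qcoord x s x' s' : perp2 v w x -> perp2 v w x' ->
    - ('i%C *: x) + (s%:C)%C *: u = - ('i%C *: x') + (s'%:C)%C *: u -> x = x' /\ s = s'.
  have ipvE z t : perp2 v w z -> ip v (- ('i%C *: z) + (t%:C)%C *: u) = (t%:C)%C.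
    by move=> [vz _]; rewrite ipDr ipNr ipZr vz ipZr vu mulr0 oppr0 add0r mulr1.
  move=> xP x'P E; have ss' : (s%:C)%C = (s'%:C)%C :> C.
    exact: etrans (esym (ipvE x s xP)) (etrans (congr1 (ip v) E) (ipvE x' s' x'P)).
  have sE : s = s' by have := congr1 (@complex.Re R) ss'; rewrite !Re_real.
  split; last exact: sE.
  move: E; rewrite sE => /addIr /oppr_inj; apply: scalerI; exact: i_neq0.
have E0 : perp2 v w 0 by split; exact: ip0r.
(* The vector [s *: u] is orthogonal to all velocities at [r0], since [ip x u = 0] and [ip v u] is
   real. The Lagrangian condition therefore turns it into a generator, which is central: all of g_(2
   alpha) is obtained. *)
have Q0 s : Q 0 s.
  have r0y : ip r0 ((s%:C)%C *: u) = 0 by rewrite ipZr r0u mulr0.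
  have [|x' [s' [Qx' E]]] := (Qlag _ r0y).1.
    move=> x t [xP _]; rewrite !ipZr xu // vu mulr0 mulr1.
    by rewrite (_ : complex.Im _ = 0) // mulr0 addr0.
  have [|x'0 ss'] := @Qcoord 0 s x' s' E0 Qx'.1; last by rewrite x'0 ss'.
  by rewrite scaler0 oppr0 add0r.
pose l x := Q x 0.
(* Membership does not depend on [s]: the test vector -i x + t u is orthogonal to all velocities
   because products of the vectors [x] are real. *)
have Ql x s : Q x s <-> l x.
  have r0y t : perp2 v w x -> ip r0 (- ('i%C *: x) + (t%:C)%C *: u) = 0.
    by move=> xP; rewrite ipDr ipNr !ipZr r0u (ip_perpC lf (r0x _ xP)) !mulr0 oppr0 addr0.
  suff h s' t : Q x s' -> Q x t by split; exact: h.
  move=> Qx; have [xP _] := Qx.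
  have [|x' [t' [Qx' E]]] := (Qlag _ (r0y t xP)).1.
    move=> x1 s1 Qx1; have [x1P _] := Qx1.
    rewrite !ipDr !ipNr !ipZr xu // vu xP.1 mulr0 addr0 mulr0 oppr0 add0r mulr1.
    by rewrite ReN ReMi (QC _ _ _ _ Qx1 Qx) !oppr0 add0r (_ : complex.Im _ = 0) ?mulr0.
  by have [-> ->] := Qcoord _ _ _ _ xP Qx'.1 E.
exists v, w, l; split=> //.
- split=> [x [] //|y yP].
  have r0y : ip r0 y = 0 by exact: (ip_perpC lf (r0x _ yP)).
  have [L1 L2] := Qlag _ r0y; have [vy _] := yP.
  have iiy : y = - ('i%C *: ('i%C *: y)) by rewrite scalerA ii scaleN1r opprK.
  have iyP : perp2 v w ('i%C *: y) by split; rewrite ipZr ?yP.1 ?yP.2 mulr0.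
  split=> [h|ly].
    have [|x [s [Qx E]]] := L1.
      by move=> x s /Ql /h ->; rewrite vy /= mulr0 addr0.
    have [|-> _] := @Qcoord ('i%C *: y) 0 x s iyP Qx.1; last exact: (Ql x s).1.
    by rewrite -E -iiy; have -> : ((0%:C)%C : C) = 0 by []; rewrite scale0r addr0.
  move=> x lx; have := L2 _ x 0 lx; rewrite mul0r addr0; apply.
  have z0 : (0%:C)%C *: u = 0 by exact: scale0r.
  by exists ('i%C *: y), 0; split; [exact: ly | rewrite -iiy z0 addr0].
- move=> A; split=> [SA|[x [s [lx ->]]]].
    have [x [s [xP AE]]] := generator_nil vw SA (Sv A SA) (fun y => Syv A y SA).
    exists x, s; split; last exact: AE.
    by apply/(Ql x s); split; [exact: xP|rewrite -AE; exact: SA].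
  by have [] := (Ql x s).2 lx.
Qed.

End Hyperbolic.

End HyperbolicFamilies.
Import HyperbolicFamilies.

Module NilpotentExponentials.

Lemma conj_imag (R : realType) (z : R[i]) : complex.Re z = 0 -> Num.conj z = - z.
Proof.
case: z => a b /= ->; rewrite conjcE; apply/eqP.
by rewrite eq_complex /= oppr0 !eqxx.
Qed.

Lemma frame_sum (K : comNzRingType) m (P P' v w : 'cV[K]_m) (z z' h a : K) :
  P' + (z' *: v + h *: w) =
  P + (z *: v + h *: w) + (P' - P) + a *: v + (z' - z - a) *: v.
Proof. by apply/matrixP => i j; rewrite !mxE; ring. Qed.

Lemma conjc_sub (R : realType) (z : R[i]) :
  Num.conj z - z = ((-2)%:C)%C * ('i%C * ((complex.Im z)%:C)%C).
Proof.
case: z => a b; rewrite conjcE; apply/eqP; rewrite eq_complex /=.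
by apply/andP; split; apply/eqP; ring.
Qed.

Opaque real_complex_def toC ofC ip outer dag gcos gsin line_of.

(** * The unipotent group of a null frame *)

Lemma nil_exp_expand (K : comNzRingType) m (h : K) (o a b x y z : 'M[K]_m) :
  h + h = 1 -> o + (a + b) + h *: (x + y + (y + z)) =
  o + b + h *: z + (a + y) + h *: x.
Proof.
move=> hh; apply/matrixP => i j; rewrite !mxE.
rewrite -[y i j in RHS]mul1r -hh; ring.
Qed.

Lemma nil_lin_mx (K : comNzRingType) m (a j s t : K) (X Y Z W V : 'M[K]_m) :
  a *: X + Z - (a *: Y + W) + (j * (a * s + t)) *: V =
  a *: (X - Y + (j * s) *: V) + (Z - W + (j * t) *: V).
Proof. by apply/matrixP => p q; rewrite !mxE; ring. Qed.

Section NilExp.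
Context {R : realType} {N : nat}.
Local Notation C := R[i].

(** The exponential series, which stops at degree two because the generators satisfy A^3 = 0. *)
Definition nil_exp (A : 'M[C]_N) : 'M[C]_N := 1%:M + A + ((2^-1)%:C)%C *: (A *m A).

Lemma nil_exp0 : nil_exp 0 = 1%:M.
Proof. by rewrite /nil_exp mulmx0 addr0 (_ : _ *: 0 = 0) ?addr0 //; exact: scaler0. Qed.

Lemma half2 : ((2^-1)%:C)%C + ((2^-1)%:C)%C = 1 :> C.
Proof. by rewrite -rmorphD -mulr2n -(mulr_natl 2^-1) divff ?pnatr_eq0 // rmorph1. Qed.

Lemma nil_expD (A B : 'M[C]_N) : A *m B = B *m A ->
  A *m (A *m A) = 0 -> A *m (A *m B) = 0 -> A *m (B *m B) = 0 ->
  nil_exp (A + B) = nil_exp A *m nil_exp B.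
Proof.
move=> AB AAA AAB ABB; rewrite /nil_exp; set h := ((2^-1)%:C)%C.
have hh : h + h = 1 by exact: half2.
rewrite !mulmxDl !mulmxDr !mul1mx -!scalemxAr -!scalemxAl !mulmx1 -!mulmxA ABB AAB.
rewrite mulmx0 (_ : forall m, m *: 0 = 0) ?addr0; last by move=> m; exact: scaler0.
rewrite -AB (_ : forall m, m *: 0 = 0) ?addr0; last by move=> m; exact: scaler0.
exact: nil_exp_expand.
Qed.

Lemma nil_expN (A : 'M[C]_N) : A *m (A *m A) = 0 -> nil_exp (- A) *m nil_exp A = 1%:M.
Proof.
move=> AAA; rewrite -nil_expD ?addNr ?nil_exp0 //.
- by rewrite mulNmx mulmxN.
- by rewrite !(mulNmx, mulmxN) AAA !oppr0.
- by rewrite !(mulNmx, mulmxN) AAA !oppr0.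
- by rewrite mulNmx AAA oppr0.
Qed.

Lemma nil_exp_inv (A : 'M[C]_N) : A *m (A *m A) = 0 ->
  nil_exp A \in unitmx /\ invmx (nil_exp A) = nil_exp (- A).
Proof.
move=> /nil_expN h; have [u _] := mulmx1_unit h.
have uA : nil_exp A \in unitmx by have [] := mulmx1_unit h.
by split=> //; rewrite -[RHS]mulmx1 -(mulmxV uA) mulmxA h mul1mx.
Qed.

End NilExp.

Section Frame.
Context {R : realType} {n : nat}.
Local Notation C := R[i].
Local Notation N := n.+1.
Variables (D : 'M[C]_N) (v w : 'cV[C]_N).
Hypotheses (D_herm : D^t* = D) (D_inv : D *m D = 1%:M).
Hypothesis vw : [/\ ip D v v = 0, ip D w w = 0, ip D v w = 1 & ip D w v = 1].
Local Notation dag := (dag D).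
Local Notation ip := (ip D).
Local Notation outer := (outer D).
Implicit Types (x y : 'cV[C]_N) (s t : R).

Let ipperp x y : ip x y = 0 -> ip y x = 0.
Proof. by move=> h; rewrite (ipC D_herm x) h; exact: rmorph0. Qed.

Lemma nil_exp_mul (A : 'M[C]_N) y :
  nil_exp A *m y = y + A *m y + ((2^-1)%:C)%C *: ((A *m A) *m y).
Proof. by rewrite /nil_exp !mulmxDl mul1mx -scalemxAl. Qed.

Lemma dag_nil_exp (A : 'M[C]_N) : dag (nil_exp A) = nil_exp (dag A).
Proof. by rewrite /nil_exp dagD dagD dagZ (dagM D_inv) (dag1 D_inv) conj_real. Qed.

Lemma nil_mx_dag x s : dag (nil_mx D v x s) = - nil_mx D v x s.
Proof.
rewrite /nil_mx dagD dagB dagZ !(dag_outer D_herm D_inv) conjM conj_i conj_real.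
by rewrite opprD opprB mulNr scaleNr.
Qed.

Lemma nil_mx_lin (a : R) x y s t :
  nil_mx D v ((a%:C)%C *: x + y) (a * s + t) =
  (a%:C)%C *: nil_mx D v x s + nil_mx D v y t.
Proof.
rewrite /nil_mx outerDl outerDr outerZl outerZr conj_real rmorphD rmorphM /=.
move: (outer x v) (outer v x) (outer y v) (outer v y) (outer v v) => X Y Z W V.
exact: nil_lin_mx.
Qed.

(** Products of two such matrices are multiples of [outer v v], which a third one kills; two of them
    commute exactly when [ip x y] is real. *)
Lemma nil_mxM x y s t : perp2 D v w x -> perp2 D v w y ->
  nil_mx D v x s *m nil_mx D v y t = (- ip x y) *: outer v v.
Proof.
move=> [vx wx] [vy wy]; have [vv ww vw1 wv1] := vw.
have xv := ipperp vx.
have nilv : nil_mx D v x s *m v = 0.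
  rewrite nil_mx_mulv vv xv mulr0 subr0.
  by rewrite !(_ : forall z, 0 *: z = 0) ?addr0 // => z; exact: scale0r.
have nily : nil_mx D v x s *m y = (- ip x y) *: v.
  rewrite nil_mx_mulv vy mulr0 sub0r.
  by rewrite (_ : 0 *: x = 0) ?add0r //; exact: scale0r.
rewrite {2}/nil_mx mulmxDr mulmxBr -scalemxAr !mul_outer nilv nily.
rewrite !outer0l subr0 outerZl (_ : _ *: 0 = 0) ?addr0 //; exact: scaler0.
Qed.

Lemma nil_mx3 x y z s t r : perp2 D v w x -> perp2 D v w y -> perp2 D v w z ->
  nil_mx D v x s *m (nil_mx D v y t *m nil_mx D v z r) = 0.
Proof.
move=> xP yP zP; have [vx _] := xP; have [vv _ _ _] := vw.
have xv := ipperp vx.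
rewrite (nil_mxM _ _ yP zP) -scalemxAr mul_outer.
have -> : nil_mx D v x s *m v = 0.
  rewrite nil_mx_mulv vv xv mulr0 subr0.
  by rewrite !(_ : forall z, 0 *: z = 0) ?addr0 // => u; exact: scale0r.
by rewrite outer0l; exact: scaler0.
Qed.

Lemma nil_exp_mulv x s y : perp2 D v w x -> nil_exp (nil_mx D v x s) *m y =
  y + ip v y *: x + ('i%C * (s%:C)%C * ip v y - ip x y -
    ((2^-1)%:C)%C * (ip x x * ip v y)) *: v.
Proof.
move=> xP; rewrite nil_exp_mul (nil_mxM _ _ xP xP).
rewrite nil_mx_mulv -scalemxAl outer_mulv !scalerA mulrN mulNr scaleNr -!mulrA.
by rewrite [in RHS]scalerBl !addrA.
Qed.

Lemma nil_exp_center_mulv s y :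
  nil_exp (nil_mx D v 0 s) *m y = y + ('i%C * (s%:C)%C * ip v y) *: v.
Proof.
have zP : perp2 D v w 0 by split; exact: ip0r.
rewrite (nil_exp_mulv s y zP) !ip0l mul0r mulr0 !subr0.
by rewrite (_ : ip v y *: 0 = 0) ?addr0 //; exact: scaler0.
Qed.

Lemma nil_exp_dag x s : dag (nil_exp (nil_mx D v x s)) = nil_exp (- nil_mx D v x s).
Proof.
by rewrite dag_nil_exp nil_mx_dag.
Qed.

Lemma nil_exp_group x y s t : perp2 D v w x -> perp2 D v w y ->
  nil_mx D v x s *m nil_mx D v y t = nil_mx D v y t *m nil_mx D v x s ->
  nil_exp (nil_mx D v x s + nil_mx D v y t) =
  nil_exp (nil_mx D v x s) *m nil_exp (nil_mx D v y t).
Proof.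
move=> xP yP xy; exact: (nil_expD xy (nil_mx3 s s s xP xP xP)
  (nil_mx3 s s t xP xP yP) (nil_mx3 s t t xP yP yP)).
Qed.

End Frame.

Opaque nil_exp nil_mx.

Section Orbits.
Context {R : realType} {n : nat}.
Local Notation C := R[i].
Local Notation N := n.+1.
Variables (D : 'M[C]_N) (c : R).
Hypothesis lf : line_form D (-1) c.
Let D_herm : D^t* = D. Proof. by case: lf. Qed.
Let D_inv : D *m D = 1%:M. Proof. by case: lf. Qed.
Local Notation dag := (dag D).
Local Notation ip := (ip D).
Local Notation outer := (outer D).
Local Notation unitv := (unitv D (-1)).
Local Notation proj := (proj D (-1)).
Local Notation M := (line_space D c).
Implicit Types (A B X Y Z : 'M[C]_N) (r x y e : 'cV[C]_N).

Lemma conj_proj g r : dag g *m g = 1%:M -> g *m proj r *m invmx g = proj (g *m r).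
Proof.
move=> gg; have gu : g \in unitmx by have [] := mulmx1_unit gg.
have -> : invmx g = dag g by rewrite -[RHS]mulmx1 -(mulmxV gu) mulmxA gg mul1mx.
rewrite /LineSpaces.proj -scalemxAr -scalemxAl mul_outer (outer_mul D_herm D_inv).
by rewrite (dagK D_herm D_inv).
Qed.

Lemma unitv_mul g r : dag g *m g = 1%:M -> unitv r -> unitv (g *m r).
Proof.
move=> gg r1; rewrite /LineSpaces.unitv (ip_dagl D_herm D_inv) mulmxA gg mul1mx; exact: r1.
Qed.

Lemma mx_act_pts g (P : cmat R N N) : dag g *m g = 1%:M -> pts (k := M) P ->
  pts (k := M) (mx_act g P).
Proof.
move=> gg /(ptsE lf) [r [r1 PE]]; apply/(ptsE lf); exists (g *m r).
split; first exact: unitv_mul gg r1.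
exact: (etrans (ofCK _) (etrans (congr1 (fun Q => g *m Q *m invmx g) PE) (conj_proj _ gg))).
Qed.

Lemma mx_actM g h (P : cmat R N N) : g \in unitmx -> h \in unitmx ->
  mx_act (g *m h) P = mx_act g (mx_act h P).
Proof.
by move=> gu hu; rewrite /mx_act ofCK (_ : invmx (g *m h) = invmx h *m invmx g) ?mulmxA //; exact: invrM.
Qed.

Lemma mx_act1 (P : cmat R N N) : mx_act 1%:M P = P.
Proof. by rewrite /mx_act invmx1 mul1mx mulmx1 toCK. Qed.

Variables v w : 'cV[C]_N.
Hypothesis vw : null_frame D v w.
Variable r0 : 'cV[C]_N.
Hypothesis r01 : unitv r0.

Lemma frame_v_neq0 : v != 0.
Proof.
have [_ _ vw1 _] := vw.
by apply: contraTneq isT => v0; move: vw1; rewrite v0 ip0l => /esym/eqP; rewrite oner_eq0.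
Qed.

Lemma unitv_ip_null r : unitv r -> ip v r != 0.
Proof.
move=> r1; apply/eqP => h; have [_ _ _ _ pos] := lf; have [vv _ _ _] := vw.
have := pos r v (unitv_pos lf r1) (ip_perpC lf h) frame_v_neq0.
by rewrite vv ltxx.
Qed.

(** The phase of the representative is fixed by [ip v r1 > 0]; the number [h] labels the horosphere
    centred at the null line of [v] that contains the point. *)
Lemma positive_rep r : unitv r -> exists r1 (h : R),
  [/\ unitv r1, proj r1 = proj r, 0 < h, ip v r1 = (h%:C)%C & h ^+ 2 = normsq (ip v r)].
Proof.
move=> r1; have [u [u1 [h [h0 uh]]]] := phase (ip v r).
have nh : h ^+ 2 = normsq (ip v r).
  rewrite -[RHS]mul1r -u1 -normsqM uh -[((h%:C)%C : C)]mulr1 normsqZ /normsq rmorph1.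
  by rewrite mulr1 /= mulr1.
exists (u *: r), h; split; last exact: nh.
- exact: unitvZ u1 r1.
- exact: projZ u1.
- rewrite lt_def h0 andbT; apply: contraNneq (unitv_ip_null r1) => hz.
  by apply/eqP/normsq_eq0; rewrite -nh hz expr0n.
- by rewrite ipZr.
Qed.

Lemma nil_exp_unitary x s : perp2 D v w x ->
  dag (nil_exp (nil_mx D v x s)) *m nil_exp (nil_mx D v x s) = 1%:M.
Proof.
move=> xP; rewrite (nil_exp_dag v D_herm D_inv).
by apply: nil_expN; exact: (nil_mx3 D_herm vw).
Qed.

Lemma ReMNi (z : C) : complex.Re (- 'i%C * z) = complex.Im z.
Proof. by rewrite mulNr ReN ReMi opprK. Qed.

Lemma lagrangian_in_perpE (l : 'cV[C]_N -> Prop) y : lagrangian_in_perp D v w l ->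
  perp2 D v w y -> (forall x, l x -> complex.Im (ip x y) = 0) <-> l y.
Proof.
move=> [lP lL] [vy wy].
have ii0 : y = 'i%C *: (- 'i%C *: y).
  by rewrite scalerA mulrN ii opprK; apply/esym; exact: scale1r.
have yP : perp2 D v w (- 'i%C *: y) by split; rewrite ipZr ?vy ?wy mulr0.
have := lL _ yP; rewrite -ii0 => <-.
by split=> h x lx; have := h x lx; rewrite ipZr ReMNi.
Qed.

Lemma lagrangian_lin (l : 'cV[C]_N -> Prop) : lagrangian_in_perp D v w l ->
  l 0 /\ forall (a : R) x y, l x -> l y -> l ((a%:C)%C *: x + y).
Proof.
move=> lL; have [lP _] := lL; split.
  apply/(lagrangian_in_perpE lL); first by split; exact: ip0r.
  by move=> x lx; rewrite ip0r.
move=> a x y lx ly; have [vx wx] := lP _ lx; have [vy wy] := lP _ ly.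
apply/(lagrangian_in_perpE lL).
  by split; rewrite ipDr ipZr ?vx ?wx ?vy ?wy mulr0 addr0.
move=> z lz; rewrite -ReMNi ipDr ipZr mulrDr ReD mulrCA ReZ !ReMNi.
rewrite ((lagrangian_in_perpE lL (conj vx wx)).2 lx z lz).
by rewrite ((lagrangian_in_perpE lL (conj vy wy)).2 ly z lz) mulr0 addr0.
Qed.

Lemma conj_sub_imag (z : C) : Num.conj z - z = ((-2)%:C)%C * ('i%C * ((complex.Im z)%:C)%C).
Proof. exact: conjc_sub. Qed.

Lemma tr_nil_proj x s r (h : R) : unitv r -> ip v r = (h%:C)%C ->
  \tr (nil_mx D v x s *m proj r) =
  'i%C * ((2 * h * complex.Im (ip x r) - s * h ^+ 2)%:C)%C.
Proof.
move=> r1 vr; rewrite tr_proj_mul nil_mx_mulv vr ipDr !ipZr (ipC D_herm v) vr conj_real.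
rewrite (ipC D_herm x r).
move: (ip x r) => z.
have -> : ((-1)%:C)%C * ((h%:C)%C * Num.conj z + ('i%C * (s%:C)%C * (h%:C)%C - z) * (h%:C)%C)
  = (- h%:C)%C * (Num.conj z - z) - 'i%C * ((s * h ^+ 2)%:C)%C.
  by rewrite rmorphN1 rmorphM rmorphXn /=; ring.
rewrite conj_sub_imag rmorphB !rmorphM rmorphN /= rmorph_nat; ring.
Qed.

(* The moment map of the nilpotent group separates its orbits. *)
Lemma moment_separates (l : 'cV[C]_N -> Prop) r r' :
  lagrangian_in_perp D v w l -> unitv r -> unitv r' ->
  (forall x s, l x -> \tr (nil_mx D v x s *m proj r') = \tr (nil_mx D v x s *m proj r)) ->
  exists x s, l x /\ proj r' =
    nil_exp (nil_mx D v x s) *m proj r *m invmx (nil_exp (nil_mx D v x s)).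
Proof.
move=> lL r1 r'1; have [lP lL2] := lL; have [l0 llin] := lagrangian_lin lL.
have [p [h [p1 <- h0 vp hn]]] := positive_rep r1.
have [p' [h' [p'1 <- h'0 vp' h'n]]] := positive_rep r'1 => mom.
have vv : ip v v = 0 by case: vw.
have iinj (a b : R) : 'i%C * (a%:C)%C = 'i%C * (b%:C)%C :> C -> a = b.
  by move=> /(mulfI i_neq0) /(congr1 (@complex.Re R)); rewrite !Re_real.
have mom' x s (lx : l x) := iinj _ _ (etrans (esym (tr_nil_proj x s p'1 vp'))
  (etrans (mom x s lx) (tr_nil_proj x s p1 vp))).
(* The moments of the central generators give [h ^+ 2], so both points lie on the same
   horosphere. *)
have hh : h' = h.
  have := mom' 0 1 l0; rewrite !ip0l; rewrite (_ : complex.Im 0 = 0) // !mulr0 !sub0r !mul1r => /oppr_inj.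
  by move/eqP; rewrite eqrXn2 ?ltW // => /eqP.
rewrite hh in vp' mom' => {h' h'0 h'n hh}.
have momI x : l x -> complex.Im (ip x p') = complex.Im (ip x p).
  by move=> lx; have := mom' x 0 lx; rewrite !mul0r !subr0; apply: mulfI; rewrite mulf_neq0 ?pnatr_eq0 // gt_eqF.
have hC0 : (h%:C)%C != 0 :> C by apply: realC_neq0; rewrite gt_eqF.
(* The moments of the vectors of [l] say that [d] has real products with [l]; being Lagrangian, [l]
   contains [d]. *)
pose d := perp_part D v w p' - perp_part D v w p.
have [vp1 wp1] := perp_partP p vw; have [vp2 wp2] := perp_partP p' vw.
have dP : perp2 D v w d.
  split; refine (etrans (ipBr _ _ _ _) _); first by rewrite vp1 vp2 subrr.
  by rewrite wp1 wp2 subrr.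
have ld : l d.
  apply/(lagrangian_in_perpE lL) => // x lx.
  have [xv xw] := perp2C lf (lP _ lx).
  have E y : ip x (perp_part D v w y) = ip x y.
    rewrite /perp_part ipBr ipDr !ipZr xv xw; move: (ip v y) (ip w y) => a b.
    by rewrite !mulr0 addr0 subr0.
  by rewrite /d ipBr !E -ReMNi mulrBr ReB !ReMNi momI // subrr.
(* The exponential of [nil_mx D v x0 0] shifts the component orthogonal to the frame by h x0 = d,
   bringing it to that of [p']. *)
pose x0 := ((h^-1)%:C)%C *: d.
have lx0 : l x0 by have := llin h^-1 _ _ ld l0; rewrite addr0.
have x0P := lP _ lx0; have [vx0 _] := x0P.
have hx0 : (h%:C)%C *: x0 = d.
  by rewrite /x0 scalerA -rmorphM mulfV ?gt_eqF //; exact: scale1r.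
clearbody x0.
pose q := nil_exp (nil_mx D v x0 0) *m p.
have q1 : unitv q by apply: unitv_mul p1; exact: nil_exp_unitary.
have qq : nil_exp (nil_mx D v x0 0) *m p = q by [].
pose a : C := 'i%C * (0%:C)%C * ip v p - ip x0 p - ((2^-1)%:C)%C * (ip x0 x0 * ip v p).
have qd : q = p + d + a *: v.
  by rewrite -hx0 -vp; exact: (nil_exp_mulv D_herm vw _ _ x0P).
clearbody a q.
(* Only the component along [v] may still differ; as both vectors have square -1, the coefficient
   [kap] is imaginary. *)
have [kap qE] : exists kap, p' = q + kap *: v.
  exists (ip w p' - ip w p - a).
  have pE := perp_partK D v w p; have p'E := perp_partK D v w p'.
  rewrite vp in pE; rewrite vp' in p'E; rewrite qd /d.
  move: (perp_part D v w p) (perp_part D v w p') pE p'E => P P' pE p'E.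
  rewrite [LHS]p'E [X in X + (P' - P)]pE.
  exact: frame_sum.
have vq : ip v q = (h%:C)%C.
  have := vp'; rewrite qE ipDr ipZr vv mulr0 addr0; exact.
have qv : ip q v = (h%:C)%C by rewrite (ipC D_herm v) vq conj_real.
have kap0 : complex.Re kap = 0.
  have := neg_norm p'1; rewrite qE ipDl !ipDr !ipZl !ipZr vv vq qv (neg_norm q1).
  rewrite mulr0 mulr0 addr0 -addrA -[RHS]addr0 => /addrI.
  rewrite -mulrDl addc_conj => /eqP; rewrite mulf_eq0 (negPf hC0) orbF => /eqP.
  move=> /(congr1 (@complex.Re R)); rewrite Re_real => /eqP.
  by rewrite mulf_eq0 pnatr_eq0 => /eqP.
have kapE : kap = 'i%C * ((complex.Im kap)%:C)%C.
  by apply: imag_conj; exact: conj_imag.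
(* A central element with parameter [s] adds i s h v, so this value supplies [kap *: v]. *)
have [s sE] : exists s, s = complex.Im kap / h by exists (complex.Im kap / h).
have zP : perp2 D v w 0 by split; exact: ip0r.
exists x0, s; split; first exact: lx0.
rewrite (conj_proj _ (nil_exp_unitary s x0P)); congr (LineSpaces.proj D (-1) _).
have -> : nil_mx D v x0 s = nil_mx D v 0 s + nil_mx D v x0 0.
  have := nil_mx_lin D v 1 0 x0 s 0; rewrite mul1r addr0.
  rewrite (_ : (1%:C)%C = 1 :> C) // !scale1r add0r; exact.
rewrite (nil_exp_group D_herm vw zP x0P); last first.
  by rewrite (nil_mxM D_herm vw _ _ zP x0P) (nil_mxM D_herm vw _ _ x0P zP) ip0l ip0r.
have E1 := mulmxA (nil_exp (nil_mx D v 0 s)) (nil_exp (nil_mx D v x0 0)) p.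
have E2 := congr1 (mulmx (nil_exp (nil_mx D v 0 s))) qq.
have E3 := nil_exp_center_mulv D_herm vw s q.
refine (etrans _ E1).
refine (etrans _ (esym E2)).
refine (etrans _ (esym E3)).
rewrite qE kapE vq sE; congr (_ + _ *: _).
by rewrite -mulrA -rmorphM mulfVK // gt_eqF.
Qed.

End Orbits.

End NilpotentExponentials.
Import NilpotentExponentials.

(** * Equality of the orbits of the group and of the nilpotent group *)

Module HyperbolicOrbits.

Lemma perp_part_lin (K : comNzRingType) m (a b d e f : K) (y z v w : 'cV[K]_m) :
  a *: y + z - ((a * b + d) *: v + (a * e + f) *: w) =
  a *: (y - (b *: v + e *: w)) + (z - (d *: v + f *: w)).
Proof. by apply/matrixP => i j; rewrite !mxE; ring. Qed.

Lemma im_combo (K : comNzRingType) (a h p q r s : K) :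
  (a * p + q + (a * r + s)) * h = a * ((p + r) * h) + (q + s) * h.
Proof. ring. Qed.

Section Im.
Variable R : realType.
Implicit Types x y : R[i].
Lemma ImD x y : complex.Im (x + y) = complex.Im x + complex.Im y.
Proof. by case: x y => ? ? [? ?]. Qed.
Lemma ImN x : complex.Im (- x) = - complex.Im x.
Proof. by case: x. Qed.
Lemma ImZ (a : R) x : complex.Im ((a%:C)%C * x) = a * complex.Im x.
Proof. by case: x => ? ? /=; rewrite mul0r addr0. Qed.
Lemma Im_real (a : R) : complex.Im (a%:C)%C = 0.
Proof. by []. Qed.
Lemma Im_i_real (a : R) : complex.Im ('i%C * (a%:C)%C) = a.
Proof. by rewrite /= mul0r mul1r add0r. Qed.
End Im.

Opaque real_complex_def toC ofC ip outer dag gcos gsin line_of nil_exp nil_mx.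

Section HyperbolicOrbits.
Context {R : realType} {n : nat}.
Local Notation C := R[i].
Local Notation N := n.+1.
Variables (D : 'M[C]_N) (c : R).
Hypothesis lf : line_form D (-1) c.
Let D_herm : D^t* = D. Proof. by case: lf. Qed.
Let D_inv : D *m D = 1%:M. Proof. by case: lf. Qed.
Local Notation dag := (dag D).
Local Notation ip := (ip D).
Local Notation outer := (outer D).
Local Notation unitv := (unitv D (-1)).
Local Notation proj := (proj D (-1)).
Local Notation M := (line_space D c).
Local Notation cN := (coordinates_cmat N N).
Implicit Types (A B X Y Z : 'M[C]_N) (r x y e : 'cV[C]_N).
Variables (v w r0 : 'cV[C]_N) (l : 'cV[C]_N -> Prop).
Hypothesis vw : null_frame D v w.
Hypothesis r01 : unitv r0.
Hypothesis lL : lagrangian_in_perp D v w l.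
Variables (G : lie_group R) (act : 'rV[R]_(lg_amb G) -> cmat R N N -> cmat R N N).
Hypothesis actP : action_by_holomorphic_isometries (M := M) act.
Hypothesis act_lagrangian : forall P : cmat R N N, pts (k := M) P ->
  lagrangian_in (metric (k := M) P) (cstr (k := M) P) (tangent (@pts R M) P)
    (orbit_tangent (M := M) act P).
Hypothesis Gc : connected (@lg_set R G).
Local Notation S := (generator D c act).
Hypothesis SE : forall A, S A <-> exists x s, l x /\ A = nil_mx D v x s.

Let lP x : l x -> perp2 D v w x. Proof. by case: lL => h _; exact: h. Qed.

Lemma nil_generator3 A : S A -> A *m (A *m A) = 0.
Proof.
move=> /SE [x [s [lx ->]]]; exact: (nil_mx3 D_herm vw s s s (lP lx) (lP lx) (lP lx)).
Qed.

Lemma nil_generator_unitary A : S A -> dag (nil_exp A) *m nil_exp A = 1%:M.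
Proof.
move=> /SE [x [s [lx ->]]]; exact: (nil_exp_unitary lf vw s (lP lx)).
Qed.

Lemma generator_lin (a : R) A B : S A -> S B -> S ((a%:C)%C *: A + B).
Proof.
move=> /SE [x [s [lx ->]]] /SE [y [t [ly ->]]]; apply/SE.
exists ((a%:C)%C *: x + y), (a * s + t); split; last exact/esym/nil_mx_lin.
exact: (lagrangian_lin lL).2.
Qed.

Lemma generator_0 : S 0.
Proof.
apply/SE; exists 0, 0; split; first exact: (lagrangian_lin lL).1.
have := nil_mx_lin D v (-1) 0 0 0 0; rewrite rmorphN1 !scaleN1r oppr0 !addr0 mulr0 addNr.
by move=> <-.
Qed.

Lemma nil_generatorD A B : S A -> S B -> nil_exp (A + B) = nil_exp A *m nil_exp B.
Proof.
move=> SA SB; have AB := generator_comm lf r01 actP act_lagrangian SA SB.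
move: SA SB AB => /SE [x [s [lx ->]]] /SE [y [t [ly ->]]] AB.
exact: (nil_exp_group D_herm vw (lP lx) (lP ly) AB).
Qed.

Lemma generator_null A : S A -> A *m v = 0.
Proof. by move=> /SE [x [s [lx ->]]]; exact: (nil_mx_v lf s vw (lP lx)). Qed.

Lemma nil_exp_fix A y : A *m y = 0 -> nil_exp A *m y = y.
Proof.
by move=> Ay; rewrite nil_exp_mul -mulmxA Ay mulmx0 addr0 scaler0 addr0.
Qed.

Lemma act_in_nil_orbit g (p : cmat R N N) : lg_set g -> pts (k := M) p ->
  exists A, S A /\ act g p = mx_act (nil_exp A) p.
Proof.
move=> Gx Mp; have /(ptsE lf) [r [r1 pE]] := Mp.
have /(ptsE lf) [r' [r'1 p'E]] := act_pts_line actP Gx Mp.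
have [|y [s [ly E]]] := moment_separates lf vw lL r1 r'1.
  move=> y s ly; rewrite -pE -p'E.
  apply: (generator_moment lf r01 actP act_lagrangian Gc) => //.
  by apply/SE; exists y, s.
exists (nil_mx D v y s); split; first by apply/SE; exists y, s.
by apply: toC_inj; rewrite /mx_act ofCK p'E E pE.
Qed.

(** The extension of [act g] is multiplicative and fixes [A], hence fixes its exponential and the
    inverse of it. *)
Lemma act_nil_comm g (q : cmat R N N) A : lg_set g -> pts (k := M) q -> S A ->
  act g (mx_act (nil_exp A) q) = mx_act (nil_exp A) (act g q).
Proof.
move=> Gx Mq SA; have [F [Fext FM Fdag]] := act_extension lf r01 actP Gx.
have [Fl FP Ftr] := Fext; have gu := nil_generator_unitary SA.
have FA := generator_fixed lf r01 actP act_lagrangian Gc SA Gx Fext.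
have [_ invE] := nil_exp_inv (nil_generator3 SA).
have F1 : F 1%:M = 1%:M.
  have [f' fi] := act_isometry actP Gx.
  apply/eqP; rewrite -subr_eq0; apply/eqP; apply: (tr_ext lf r01) => Q MQ.
  have [MP E] := hi_inv fi MQ.
  rewrite mulmxBl raddfB /= -E -(FP _ MP) Ftr !mul1mx (FP _ MP) E.
  by rewrite (tr_pts lf MP) (tr_pts lf MQ) subrr.
have FE B : F B = B -> F (nil_exp B) = nil_exp B.
  Transparent nil_exp.
  move=> FB; have FBB : F (B *m B) = B *m B by rewrite FM FB.
  rewrite /nil_exp; move: (B *m B) FBB => BB FBB.
  Opaque nil_exp.
  by rewrite addrC Fl FBB linear_add // F1 FB.
have FN : F (- A) = - A.
  by have := linear_scale (-1) A Fl; rewrite !scaleN1r FA.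
apply: toC_inj; refine (etrans (esym (FP _ (mx_act_pts lf gu Mq))) _).
refine (etrans (congr1 F (ofCK _)) (etrans _ (esym (ofCK _)))); rewrite -(FP _ Mq).
by rewrite !FM invE (FE _ FA) (FE _ FN).
Qed.


Lemma generator_vspace : exists U : {vspace cmat R N N},
  forall X : cmat R N N, X \in U <-> S (toC X).
Proof.
apply: vspace_of_pred => [|a X Y SX SY]; first by rewrite toC0; exact: generator_0.
by rewrite toCD toCZ; exact: generator_lin.
Qed.

(* Recovers [A] from [nil_exp A *m r - r] (and from [A *m r]), as a real linear
   function; [h = ip v r]. *)
Definition nil_log r (h : R) y : 'M[C]_N :=
  let x := ((h^-1)%:C)%C *: perp_part D v w y in
  nil_mx D v x ((complex.Im (ip w y) + complex.Im (ip x r)) / h).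

Lemma nil_log_linear r h (a : R) y z :
  nil_log r h ((a%:C)%C *: y + z) = (a%:C)%C *: nil_log r h y + nil_log r h z.
Proof.
rewrite /nil_log /= -nil_mx_lin.
have -> : perp_part D v w ((a%:C)%C *: y + z) =
    (a%:C)%C *: perp_part D v w y + perp_part D v w z.
  rewrite /perp_part !ipDr !ipZr.
  move: (ip w y) (ip w z) (ip v y) (ip v z) => b d e f.
  exact: perp_part_lin.
set Y := perp_part D v w y; set Z := perp_part D v w z.
rewrite scalerDr scale_swap; congr (nil_mx _ _ _ _).
move: (((h^-1)%:C)%C *: Y) (((h^-1)%:C)%C *: Z) => X W; rewrite ipDr ipZr ipDl ipZl conj_real !ImD !ImZ.
exact: im_combo.
Qed.

(** Only the imaginary part of the coefficient of [v] is read, so a real summand [b] is invisible.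
    With b = h ip x x / 2 this is the quadratic term of the exponential, and with b = 0 the case of
    [A *m r]. *)
Lemma nil_log_combo r h x s (b : R) : ip v r = (h%:C)%C -> 0 < h -> perp2 D v w x ->
  nil_log r h ((h%:C)%C *: x + ('i%C * (s%:C)%C * (h%:C)%C - ip x r - (b%:C)%C) *: v) =
  nil_mx D v x s.
Proof.
move=> vr h0 xP; have [vx wx] := xP; have [vv _ vw1 wv1] := vw.
rewrite /nil_log /=; set k := (_ - _ - _ : C).
have -> : perp_part D v w ((h%:C)%C *: x + k *: v) = (h%:C)%C *: x.
  rewrite /perp_part !ipDr !ipZr vx wx vv wv1 !mulr0 addr0 add0r mulr1.
  by rewrite (_ : 0 *: w = 0) ?addr0 ?addrK //; exact: scale0r.
rewrite ipDr !ipZr wx wv1 mulr0 add0r mulr1.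
have -> : ((h^-1)%:C)%C *: ((h%:C)%C *: x) = x.
  by rewrite scalerA -rmorphM mulVf ?gt_eqF //; exact: scale1r.
congr (nil_mx _ _ _ _); rewrite /k -!addrA !ImD !ImN Im_real -mulrA -rmorphM Im_i_real.
by rewrite oppr0 addr0 subrK mulfK // gt_eqF.
Qed.

Lemma nil_exp_log r h A : ip v r = (h%:C)%C -> 0 < h -> S A ->
  nil_log r h (nil_exp A *m r - r) = A /\ nil_log r h (A *m r) = A.
Proof.
move=> vr h0 /SE [x [s [lx ->]]]; have xP := lP lx.
have e1 := nil_exp_mulv D_herm vw s r xP; have e2 := nil_mx_mulv D v x s r.
rewrite vr in e1 e2; split.
  refine (etrans (congr1 (fun y => nil_log r h (y - r)) e1) _).
  rewrite -[r + _ + _]addrA [r + _]addrC addrK.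
  rewrite (ip_real D_herm x) -!rmorphM; exact: nil_log_combo.
refine (etrans (congr1 (nil_log r h) e2) _).
have := nil_log_combo s 0 vr h0 xP.
have z0 : (0%:C)%C = 0 :> C by exact: rmorph0.
by rewrite z0 subr0.
Qed.

(** In coordinates on the space of generators, the parameters [x] for which exp(x) p lies in the
    orbit are stable under addition, since both actions commute. A group curve with velocity a basis
    vector yields, through the logarithm, a smooth curve of such parameters with the same velocity;
    a contraction argument then fills the space. *)
Lemma nil_orbit_in_act A (p : cmat R N N) : S A -> pts (k := M) p ->
  exists2 g, lg_set g & act g p = mx_act (nil_exp A) p.
Proof.
move=> SA Mp; have [U UE] := generator_vspace.
pose d := \dim U; pose b := vbasis U.
have bU (i : 'I_d) : S (toC b`_i) by apply/UE/vbasis_mem/mem_nth; rewrite size_tuple.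
have clin (j : 'I_d) (a : R) (X Z : cmat R N N) :
    coord b j (a *: X + Z) = a * coord b j X + coord b j Z by rewrite linearP.
pose comb (x : 'rV[R]_d) : cmat R N N := \sum_i x 0 i *: b`_i.
have combU (x : 'rV[R]_d) : comb x \in U.
  by apply: memv_suml => i _; apply/memvZ/vbasis_mem/mem_nth; rewrite size_tuple.
have Scomb (x : 'rV[R]_d) : S (toC (comb x)) by apply/UE.
have combD (x y : 'rV[R]_d) : comb (x + y) = comb x + comb y.
  by rewrite /comb -big_split; apply: eq_bigr => i _; rewrite mxE scalerDl.
have combK (X : cmat R N N) : X \in U -> comb (\row_i coord b i X) = X.
  move=> XU; rewrite [RHS](coord_vbasis XU); apply: eq_bigr => i _.
  by rewrite mxE.
have comb0 : comb 0 = 0 by rewrite /comb big1 // => i _; rewrite mxE scale0r.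
clearbody comb.
pose H : set 'rV[R]_d := [set x | exists2 g, lg_set g &
  act g p = mx_act (nil_exp (toC (comb x))) p].
suff : H (\row_i coord b i (ofC A)).
  move=> [g Gg]; rewrite combK ?ofCK; first by exists g.
  by apply/UE; rewrite ofCK.
apply: additive_subgroup_full.
- exists (lg_one G); first exact: lg_one_in.
  by rewrite comb0 toC0 nil_exp0 mx_act1 (act_one actP).
- move=> x y [g Gg gE] [h Gh hE]; exists (lg_mul h g); first exact: lg_mul_in.
  have Sx := Scomb x; have Sy := Scomb y.
  have ux := (nil_exp_inv (nil_generator3 Sx)).1.
  have uy := (nil_exp_inv (nil_generator3 Sy)).1.
  refine (etrans (act_mul actP Gh Gg Mp) _).
  refine (etrans (congr1 (act h) gE) _).
  refine (etrans (act_nil_comm Gh Mp Sx) _).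
  refine (etrans (congr1 (mx_act _) hE) _).
  refine (etrans (esym (mx_actM p ux uy)) _).
  have E : toC (comb x) + toC (comb y) = toC (comb (x + y)).
    exact: etrans (esym (toCD _ _)) (congr1 (@toC R N N) (esym (combD x y))).
  have E2 := etrans (esym (nil_generatorD Sx Sy)) (congr1 nil_exp E).
  exact: (congr1 (fun g => mx_act g p) E2).
move=> i; have [_ _ [gam [Gg gd]]] := bU i.
have /(ptsE lf) [r' [r'1 pE']] := Mp.
have [r [h [r1 rr' h0 vr _]]] := positive_rep lf vw r'1.
have pE : toC p = proj r by rewrite rr'.
have hC0 : (h%:C)%C != 0 :> C by apply: realC_neq0; rewrite gt_eqF.
(* [Y Q = nil_exp A *m r] when [Q = mx_act (nil_exp A) p]. *)
pose Y (Q : cmat R N N) : 'cV[C]_N := (- ((h^-1)%:C)%C) *: (toC Q *m v).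
have Yprojv : (- ((h^-1)%:C)%C) *: (proj r *m v) = r.
  rewrite proj_mulv (ipC D_herm v) vr conj_real scalerA rmorphN1 mulN1r mulrNN.
  by rewrite -(rmorphM (real_complex R)) mulVf ?gt_eqF //; exact: scale1r.
have Yp : Y p = r by rewrite /Y pE.
have Yact B : S B -> Y (mx_act (nil_exp B) p) = nil_exp B *m r.
  move=> SB; rewrite /Y /mx_act ofCK pE (nil_exp_inv (nil_generator3 SB)).2.
  have Bv : nil_exp (- B) *m v = v.
    by apply: nil_exp_fix; rewrite mulNmx (generator_null SB) oppr0.
  rewrite -(mulmxA _ (nil_exp (- B)) v) Bv -(mulmxA _ (proj r)) scalemxAr.
  exact: (congr1 (mulmx _) Yprojv).
have Ybr B : S B -> Y (ofC (B *m toC p - toC p *m B)) = B *m r.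
  move=> SB; rewrite /Y ofCK mulmxBl -!mulmxA (generator_null SB) mulmx0 subr0 pE.
  by rewrite scalemxAr Yprojv.
have Ylin a Q Q' : Y (a *: Q + Q') = (a%:C)%C *: Y Q + Y Q'.
  by rewrite /Y toCD toCZ mulmxDl -scalemxAl scalerDr scale_swap.
pose L (Q : cmat R N N) : 'rV[R]_d := \row_j coord b j (ofC (nil_log r h (Y Q))).
have LE Q j : L Q 0 j = coord b j (ofC (nil_log r h (Y Q))) by rewrite mxE.
have YB Q Q' : Y (Q - Q') = Y Q - Y Q'.
  by have := Ylin (-1) Q' Q; rewrite rmorphN1 !scaleN1r addrC => ->; rewrite addrC.
clearbody L Y.
have logl a Q Q' : ofC (nil_log r h (Y (a *: Q + Q'))) =
    a *: ofC (nil_log r h (Y Q)) + ofC (nil_log r h (Y Q')).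
  by rewrite Ylin nil_log_linear ofCD ofCZ.
have Llin : linear L.
  move=> a Q Q'; apply/rowP => j; rewrite LE [RHS]mxE [X in _ = X + _]mxE !LE.
  exact: etrans (congr1 (coord b j) (logl a Q Q')) (clin j a _ _).
have LD Q Q' : L (Q - Q') = L Q - L Q'.
  by have := Llin (-1) Q' Q; rewrite !scaleN1r [- Q' + Q]addrC [- L Q' + _]addrC.
(* The coordinates of the generator [B] for which [act (gam t) p] is the image of [p] under its
   exponential. *)
pose psi t := L (act (gam t) p - p).
have [gam0 [U1 [U10 [U1o _] U1G]]] := Gg.
have [_ [U2 [U20 [U2o U2s] _]]] := act_curve (M := M) cN actP Gg Mp.
have psiE : psi = (fun t => L (act (gam t) p) + - L p).
  by apply/funext => t; rewrite /psi LD.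
exists psi; split.
  split.
    rewrite /psi gam0 (act_one actP) // subrr; have := LD p p; rewrite !subrr; exact.
  exists (U1 `&` U2); split; first by split.
    split; first exact: openI.
    move=> m; rewrite psiE; apply: CkD; first exact: openI; last by apply: Ck_cst; exact: openI.
    refine (Ck_lin cN (openI U1o U2o) Llin _).
    by apply: Ck_sub (U2s m) => t [].
  move=> t [/U1G Gt _]; exists (gam t) => //.
  have [B [SB aE]] := act_in_nil_orbit Gt Mp.
  have -> : comb (psi t) = ofC B.
    have BU : ofC B \in U by apply/UE; rewrite ofCK.
    rewrite -(combK _ BU); congr comb; apply/rowP => j; rewrite /psi LE [RHS]mxE.
    congr (coord b j (ofC _)); rewrite YB aE (Yact _ SB) Yp.
    exact: (nil_exp_log vr h0 SB).1.
  by rewrite ofCK.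
have := is_derive_lin cN Llin (gd p Mp) => Ld.
rewrite derive1E; have -> : 'D_1 psi 0 = L (ofC (toC b`_i *m toC p - toC p *m toC b`_i)).
  apply: derive_val; rewrite psiE -[X in is_derive _ _ _ X]addr0.
  exact: is_deriveD.
apply/rowP => j; rewrite LE (Ybr _ (bU i)) (nil_exp_log vr h0 (bU i)).2 toCK.
rewrite [RHS]mxE eqxx /=.
have bfree : free b by exact: basis_free (vbasisP U).
by rewrite coord_free // eq_sym.
Qed.

Theorem act_orbit_nil (p : cmat R N N) : pts (k := M) p ->
  orbit_of (M := M) act p = [set mx_act (nil_exp A) p | A in S].
Proof.
move=> Mp; rewrite eqEsubset; split=> [_ [g Gg <-]|_ [A SA <-]].
  by have [A [SA ->]] := act_in_nil_orbit Gg Mp; exists A.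
by have [g Gg <-] := nil_orbit_in_act SA Mp; exists g.
Qed.

End HyperbolicOrbits.

End HyperbolicOrbits.
Import HyperbolicOrbits.

Module KillingForm.

(** * The Killing form of su(1,n) *)

Lemma linfun_linear (K : fieldType) (aT rT : vectType K) (f : aT -> rT) :
  linear f -> linfun f =1 f.
Proof.
move=> fl x.
pose f' : {linear aT -> rT} := HB.pack f (GRing.isLinear.Build K aT rT _ f fl).
exact: (lfunE f' x).
Qed.

Lemma su_combo_mx (K : comNzRingType) m (j h : K) (X Y : 'M[K]_m) :
  j * j = -1 -> h + h = 1 ->
  h *: (X - Y) + j *: (h *: (- j *: X - j *: Y)) = X.
Proof.
move=> jj hh; apply/matrixP => p q; rewrite !mxE.
have -> : h * (X p q - Y p q) + j * (h * (- j * X p q - j * Y p q)) =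
  h * (X p q - Y p q) - (j * j) * (h * (X p q + Y p q)) by ring.
rewrite jj mulN1r opprK -mulrDr -[RHS]mul1r -hh; ring.
Qed.

Lemma bracket_lin (K : comNzRingType) m (X : 'M[K]_m) a (A B : 'M[K]_m) :
  X *m (a *: A + B) - (a *: A + B) *m X =
  a *: (X *m A - A *m X) + (X *m B - B *m X).
Proof. by rewrite mulmxDr mulmxDl -scalemxAr -scalemxAl opprD addrACA scalerBr. Qed.

Lemma double_bracket (K : comNzRingType) m (X Y A : 'M[K]_m) :
  X *m (Y *m A - A *m Y) - (Y *m A - A *m Y) *m X =
  (X *m Y) *m A *m 1%:M - X *m A *m Y - Y *m A *m X + 1%:M *m A *m (Y *m X).
Proof.
by rewrite mulmxBr mulmxBl mulmx1 mul1mx !mulmxA opprB addrA addrAC.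
Qed.

Lemma scale_entry (K : comNzRingType) m p (a : K^o) (A : 'M[K]_(m, p)) i j :
  A i j *: a = (a *: A) i j.
Proof. by rewrite mxE; exact: mulrC. Qed.

Lemma combo_entry (K : comNzRingType) m p (A B E F : 'M[K]_(m, p)) i j :
  (A - B - E + F) i j = A i j - B i j - E i j + F i j.
Proof. by rewrite !mxE. Qed.

Lemma complexify_linear (R : realType) (V : lmodType R[i]) (u : V -> R) :
  (forall A B, u (A + B) = u A + u B) ->
  (forall a A, u ((a%:C)%C *: A) = a * u A) ->
  linear ((fun A => ((u A)%:C)%C + 'i%C * ((u (- 'i%C *: A))%:C)%C) : V -> R[i]^o).
Proof.
move=> uD uZ.
have i2 : 'i%C * 'i%C = -1 :> R[i] := @ii R.
pose g A := ((u A)%:C)%C + 'i%C * ((u (- 'i%C *: A))%:C)%C.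
have gD A B : g (A + B) = g A + g B.
  by rewrite /g scalerDr !uD !(rmorphD (real_complex R)) /= mulrDr addrACA.
have gR a A : g ((a%:C)%C *: A) = (a%:C)%C * g A.
  by rewrite /g scale_swap !uZ !(rmorphM (real_complex R)) /= mulrDr (mulrCA 'i%C).
have gI A : g ('i%C *: A) = 'i%C * g A.
  rewrite /g scalerA mulNr i2 opprK scale1r mulrDr mulrA i2 mulN1r addrC.
  congr (_ + _); have := uZ (-1) ('i%C *: A).
  by rewrite rmorphN1 !scaleN1r scaleNr => ->; rewrite mulN1r rmorphN opprK.
move=> a A B; rewrite -/(g _) -/(g A) -/(g B) gD; congr (_ + _).
rewrite [a in LHS]complexE scalerDl gD gR -scalerA gI gR.
by rewrite [a in RHS]complexE [_ *: _]mulrDl -mulrA.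
Qed.

Section SpecialUnitary.
Context {R : realType} {n : nat}.
Local Notation C := R[i].
Local Notation N := n.+1.
Local Notation D := (I1n R n).
Local Notation dag := (HermitianForms.dag D).
Implicit Types (X Y Z : cmat R N N) (A B : 'M[C]_N).

Lemma I1n_herm : D^t* = D.
Proof.
apply/matrixP => i j; rewrite !mxE; have [->|ij] := eqVneq i j.
  by rewrite !mulr1n; case: ifP => _; [exact: conjN1 | exact: rmorph1].
rewrite !mulr0n; exact: rmorph0.
Qed.

Lemma I1n_inv : D *m D = 1%:M.
Proof.
apply/matrixP => i j; rewrite mul_diag_mx !mxE; have [->|ij] := eqVneq i j.
  by rewrite !mulr1n; case: ifP => _; rewrite ?mulrNN mulr1.
by rewrite !mulr0n mulr0.
Qed.

Lemma skew_tr_linear : linear (fun X : cmat R N N => ofC ((\tr (toC X))%:M : 'M[C]_1)).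
Proof.
move=> a X Y; rewrite toCD toCZ mxtraceD mxtraceZ -ofCZ -ofCD; congr ofC.
by apply/matrixP => i j; rewrite !mxE mulrnDl mulrnAr.
Qed.

Lemma mem_su1n X : X \in su1n R n <-> dag (toC X) = - toC X /\ \tr (toC X) = 0.
Proof.
have l1 : linear (fun X : cmat R N N => ofC ((toC X)^t* *m D + D *m toC X)).
  move=> a Y Z; rewrite toCD toCZ adjD adjZ conj_real mulmxDl mulmxDr -scalemxAl -scalemxAr.
  by rewrite addrACA -scalerDr ofCD ofCZ.
have DD := I1n_inv.
rewrite /su1n memv_cap !memv_ker (linfun_linear l1) (linfun_linear skew_tr_linear).
split=> [/andP[/eqP h1 /eqP h2]|[h1 h2]].
  split.
    apply/eqP; rewrite -addr_eq0; apply/eqP.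
    have := congr1 (@toC R _ _) h1; rewrite ofCK toC0 => /(congr1 (mulmx D)).
    by rewrite mulmxDr mulmx0 [D *m (D *m _)]mulmxA DD mul1mx mulmxA.
  have := congr1 (@toC R _ _) h2; rewrite ofCK toC0 => /matrixP /(_ 0 0).
  by rewrite !mxE.
apply/andP; split; apply/eqP; last first.
  by rewrite h2 -ofC0; congr ofC; apply/matrixP => i j; rewrite !mxE mul0rn.
rewrite -ofC0; congr ofC.
rewrite -[_^t* *m D]mul1mx -DD -!mulmxA -mulmxDr [D *m (_ *m _)]mulmxA -/(dag (toC X)) h1.
by rewrite addNr mulmx0.
Qed.

Lemma adE X Y : ad X Y = ofC (toC X *m toC Y - toC Y *m toC X).
Proof.
rewrite /ad linfun_linear // => a Z W.
rewrite !toCD !toCZ mulmxDr mulmxDl -scalemxAr -scalemxAl opprD addrACA -scalerBr.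
by rewrite ofCD ofCZ.
Qed.

Lemma ad_su1n X Y : X \in su1n R n -> Y \in su1n R n -> ad X Y \in su1n R n.
Proof.
have DD := I1n_inv.
move=> /mem_su1n [dX tX] /mem_su1n [dY tY]; apply/mem_su1n; rewrite adE ofCK.
split; last by rewrite raddfB /= mxtrace_mulC subrr.
by rewrite dagB !(dagM DD) dX dY !mulNmx !mulmxN !opprK opprB.
Qed.

Opaque toC ofC HermitianForms.dag real_complex_def I1n su1n.

(* The complex linear extension to sl(n+1) = su(1,n) + i su(1,n) of a real
   linear form on su(1,n), composed with the projection A |-> A - (tr A / (n+1)). *)
Definition sl_part A : 'M[C]_N := A - (\tr A / N%:R)%:M.
Definition su_part A : cmat R N N := ofC (((2^-1)%:C)%C *: (sl_part A - dag (sl_part A))).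
Definition cext (f : cmat R N N -> R^o) A : C :=
  ((f (su_part A))%:C)%C + 'i%C * ((f (su_part (- 'i%C *: A)))%:C)%C.

Lemma sl_part_id A : \tr A = 0 -> sl_part A = A.
Proof. by move=> tA; rewrite /sl_part tA mul0r raddf0 subr0. Qed.

Lemma sl_part0 : sl_part 0 = 0.
Proof. by apply: sl_part_id; exact: mxtrace0. Qed.

Lemma tr_sl_part A : \tr (sl_part A) = 0.
Proof.
rewrite /sl_part raddfB /= mxtrace_scalar -[X in _ - X]mulr_natr mulfVK ?subrr //.
Qed.

Lemma su_partE A : toC (su_part A) = ((2^-1)%:C)%C *: (sl_part A - dag (sl_part A)).
Proof. exact: ofCK. Qed.

Lemma su_part_su A : su_part A \in su1n R n.
Proof.
have DD := I1n_inv; have DH := I1n_herm.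
apply/mem_su1n; rewrite su_partE; move: (sl_part A) (tr_sl_part A) => X tX; split.
  by rewrite dagZ conj_real dagB (dagK DH DD) -scalerN opprB.
by rewrite mxtraceZ raddfB /= (tr_dag DD) tX rmorph0 subrr mulr0.
Qed.

Lemma sl_part_lin a A B : sl_part (a *: A + B) = a *: sl_part A + sl_part B.
Proof.
rewrite /sl_part mxtraceD mxtraceZ mulrDl; apply/matrixP => i j; rewrite !mxE.
rewrite mulrnDl -mulrA -mulrnAr.
move: (_ *+ _) (_ *+ _) => x y; ring.
Qed.

Lemma su_part_lin (a : R) A B : su_part ((a%:C)%C *: A + B) = a *: su_part A + su_part B.
Proof.
rewrite /su_part sl_part_lin dagD dagZ conj_real opprD addrACA -scalerBr scalerDr.
by rewrite ofCD scale_swap ofCZ.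
Qed.

Lemma su_combo_dag (X : 'M[C]_N) : ((2^-1)%:C)%C *: (X - dag X) +
  'i%C *: (((2^-1)%:C)%C *: (- 'i%C *: X - dag (- 'i%C *: X))) = X.
Proof.
rewrite dagZ conjN conj_i opprK; move: (dag X) => Y.
exact: (su_combo_mx X Y (@ii R) (@half2 R)).
Qed.

Lemma su_part_combo A : toC (su_part A) + 'i%C *: toC (su_part (- 'i%C *: A)) = sl_part A.
Proof.
have slE : sl_part (- 'i%C *: A) = - 'i%C *: sl_part A.
  have := sl_part_lin (- 'i%C) A 0; rewrite addr0 => ->.
  by rewrite sl_part0 addr0.
have eA := su_partE A; have eB := su_partE (- 'i%C *: A); rewrite slE in eB.
refine (etrans (congr2 (fun U V => U + 'i%C *: V) eA eB) _).
exact: su_combo_dag.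
Qed.
Opaque su_part sl_part.

Lemma cext_lin (f : cmat R N N -> R^o) : linear f -> linear (cext f : 'M[C]_N -> C^o).
Proof.
move=> fl.
have f0 : f 0 = 0 by have := fl (-1) 0 0; rewrite scaler0 addr0 scaleN1r addNr.
have fD X Y : f (X + Y) = f X + f Y by have := fl 1 X Y; rewrite !scale1r.
have fZ a X : f (a *: X) = a * f X by have := fl a X 0; rewrite f0 !addr0.
have suD A B : su_part (A + B) = su_part A + su_part B.
  by have := su_part_lin 1 A B; rewrite !scale1r.
have suZ a A : su_part ((a%:C)%C *: A) = a *: su_part A.
  have := su_part_lin a A 0; rewrite !addr0 => ->.
  have := su_part_lin (-1) 0 0; rewrite scaler0 addr0 scaleN1r addNr => ->.
  by rewrite addr0.
by apply: complexify_linear => [A B|a A]; rewrite ?suD ?suZ ?fD ?fZ.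
Qed.


Lemma mem_su_part X : X \in su1n R n -> su_part (toC X) = X.
Proof.
move=> /mem_su1n [dX tX]; apply: toC_inj; rewrite su_partE.
by rewrite (sl_part_id tX) dX opprK scalerDr -scalerDl half2 scale1r.
Qed.

(** The trace of the endomorphism [Z |-> A *m Z *m B] of the matrix space. *)
Lemma sum_delta_trace A B : \sum_p \sum_q (A *m delta_mx p q *m B) p q = \tr A * \tr B.
Proof.
rewrite /mxtrace big_distrl /=; apply: eq_bigr => p _; rewrite big_distrr /=.
apply: eq_bigr => q _; rewrite mxE (bigD1 q) //= big1 => [|k kq].
  rewrite mxE (bigD1 p) //= big1 => [|k kp]; first by rewrite mxE !eqxx /= mulr1 !addr0.
  by rewrite mxE (negbTE kp) mulr0.
rewrite mxE big1 ?mul0r // => l _; by rewrite mxE (negbTE kq) andbF mulr0.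
Qed.

Lemma toC_combo (I : finType) (a a' : I -> R) (F : I -> cmat R N N) :
  toC (\sum_i a i *: F i) + 'i%C *: toC (\sum_i a' i *: F i) =
  \sum_i (((a i)%:C)%C + 'i%C * ((a' i)%:C)%C) *: toC (F i).
Proof.
rewrite (toC_sum (fun i => a i *: F i)) (toC_sum (fun i => a' i *: F i)).
rewrite scaler_sumr -big_split; apply: eq_bigr => i _.
by rewrite !toCZ [RHS]scalerDl scalerA.
Qed.

(** The real trace on su(1,n) equals the complex trace of the double bracket on its complexification
    sl(n+1), and also on all matrices, since the double bracket has trace-free values. There it is
    computed on matrix units. *)
Lemma killing_tr X Y : X \in su1n R n -> Y \in su1n R n ->
  killing X Y = 2 * N%:R * complex.Re (\tr (toC X *m toC Y)).
Proof.
move=> Xsu Ysu; rewrite /killing; set U := su1n R n; set b := vbasis U.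
have bU (i : 'I_(\dim U)) : b`_i \in U by apply/vbasis_mem/mem_nth; rewrite size_tuple.
pose f (i : 'I_(\dim U)) := cext (fun X => coord b i X).
have fl i : linear (f i : 'M[C]_N -> C^o).
  by apply: cext_lin => a Z W; rewrite linearP.
pose f' i : {linear 'M[C]_N -> C^o} :=
  HB.pack (f i : 'M[C]_N -> C^o) (GRing.isLinear.Build C 'M[C]_N C^o _ (f i) (fl i)).
have fsu i Z : Z \in U -> f i (toC Z) = ((coord b i Z)%:C)%C.
  move=> ZU; rewrite /f /cext (mem_su_part ZU).
  have -> : su_part (- 'i%C *: toC Z) = 0.
    have := su_part_combo (toC Z); rewrite (mem_su_part ZU) sl_part_id; last first.
      by have /mem_su1n [] := ZU.
    move=> /(canRL (addKr _)); rewrite addNr => /eqP; rewrite scaler_eq0 (negbTE i_neq0) /=.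
    by move=> /eqP h; apply: toC_inj; rewrite h toC0.
  by rewrite linear0 rmorph0 mulr0 addr0.
have fsum A : \sum_i f i A *: toC b`_i = sl_part A.
  rewrite -(su_part_combo A).
  have e1 := coord_vbasis (su_part_su A).
  have e2 := coord_vbasis (su_part_su (- 'i%C *: A)).
  refine (esym (etrans (congr2 (fun P Q => toC P + 'i%C *: toC Q) e1 e2) _)).
  exact: toC_combo.
pose T A : 'M[C]_N := toC X *m (toC Y *m A - A *m toC Y) - (toC Y *m A - A *m toC Y) *m toC X.
have Tl : linear T.
  by move=> a A B; rewrite /T bracket_lin bracket_lin.
have TE Z : Z \in U -> ad X (ad Y Z) = ofC (T (toC Z)) by rewrite !adE !ofCK.
have E : ((\sum_i coord b i (ad X (ad Y b`_i)))%:C)%C = \sum_i f i (T (toC b`_i)).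
  rewrite rmorph_sum; apply: eq_bigr => i _ /=.
  rewrite -fsu; last exact: (ad_su1n Xsu (ad_su1n Ysu (bU i))).
  by congr (f i _); exact: (etrans (congr1 (@toC R N N) (TE _ (bU i))) (ofCK _)).
have [_ tX] := (mem_su1n X).1 Xsu; have [_ tY] := (mem_su1n Y).1 Ysu.
have slT A : sl_part (T A) = T A.
  by apply: sl_part_id; rewrite /T raddfB /= mxtrace_mulC subrr.
pose T' : {linear 'M[C]_N -> 'M[C]_N} := HB.pack T (GRing.isLinear.Build C _ _ _ T Tl).
(* Expanding the basis vectors in matrix units and exchanging the sums, [fsum] rebuilds the matrix
   [T (delta_mx p q)] from its coordinates. *)
have E2 : \sum_i f i (T (toC b`_i)) = \sum_p \sum_q T (delta_mx p q) p q.
  under eq_bigr => i _.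
    rewrite [toC _]matrix_sum_delta -[T _]/(T' _) linear_sum /=.
    rewrite -[f i _]/(f' i _) linear_sum /=.
    under eq_bigr => p _.
      rewrite -[T _]/(T' _) linear_sum /= -[f i _]/(f' i _) linear_sum /=.
      under eq_bigr => q _ do rewrite -[T _]/(T' _) linearZ /= -[f i _]/(f' i _) linearZ /=.
      over.
    over.
  rewrite exchange_big /=; apply: eq_bigr => p _; rewrite exchange_big /=.
  apply: eq_bigr => q _; rewrite -[in RHS]slT -fsum summxE; apply: eq_bigr => i _.
  exact: scale_entry.
have E3 : \sum_p \sum_q T (delta_mx p q) p q = N%:R * \tr (toC X *m toC Y) *+ 2.
  have TD p q : T (delta_mx p q) p q = (toC X *m toC Y *m delta_mx p q *m 1%:M) p q
      - (toC X *m delta_mx p q *m toC Y) p q - (toC Y *m delta_mx p q *m toC X) p q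
      + (1%:M *m delta_mx p q *m (toC Y *m toC X)) p q.
    by rewrite /T double_bracket combo_entry.
  under eq_bigr => p _ do under eq_bigr => q _ do rewrite TD.
  under eq_bigr => p _ do rewrite !big_split /= !sumrN.
  (* The two middle terms of the double bracket contribute the product of the traces of [X] and [Y],
     which is zero. *)
  rewrite !big_split /= !sumrN !sum_delta_trace tX tY mxtrace1 !mul0r !subr0 mulrC.
  by rewrite [\tr (toC Y *m _)]mxtrace_mulC mulr2n.
rewrite E2 E3 in E.
rewrite -[LHS](Re_real) E -mulr_natl mulrA -natrM -(rmorph_nat (real_complex R)) ReZ.
by rewrite natrM.
Qed.

End SpecialUnitary.

End KillingForm.
Import KillingForm.

Module StandardForms.

(** * The Hermitian forms of the complex projective and hyperbolic spaces *)

Section StandardForms.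
Context {R : realType} {n : nat}.
Local Notation C := R[i].
Local Notation N := n.+1.
Implicit Types (x y z v : 'cV[C]_N).

Lemma ip_1E x y : ip 1%:M x y = \sum_j Num.conj (x j 0) * y j 0.
Proof. by rewrite /ip mulmx1 mxE; apply: eq_bigr => j _; rewrite !mxE. Qed.

Lemma ip_I1nE x y : ip (I1n R n) x y =
  - (Num.conj (x 0 0) * y 0 0) + \sum_(j < n) Num.conj (x (lift ord0 j) 0) * y (lift ord0 j) 0.
Proof.
rewrite /ip /I1n mul_mx_diag mxE big_ord_recl; congr (_ + _).
  by rewrite !mxE eqxx mulrN1 mulNr.
by apply: eq_bigr => j _; rewrite !mxE /= mulr1.
Qed.

Lemma Re_conj_mul (a : C) : complex.Re (Num.conj a * a) = normsq a.
Proof. by rewrite /normsq mulrC. Qed.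

Lemma normsq0 : normsq (0 : C) = 0.
Proof. by rewrite /normsq mul0r. Qed.

Lemma normsq_neq0 (a : C) : a != 0 -> 0 < normsq a.
Proof.
by move=> a0; rewrite lt_neqAle normsq_ge0 andbT eq_sym; apply: contra_neq a0 => /normsq_eq0.
Qed.

Lemma sum_normsq_gt0 (I : finType) (f : I -> C) i : f i != 0 -> 0 < \sum_i normsq (f i).
Proof.
move=> fi; rewrite (bigD1 i) //=; apply: (ltr_pwDl (normsq_neq0 fi)).
by apply: sumr_ge0 => j _; exact: normsq_ge0.
Qed.

Lemma Re_ip_1E x : complex.Re (ip 1%:M x x) = \sum_j normsq (x j 0).
Proof. by rewrite ip_1E Re_sum; apply: eq_bigr => j _; exact: Re_conj_mul. Qed.

Lemma Re_ip_I1nE x : complex.Re (ip (I1n R n) x x) =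
  - normsq (x 0 0) + \sum_(j < n) normsq (x (lift ord0 j) 0).
Proof.
rewrite ip_I1nE ReD ReN Re_sum Re_conj_mul; congr (_ + _).
by apply: eq_bigr => j _; exact: Re_conj_mul.
Qed.

Lemma cV_neq0 m (x : 'cV[C]_m) : x != 0 -> exists j, x j 0 != 0.
Proof.
move=> x0; have [[j xj]|h] := pselect (exists j, x j 0 != 0); first by exists j.
case/eqP: x0; apply/matrixP => i j; rewrite ord1 mxE; apply/eqP.
by apply/negP => /negP xi; apply: h; exists i.
Qed.

Lemma CP_line_form (c : R) : 0 < c -> line_form (1%:M : 'M[C]_N) 1 c.
Proof.
move=> c0; split; [exact: adj1|exact: mulmx1|by left|by rewrite mul1r|].
by move=> v y _ _ /cV_neq0 [j yj]; rewrite Re_ip_1E; exact: (sum_normsq_gt0 (f := fun k => y k 0) yj).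
Qed.

Opaque ip.
(** The combination [z] has zero first coordinate, so its square is nonnegative; expanded, it is
    |v0|^2 q(y, y) + |y0|^2 q(v, v), whose second term is negative when y0 is nonzero. *)
Lemma I1n_pos v y : complex.Re (ip (I1n R n) v v) < 0 -> ip (I1n R n) v y = 0 -> y != 0 ->
  0 < complex.Re (ip (I1n R n) y y).
Proof.
set q := ip (I1n R n) => vneg vy y0.
have yv : q y v = 0 by rewrite /q (ipC (I1n_herm (R := R) (n := n)) v) -/q vy; exact: rmorph0.
have [y00|y00] := eqVneq (y 0 0) 0.
  rewrite Re_ip_I1nE y00 normsq0 oppr0 add0r.
  have [j yj] := cV_neq0 y0.
  case: (unliftP ord0 j) yj => [k ->|->]; last by rewrite y00 eqxx.
  by move=> yk; exact: (sum_normsq_gt0 (f := fun k => y (lift ord0 k) 0) yk).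
pose z := v 0 0 *: y - y 0 0 *: v.
have z0 : z 0 0 = 0 by rewrite !mxE mulrC subrr.
have zz : 0 <= complex.Re (q z z).
  rewrite Re_ip_I1nE z0 normsq0 oppr0 add0r; apply: sumr_ge0 => j _; exact: normsq_ge0.
have E : q z z = (v 0 0 * Num.conj (v 0 0)) * q y y + (y 0 0 * Num.conj (y 0 0)) * q v v.
  rewrite /z /q !(ipBl, ipBr, ipZl, ipZr) -/q vy yv.
  ring.
have v2 := normsq_ge0 (v 0 0).
move: zz; rewrite E ReD !normsqE !ReZ; have := normsq_neq0 y00; move: v2 vneg.
move: (complex.Re _) (complex.Re _) (normsq _) (normsq _) => a b d e; nra.
Qed.

Lemma CH_line_form (c : R) : c < 0 -> line_form (I1n R n) (-1) c.
Proof.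
move=> c0; split; [exact: I1n_herm|exact: I1n_inv|by right|by rewrite mulN1r oppr_gt0|].
by move=> v y; rewrite mulN1r oppr_gt0; exact: I1n_pos.
Qed.

Definition e0 : 'cV[C]_N := delta_mx 0 0.

Lemma unitv_e0 : unitv (I1n R n) (-1) e0.
Proof.
rewrite /unitv ip_I1nE /e0 !mxE !eqxx /= mulr1 big1 ?addr0 => [|j _].
  by rewrite rmorph1 rmorphN1.
by rewrite !mxE /= mulr0.
Qed.

Lemma proj_e0 : proj (I1n R n) (-1) e0 = delta_mx 0 0.
Proof.
rewrite /proj /outer /I1n mul_mx_diag; apply/matrixP => i j.
have e0E k : e0 k 0 = (k == 0)%:R :> C by rewrite mxE andbT.
rewrite mxE mxE mxE big_ord1 adj_entry !e0E [RHS]mxE mxE.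
have [_|j0] := eqVneq j 0; last by rewrite rmorph0 andbF mulr0 mul0r mulr0.
by rewrite rmorph1 mulr1 andbT mulrN1 rmorphN1 mulN1r opprK.
Qed.

(** Conjugation by [D] is thus the Cartan involution at the point [e0]: commuting with the projector
    amounts to commuting with [D]. *)
Lemma I1n_proj : I1n R n = 1%:M - 2 *: proj (I1n R n) (-1) e0.
Proof.
rewrite proj_e0; apply/matrixP => i j; rewrite !mxE.
have [<-|ij] := eqVneq i j; last first.
  rewrite mulr0n (_ : _ && _ = false) ?mulr0 ?subr0 //.
  by have [i0|//] := eqVneq i 0; move: ij; rewrite i0 eq_sym => /negbTE ->.
by case: (i == 0) => /=; rewrite ?mulr1 ?mulr1n ?mulr0 ?subr0 //; ring.
Qed.

End StandardForms.

End StandardForms.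
Import StandardForms.

Module RestrictedRoots.

(** * Restricted roots of su(1,n) *)

Lemma dagE (R : realType) m (D A : 'M[R[i]]_m) : HermitianForms.dag D A = D *m A^t* *m D.
Proof. by []. Qed.

Lemma mem_leigenspace (K : fieldType) (V : vectType K) (f : 'End(V)) (a : K) x :
  x \in passmx.leigenspace f a <-> f x = a *: x.
Proof.
rewrite memv_ker lfunE /= opp_lfunE scale_lfunE id_lfunE subr_eq0; split=> /eqP //.
Qed.

Opaque real_complex_def toC ofC ip outer dag gcos gsin line_of nil_exp nil_mx I1n su1n.

Lemma toC_eq0 (R : realType) m p (A : 'M[R[i]]_(m, p)) : ofC A = 0 <-> A = 0.
Proof.
by split=> [/(congr1 (@toC R m p))|->]; rewrite ?ofCK ?toC0 ?ofC0.
Qed.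

Lemma opp_self (K : numFieldType) (V : lmodType K) (x : V) : x = - x -> x = 0.
Proof.
move=> e; have : x + x == 0 by rewrite {1}e addNr.
have -> : x + x = (2 : K) *: x by rewrite scaler_nat mulr2n.
rewrite scaler_eq0 pnatr_eq0 /= => /eqP; exact.
Qed.

Lemma involution_commute (K : numFieldType) m (D P Y : 'M[K]_m) :
  D = 1%:M - 2 *: P -> D *m D = 1%:M -> (P *m Y - Y *m P = 0 <-> D *m Y *m D = Y).
Proof.
move=> DE DD.
have E : D *m Y - Y *m D = (-2) *: (P *m Y - Y *m P).
  rewrite DE mulmxBl mulmxBr mul1mx mulmx1 -scalemxAl -scalemxAr scaleNr scalerBr.
  move: (2 *: _) (2 *: _) => A B; by rewrite !opprB addrCA addrAC subrr add0r.
have -> : (P *m Y - Y *m P = 0) <-> (D *m Y - Y *m D = 0).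
  split=> [h|/eqP]; first by rewrite E h scaler0.
  by rewrite E scaler_eq0 oppr_eq0 pnatr_eq0 /= => /eqP.
split=> [/eqP|h]; first by rewrite subr_eq0 => /eqP ->; rewrite -mulmxA DD mulmx1.
by rewrite -{2}h -(mulmxA (D *m Y) D D) DD mulmx1; exact: subrr.
Qed.

Section Roots.
Context {R : realType} {n : nat}.
Local Notation C := R[i].
Local Notation N := n.+1.
Local Notation D := (I1n R n).
Local Notation dag := (HermitianForms.dag D).
Local Notation ip := (HermitianForms.ip D).
Local Notation outer := (HermitianForms.outer D).
Local Notation proj := (LineSpaces.proj D (-1)).
Implicit Types (X Y Z : cmat R N N) (A B : 'M[C]_N) (x y : 'cV[C]_N).
Let DH : D^t* = D := I1n_herm.
Let DD : D *m D = 1%:M := I1n_inv.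
Let o : cmat R N N := ofC (proj e0).

Lemma isotropy_algebraE Y :
  Y \in isotropy_algebra o <-> Y \in su1n R n /\ D *m toC Y *m D = toC Y.
Proof.
rewrite /isotropy_algebra memv_cap memv_ker adE ofCK.
have IC := involution_commute (toC Y) (I1n_proj (R := R) (n := n)) DD.
split=> [/andP[-> /eqP /toC_eq0 /IC ->] //|[-> /IC /toC_eq0 ->]].
by rewrite eqxx.
Qed.

Lemma tr_mul_adj m (A : 'M[C]_m) : complex.Re (\tr (A *m A^t*)) = 0 -> A = 0.
Proof.
move=> h; apply/matrixP => i j; rewrite mxE; apply: normsq_eq0; apply/eqP.
have E : complex.Re (\tr (A *m A^t*)) = \sum_i \sum_j normsq (A i j).
  rewrite /mxtrace Re_sum; apply: eq_bigr => k _; rewrite mxE Re_sum.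
  by apply: eq_bigr => l _; rewrite adj_entry.
rewrite h in E; have := esym E; rewrite big_mkcond => /eqP.
rewrite psumr_eq0 => [/allP /(_ i (mem_index_enum i)) /eqP|k _]; last first.
  by apply: sumr_ge0 => l _; exact: normsq_ge0.
move=> /= /eqP; rewrite psumr_eq0 => [/allP /(_ j (mem_index_enum j)) //|l _].
exact: normsq_ge0.
Qed.

(** [B] is twice the component of [X] in the isotropy algebra. Killing-orthogonality gives tr (B B)
    = 0 in real part, and [B] is skew-Hermitian in the ordinary sense, so it vanishes. *)
Lemma cartan_pE X : cartan_p o X <-> X \in su1n R n /\ D *m toC X *m D = - toC X.
Proof.
split=> [[Xsu XK]|[Xsu XD]]; split=> //.
  have /mem_su1n [dX tX] := Xsu.
  pose B := toC X + D *m toC X *m D.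
  have DB : D *m B *m D = B.
    rewrite /B mulmxDr mulmxDl; move: (toC X) => A.
    by rewrite !mulmxA DD mul1mx -(mulmxA A D D) DD mulmx1 addrC.
  have dB : dag B = - B.
    rewrite /B dagD !(dagM DD) dX (_ : dag D = D); last by rewrite dagE DH DD mul1mx.
    by rewrite mulNmx mulmxN mulmxA -opprD.
  have tB : \tr B = 0.
    by rewrite /B mxtraceD [\tr (D *m _ *m D)]mxtrace_mulC mulmxA DD mul1mx tX addr0.
  have Bsu : ofC B \in su1n R n by apply/mem_su1n; rewrite ofCK.
  have := XK (ofC B); rewrite isotropy_algebraE ofCK => /(_ (conj Bsu DB)).
  rewrite killing_tr // ofCK => /eqP.
  rewrite mulf_eq0 mulf_eq0 !pnatr_eq0 /= => /eqP XB.
  have XDXD : \tr (D *m toC X *m D *m B) = \tr (toC X *m B).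
    by rewrite -{1}DB !mulmxA mxtrace_mulC !mulmxA DD mul1mx -!(mulmxA _ D D) DD mulmx1.
  have BB : complex.Re (\tr (B *m B)) = 0.
    by rewrite {1}/B mulmxDl mxtraceD XDXD ReD XB addr0.
  have B0 : B = 0.
    apply: tr_mul_adj; have -> : B^t* = - B.
      have := congr1 (fun Z : 'M[C]_N => D *m Z *m D) dB.
      by rewrite dagE mulmxN mulNmx DB !mulmxA DD mul1mx -mulmxA DD mulmx1.
    by rewrite mulmxN raddfN ReN BB oppr0.
  by apply/eqP; rewrite -addr_eq0 addrC; apply/eqP.
move=> Y /isotropy_algebraE [Ysu YD]; rewrite killing_tr //.
suff -> : \tr (toC X *m toC Y) = 0 by rewrite mulr0.
have h : \tr (toC X *m toC Y) = - \tr (toC X *m toC Y).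
  rewrite -{1}YD !mulmxA mxtrace_mulC !mulmxA XD mulNmx raddfN //.
exact: (@opp_self C C^o _ h).
Qed.

Variables v w : 'cV[C]_N.
Hypothesis vw : null_frame D v w.
Hypothesis r0E : e0 = ((2^-1)%:C)%C *: v - w.

Lemma I1n_mulv y : D *m y = y + (2 * ip e0 y) *: e0.
Proof.
rewrite {1}I1n_proj mulmxBl mul1mx -scalemxAl proj_mulv rmorphN1 mulN1r !scaleNr scalerN opprK.
by rewrite scalerA.
Qed.

Lemma half_twice : 2 * ((2^-1)%:C)%C = 1 :> C.
Proof. by rewrite mulr_natl mulr2n half2. Qed.

Lemma half_scale a y : ((2^-1)%:C)%C *: (a *: (2 *: y)) = a *: y.
Proof. by rewrite scale_swap (scalerA _ 2) mulrC half_twice scale1r. Qed.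

(** [D] induces the geodesic symmetry at [e0] and exchanges the two null lines; the factor comes
    from the normalisation of [e0] as v/2 - w. *)
Lemma I1n_v : D *m v = 2 *: w.
Proof.
have [vv ww vw1 wv1] := vw.
rewrite I1n_mulv {1}r0E ipBl ipZl vv mulr0 wv1 sub0r r0E mulrN1 scalerBr scalerA mulNr half_twice.
by rewrite scaleN1r scaleNr opprK addNKr.
Qed.

Lemma I1n_w : D *m w = ((2^-1)%:C)%C *: v.
Proof.
have e : D *m (2 *: w) = v by rewrite -I1n_v mulmxA DD mul1mx.
by rewrite -e -scalemxAr scalerA mulrC half_twice scale1r.
Qed.

Lemma I1n_perp y : perp2 D v w y -> D *m y = y.
Proof.
move=> [vy wy]; rewrite I1n_mulv r0E ipBl ipZl vy wy mulr0 subr0 mulr0.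
by rewrite [X in _ + X](_ : _ = 0) ?addr0 //; exact: scale0r.
Qed.

(* Spans the maximal abelian subspace; [alpha] below takes the value 1 on it. *)
Definition hmx : 'M[C]_N := outer v w - outer w v.

Lemma hmx_v : hmx *m v = v.
Proof.
have [vv ww vw1 wv1] := vw; rewrite /hmx mulmxBl !outer_mulv wv1 vv scale1r.
by rewrite [X in _ - X](_ : _ = 0) ?subr0 //; exact: scale0r.
Qed.

Lemma hmx_w : hmx *m w = - w.
Proof.
have [vv ww vw1 wv1] := vw; rewrite /hmx mulmxBl !outer_mulv ww vw1 scale1r.
by rewrite [X in X - _](_ : _ = 0) ?sub0r //; exact: scale0r.
Qed.

Lemma hmx_perp y : perp2 D v w y -> hmx *m y = 0.
Proof.
move=> [vy wy]; rewrite /hmx mulmxBl !outer_mulv vy wy.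
rewrite [X in X - _](_ : _ = 0) ?sub0r; last exact: scale0r.
by rewrite [X in - X](_ : _ = 0) ?oppr0 //; exact: scale0r.
Qed.

Lemma dag_hmx : dag hmx = - hmx.
Proof. by rewrite /hmx dagB !(dag_outer DH DD) opprB. Qed.

Lemma tr_hmx : \tr hmx = 0.
Proof. by have [_ _ vw1 wv1] := vw; rewrite /hmx raddfB /= !tr_outer vw1 wv1 subrr. Qed.

Lemma I1n_hmx : D *m hmx *m D = - hmx.
Proof.
apply: (frame_ext _ _ vw).
- by rewrite -mulmxA I1n_v -mulmxA -!scalemxAr hmx_w mulNmx hmx_v mulmxN scalerN I1n_w scalerA half_twice scale1r.
- by rewrite -mulmxA I1n_w -mulmxA -!scalemxAr hmx_v mulNmx hmx_w I1n_v scalerA mulrC half_twice scale1r opprK.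
- by move=> y yP; rewrite -mulmxA (I1n_perp yP) -mulmxA mulNmx (hmx_perp yP) mulmx0 oppr0.
Qed.

Let h : cmat R N N := ofC hmx.

Lemma hmx_su : h \in su1n R n.
Proof. by apply/mem_su1n; rewrite ofCK; split; [exact: dag_hmx|exact: tr_hmx]. Qed.

Lemma hmx_neq0 : h != 0.
Proof.
apply/eqP => /toC_eq0 h0; have := hmx_v; rewrite h0 mul0mx => /esym.
have [_ _ vw1 _] := vw; move=> v0; move: vw1; rewrite v0 ip0l => /esym/eqP.
by rewrite oner_eq0.
Qed.

Lemma real_of_conj (a : C) : Num.conj a = a -> exists r : R, a = (r%:C)%C.
Proof. by move=> /complex_real_conj ->; exists (complex.Re a). Qed.

(** [X] preserves the eigenspaces of [hmx]. It multiplies [v] by a real number, [w] by the opposite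
    one through [D], and kills the orthogonal of the frame, on which [D] is the identity while
    anticommuting with [X]. *)
Lemma cartan_p_commute X : cartan_p o X -> ad h X = 0 -> exists a : R, X = a *: h.
Proof.
move=> /cartan_pE [/mem_su1n [dX _] DX]; rewrite adE ofCK => /toC_eq0 /eqP.
have [vv ww vw1 wv1] := vw.
rewrite subr_eq0 => /eqP HX; set A := toC X in dX DX HX.
have DA y : A *m (D *m y) = - (D *m (A *m y)).
  have -> : A *m (D *m y) = - (D *m A *m D) *m (D *m y) by rewrite DX opprK.
  by rewrite mulNmx -!mulmxA [D *m (D *m y)]mulmxA DD mul1mx.
have Hv : hmx *m (A *m v) = A *m v by rewrite mulmxA HX -mulmxA hmx_v.
have ipH y z : ip (hmx *m y) z = - ip y (hmx *m z).
  by rewrite (ip_dagl DH DD) dag_hmx mulNmx ipNr.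
have vAv : ip v (A *m v) = 0.
  by apply: opp_self; rewrite -{2}Hv -[RHS]ipH hmx_v.
have [a aE] : exists a, A *m v = a *: v.
  exists (ip w (A *m v)); have E := perp_partK D v w (A *m v).
  rewrite vAv [X in _ + (_ + X)](_ : _ = 0) ?addr0 in E; last exact: scale0r.
  refine (etrans (esym Hv) (etrans (congr1 (mulmx hmx) E) _)).
  by rewrite mulmxDr (hmx_perp (perp_partP _ vw)) add0r -scalemxAr hmx_v.
have wE : w = ((2^-1)%:C)%C *: (D *m v).
  by rewrite I1n_v scalerA mulrC half_twice scale1r.
have Aw : A *m w = - a *: w.
  by rewrite {1}wE -scalemxAr DA aE -scalemxAr I1n_v scalerN half_scale scaleNr.
have [r rE] : exists r : R, a = (r%:C)%C.
  apply: real_of_conj; have e : ip (A *m v) w = - ip v (A *m w).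
    by rewrite (ip_dagl DH DD) dX mulNmx ipNr.
  by move: e; rewrite aE Aw ipZl ipZr vw1 !mulr1 opprK.
exists r; apply: toC_inj; rewrite -/A toCZ ofCK -rE.
apply: (frame_ext _ _ vw).
- by rewrite aE -scalemxAl hmx_v.
- by rewrite Aw -scalemxAl hmx_w scalerN scaleNr.
move=> y yP; rewrite -scalemxAl (hmx_perp yP) scaler0.
have HA : hmx *m (A *m y) = 0 by rewrite mulmxA HX -mulmxA (hmx_perp yP) mulmx0.
have AP : perp2 D v w (A *m y).
  split; first by rewrite -hmx_v ipH HA ip0r oppr0.
  by rewrite -[w]opprK -hmx_w ipNl ipH HA ip0r !oppr0.
by apply: opp_self; rewrite -{2}(I1n_perp AP) -DA (I1n_perp yP).
Qed.

Lemma hmx_maximal_abelian : maximal_abelian_in (cartan_p o) <[h]>%VS.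
Proof.
split; first split.
- move=> X /= /vlineP [a ->]; apply/cartan_pE; split; first exact/memvZ/hmx_su.
  by rewrite toCZ ofCK -scalemxAr -scalemxAl I1n_hmx scalerN.
- move=> X Y /vlineP [a ->] /vlineP [b ->].
  rewrite adE !toCZ -!scalemxAl -!scalemxAr scale_swap subrr; exact: ofC0.
move=> b [bp bC] hb; apply/eqP; rewrite eqEsubv hb andbT; apply/subvP => X bX.
have hh : h \in b by apply: (subvP hb); exact: memv_line.
by have [a ->] := cartan_p_commute (bp _ bX) (bC _ _ hh bX); apply/memvZ/memv_line.
Qed.

(** The factor makes [alpha] equal to 1 on [hmx], since tr (hmx hmx) = 2. *)
Definition alpha : 'Hom(cmat R N N, R^o) :=
  linfun ((fun X => 2^-1 * complex.Re (\tr (hmx *m toC X))) : cmat R N N -> R^o).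

Lemma alpha_hmx : alpha h = 1.
Proof.
have [vv ww vw1 wv1] := vw.
rewrite /alpha linfun_linear; last first.
  move=> a X Y; rewrite toCD toCZ mulmxDr -scalemxAr mxtraceD mxtraceZ ReD ReZ mulrDr.
  by rewrite mulrCA.
rewrite ofCK; have -> : \tr (hmx *m hmx) = 2.
  rewrite {2}/hmx mulmxBr !mul_outer hmx_v hmx_w outerNl opprK mxtraceD !tr_outer vw1 wv1.
  by rewrite -mulr2n.
by rewrite -(rmorph_nat (real_complex R)) Re_real mulVf // pnatr_eq0.
Qed.

Lemma mem_root_space (k : R) X : X \in root_space <[h]>%VS (k *: alpha) <->
  X \in su1n R n /\ hmx *m toC X - toC X *m hmx = ((k%:C)%C) *: toC X.
Proof.
have h0 := hmx_neq0.
(* The chosen basis of the line is an unspecified nonzero multiple of [h]; the eigenvalue equation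
   is insensitive to that multiple. *)
have bE (i : 'I_(\dim <[h]>)) : exists a : R, a != 0 /\ (vbasis <[h]>)`_i = a *: h.
  have im : (vbasis <[h]>)`_i \in vbasis <[h]> by apply: mem_nth; rewrite size_tuple.
  have /vlineP [a aE] := vbasis_mem im; exists a; split=> //.
  apply: contra_neq h0 => a0.
  have := basis_not0 (vbasisP <[h]>) im; rewrite aE a0 scale0r eqxx //.
have aE a : (k *: alpha) (a *: h) = a * k.
  by rewrite linearZ /= scale_lfunE alpha_hmx; congr (_ * _); exact: mulr1.
have adZ a Y : ad (a *: h) Y = a *: ofC (hmx *m toC Y - toC Y *m hmx).
  by rewrite adE toCZ ofCK -scalemxAl -scalemxAr -scalerBr ofCZ.
have key a : a != 0 -> X \in passmx.leigenspace (ad (a *: h)) ((k *: alpha) (a *: h)) <->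
    hmx *m toC X - toC X *m hmx = ((k%:C)%C) *: toC X.
  move=> a0; apply: (iff_trans (mem_leigenspace _ _ _)); rewrite aE adZ.
  rewrite -scalerA; split=> [/(scalerI a0) /(congr1 (@toC R N N))|e].
    by rewrite ofCK toCZ.
  by congr (_ *: _); apply: toC_inj; rewrite ofCK toCZ.
rewrite /root_space memv_cap; split=> [/andP[Xsu]|[-> hX]]; last first.
  rewrite andTb memvE; apply/subv_bigcapP => i _; rewrite -memvE.
  by have [a [a0 aB]] := bE i; rewrite aB; apply/key.
rewrite memvE => /subv_bigcapP hX; split=> //.
have d1 : \dim <[h]> = 1%N by rewrite dim_vline h0.
have d0 : (0 < \dim <[h]>)%N by rewrite d1.
have := hX (Ordinal d0) isT; rewrite -memvE.
have [a [a0 aB]] := bE (Ordinal d0); rewrite aB => /(key _ a0); exact.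
Qed.

End Roots.

End RestrictedRoots.
Import RestrictedRoots.

(** * Decomposition of su(1,n) into restricted root spaces *)

Module RootDecomposition.

Opaque real_complex_def toC ofC ip outer dag gcos gsin line_of nil_exp nil_mx I1n su1n.

Lemma block_expand (K : comNzRingType) m (P Q U A : 'M[K]_m) :
  (P + Q + U) *m A *m (P + Q + U) - (Q *m A *m P + P *m A *m U) - (U *m A *m P + P *m A *m Q)
    - Q *m A *m U - U *m A *m Q = P *m A *m P + Q *m A *m Q + U *m A *m U.
Proof. mx_expand; mx_linear. Qed.

Lemma subrK4 (V : zmodType) (x a b d e : V) : x = x - a - b - d - e + e + d + b + a.
Proof. by rewrite !subrK. Qed.

Lemma bracketD (K : comNzRingType) m (H A B : 'M[K]_m) :
  H *m (A + B) - (A + B) *m H = (H *m A - A *m H) + (H *m B - B *m H).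
Proof. by rewrite mulmxDl mulmxDr opprD addrACA. Qed.

(** Applying the product of the f - a_j over j different from i to a vanishing sum leaves only the
    i-th vector, with a nonzero coefficient. *)
Lemma eigenspaces_direct (K : fieldType) (V : vectType K) (I : finType) (f : 'End(V))
    (a : I -> K) (U : I -> {vspace V}) : injective a ->
  (forall i x, x \in U i -> f x = a i *: x) -> directv (\sum_i U i)%VS.
Proof.
move=> aI fU; apply/directv_sum_independent => u uU u0 i _.
pose g s x := foldr (fun j y => f y - a j *: y) x s.
have gE s (x : I -> V) : (forall j, x j \in U j) ->
    g s (\sum_j x j) = \sum_j (\prod_(k <- s) (a j - a k)) *: x j.
  move=> xU; elim: s => [|k s /= ->].
    by apply: eq_bigr => j _; rewrite big_nil scale1r.
  rewrite linear_sum scaler_sumr -sumrB; apply: eq_bigr => j _.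
  rewrite linearZ /= (fU j) // big_cons !scalerA -scalerBl (mulrC (a k)) -mulrBr mulrC.
  by [].
have := gE (enum [pred j | j != i]) u (fun j => uU j isT).
rewrite u0 (bigD1 i) //= [X in _ + X]big1 ?addr0 => [|j ji]; last first.
  rewrite (big_rem j) /= ?subrr ?mul0r ?scale0r //.
  by rewrite mem_enum inE.
have -> : g (enum [pred j | j != i]) 0 = 0.
  by elim: (enum _) => //= k s ->; rewrite linear0 scaler0 subr0.
move=> /esym/eqP; rewrite scaler_eq0 => /orP[|/eqP //].
rewrite prodf_seq_eq0 => /hasP [j]; rewrite mem_enum inE /= => ji.
by rewrite subr_eq0 => /eqP /aI ij; rewrite ij eqxx in ji.
Qed.

Section RootDecomposition.
Context {R : realType} {n : nat}.
Local Notation C := R[i].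
Local Notation N := n.+1.
Local Notation D := (I1n R n).
Local Notation dag := (HermitianForms.dag D).
Local Notation ip := (HermitianForms.ip D).
Local Notation outer := (HermitianForms.outer D).
Implicit Types (X Y Z : cmat R N N) (A B : 'M[C]_N) (x y : 'cV[C]_N).
Let DH : D^t* = D := I1n_herm.
Let DD : D *m D = 1%:M := I1n_inv.
Variables v w : 'cV[C]_N.
Hypothesis vw : null_frame D v w.
Local Notation H := (hmx v w).
Local Notation h := (ofC H).

Lemma block_bracket A B E a b : H *m A = a *: A -> B *m H = b *: B ->
  H *m (A *m E *m B) - (A *m E *m B) *m H = (a - b) *: (A *m E *m B).
Proof.
by move=> HA BH; rewrite !mulmxA HA -(mulmxA _ B H) BH -scalemxAr -!scalemxAl scalerBl.
Qed.

Lemma hmx_outer_l x y a : H *m x = a *: x -> H *m outer x y = a *: outer x y.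
Proof. by move=> Hx; rewrite mul_outer Hx outerZl. Qed.

(** Spectral projectors of [hmx] for the eigenvalues 1, -1 and 0; the adjoint exchanges the first
    two. *)
Let P1 := outer v w.
Let P2 := outer w v.
Let P0 := 1%:M - P1 - P2.

Lemma hmx_P1 : H *m P1 = 1 *: P1.
Proof. by apply: hmx_outer_l; rewrite (hmx_v vw) scale1r. Qed.

Lemma hmx_P2 : H *m P2 = (-1) *: P2.
Proof. by apply: hmx_outer_l; rewrite (hmx_w vw) scaleN1r. Qed.

Lemma hmx_P0 : H *m P0 = 0 *: P0.
Proof.
by rewrite /P0 !mulmxBr mulmx1 hmx_P1 hmx_P2 scale1r scaleN1r opprK scale0r /hmx addrAC subrK subrr.
Qed.

Lemma dagP1 : dag P1 = P2. Proof. exact: dag_outer. Qed.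
Lemma dagP2 : dag P2 = P1. Proof. exact: dag_outer. Qed.
Lemma dagP0 : dag P0 = P0.
Proof.
rewrite /P0 (dagB _ (1%:M - P1)) (dagB _ 1%:M) dagP1 dagP2 (dag1 DD); exact: addrAC.
Qed.

Lemma mul_hmx A B a : dag A = B -> H *m A = a *: A -> B *m H = (- Num.conj a) *: B.
Proof.
move=> <- HA; have := congr1 dag HA; rewrite (dagM DD) dagZ dag_hmx mulmxN => e.
by rewrite scaleNr -e opprK.
Qed.

Lemma P2_hmx : P2 *m H = (-1) *: P2.
Proof. by rewrite (mul_hmx dagP1 hmx_P1) rmorph1. Qed.
Lemma P1_hmx : P1 *m H = 1 *: P1.
Proof. by rewrite (mul_hmx dagP2 hmx_P2) conjN1 opprK. Qed.
Lemma P0_hmx : P0 *m H = 0 *: P0.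
Proof. by rewrite (mul_hmx dagP0 hmx_P0) rmorph0 oppr0. Qed.

Lemma bracket_tr0 A a : a != 0 -> H *m A - A *m H = a *: A -> \tr A = 0.
Proof.
move=> a0 /(congr1 mxtrace); rewrite raddfB /= mxtraceZ mxtrace_mulC subrr.
by move=> /esym/eqP; rewrite mulf_eq0 (negbTE a0) => /eqP.
Qed.

Lemma mem_root_space_neq0 (k : R) A : k != 0 -> dag A = - A ->
  H *m A - A *m H = ((k%:C)%C) *: A -> ofC A \in root_space <[h]>%VS (k *: alpha v w).
Proof.
move=> k0 dA HA; apply/(mem_root_space vw); rewrite ofCK; split=> //.
apply/mem_su1n; rewrite ofCK; split=> //.
by apply: bracket_tr0 HA; exact: realC_neq0.
Qed.

Lemma block_sum (Q0 Q1 Q2 A : 'M[C]_N) : Q0 = 1%:M - Q1 - Q2 ->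
  A - (Q1 *m A *m Q0 + Q0 *m A *m Q2) - (Q2 *m A *m Q0 + Q0 *m A *m Q1)
    - Q1 *m A *m Q2 - Q2 *m A *m Q1 =
  Q0 *m A *m Q0 + Q1 *m A *m Q1 + Q2 *m A *m Q2.
Proof.
move=> Q0E; have {1}-> : A = (Q0 + Q1 + Q2) *m A *m (Q0 + Q1 + Q2).
  have -> : Q0 + Q1 + Q2 = 1%:M by rewrite Q0E -addrA [Q1 + _]addrC addrA !subrK.
  by rewrite mul1mx mulmx1.
exact: block_expand.
Qed.

Lemma dag_block A B B' E E' : dag A = - A -> dag B = B' -> dag E = E' ->
  dag (B *m A *m E) = - (E' *m A *m B').
Proof. by move=> dA dB dE; rewrite !(dagM DD) dA dB dE mulNmx mulmxN mulmxA. Qed.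

Lemma root_block A (Q Q' : 'M[C]_N) a b (k : R) : H *m Q = a *: Q -> Q' *m H = b *: Q' ->
  a - b = ((k%:C)%C) ->
  H *m (Q *m A *m Q') - (Q *m A *m Q') *m H = ((k%:C)%C) *: (Q *m A *m Q').
Proof. by move=> HQ QH <-; exact: block_bracket. Qed.

Lemma root_block2 A (Q Q' P P' : 'M[C]_N) a b a' b' (k : R) :
  H *m Q = a *: Q -> Q' *m H = b *: Q' -> H *m P = a' *: P -> P' *m H = b' *: P' ->
  a - b = ((k%:C)%C) -> a' - b' = ((k%:C)%C) ->
  H *m (Q *m A *m Q' + P *m A *m P') - (Q *m A *m Q' + P *m A *m P') *m H =
  ((k%:C)%C) *: (Q *m A *m Q' + P *m A *m P').
Proof.
move=> HQ QH HP PH e e'; refine (etrans (bracketD _ _ _) _).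
by rewrite (root_block A HQ QH e) (root_block A HP PH e') scalerDr.
Qed.

(** A matrix is cut into nine blocks by the spectral projectors, and the block from eigenvalue b to
    eigenvalue a has weight a - b. Blocks exchanged by the adjoint have the same weight and are
    grouped, so that each group is skew. *)
Lemma hmx_root_decomposition : root_decomposition <[h]>%VS (alpha v w).
Proof.
rewrite /root_decomposition /=.
pose U (k : 'I_5) := root_space <[h]>%VS ((k%:R - 2) *: alpha v w).
split.
  apply: (@eigenspaces_direct _ _ _ (ad h) (fun k : 'I_5 => k%:R - 2 : R) U).
    by move=> k l /addIr /eqP; rewrite eqr_nat => /eqP /val_inj.
  move=> k X /(mem_root_space vw) [_ HX]; rewrite adE ofCK; apply: toC_inj.
  by rewrite ofCK toCZ.
apply/eqP; rewrite eqEsubv; apply/andP; split; last first.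
  by apply/subv_sumP => k _; exact: capvSl.
apply/subvP => X Xsu; have /mem_su1n [dX tX] := Xsu.
set A := toC X in dX tX.
pose A1 := P1 *m A *m P0 + P0 *m A *m P2.
pose A2 := P2 *m A *m P0 + P0 *m A *m P1.
pose A3 := P1 *m A *m P2.
pose A4 := P2 *m A *m P1.
pose A0 := A - A1 - A2 - A3 - A4.
have mem (k : 'I_5) Y : Y \in U k -> Y \in (\sum_(k < 5) U k)%VS.
  by move=> YU; apply: (subvP (sumv_sup k isT (subvv _))).
(* The index k of the five root spaces carries the weight k - 2. *)
have m1 : ofC A1 \in U (@Ordinal 5 3 isT).
  have k1 : (3%:R - 2 : R) = 1 by lra.
  apply: mem_root_space_neq0; first by rewrite k1 oner_neq0.
    rewrite /A1 dagD (dag_block dX dagP1 dagP0) (dag_block dX dagP0 dagP2).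
    by rewrite -opprD addrC.
  rewrite k1; apply: (root_block2 A hmx_P1 P0_hmx hmx_P0 P2_hmx).
    by rewrite subr0 rmorph1.
  by rewrite sub0r opprK rmorph1.
have m2 : ofC A2 \in U (@Ordinal 5 1 isT).
  have k1 : (1%:R - 2 : R) = -1 by lra.
  apply: mem_root_space_neq0; first by rewrite k1 oppr_eq0 oner_neq0.
    rewrite /A2 dagD (dag_block dX dagP2 dagP0) (dag_block dX dagP0 dagP1).
    by rewrite -opprD addrC.
  rewrite k1; apply: (root_block2 A hmx_P2 P0_hmx hmx_P0 P1_hmx).
    by rewrite subr0 rmorphN1.
  by rewrite sub0r rmorphN1.
have m3 : ofC A3 \in U (@Ordinal 5 4 isT).
  have k1 : (4%:R - 2 : R) = 2 by lra.
  apply: mem_root_space_neq0; first by rewrite k1 pnatr_eq0.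
    exact: (dag_block dX dagP1 dagP2).
  rewrite k1; apply: (root_block A hmx_P1 P2_hmx).
  by rewrite opprK (rmorph_nat (real_complex R)).
have m4 : ofC A4 \in U (@Ordinal 5 0 isT).
  have k1 : (0%:R - 2 : R) = - 2 by lra.
  apply: mem_root_space_neq0; first by rewrite k1 oppr_eq0 pnatr_eq0.
    exact: (dag_block dX dagP2 dagP1).
  rewrite k1; apply: (root_block A hmx_P2 P1_hmx).
  by rewrite (rmorphN (real_complex R)) (rmorph_nat (real_complex R)) -opprD.
have m0 : ofC A0 \in U (@Ordinal 5 2 isT).
  apply/(mem_root_space vw); split.
    rewrite /A0 !ofCB toCK; have su k Y : Y \in U k -> Y \in su1n R n by rewrite memv_cap => /andP[].
    exact: (memvB (memvB (memvB (memvB Xsu (su _ _ m1)) (su _ _ m2)) (su _ _ m3)) (su _ _ m4)).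
  have k1 : (2%:R - 2 : R) = 0 by lra.
  have z : 0 - 0 = (((2%:R - 2 : R)%:C)%C) :> C by rewrite k1 subrr rmorph0.
  have z1 : 1 - 1 = (((2%:R - 2 : R)%:C)%C) :> C by rewrite k1 subrr rmorph0.
  have z2 : -1 - -1 = (((2%:R - 2 : R)%:C)%C) :> C by rewrite k1 subrr rmorph0.
  have A0E : A0 = _ := block_sum A (erefl P0).
  rewrite ofCK A0E.
  refine (etrans (bracketD _ _ _) _); rewrite scalerDr; congr (_ + _); last first.
    exact: root_block hmx_P2 P2_hmx z2.
  exact: (root_block2 A hmx_P0 P0_hmx hmx_P1 P1_hmx z z1).
have -> : X = ofC A0 + ofC A4 + ofC A3 + ofC A2 + ofC A1.
  by rewrite /A0 !ofCB toCK; exact: subrK4.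
exact: (memvD (memvD (memvD (memvD (mem _ _ m0) (mem _ _ m4)) (mem _ _ m3)) (mem _ _ m2)) (mem _ _ m1)).
Qed.
End RootDecomposition.

End RootDecomposition.
Import RootDecomposition.

Module HorocycleFoliation.

(** * The Lagrangian horocycle foliation *)

Lemma nil_mxE (R : realType) n (D : 'M[R[i]]_n.+1) v x s :
  nil_mx D v x s = outer D x v - outer D v x + ('i%C * (s%:C)%C) *: outer D v v.
Proof. by []. Qed.

Lemma conj_Im0 (R : realType) (z : R[i]) : complex.Im z = 0 -> Num.conj z = z.
Proof.
by case: z => a b /= ->; rewrite conjcE; apply/eqP; rewrite eq_complex /= oppr0 !eqxx.
Qed.

Lemma nil_expE (R : realType) n (A : 'M[R[i]]_n) :
  nil_exp A = 1%:M + A + ((2^-1)%:C)%C *: (A *m A).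
Proof. by []. Qed.

Lemma bracket_combo (K : comNzRingType) m (H X Y Z X1 Y1 Z1 X2 Y2 Z2 : 'M[K]_m) a :
  H *m X = X1 -> X *m H = X2 -> H *m Y = Y1 -> Y *m H = Y2 -> H *m Z = Z1 -> Z *m H = Z2 ->
  H *m (X - Y + a *: Z) - (X - Y + a *: Z) *m H = (X1 - X2) - (Y1 - Y2) + a *: (Z1 - Z2).
Proof.
move=> <- <- <- <- <- <-.
by mx_expand; mx_linear.
Qed.

Lemma expm_series (R : realType) n (A l : 'M[R[i]]_n.+1) :
  (forall k, (3 <= k)%N -> series (fun k => (k`!%:R)^-1 *: A ^+ k) k = l) -> expm A = l.
Proof.
move=> h; rewrite /expm; pose V : normedModType R[i] := 'M[R[i]]_n.+1.
have H : hausdorff_space V := @norm_hausdorff _ V.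
have := @lim_near_cst V H nat \oo _ l (series (fun k => (k`!%:R)^-1 *: A ^+ k)).
by apply; exists 3%N.
Qed.

Lemma big_nat3 (V : nmodType) (f : nat -> V) : \sum_(0 <= i < 3) f i = f 0%N + f 1%N + f 2%N.
Proof. by rewrite !big_nat_recr //= big_geq // add0r. Qed.

Lemma expm_nil (R : realType) n (A : 'M[R[i]]_n.+1) : A *m (A *m A) = 0 -> expm A = nil_exp A.
Proof.
move=> A3; apply: expm_series => k k3.
have Ak j : (3 <= j)%N -> A ^+ j = 0.
  by move=> /subnK <-; rewrite exprD (_ : A ^+ 3 = 0) ?mulr0 // !exprS expr0 mulr1.
rewrite /series /= (big_cat_nat (n := 3)) //= [X in _ + X]big_nat_cond [X in _ + X]big1 ?addr0; last first.
  by move=> j; rewrite andbT => /andP[j3 _]; rewrite Ak // scaler0.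
rewrite big_nat3 nil_expE; congr (_ + _ + _).
- by rewrite expr0 invr1 scale1r.
- by rewrite expr1 invr1 scale1r.
by rewrite expr2 (fmorphV (real_complex R)) (rmorph_nat (real_complex R)).
Qed.

Opaque real_complex_def toC ofC nil_exp.
Section FundamentalVector.
Context {R : realType} {n : nat}.
Local Notation N := n.+1.
Local Notation C := R[i].

Lemma is_derive_nil_exp (X : cmat R N N) :
  is_derive (0 : R) 1 (fun t : R => ofC (nil_exp (toC (t *: X)))) X.
Proof.
have dX : is_derive (0 : R) 1 (fun t : R => 0 + t *: X) X := is_derive_affine 0 X 0.
have dX2 := is_derive_cmatM dX dX.
rewrite !scale0r !addr0 toC0 mulmx0 mul0mx addr0 ofC0 in dX2.
have d1 : is_derive (0 : R) 1 (fun t : R => ofC (1%:M : 'M[C]_N) + t *: X) X := is_derive_affine _ X 0.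
have d2 : is_derive (0 : R) 1
  (fun t : R => (2^-1 : R) *: ofC (toC (0 + t *: X) *m toC (0 + t *: X))) ((2^-1 : R) *: (0 : cmat R N N)).
  exact: is_deriveZ.
have := is_deriveD d1 d2; rewrite scaler0 addr0; apply: is_derive_ext => t.
transitivity (ofC (1%:M : 'M[C]_N) + t *: X + (2^-1 : R) *: ofC (toC (0 + t *: X) *m toC (0 + t *: X))).
  by [].
by rewrite nil_expE add0r !ofCD toCK ofCZ.
Qed.

Lemma conj_curve_value (o : cmat R N N) (a b : 'M[C]_N) :
  ofC (toC (ofC (toC (ofC a) *m toC o)) *m toC (ofC b)) = ofC (a *m toC o *m b).
Proof. by rewrite !ofCK. Qed.

Lemma conj_derive_value (X o : cmat R N N) (a b : 'M[C]_N) : a = 1%:M -> b = 1%:M ->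
  ofC (toC (ofC (toC X *m toC o + toC (ofC a) *m toC (0 : cmat R N N))) *m toC (ofC b) +
       toC (ofC (toC (ofC a) *m toC o)) *m toC (- X)) =
  ofC (toC X *m toC o - toC o *m toC X).
Proof.
by move=> -> ->; rewrite !ofCK toC0 mulmx0 addr0 mulmx1 mul1mx toCN mulmxN.
Qed.

Lemma fundamental_vector_nil (o X : cmat R N N) : toC X *m (toC X *m toC X) = 0 ->
  fundamental_vector o X = ofC (toC X *m toC o - toC o *m toC X).
Proof.
move=> X3; rewrite /fundamental_vector derive1E.
have tX3 (t : R) : toC (t *: X) *m (toC (t *: X) *m toC (t *: X)) = 0.
  by rewrite toCZ -!scalemxAl -!scalemxAr X3 !scaler0.
have dX := is_derive_nil_exp X.
have dN : is_derive (0 : R) 1 (fun t : R => ofC (nil_exp (toC (t *: (- X))))) (- X) := is_derive_nil_exp (- X).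
have co : is_derive (0 : R) 1 (fun _ : R => o) 0 := is_derive_cst _ _ _.
have d1 := is_derive_cmatM dX co; have d2 := is_derive_cmatM d1 dN.
have e : nil_exp (toC ((0 : R) *: X)) = 1%:M by rewrite scale0r toC0 nil_exp0.
have e' : nil_exp (toC ((0 : R) *: (- X))) = 1%:M by rewrite scale0r toC0 nil_exp0.
rewrite (conj_derive_value X o e e') in d2.
apply: derive_val; apply: is_derive_ext d2 => t /=.
refine (etrans (conj_curve_value _ _ _) _).
have e2 : nil_exp (toC (t *: - X)) = invmx (expm (toC (t *: X))).
  refine (etrans _ (congr1 invmx (esym (expm_nil (tX3 t))))).
  by rewrite (nil_exp_inv (tX3 t)).2 scalerN toCN.
by rewrite e2 -(expm_nil (tX3 t)).
Qed.
End FundamentalVector.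

Opaque real_complex_def toC ofC ip outer dag gcos gsin line_of nil_exp nil_mx I1n su1n.

Lemma bracket_value (K : comNzRingType) m (j s : K) (X Y Z : 'M[K]_m) :
  0 *: X - (-1) *: X - (1 *: Y - (-0) *: Y) + (j * s) *: (1 *: Z - (-1) *: Z) =
  X - Y + (j * (2 * s)) *: Z.
Proof. by apply/matrixP => p q; rewrite !mxE; ring. Qed.

Section Horocycles.
Context {R : realType} {n : nat}.
Local Notation C := R[i].
Local Notation N := n.+1.
Local Notation D := (I1n R n).
Local Notation dag := (HermitianForms.dag D).
Local Notation ip := (HermitianForms.ip D).
Local Notation outer := (HermitianForms.outer D).
Implicit Types (X Y Z : cmat R N N) (A B : 'M[C]_N) (x y : 'cV[C]_N).
Let DH : D^t* = D := I1n_herm.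
Let DD : D *m D = 1%:M := I1n_inv.
(** The curvature enters a [line_form] through its sign only, so -1 stands for any negative
    value. *)
Let lf : line_form D (-1) (-1) := CH_line_form (ltrN10 R).
Variables v w : 'cV[C]_N.
Hypothesis vw : null_frame D v w.
Local Notation H := (hmx v w).
Local Notation h := (ofC H).

Lemma outer_hmx x y a : H *m y = a *: y -> outer x y *m H = (- Num.conj a) *: outer x y.
Proof.
by move=> Hy; rewrite (outer_mul DH DD) dag_hmx mulNmx Hy outerNr outerZr scaleNr.
Qed.

(** The part in [x] has weight 1 and the part in [s] has weight 2. *)
Lemma nil_mx_bracket x s : perp2 D v w x ->
  H *m nil_mx D v x s - nil_mx D v x s *m H = nil_mx D v x (2 * s).
Proof.
move=> xP; have Hx0 : H *m x = 0 *: x by rewrite (hmx_perp xP) scale0r.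
have Hv1 : H *m v = 1 *: v by rewrite (hmx_v vw) scale1r.
rewrite !nil_mxE; refine (etrans (bracket_combo _ (hmx_outer_l _ Hx0) (outer_hmx _ Hv1)
  (hmx_outer_l _ Hv1) (outer_hmx _ Hx0) (hmx_outer_l _ Hv1) (outer_hmx _ Hv1)) _).
rewrite rmorph0 rmorph1 (rmorphM (real_complex R)) (rmorph_nat (real_complex R)).
exact: bracket_value.
Qed.

Lemma nil_mx0 : nil_mx D v 0 0 = 0.
Proof.
rewrite nil_mxE outer0l outer0r subrr add0r rmorph0 mulr0; exact: scale0r.
Qed.

Lemma nil_mx_su x s : perp2 D v w x -> ofC (nil_mx D v x s) \in su1n R n.
Proof.
move=> xP; apply/mem_su1n; rewrite ofCK; split; first exact: (nil_mx_dag v DH DD).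
have [vx _] := xP; have [xv _] := perp2C lf xP; have [vv _ _ _] := vw.
rewrite nil_mxE mxtraceD raddfB /= mxtraceZ !tr_outer vx xv vv subrr add0r mulr0 //.
Qed.

Lemma hmx_ip x y : ip (H *m x) y = - ip x (H *m y).
Proof. by rewrite (ip_dagl DH DD) dag_hmx mulNmx ipNr. Qed.

Lemma hmx_eigen a y : H *m y = a *: y ->
  [/\ a <> 1 -> ip w y = 0, a <> -1 -> ip v y = 0 & a <> 0 -> perp_part D v w y = 0].
Proof.
move=> Hy.
have e1 : ip w y = a * ip w y by rewrite -ipZr -Hy -[RHS]opprK -hmx_ip (hmx_w vw) ipNl opprK.
have e2 : - ip v y = a * ip v y by rewrite -ipZr -Hy -[RHS]opprK -hmx_ip (hmx_v vw).
split=> a1.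
- apply/eqP; have /eqP : (a - 1) * ip w y = 0 by rewrite mulrBl mul1r -e1 subrr.
  by rewrite mulf_eq0 subr_eq0 => /orP[/eqP //|].
- apply/eqP; have /eqP : (a + 1) * ip v y = 0 by rewrite mulrDl mul1r -e2 addNr.
  by rewrite mulf_eq0 addr_eq0 => /orP[/eqP //|].
have E := perp_partK D v w y; have pP := perp_partP y vw.
move: E pP e1 e2 Hy; move: (perp_part D v w y) (ip w y) (ip v y) => p b d -> pP e1 e2.
rewrite !mulmxDr (hmx_perp pP) add0r -!scalemxAr (hmx_v vw) (hmx_w vw) !scalerDr !scalerA -e1 -e2.
rewrite scalerN scaleNr -[LHS]add0r => /addIr /esym/eqP.
by rewrite scaler_eq0 => /orP[/eqP //|/eqP].
Qed.

Lemma frame_comb0 y : perp_part D v w y = 0 -> y = ip w y *: v + ip v y *: w.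
Proof. by move=> p0; have := perp_partK D v w y; rewrite p0 add0r. Qed.

Lemma hmx_eigen_big (k : nat) y : (1 < k)%N -> H *m y = k%:R *: y -> y = 0.
Proof.
move=> k1 /hmx_eigen [e1 e2 e3].
have k0 : (0 < k)%N by exact: ltn_trans k1.
rewrite (frame_comb0 (e3 _)) ?e1 ?e2.
- by rewrite [X in X + _](_ : _ = 0) ?add0r; exact: scale0r.
- by apply/eqP; rewrite -addr_eq0 -[1]/(1%:R) -natrD pnatr_eq0 addn1.
- by apply/eqP; rewrite -[1]/(1%:R) eqr_nat gtn_eqF.
- by apply/eqP; rewrite pnatr_eq0 -lt0n.
Qed.

Lemma hmx_eigen1 y : H *m y = y -> y = ip w y *: v.
Proof.
rewrite -{2}[y]scale1r => /hmx_eigen [_ e2 e3].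
rewrite {1}(frame_comb0 (e3 _)) ?e2.
- by rewrite [X in _ + X](_ : _ = 0) ?addr0 //; exact: scale0r.
- by apply/eqP; rewrite -addr_eq0 -mulr2n pnatr_eq0.
- by apply/eqP; exact: oner_neq0.
Qed.

Lemma hmx_eigen0 y : H *m y = 0 -> perp2 D v w y.
Proof.
rewrite -[RHS](scale0r y) => /hmx_eigen [e1 e2 _]; split.
  by apply: e2; apply/eqP; rewrite eq_sym oppr_eq0 oner_neq0.
by apply: e1; apply/eqP; rewrite eq_sym oner_neq0.
Qed.

Lemma root_vector_skew X : X \in su1n R n -> forall y z, ip (toC X *m y) z = - ip y (toC X *m z).
Proof. by move=> /mem_su1n [dX _] y z; rewrite (ip_dagl DH DD) dX mulNmx ipNr. Qed.

Lemma root_vector_mul (A : 'M[C]_N) a y : H *m A - A *m H = a *: A ->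
  H *m (A *m y) = A *m (H *m y) + a *: (A *m y).
Proof. by move=> HA; rewrite !mulmxA scalemxAl -mulmxDl -HA addrC subrK. Qed.

(** A root vector of weight 1 raises eigenvalues of [hmx] by 1: it kills [v], as 2 is no eigenvalue,
    maps [w] into the orthogonal of the frame, and maps the latter to multiples of [v]. Skewness
    leaves only the freedom of the image of [w]. *)
Lemma mem_root_alpha X : X \in root_space <[h]>%VS (alpha v w) <->
  exists x, perp2 D v w x /\ toC X = nil_mx D v x 0.
Proof.
rewrite -[alpha v w]scale1r; split=> [/(mem_root_space vw)|[x [xP XE]]]; last first.
  apply/(mem_root_space vw); split; first by rewrite -[X]toCK XE; exact: nil_mx_su.
  by rewrite XE (nil_mx_bracket _ xP) mulr0 rmorph1 scale1r.
move=> [Xsu HX]; set A := toC X in HX; have skA := root_vector_skew Xsu.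
have HA y := root_vector_mul y HX; rewrite rmorph1 in HA.
have Av : A *m v = 0.
  apply: (@hmx_eigen_big 2) => //.
  by rewrite HA (hmx_v vw) scale1r -mulr2n scaler_nat.
have Aw : perp2 D v w (A *m w).
  by apply: hmx_eigen0; rewrite HA (hmx_w vw) mulmxN scale1r addNr.
exists (A *m w); split=> //; apply: (frame_ext _ _ vw) => [||y yP].
- by rewrite Av (nil_mx_v lf _ vw Aw).
- rewrite (nil_mx_w lf _ vw Aw) rmorph0 mulr0 [X in _ + X](_ : _ = 0) ?addr0 //; exact: scale0r.
rewrite (nil_mx_perp _ _ yP) skA opprK.
by apply: hmx_eigen1; rewrite HA (hmx_perp yP) mulmx0 add0r scale1r.
Qed.

(** Raising eigenvalues by 2 kills everything except [w], which goes to an imaginary multiple of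
    [v]. *)
Lemma mem_root_2alpha X : X \in root_space <[h]>%VS (2 *: alpha v w) <->
  exists s, toC X = nil_mx D v 0 s.
Proof.
have zP : perp2 D v w 0 by split; exact: ip0r.
have r2 : ((2%:C)%C : C) = 2 by exact: (rmorph_nat (real_complex R)).
split=> [/(mem_root_space vw)|[s XE]]; last first.
  apply/(mem_root_space vw); split; first by rewrite -[X]toCK XE; exact: nil_mx_su.
  rewrite XE (nil_mx_bracket _ zP).
  have := nil_mx_lin D v 2 0 0 s 0; rewrite scaler0 !addr0 => ->.
  by rewrite nil_mx0 addr0.
move=> [Xsu HX]; set A := toC X in HX; have skA := root_vector_skew Xsu.
have HA y := root_vector_mul y HX; rewrite r2 in HA.
have Av : A *m v = 0.
  apply: (@hmx_eigen_big 3) => //.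
  by rewrite HA (hmx_v vw) (natrD C 1 2) [RHS]scalerDl scale1r.
have Aw : A *m w = ip w (A *m w) *: v.
  apply: hmx_eigen1; rewrite HA (hmx_w vw) mulmxN scaler_nat mulr2n addrA addNr add0r //.
exists (complex.Im (ip w (A *m w))); apply: (frame_ext _ _ vw) => [||y yP].
- by rewrite Av (nil_mx_v lf _ vw zP).
- rewrite (nil_mx_w lf _ vw zP) add0r; refine (etrans Aw (congr1 (fun a => a *: v) _)).
  by apply: imag_conj; rewrite -(ipC DH) skA.
rewrite (nil_mx_perp _ _ yP) ip0l oppr0 [RHS](_ : _ = 0); last exact: scale0r.
by apply: (@hmx_eigen_big 2) => //; rewrite HA (hmx_perp yP) mulmx0 add0r.
Qed.

Hypothesis r0E : e0 = ((2^-1)%:C)%C *: v - w.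
Variable l : 'cV[C]_N -> Prop.
Hypothesis lL : lagrangian_in_perp D v w l.
Let lP x : l x -> perp2 D v w x. Proof. exact: (proj1 lL). Qed.
Let l0 : l 0 := (lagrangian_lin lL).1.
Let llin := (lagrangian_lin lL).2.
Local Notation P := (proj D (-1) e0).
Let o : cmat R N N := ofC P.

Lemma nil_mx_e0 x : perp2 D v w x -> nil_mx D v x 0 *m e0 = - x.
Proof.
move=> xP; rewrite r0E mulmxBr -scalemxAr (nil_mx_v lf _ vw xP) scaler0 sub0r.
rewrite (nil_mx_w lf _ vw xP) rmorph0 mulr0 [X in _ + X](_ : _ = 0) ?addr0 //; exact: scale0r.
Qed.

Lemma perp_e0 x : perp2 D v w x -> ip e0 x = 0 /\ ip x e0 = 0.
Proof.
move=> xP; have [xv xw] := perp2C lf xP; have [vx wx] := xP.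
by rewrite r0E ipBl ipBr ipZl ipZr xv xw vx wx !mulr0 subrr.
Qed.

(** The tangent vector at [e0] produced by [nil_mx D v x 0]: the sign of the image - x of [e0]
    cancels the factor -1 of the projector. *)
Definition tvec x : 'M[C]_N := outer x e0 + outer e0 x.

Lemma fundamental_vector_tvec X x : perp2 D v w x -> toC X = nil_mx D v x 0 ->
  fundamental_vector o X = ofC (tvec x).
Proof.
move=> xP XE; rewrite fundamental_vector_nil; last first.
  by rewrite XE; exact: (nil_mx3 DH vw 0 0 0 xP xP xP).
congr ofC; rewrite ofCK XE (skew_proj_bracket lf); last exact: (nil_mx_dag v DH DD).
by rewrite (nil_mx_e0 xP) outerNl outerNr -opprD rmorphN1 scaleN1r opprK.
Qed.

Lemma metric_tvec c x y : perp2 D v w x -> perp2 D v w y ->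
  @metric R (CH n c) o (ofC (tvec x)) (ofC (tvec y)) = - (4 / c) * complex.Re (ip x y).
Proof.
move=> xP yP; have [e0x xe0] := perp_e0 xP; have [e0y ye0] := perp_e0 yP.
have e1 := neg_norm (@unitv_e0 R n).
refine (etrans (congr1 (fun Z : 'M[C]_N => 2 / c * complex.Re (\tr Z))
  (congr2 mulmx (ofCK (tvec x)) (ofCK (tvec y)))) _).
have -> : \tr (tvec x *m tvec y) = - (ip y x + ip x y).
  rewrite /tvec tr_outer_sym e0x ye0 e1; move: (ip y x) (ip x y) (ip e0 y) (ip x e0) => a b d e.
  ring.
rewrite ReN ReD (ipC DH x y) Re_conj.
by move: (complex.Re _) c^-1 => a b; ring.
Qed.

Lemma cstr_tvec c x : perp2 D v w x ->
  @cstr R (CH n c) o (ofC (tvec x)) = ofC (tvec ('i%C *: x)).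
Proof.
move=> xP; have [e0x xe0] := perp_e0 xP.
have e1 := neg_norm (@unitv_e0 R n).
refine (congr1 (@ofC R N N) (etrans (congr1 (fun Z : 'M[C]_N => 'i%C *: Z)
  (congr2 (fun X Y : 'M[C]_N => X *m Y - Y *m X) (ofCK (tvec x)) (ofCK P))) _)).
have TP : tvec x *m P = outer x e0.
  rewrite /LineSpaces.proj -scalemxAr rmorphN1 scaleN1r /tvec mulmxDl !outerM e1 xe0 scaleN1r.
  by rewrite [X in - (_ + X)](_ : _ = 0) ?addr0 ?opprK //; exact: scale0r.
have PT : P *m tvec x = outer e0 x.
  rewrite /LineSpaces.proj -scalemxAl rmorphN1 scaleN1r /tvec mulmxDr !outerM e1 e0x scaleN1r.
  by rewrite [X in - (X + _)](_ : _ = 0) ?add0r ?opprK //; exact: scale0r.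
by rewrite TP PT /tvec outerZl outerZr conj_i scalerBr scaleNr.
Qed.

Lemma horocycle_algebra : exists L : {vspace cmat R N N},
  forall X, X \in L <-> exists x, l x /\ toC X = nil_mx D v x 0.
Proof.
apply: vspace_of_pred; first by exists 0; rewrite nil_mx0 toC0.
move=> a X Y [x [lx XE]] [y [ly YE]]; exists ((a%:C)%C *: x + y).
split; first exact: llin.
by have := nil_mx_lin D v a x y 0 0; rewrite mulr0 addr0 toCD toCZ XE YE => ->.
Qed.

Variable L : {vspace cmat R N N}.
Hypothesis LE : forall X, X \in L <-> exists x, l x /\ toC X = nil_mx D v x 0.

Lemma horocycle_algebra_sub : (L <= root_space <[h]>%VS (alpha v w))%VS.
Proof.
by apply/subvP => X /LE [x [lx XE]]; apply/mem_root_alpha; exists x; split=> //; exact: lP.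
Qed.

Lemma image_root_alpha T :
  (fundamental_vector o @` [set` root_space <[h]>%VS (alpha v w)]) T <->
  exists x, perp2 D v w x /\ T = ofC (tvec x).
Proof.
split=> [[X /mem_root_alpha [x [xP XE]] <-]|[x [xP ->]]].
  by exists x; split=> //; exact: fundamental_vector_tvec.
exists (ofC (nil_mx D v x 0)); last by apply: fundamental_vector_tvec xP _; exact: ofCK.
by apply/mem_root_alpha; exists x; rewrite ofCK.
Qed.

Lemma image_horocycle_algebra T :
  (fundamental_vector o @` [set` L]) T <-> exists x, l x /\ T = ofC (tvec x).
Proof.
split=> [[X /LE [x [lx XE]] <-]|[x [lx ->]]].
  by exists x; split=> //; exact: (fundamental_vector_tvec (lP lx)).
exists (ofC (nil_mx D v x 0)); last by apply: fundamental_vector_tvec (lP lx) _; exact: ofCK.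
by apply/LE; exists x; rewrite ofCK.
Qed.

Lemma lagrangianN x : l x -> l (- x).
Proof. by move=> lx; have := llin (-1) lx l0; rewrite rmorphN1 scaleN1r addr0. Qed.

Lemma perp2_i x : perp2 D v w x -> perp2 D v w ('i%C *: x).
Proof. by move=> [vx wx]; split; rewrite ipZr ?vx ?wx mulr0. Qed.

Lemma ii_scale x : 'i%C *: ('i%C *: x) = - x.
Proof. by rewrite scalerA (@ii R) scaleN1r. Qed.

Lemma horocycle_lagrangian c : c < 0 ->
  lagrangian_in (@metric R (CH n c) o) (@cstr R (CH n c) o)
    (fundamental_vector o @` [set` root_space <[h]>%VS (alpha v w)])
    (fundamental_vector o @` [set` L]).
Proof.
move=> c0; have c4 : - (4 / c) != 0.
  by rewrite oppr_eq0 mulf_eq0 invr_eq0 pnatr_eq0 /= lt_eqF.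
split=> [T /image_horocycle_algebra [x [lx ->]]|].
  by apply/image_root_alpha; exists x; split=> //; exact: lP.
rewrite eqEsubset; split=> [T [X /image_horocycle_algebra [x [lx ->]] <-]|T [/image_root_alpha [y [yP ->]] yL]].
  rewrite (cstr_tvec c (lP lx)); split.
    by apply/image_root_alpha; exists ('i%C *: x); split=> //; exact/perp2_i/lP.
  move=> V /image_horocycle_algebra [x' [lx' ->]].
  rewrite (metric_tvec c (lP lx') (perp2_i (lP lx))).
  have := (proj2 lL) _ (perp2_i (lP lx)); rewrite ii_scale => -[_ /(_ (lagrangianN lx))].
  by move=> ->; rewrite ?mulr0.
have ly : l ('i%C *: y).
  apply/((proj2 lL) _ yP) => x lx; apply/eqP.
  have /eqP := yL (ofC (tvec x)) ((image_horocycle_algebra _).2 (ex_intro _ x (conj lx erefl))).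
  by rewrite (metric_tvec c (lP lx) yP) mulf_eq0 (negbTE c4).
exists (ofC (tvec (- ('i%C *: y)))).
  by apply/image_horocycle_algebra; eexists; split; last by []; exact: lagrangianN.
by rewrite (cstr_tvec c (lP (lagrangianN ly))) scalerN ii_scale opprK.
Qed.

Lemma lagrangian_ip_sym x y : l x -> l y -> ip x y = ip y x.
Proof.
move=> lx ly; have h0 := ((lagrangian_in_perpE lL (lP ly)).2 ly) _ lx.
by rewrite (ipC DH x y); apply/esym; exact: conj_Im0.
Qed.

Lemma nil_mx_split x s : nil_mx D v x 0 + nil_mx D v 0 s = nil_mx D v x s.
Proof.
by have := nil_mx_lin D v 1 x 0 0 s; rewrite rmorph1 !scale1r addr0 mulr0 add0r.
Qed.

Lemma mem_horocycle_group X : X \in (L + root_space <[h]>%VS (2 *: alpha v w))%VS <->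
  exists x s, l x /\ toC X = nil_mx D v x s.
Proof.
split=> [/memv_addP [Y /LE [x [lx YE]] [Z /mem_root_2alpha [s ZE] ->]]|[x [s [lx XE]]]].
  exists x, s; split; first exact: lx.
  exact: (etrans (toCD Y Z) (etrans (congr2 +%R YE ZE) (nil_mx_split x s))).
have -> : X = ofC (nil_mx D v x 0) + ofC (nil_mx D v 0 s).
  apply: toC_inj; rewrite XE -nil_mx_split.
  exact: (esym (etrans (toCD _ _) (congr2 +%R (ofCK _) (ofCK _)))).
apply: memv_add; first by apply/LE; exists x; rewrite ofCK.
exact: ((mem_root_2alpha (ofC (nil_mx D v 0 s))).2 (ex_intro _ s (ofCK _))).
Qed.

Lemma expm_horocycle x s : l x -> expm (nil_mx D v x s) = nil_exp (nil_mx D v x s).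
Proof. by move=> /lP xP; apply: expm_nil; exact: (nil_mx3 DH vw s s s xP xP xP). Qed.

(** Elements of [l] have real products, so the matrices of the algebra commute and a product of
    exponentials is the exponential of a sum. *)
Lemma horocycle_group : connected_subgroup (L + root_space <[h]>%VS (2 *: alpha v w))%VS =
  [set nil_exp A | A in [set A | exists x s, l x /\ A = nil_mx D v x s]].
Proof.
rewrite eqEsubset; split=> [_ [s sL <-]|_ [A [x [s [lx ->]]] <-]]; last first.
  exists [:: ofC (nil_mx D v x s)].
    by move=> X; rewrite inE => /eqP ->; apply/mem_horocycle_group; exists x, s; rewrite ofCK.
  by rewrite big_seq1 ofCK expm_horocycle.
elim: s sL => [|X s IH] sL.
  by rewrite big_nil; exists 0; [exists 0, 0; rewrite nil_mx0|exact: nil_exp0].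
have sub Y : Y \in s -> Y \in (L + root_space <[h]> (2 *: alpha v w))%VS.
  by move=> sY; apply: sL; rewrite inE sY orbT.
have [A [y [t [ly AE]]] prodE] := IH sub.
have /mem_horocycle_group [x [r [lx XE]]] := sL X (mem_head _ _).
rewrite big_cons -prodE AE XE (expm_horocycle _ lx).
exists (nil_mx D v x r + nil_mx D v y t).
  exists (x + y), (r + t); split; first by have := llin 1 lx ly; rewrite rmorph1 scale1r.
  by have := nil_mx_lin D v 1 x y r t; rewrite rmorph1 !scale1r mul1r => ->.
refine (nil_exp_group DH vw (lP lx) (lP ly) _).
rewrite (nil_mxM DH vw r t (lP lx) (lP ly)) (nil_mxM DH vw t r (lP ly) (lP lx)).
by rewrite (lagrangian_ip_sym lx ly).
Qed.
End Horocycles.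

Lemma horocycle_foliation (R : realType) (n : nat) (c : R) (v w : 'cV[R[i]]_n.+1)
    (l : 'cV[R[i]]_n.+1 -> Prop) : c < 0 -> null_frame (I1n R n) v w ->
  e0 = ((2^-1)%:C)%C *: v - w -> lagrangian_in_perp (I1n R n) v w l ->
  lagrangian_horocycle_foliation (n := n) (c := c)
    [set [set mx_act (nil_exp A) p |
             A in [set A | exists x s, l x /\ A = nil_mx (I1n R n) v x s]]
         | p in @pts R (CH n c)].
Proof.
move=> c0 vw r0E lL; have [L LE] := horocycle_algebra lL.
exists (ofC (proj (I1n R n) (-1) e0)), <[ofC (hmx v w)]>%VS, (alpha v w), L; split.
- apply/(ptsE (CH_line_form c0)); exists e0; split; first exact: unitv_e0.
  exact: ofCK.
- exact: hmx_maximal_abelian.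
- exact: hmx_root_decomposition.
- split; first exact: (horocycle_algebra_sub vw lL LE).
  exact: (horocycle_lagrangian vw r0E lL LE c0).
rewrite (horocycle_group vw lL LE).
by congr (image _ _); apply/funext => p; rewrite image_comp.
Qed.

End HorocycleFoliation.
Import HorocycleFoliation.

(** * Conclusion for projective and hyperbolic spaces *)

Module CurvedFoliations.

Lemma smooth_map_id (R : realType) (E : normedModType R) (A : set E) : smooth_map A (@id E).
Proof.
move=> a Aa; exists setT, id; split=> //; split; first exact: openT.
case=> [|k] /=; first by move=> x _; exact: cvg_id.
move=> v; split=> [x _|]; first exact: derivable_id.
apply: (Ck_ext (f := cst v)) => [|x _|]; [exact: openT| |exact/Ck_cst/openT].
by rewrite derive_id.
Qed.

Lemma congruent_refl (R : realType) (M : kahler R) (F : set (set (amb M))) :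
  holomorphically_congruent F F.
Proof.
exists id; split.
  exists id; split.
  - exact: smooth_map_id.
  - exact: smooth_map_id.
  - by [].
  - by [].
  - by [].
  - by [].
rewrite eqEsubset; split=> [_ [L FL <-]|L FL]; first by rewrite image_id.
by exists L => //; rewrite image_id.
Qed.

Lemma CP_no_lagrangian_foliation (R : realType) (n : nat) (c : R)
    (F : set (set (amb (CP n c)))) : (0 < n)%N -> 0 < c ->
  ~ homogeneous_lagrangian_foliation F.
Proof.
move=> n0 c0 [G [act [Gc actP _ act_lag]]].
have lf := @CP_line_form R n c c0.
have r01 : unitv (1%:M : 'M[R[i]]_n.+1) 1 (delta_mx 0 0).
  rewrite /unitv ip_1E big_ord_recl big1 ?addr0 => [|j _]; rewrite !mxE /=; last by rewrite mulr0.
  by rewrite rmorph1 mulr1.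
have LS := generator_lagrangian_family lf r01 actP act_lag.
have [e [eS _]] : exists e, common_eigen (generator 1%:M c act) e /\ (e^T <= (1%:M : 'M[R[i]]_n.+1))%MS.
  apply: (common_eigen_exists LS); first exact: oner_neq0.
  by move=> A _ x _; exact: submx1.
have [e0 _] := eS.
apply: (eigen_not_pos_vec lf LS _ eS); first by [].
rewrite /pos_vec mul1r Re_ip_1E; have [j ej] := cV_neq0 e0.
exact: (sum_normsq_gt0 (f := fun k => e k 0) ej).
Qed.

Lemma CH_lagrangian_foliation (R : realType) (n : nat) (c : R)
    (F : set (set (amb (CH n c)))) : (1 < n)%N -> c < 0 ->
  homogeneous_lagrangian_foliation F -> lagrangian_horocycle_foliation F.
Proof.
move=> n1 c0 [G [act [Gc actP -> act_lag]]].
have lf := @CH_line_form R n c c0.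
have r01 := @unitv_e0 R n.
have LS := generator_lagrangian_family lf r01 actP act_lag.
have [v [w [l [vw r0E lL SE]]]] := hyperbolic_structure lf r01 n1 LS.
rewrite (_ : [set _ | p in _] = [set [set mx_act (nil_exp A) p |
             A in [set A | exists x s, l x /\ A = nil_mx (I1n R n) v x s]]
         | p in @pts R (CH n c)]); first exact: horocycle_foliation c0 vw r0E lL.
have -> : [set A | exists x s, l x /\ A = nil_mx (I1n R n) v x s] = generator (I1n R n) c act.
  by apply/seteqP; split=> A /SE.
have orbE := act_orbit_nil lf vw r01 lL actP act_lag Gc SE.
rewrite eqEsubset; split=> [_ [p Mp <-]|_ [p Mp <-]]; exists p => //; rewrite -?orbE //; by rewrite orbE.
Qed.

End CurvedFoliations.
Import CurvedFoliations.

Module FlatIsometries.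

(** * Isometries of complex Euclidean space *)

Section RealInnerProduct.
Context {R : realType} {n : nat}.
Local Notation C := R[i].
Local Notation ip := (HermitianForms.ip (1%:M : 'M[C]_n)).
Implicit Types (x y z : 'cV[C]_n) (a : R).

Definition rip x y : R := complex.Re (ip x y).

Lemma id_herm : (1%:M : 'M[C]_n)^t* = 1%:M. Proof. exact: adj1. Qed.
Lemma rip_sym x y : rip x y = rip y x.
Proof. by rewrite /rip (ipC id_herm x y) Re_conj. Qed.
Lemma ripDl x y z : rip (x + y) z = rip x z + rip y z.
Proof. by rewrite /rip ipDl ReD. Qed.
Lemma ripDr x y z : rip x (y + z) = rip x y + rip x z.
Proof. by rewrite /rip ipDr ReD. Qed.
Lemma ripZl a x y : rip ((a%:C)%C *: x) y = a * rip x y.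
Proof. by rewrite /rip ipZl conj_real ReZ. Qed.
Lemma ripZr a x y : rip x ((a%:C)%C *: y) = a * rip x y.
Proof. by rewrite /rip ipZr ReZ. Qed.
Lemma ripNl x y : rip (- x) y = - rip x y.
Proof. by rewrite /rip ipNl ReN. Qed.
Lemma ripNr x y : rip x (- y) = - rip x y.
Proof. by rewrite /rip ipNr ReN. Qed.
Lemma ripBl x y z : rip (x - y) z = rip x z - rip y z.
Proof. by rewrite ripDl ripNl. Qed.
Lemma ripBr x y z : rip x (y - z) = rip x y - rip x z.
Proof. by rewrite ripDr ripNr. Qed.

Lemma rip_ge0 x : 0 <= rip x x.
Proof.
rewrite /rip /HermitianForms.ip mulmx1 mxE Re_sum; apply: sumr_ge0 => j _.
by rewrite adj_entry Re_conj_mul normsq_ge0.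
Qed.

Lemma rip_eq0 x : rip x x = 0 -> x = 0.
Proof.
rewrite /rip /HermitianForms.ip mulmx1 mxE Re_sum => /eqP; rewrite psumr_eq0 => [/allP h|j _]; last first.
  by rewrite adj_entry Re_conj_mul normsq_ge0.
apply/matrixP => i j; rewrite ord1 mxE; have := h i (mem_index_enum i).
by rewrite adj_entry Re_conj_mul => /eqP /normsq_eq0.
Qed.

Lemma rip_cauchy_schwarz x y : rip x y ^+ 2 <= rip x x * rip y y.
Proof.
have := rip_ge0 ((((rip y y)%:C)%C *: x) - ((rip x y)%:C)%C *: y).
rewrite ripBl !ripBr !ripZl !ripZr (rip_sym y x).
have := rip_ge0 y; have [y0|y0] := eqVneq (rip y y) 0.
  by move=> _ _; rewrite (rip_eq0 y0) /rip !ip0r /= expr0n mulr0.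
rewrite le_eqVlt eq_sym (negbTE y0) /=; move: (rip x x) (rip x y) (rip y y) => a b d d0 h.
have {}h : 0 <= d * (a * d - b ^+ 2) by apply: le_trans h _; rewrite le_eqVlt; apply/orP; left; apply/eqP; ring.
by rewrite -subr_ge0 -(pmulr_rge0 _ d0).
Qed.

Lemma rip_le x : forall e, rip e e ^+ 2 <= rip e e * rip x x -> rip e e <= rip x x.
Proof.
move=> e; have := rip_ge0 e; have := rip_ge0 x.
rewrite le_eqVlt => /orP[/eqP <- _|_].
  by rewrite mulr0 => h; apply: contraTT h; rewrite -!ltNge => h; rewrite exprn_gt0.
rewrite le_eqVlt => /orP[/eqP <- _|e0]; first exact: rip_ge0.
by rewrite expr2 ler_pM2l.
Qed.

End RealInnerProduct.

Lemma linear_matrix (R : realType) n (L : 'cV[R[i]]_n -> 'cV[R[i]]_n) : linear L ->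
  exists A : 'M[R[i]]_n, forall x, L x = A *m x.
Proof.
move=> Ll; pose L' : {linear 'cV[R[i]]_n -> 'cV[R[i]]_n} := HB.pack L (GRing.isLinear.Build _ _ _ _ L Ll).
exists (\matrix_(i, j) L (delta_mx j 0) i 0) => x.
rewrite -[L _]/(L' _) {1}[x]matrix_sum_delta linear_sum /=.
apply/matrixP => i j; rewrite ord1 summxE mxE; apply: eq_bigr => k _.
by rewrite big_ord1 -[L _]/(L' _) linearZ /= !mxE mulrC.
Qed.

Section FlatIsometry.
Context {R : realType} {n : nat}.
Local Notation C := R[i].
Local Notation M := (flat_space R n).
Local Notation cn := (coordinates_cmat n 1).
Implicit Types (p q u : cmat R n 1) (x y z : 'cV[C]_n).

Lemma flat_metric p u v : @metric R M p u v = rip (toC u) (toC v).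
Proof. by rewrite /= /rip /ip mulmx1 trace_mx11. Qed.

Opaque real_complex_def toC ofC HermitianForms.ip.

Lemma line_curve p u (t : R) : curve (@pts R M) (p + t *: u) (fun s => (p + t *: u) + s *: u).
Proof. exact: curve_line. Qed.

Lemma derive1_line p u : derive1 (fun s : R => p + s *: u) 0 = u.
Proof. rewrite derive1E; apply: derive_val; exact: is_derive_affine. Qed.

(** Along the segment from p to q, the product with e = f q - f p has derivative at most |e| |q -
    p|, so that |e|^2 <= |e| |q - p|. *)
Lemma flat_isometry_le (f : cmat R n 1 -> cmat R n 1) p q :
  smooth_map [set: cmat R n 1] f ->
  (forall p (gamma : R -> cmat R n 1), curve setT p gamma ->
     rip (toC (derive1 (f \o gamma) 0)) (toC (derive1 (f \o gamma) 0)) =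
     rip (toC (derive1 gamma 0)) (toC (derive1 gamma 0))) ->
  rip (toC (f q - f p)) (toC (f q - f p)) <= rip (toC (q - p)) (toC (q - p)).
Proof.
move=> fs fm; set u := q - p; set e := f q - f p.
pose g (t : R) := f (p + t *: u).
have gd (t : R) : is_derive t 1 g (derive1 (fun s : R => f ((p + t *: u) + s *: u)) 0).
  apply: is_derive_shift0.
  have := curve_is_derive (smooth_map_curve (B := setT) cn cn fs (fun q _ => I) (line_curve p u t)).
  apply: is_derive_ext => s /=; rewrite /g scalerDl addrA //.
set dg := fun t : R => derive1 (fun s : R => f ((p + t *: u) + s *: u)) 0 in gd.
have dgn t : rip (toC (dg t)) (toC (dg t)) = rip (toC u) (toC u).
  by have := fm _ _ (line_curve p u t); rewrite derive1_line.
have Ll : linear ((fun X : cmat R n 1 => rip (toC e) (toC X)) : cmat R n 1 -> R^o).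
  by move=> a X Y; rewrite (toCD (a *: X)) (toCZ a X) ripDr ripZr.
have fd (t : R) := is_derive_lin cn Ll (gd t).
have s0 : 0 <= Num.sqrt (rip (toC e) (toC e) * rip (toC u) (toC u)) by exact: sqrtr_ge0.
have fb (t : R) : `|rip (toC e) (toC (dg t))| <= Num.sqrt (rip (toC e) (toC e) * rip (toC u) (toC u)).
  apply: norm_le_sqr => //; rewrite sqr_sqrtr; last by apply: mulr_ge0; exact: rip_ge0.
  by rewrite -(dgn t); exact: rip_cauchy_schwarz.
have := MVT_norm0 (f := fun t => rip (toC e) (toC (g t))) ler01 fd fb.
have g1 : g 1 = f q by rewrite /g /u scale1r addrC subrK.
have g0 : g 0 = f p by rewrite /g scale0r addr0.
rewrite -ripBr -toCB mulr1 g1 g0 -/e => h.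
apply: rip_le; have h1 := le_trans (ler_norm _) h.
have := lerXn2r 2 (rip_ge0 (toC e)) s0 h1.
by rewrite sqr_sqrtr // mulr_ge0 ?rip_ge0.
Qed.

Lemma flat_isometry_norm (f f' : cmat R n 1 -> cmat R n 1) p q :
  holomorphic_isometry_with (M := M) (N := M) f f' ->
  rip (toC (f q - f p)) (toC (f q - f p)) = rip (toC (q - p)) (toC (q - p)).
Proof.
move=> fi.
have fm p' (gamma : R -> cmat R n 1) : curve setT p' gamma ->
     rip (toC (derive1 (f \o gamma) 0)) (toC (derive1 (f \o gamma) 0)) =
     rip (toC (derive1 gamma 0)) (toC (derive1 gamma 0)).
  move=> gc; have := hi_metric fi (p := p') I gc gc.
  by rewrite !flat_metric.
have fm' p' (gamma : R -> cmat R n 1) : curve setT p' gamma ->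
     rip (toC (derive1 (f' \o gamma) 0)) (toC (derive1 (f' \o gamma) 0)) =
     rip (toC (derive1 gamma 0)) (toC (derive1 gamma 0)).
  move=> gc; have := fm _ _ (smooth_map_curve (B := setT) cn cn (hi_inv_smooth fi) (fun q _ => I) gc).
  have -> : f \o (f' \o gamma) = gamma by apply/funext => t /=; rewrite (hi_inv fi I).2.
  by move=> E; exact: (esym E).
have ff' p' : f' (f p') = p' by exact: (hi_fun fi I).2.
apply/eqP; rewrite eq_le (flat_isometry_le _ _ (hi_smooth fi) fm) /=.
by have := flat_isometry_le (f p) (f q) (hi_inv_smooth fi) fm'; rewrite !ff'.
Qed.

(** After removal of [f 0], preservation of norms of differences gives preservation of real inner
    products, hence real linearity. The complex structure, tested along lines through 0, gives
    complex linearity. *)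
Lemma flat_isometry_affine (f f' : cmat R n 1 -> cmat R n 1) :
  holomorphic_isometry_with (M := M) (N := M) f f' ->
  exists U : 'M[C]_n, forall p, toC (f p) = U *m toC p + toC (f 0).
Proof.
move=> fi; pose L x := toC (f (ofC x)) - toC (f 0).
have Ln x y : rip (L x - L y) (L x - L y) = rip (x - y) (x - y).
  have := flat_isometry_norm (ofC y) (ofC x) fi.
  by rewrite !toCB !ofCK /L opprB addrA subrK.
have L0 : L 0 = 0 by rewrite /L ofC0 subrr.
have Lq x : rip (L x) (L x) = rip x x by have := Ln x 0; rewrite L0 !subr0.
have LE x : toC (f (ofC x)) = L x + toC (f 0) by rewrite /L subrK.
clearbody L.
have Lr x y : rip (L x) (L y) = rip x y.
  have := Ln x y; rewrite !ripBl !ripBr (Lq x) (Lq y) (rip_sym (L y) (L x)) (rip_sym y x).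
  by move: (rip (L x) (L y)) (rip x x) (rip y y) (rip x y) => a b d e h; lra.
have Llin (a : R) x y : L ((a%:C)%C *: x + y) = (a%:C)%C *: L x + L y.
  apply/eqP; rewrite -subr_eq0; apply/eqP; apply: rip_eq0.
  have E z : rip (L ((a%:C)%C *: x + y) - ((a%:C)%C *: L x + L y)) (L z) = 0.
    by rewrite ripBl ripDl ripZl !Lr ripDl ripZl subrr.
  by rewrite [X in rip _ X]/(_ - _) ripBr ripDr ripZr !E mulr0 addr0 subrr.
have LZ (a : R) x : L ((a%:C)%C *: x) = (a%:C)%C *: L x.
  by have := Llin a x 0; rewrite L0 !addr0.
have Lline x : derive1 (f \o (fun t : R => 0 + t *: ofC x)) 0 = ofC (L x).
  have -> : f \o (fun t : R => 0 + t *: ofC x) = (fun t : R => f 0 + t *: ofC (L x)).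
    apply/funext => t /=; apply: toC_inj; rewrite add0r -ofCZ LE LZ toCD toCZ ofCK.
    exact: addrC.
  exact: derive1_line.
have Li x : L ('i%C *: x) = 'i%C *: L x.
  have := hi_cstr fi (p := 0) I (curve_line 0 (ofC x)) (curve_line 0 (ofC ('i%C *: x))).
  rewrite !Lline !derive1_line /= !ofCK => /(_ erefl) /(congr1 (@toC R n 1)).
  by rewrite !ofCK.
have LD x y : L (x + y) = L x + L y.
  by have := Llin 1 x y; rewrite rmorph1 !scale1r.
have LC : linear L.
  move=> a x y; rewrite LD; congr (_ + _); rewrite [a in LHS]complexE scalerDl LD LZ.
  by rewrite -scalerA Li LZ [a in RHS]complexE scalerDl scalerA.
have [U UE] := linear_matrix LC.
by exists U => p; rewrite -{1}[p]toCK LE UE.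
Qed.

End FlatIsometry.

End FlatIsometries.
Import FlatIsometries.

Module FlatActions.

(** * Lagrangian foliations of complex Euclidean space *)

Lemma rip_entry (R : realType) n (x y : 'cV[R[i]]_n) : complex.Re ((x^t* *m y) 0 0) = rip x y.
Proof. by rewrite /rip /HermitianForms.ip mulmx1. Qed.

Opaque real_complex_def toC ofC HermitianForms.ip.

Lemma rip_ofC (R : realType) n (u v : cmat R n 1) :
  complex.Re (toC (ofC (toC (ofC ((toC u)^t*)) *m toC v)) 0 0) = rip (toC u) (toC v).
Proof. by rewrite !ofCK rip_entry. Qed.

Lemma rip_ofC2 (R : realType) n (u v u' v' : cmat R n 1) :
  complex.Re (toC (ofC (toC (ofC ((toC u)^t*)) *m toC v + toC (ofC ((toC u')^t*)) *m toC v')) 0 0) =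
  rip (toC u) (toC v) + rip (toC u') (toC v').
Proof. by rewrite !ofCK mxE ReD !rip_entry. Qed.


Lemma toC_affine (R : realType) n (a : R[i]) (p q r : cmat R n 1) :
  toC (ofC (a *: toC (p - q)) + (r - q)) = a *: (toC p - toC q) + (toC r - toC q).
Proof. by rewrite toCD ofCK !toCB. Qed.

Section FlatAction.
Context {R : realType} {n : nat}.
Local Notation C := R[i].
Local Notation M := (flat_space R n).
Local Notation cn := (coordinates_cmat n 1).
Local Notation ip := (HermitianForms.ip (1%:M : 'M[C]_n)).
Implicit Types (p q u : cmat R n 1) (x y z b e : 'cV[C]_n) (A B : 'M[C]_n).
Variables (G : lie_group R) (act : 'rV[R]_(lg_amb G) -> cmat R n 1 -> cmat R n 1).
Hypothesis actP : action_by_holomorphic_isometries (M := M) act.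

Lemma flat_act_affine g : lg_set g ->
  exists U : 'M[C]_n, forall p, toC (act g p) = U *m toC p + toC (act g 0).
Proof. by move=> /(act_isometry actP) [f' fi]; exact: (flat_isometry_affine fi). Qed.

Lemma flat_act_norm g p q : lg_set g ->
  rip (toC (act g q - act g p)) (toC (act g q - act g p)) = rip (toC (q - p)) (toC (q - p)).
Proof. by move=> /(act_isometry actP) [f' fi]; exact: flat_isometry_norm fi. Qed.

Lemma flat_act_is_derive gamma p : curve (@lg_set R G) (lg_one G) gamma ->
  is_derive (0 : R) 1 (fun t => act (gamma t) p) (derive1 (fun t => act (gamma t) p) 0).
Proof.
by move=> Gg; exact: (curve_is_derive (act_curve (M := M) cn actP Gg (p := p) I)).
Qed.

Lemma is_derive_rip (f g : R -> cmat R n 1) (t : R) df dg :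
  is_derive t 1 f df -> is_derive t 1 g dg ->
  is_derive t 1 (fun s => rip (toC (f s)) (toC (g s)))
    (rip (toC df) (toC (g t)) + rip (toC (f t)) (toC dg)).
Proof.
move=> fd gd.
have al : linear (fun X : cmat R n 1 => ofC ((toC X)^t*)).
  by move=> a X Y; rewrite (toCD (a *: X)) (toCZ a X) adjD adjZ conj_real ofCD ofCZ.
have := is_derive_cmatM (is_derive_lin cn al fd) gd.
have tl : linear ((fun X : cmat R 1 1 => complex.Re (toC X 0 0)) : cmat R 1 1 -> R^o).
  by move=> a X Y; rewrite (toCD (a *: X)) (toCZ a X) !mxE ReD ReZ.
move=> /(is_derive_lin (coordinates_cmat 1 1) tl).
by rewrite rip_ofC2; apply: is_derive_ext => s; exact: rip_ofC.
Qed.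

(** The velocity field [z |-> A *m z + b] of a curve of the group, with [A] skew for the real inner
    product. *)
Definition flat_generator A b :=
  (forall x, rip (A *m x) x = 0) /\ exists gamma, curve (@lg_set R G) (lg_one G) gamma /\
    forall p, is_derive (0 : R) 1 (fun t => act (gamma t) p) (ofC (A *m toC p + b)).

Lemma flat_action_generator gamma : curve (@lg_set R G) (lg_one G) gamma ->
  exists A b, flat_generator A b /\
    forall p, derive1 (fun t => act (gamma t) p) 0 = ofC (A *m toC p + b).
Proof.
move=> Gg; pose d p := derive1 (fun t => act (gamma t) p) 0.
have dP p : is_derive (0 : R) 1 (fun t => act (gamma t) p) (d p) := flat_act_is_derive p Gg.
have nearG := curve_near Gg.
have affine (a : C) x y : toC (d (ofC (a *: x + y))) - toC (d 0) =
    a *: (toC (d (ofC x)) - toC (d 0)) + (toC (d (ofC y)) - toC (d 0)).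
  have Ll : linear (fun X : cmat R n 1 => ofC (a *: toC X)).
    by move=> r X Y; rewrite (toCD (r *: X)) (toCZ r X) scalerDr scale_swap ofCD ofCZ.
  have dB p : is_derive (0 : R) 1 (fun t => act (gamma t) p - act (gamma t) 0) (d p - d 0).
    exact: (is_deriveB (dP p) (dP 0)).
  have d1 := is_deriveD (is_derive_lin cn Ll (dB (ofC x))) (dB (ofC y)).
  have d2 := dB (ofC (a *: x + y)).
  have E : d (ofC (a *: x + y)) - d 0 = ofC (a *: toC (d (ofC x) - d 0)) + (d (ofC y) - d 0).
    apply: is_derive_unique d2 _; apply: near_eq_is_derive d1.
    apply: filterS nearG => t Gt; have [U UE] := flat_act_affine Gt.
    transitivity (ofC (a *: toC (act (gamma t) (ofC x) - act (gamma t) 0)) +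
      (act (gamma t) (ofC y) - act (gamma t) 0)); first by [].
    have dd z : act (gamma t) (ofC z) - act (gamma t) 0 = ofC (U *m z).
      by apply: toC_inj; rewrite toCB UE !ofCK addrK.
    by rewrite !dd ofCK -ofCD mulmxDr scalemxAr.
  exact: (etrans (esym (toCB _ _)) (etrans (congr1 (@toC R n 1) E) (toC_affine a _ _ _))).
have [A AE] : exists A : 'M[C]_n, forall x, toC (d (ofC x)) - toC (d 0) = A *m x.
  exact: linear_matrix affine.
have dE p : d p = ofC (A *m toC p + toC (d 0)) by rewrite -AE subrK !toCK.
exists A, (toC (d 0)); split; last exact: dE.
split; last by exists gamma; split=> // p; rewrite -dE.
move=> x.
have dB : is_derive (0 : R) 1 (fun t => act (gamma t) (ofC x) - act (gamma t) 0) (d (ofC x) - d 0).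
  exact: (is_deriveB (dP (ofC x)) (dP 0)).
have d1 := is_derive_rip dB dB.
have g0 : gamma 0 = lg_one G by case: Gg.
rewrite g0 !(act_one actP I) subr0 toCB AE ofCK (rip_sym x) in d1.
have d2 : is_derive (0 : R) 1 (fun t => rip (toC (act (gamma t) (ofC x) - act (gamma t) 0))
    (toC (act (gamma t) (ofC x) - act (gamma t) 0))) 0.
  apply: near_eq_is_derive (is_derive_cst (rip x x : R^o) _ _).
  by apply: filterS nearG => t Gt; rewrite (flat_act_norm _ _ Gt) subr0 ofCK.
by have := is_derive_unique d1 d2; lra.
Qed.

Lemma flat_orbit_tangent p u : orbit_tangent (M := M) act p u <->
  exists A b, flat_generator A b /\ u = ofC (A *m toC p + b).
Proof.
split=> [[gamma Gg <-]|[A [b [[_ [gamma [Gg gd]]] ->]]]].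
  by have [A [b [Ab dE]]] := flat_action_generator Gg; exists A, b; split; last exact: dE.
exists gamma => //; rewrite derive1E; apply: derive_val; exact: gd.
Qed.

Hypothesis act_lagrangian : forall p,
  lagrangian_in (metric (k := M) p) (cstr (k := M) p) (tangent (@pts R M) p)
    (orbit_tangent (M := M) act p).

Lemma flat_tangent p u : tangent (@pts R M) p u.
Proof. by exists (fun t => p + t *: u); [exact: curve_line|exact: derive1_line]. Qed.

(* V_z = J V_z^perp at the point z, for V_z = {A z + b | (A, b) a generator}. *)
Lemma flat_lagrangian x y :
  (forall A b, flat_generator A b -> rip (A *m x + b) y = 0) <->
  exists A b, flat_generator A b /\ y = 'i%C *: (A *m x + b).
Proof.
have [_ /seteqP [h1 h2]] := act_lagrangian (ofC x); split=> [h|[A [b [Ab ->]]]].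
  have [|u /flat_orbit_tangent [A [b [Ab ->]]] uE] := h2 (ofC y).
    split; first exact: flat_tangent.
    move=> u /flat_orbit_tangent [A [b [Ab ->]]].
    by rewrite flat_metric !ofCK; exact: h.
  exists A, b; split=> //.
  by have := congr1 (@toC R n 1) uE; rewrite /= !ofCK.
move=> A' b' Ab'.
have [|_ /(_ (ofC (A' *m x + b')))] := h1 (ofC ('i%C *: (A *m x + b))).
  exists (ofC (A *m x + b)); last by rewrite /= ofCK.
  by apply/flat_orbit_tangent; exists A, b; rewrite ofCK.
rewrite flat_metric !ofCK; apply.
by apply/flat_orbit_tangent; exists A', b'; rewrite ofCK.
Qed.

End FlatAction.

End FlatActions.
Import FlatActions.

(** * Vanishing of the linear parts, and orbits as affine subspaces *)

Module FlatFoliations.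

Opaque real_complex_def toC ofC HermitianForms.ip.

Section SymplecticForm.
Context {R : realType} {n : nat}.
Implicit Types x y z : 'cV[R[i]]_n.

Definition om x y : R := rip x ('i%C *: y).

Lemma omDl x y z : om (x + y) z = om x z + om y z. Proof. exact: ripDl. Qed.
Lemma omNl x y : om (- x) y = - om x y. Proof. exact: ripNl. Qed.
Lemma omDr x y z : om x (y + z) = om x y + om x z.
Proof. by rewrite /om scalerDr ripDr. Qed.
Lemma omNr x y : om x (- y) = - om x y.
Proof. by rewrite /om scalerN ripNr. Qed.
Lemma omC x y : om y x = - om x y.
Proof.
rewrite /om /rip !ipZr (ipC id_herm x y); move: (HermitianForms.ip _ _ _) => [a b].
by rewrite !ReMi conjcE /= opprK.
Qed.
Lemma om_i x y : om x ('i%C *: y) = - rip x y.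
Proof. by rewrite /om scalerA (@ii R) scaleN1r ripNr. Qed.
Lemma omZr (a : R) x y : om x ((a%:C)%C *: y) = a * om x y.
Proof. by rewrite /om scale_swap ripZr. Qed.
Lemma om_nondeg y : (forall x, om x y = 0) -> y = 0.
Proof.
move=> /(_ ('i%C *: y)) /rip_eq0 /eqP.
by rewrite scaler_eq0 (negbTE (@i_neq0 R)) => /eqP.
Qed.

(** Used for two affine fields at x, - x and 0: the quadratic and linear parts in x of their
    symplectic product vanish separately. *)
Lemma om_split a b a' b' : om (a + b) (a' + b') = 0 -> om (- a + b) (- a' + b') = 0 ->
  om b b' = 0 -> om a a' = 0 /\ om a b' + om b a' = 0.
Proof.
rewrite !omDl !omDr !omNl !omNr opprK.
move: (om a a') (om a b') (om b a') (om b b') => p q r s h1 h2 h3.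
by split; lra.
Qed.

(** Polarisation makes [Q] self-adjoint for the symplectic form up to sign conventions; replacing a
    vector by i times it yields the real inner product. *)
Lemma om_sym_op (Q : 'M[R[i]]_n) : (forall x, om x (Q *m x) = 0) ->
  forall x y, rip x (Q *m y) = rip (Q *m x) y.
Proof.
move=> Qr x y.
have E z : om x (Q *m z) = om (Q *m x) z.
  have := Qr (x + z); rewrite mulmxDr omDl !omDr (Qr x) (Qr z) addr0 add0r.
  by rewrite (omC (Q *m x) z) => /eqP; rewrite subr_eq0 => /eqP.
by have := E ('i%C *: y); rewrite -scalemxAr !om_i => /oppr_inj.
Qed.
End SymplecticForm.
Opaque om.

Section AffineFamilies.
Context {R : realType} {n : nat}.
Local Notation C := R[i].
Local Notation ip := (HermitianForms.ip (1%:M : 'M[C]_n)).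
Implicit Types (x y z b e : 'cV[C]_n) (A B : 'M[C]_n).
Variable S : 'M[C]_n -> 'cV[C]_n -> Prop.
Hypothesis Sskew : forall A b, S A b -> forall x, rip (A *m x) x = 0.
Hypothesis Slag : forall x y, (forall A b, S A b -> rip (A *m x + b) y = 0) <->
  exists A b, S A b /\ y = 'i%C *: (A *m x + b).

Lemma skew_rip A b x y : S A b -> rip (A *m x) y = - rip x (A *m y).
Proof.
move=> SA; have := Sskew SA (x + y).
rewrite mulmxDr ripDl !ripDr (Sskew SA x) (Sskew SA y) addr0 add0r (rip_sym _ x).
by move/eqP; rewrite addr_eq0 => /eqP.
Qed.

Lemma affine_skew A b x y : S A b -> ip (A *m x) y = - ip x (A *m y).
Proof.
move=> SA; apply/eqP; rewrite -subr_eq0 opprK; apply/eqP; apply: complex_eq_Re.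
  by rewrite ReD; have := skew_rip x y SA; rewrite /rip => ->; rewrite addNr.
rewrite mulrDr -!ipZr ReD; have := skew_rip x ('i%C *: y) SA; rewrite /rip => ->.
by rewrite -scalemxAr addNr.
Qed.

Lemma affine_isotropic A b A' b' x : S A b -> S A' b' -> om (A *m x + b) (A' *m x + b') = 0.
Proof. by move=> SA SA'; apply: (Slag _ _).2 SA; exists A', b'. Qed.

Lemma affine_isotropic_split A b A' b' x : S A b -> S A' b' ->
  om (A *m x) (A' *m x) = 0 /\ om (A *m x) b' + om b (A' *m x) = 0.
Proof.
move=> SA SA'; apply: om_split; first exact: affine_isotropic.
  by have := affine_isotropic (- x) SA SA'; rewrite !mulmxN.
by have := affine_isotropic 0 SA SA'; rewrite !mulmx0 !add0r.
Qed.

Lemma skew_om A b x y : S A b -> om (A *m x) y = - om x (A *m y).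
Proof.
move=> SA; have := skew_rip x ('i%C *: y) SA; rewrite -scalemxAr; exact.
Qed.

(** The quadratic part of the isotropy condition makes A A' self-adjoint; the adjoint of A A' is A'
    A because both factors are skew. *)
Lemma affine_comm A b A' b' : S A b -> S A' b' -> A *m A' = A' *m A.
Proof.
move=> SA SA'; have H : forall x, om x ((A *m A') *m x) = 0.
  move=> x; have [h _] := affine_isotropic_split x SA SA'.
  by move: h; rewrite (skew_om _ _ SA) mulmxA => /eqP; rewrite oppr_eq0 => /eqP.
apply/eqP; rewrite -subr_eq0; apply/eqP; apply: outer_ext => y.
apply: rip_eq0; set z := {1}(_ *m y).
rewrite mulmxBl ripBr (om_sym_op H).
by rewrite -!mulmxA (skew_rip _ _ SA) (skew_rip _ _ SA') opprK subrr.
Qed.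

(** The linear part of the isotropy condition; [A *m b' - A' *m b] is the translation part of the
    bracket of the two fields. *)
Lemma affine_cross A b A' b' : S A b -> S A' b' -> A *m b' = A' *m b.
Proof.
move=> SA SA'; apply/eqP; rewrite -subr_eq0; apply/eqP; apply: om_nondeg => x.
have [_] := affine_isotropic_split x SA SA'.
rewrite (skew_om _ _ SA) (omC (A' *m x)) (skew_om _ _ SA') opprK omDr omNr.
by move: (om _ _) (om _ _) => p q; lra.
Qed.

(* An eigenvector e in the image of A0 has a nonzero eigenvalue for A0, so that
   A0 z + b0 is orthogonal to e at some point z of the line of e; there, all the
   A z + b are orthogonal to e, so that e itself has the form i (A z + b). *)
Lemma affine_linear_part0 A0 b0 : S A0 b0 -> A0 = 0.
Proof.
move=> S0; apply/eqP; apply: contraT => A00.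
have [|A [b SA] x /submxP [u xE]|A B [b SA] [b' SB]|e [e0 eU eS]] :=
    @common_eigenvector_in _ n (fun A => exists b, S A b) A0^T.
- by rewrite trmx_eq0.
- have -> : x = A0 *m u^T by apply: trmx_inj; rewrite xE trmx_mul trmxK.
  rewrite mulmxA (affine_comm SA S0) -mulmxA trmx_mul; exact: submxMl.
- exact: affine_comm SA SB.
have [y yE] : exists y, e = A0 *m y.
  by have [u uE] := submxP eU; exists u^T; apply: trmx_inj; rewrite uE trmx_mul trmxK.
have ee0 : ip e e != 0.
  apply: contra_neq e0 => ee; apply: rip_eq0; by rewrite /rip ee.
have imag A b a : S A b -> A *m e = a *: e -> Num.conj a = - a.
  move=> SA Ae; have := affine_skew e e SA; rewrite Ae ipZl ipZr -mulNr.
  by move=> /(mulIf ee0).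
have [a aE] := eS A0 (ex_intro _ b0 S0).
have a0 : a != 0.
  apply: contra_neq ee0 => a0; rewrite {1}yE (affine_skew _ _ S0) aE a0.
  by rewrite ipZr mul0r oppr0.
(* Solves [ip e (A0 *m z + b0) = 0] on the line of [e], where [A0] acts by the nonzero scalar
   [a]. *)
pose z := (- (ip e b0 / (a * ip e e))) *: e.
have ez A b : S A b -> ip e (A *m z + b) = 0.
  move=> SA; have [l lE] := eS A (ex_intro _ b SA).
  have E : a * ip e b = l * ip e b0.
    have := congr1 (ip e) (affine_cross S0 SA).
    rewrite -[LHS]opprK -[RHS]opprK -(affine_skew _ _ S0) -(affine_skew _ _ SA) aE lE !ipZl.
    by rewrite (imag _ _ _ S0 aE) (imag _ _ _ SA lE) !mulNr !opprK.
  rewrite /z -scalemxAr lE ipDr !ipZr; move: ee0 a0 E.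
  move: (ip e e) (ip e b0) (ip e b) => d p q d0 a0 E.
  have -> : q = l * p / a by rewrite -E mulrAC mulfV // mul1r.
  by field; rewrite d0 a0.
have [A [b [SA eE]]] : exists A b, S A b /\ e = 'i%C *: (A *m z + b).
  by apply/Slag => A b SA; rewrite rip_sym /rip ez.
by have := ee0; rewrite {2}eE ipZr (ez _ _ SA) mulr0 eqxx.
Qed.

(** With the linear parts gone, the Lagrangian condition at 0 says that the translation vectors are
    their own symplectic orthogonal; this is what makes them a real vector space. *)
Lemma translation_generators : exists V : {vspace cmat R n 1},
  [/\ forall u, u \in V <-> S 0 (toC u),
      forall A b, S A b -> A = 0,
      forall y, (forall b, S 0 b -> rip b y = 0) <-> exists b, S 0 b /\ y = 'i%C *: b &
      forall b, S 0 b <-> forall d, S 0 d -> om d b = 0].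
Proof.
have A0 A b : S A b -> A = 0 := @affine_linear_part0 A b.
have VL y : (forall b, S 0 b -> rip b y = 0) <-> exists b, S 0 b /\ y = 'i%C *: b.
  have := Slag 0 y; rewrite /=.
  have E A b : A *m 0 + b = b by rewrite mulmx0 add0r.
  move=> [h1 h2]; split=> [h|[b [Sb ->]] d Sd].
    have [A [b [SA yE]]] : exists A b, S A b /\ y = 'i%C *: (A *m 0 + b).
      by apply: h1 => A b SA; rewrite E; apply: h; rewrite -(A0 _ _ SA).
    by exists b; rewrite -{1}(A0 _ _ SA) -{2}(E A b).
  by have := (Slag 0 ('i%C *: b)).2 _ 0 d Sd; rewrite E; apply; exists 0, b; rewrite E.
have VE b : S 0 b <-> forall d, S 0 d -> om d b = 0.
  split=> [Sb d Sd|h]; first by apply: (VL ('i%C *: b)).2 Sd; exists b.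
  have [d [Sd]] := (VL ('i%C *: b)).1 h.
  by move=> /(scalerI (@i_neq0 R)) ->.
have [V Vm] : exists V : {vspace cmat R n 1}, forall u, u \in V <-> S 0 (toC u).
  apply: vspace_of_pred; first by rewrite toC0; apply/VE => d _; rewrite -[0](subrr 0) omDr omNr subrr.
  move=> a x y /VE Sx /VE Sy; apply/VE => d Sd; rewrite toCD toCZ omDr (Sy _ Sd) addr0.
  by rewrite omZr (Sx _ Sd) mulr0.
by exists V.
Qed.
End AffineFamilies.

Section FlatFoliation.
Context {R : realType} {n : nat}.
Local Notation C := R[i].
Local Notation M := (flat_space R n).
Local Notation cn := (coordinates_cmat n 1).
Implicit Types (p q u : cmat R n 1) (x y z b e : 'cV[C]_n) (A B : 'M[C]_n).
Variables (G : lie_group R) (act : 'rV[R]_(lg_amb G) -> cmat R n 1 -> cmat R n 1).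
Hypothesis actP : action_by_holomorphic_isometries (M := M) act.
Hypothesis Gc : connected (@lg_set R G).
Local Notation S := (flat_generator act).
Variable V : {vspace cmat R n 1}.
Hypotheses (VS : forall u, u \in V <-> S 0 (toC u)) (S0 : forall A b, S A b -> A = 0)
  (SE : forall b, S 0 b <-> forall d, S 0 d -> om d b = 0).

Lemma flat_generator_translation gamma p : curve (@lg_set R G) (lg_one G) gamma ->
  exists b, S 0 b /\ derive1 (fun t => act (gamma t) p) 0 = ofC b.
Proof.
move=> Gg; have [A [b [SA dE]]] := flat_action_generator actP Gg.
have A0 := S0 SA; rewrite A0 in SA dE.
by exists b; rewrite dE mul0mx add0r.
Qed.

(** For [d] in V, the function [om d] is constant along orbits, as V is isotropic. A displacement is
    therefore symplectically orthogonal to V, that is, in V. *)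
Lemma flat_act_increment g p : lg_set g -> act g p - p \in V.
Proof.
move=> Gx; apply/VS/SE => d Sd; rewrite toCB omDr omNr; apply/eqP; rewrite subr_eq0; apply/eqP.
apply: (@action_invariant R G M act actP Gc (fun q => om d (toC q)) _ g p Gx I).
move=> gamma q Gg _; have [b [Sb bE]] := flat_generator_translation q Gg.
have Ll : linear ((fun X : cmat R n 1 => om d (toC X)) : cmat R n 1 -> R^o).
  by move=> a X Y; rewrite (toCD (a *: X)) (toCZ a X) omDr omZr.
have := is_derive_lin cn Ll (flat_act_is_derive actP q Gg).
by rewrite bE ofCK ((SE b).1 Sb d Sd).
Qed.

(** The linear part U of an element satisfies U x - x in V for all x. These vectors form a set
    stable under i, while V meets i V only in 0. *)
Lemma flat_act_translation g p : lg_set g -> act g p = p + act g 0.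
Proof.
move=> Gx; have [U UE] := flat_act_affine actP Gx.
suff U1 x : U *m x = x by apply: toC_inj; rewrite UE U1 toCD.
have inV y : S 0 (U *m y - y).
  have : (act g (ofC y) - ofC y) - (act g 0 - 0) \in V.
    by apply: memvB; exact: flat_act_increment.
  by move/VS; rewrite subr0 !toCB UE ofCK addrAC addrK.
apply/eqP; rewrite -subr_eq0; apply/eqP; set xi := U *m x - x.
have := (SE xi).1 (inV x) ('i%C *: xi); rewrite /xi.
have -> : 'i%C *: (U *m x - x) = U *m ('i%C *: x) - 'i%C *: x.
  by rewrite scalerBr scalemxAr.
move=> /(_ (inV _)); rewrite -scalemxAr -scalerBr -/xi => h.
apply: rip_eq0; have := h; rewrite omC => /eqP; rewrite oppr_eq0 => /eqP.
by rewrite om_i => /eqP; rewrite oppr_eq0 => /eqP.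
Qed.

(** The coordinates of vectors realised as displacements of 0 are stable under addition and contain
    smooth curves with every basis velocity, so they fill the whole coordinate space. *)
Lemma flat_translation_in_act u : u \in V -> exists2 g, lg_set g & act g 0 = u.
Proof.
move=> uV; pose d := \dim V; pose b := vbasis V.
pose comb (x : 'rV[R]_d) : cmat R n 1 := \sum_i x 0 i *: b`_i.
have combD (x y : 'rV[R]_d) : comb (x + y) = comb x + comb y.
  by rewrite /comb -big_split; apply: eq_bigr => i _; rewrite mxE scalerDl.
have combK (X : cmat R n 1) : X \in V -> comb (\row_i coord b i X) = X.
  move=> XU; rewrite [RHS](coord_vbasis XU); apply: eq_bigr => i _.
  by rewrite mxE.
have comb0 : comb 0 = 0 by rewrite /comb big1 // => i _; rewrite mxE scale0r.
clearbody comb.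
pose H : set 'rV[R]_d := [set x | exists2 g, lg_set g & act g 0 = comb x].
suff : H (\row_i coord b i u) by move=> [g Gg]; rewrite combK //; exists g.
apply: additive_subgroup_full.
- by exists (lg_one G); [exact: lg_one_in|rewrite comb0 (act_one actP I)].
- move=> x y [g Gg gE] [h Gh hE]; exists (lg_mul g h); first exact: lg_mul_in.
  by rewrite (act_mul actP Gg Gh I) (flat_act_translation _ Gg) hE gE addrC combD.
move=> i; have bV : b`_i \in V by apply/vbasis_mem/mem_nth; rewrite size_tuple.
have [_ [gam [Gg gd]]] := (VS _).1 bV.
pose L (Q : cmat R n 1) : 'rV[R]_d := \row_j coord b j Q.
have LE Q j : L Q 0 j = coord b j Q by rewrite mxE.
have Llin : linear L.
  move=> a Q Q'; apply/rowP => j; rewrite LE [RHS]mxE [X in _ = X + _]mxE !LE.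
  by rewrite linearP.
exists (fun t => L (act (gam t) 0)); split.
  have [gam0 [U1 [U10 [U1o _] U1G]]] := Gg.
  have [_ [U2 [U20 [U2o U2s] _]]] := act_curve (M := M) cn actP Gg (p := 0) I.
  split.
    by rewrite gam0 (act_one actP I); have := Llin (-1) 0 0; rewrite !scaleN1r oppr0 add0r addNr.
  exists (U1 `&` U2); split=> //.
    split; first exact: openI.
    move=> m; apply: (Ck_lin cn) => //; first exact: openI.
    by apply: Ck_sub (U2s m) => t [].
  move=> t [/U1G Gt _]; exists (gam t) => //; rewrite combK //.
  by rewrite -[act _ _]subr0; exact: flat_act_increment.
have := is_derive_lin cn Llin (gd 0); rewrite mul0mx add0r toCK => Ld.
rewrite derive1E; have -> := derive_val (is_derive := Ld).
apply/rowP => j; rewrite LE [RHS]mxE eqxx /=.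
have bfree : free b by exact: basis_free (vbasisP V).
by rewrite coord_free // eq_sym.
Qed.

Lemma flat_orbit p : orbit_of (M := M) act p = [set p + u | u in [set` V]].
Proof.
rewrite eqEsubset; split=> [_ [g Gx <-]|_ [u uV <-]].
  by exists (act g p - p); [exact: flat_act_increment|rewrite addrC subrK].
have [g Gx <-] := flat_translation_in_act uV.
by exists g => //; exact: flat_act_translation.
Qed.
End FlatFoliation.

Lemma flat_lagrangian_foliation (R : realType) (n : nat) (F : set (set (amb (flat_space R n)))) :
  homogeneous_lagrangian_foliation F -> lagrangian_affine_subspace_foliation F.
Proof.
move=> [G [act [Gc actP -> act_lag]]].
have lag p := act_lag p I.
have Sskew A b (SA : flat_generator act A b) : forall x, rip (A *m x) x = 0 := proj1 SA.
have [V [VS S0 VL SE]] := translation_generators Sskew (flat_lagrangian actP lag).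
exists V; split.
  split=> [//|]; rewrite eqEsubset; split=> [_ [u /VS Su <-]|y [_ yV]].
    split=> // w /VS Sw; rewrite flat_metric /= ofCK.
    by apply: (VL _).2 Sw; exists (toC u).
  have [b Sb|b [Sb yE]] := (VL (toC y)).1 _.
    have := yV (ofC b); rewrite flat_metric ofCK; apply.
    by apply/VS; rewrite ofCK.
  exists (ofC b); first by apply/VS; rewrite ofCK.
  by apply: toC_inj; rewrite /= !ofCK.
congr (image _ _); apply/funext => p.
exact: (flat_orbit actP Gc VS S0 SE).
Qed.

End FlatFoliations.
Import FlatFoliations.

Theorem mainTheorem1 (R : realType) (n : nat) (c : R)
    (n_gt0 : (0 < n)%N) (n_gt1_hyperbolic : c < 0 -> (1 < n)%N)
    (F : set (set (amb (space_form n c)))) :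
  homogeneous_lagrangian_foliation F ->
  (exists F' : set (set (amb (flat_space R n))),
     lagrangian_affine_subspace_foliation F' /\
     holomorphically_congruent F F') \/
  (exists (c' : R) (F' : set (set (amb (CH n c')))),
     [/\ c' < 0, lagrangian_horocycle_foliation F' &
         holomorphically_congruent F F']).
Proof.
move: F; rewrite /space_form; case: (eqVneq c 0) => [_|c0] F FL.
  (* The foliation is itself a model, so the identity is the congruence; likewise in the hyperbolic
     case. *)
  left; exists F; split; [exact: flat_lagrangian_foliation | exact: congruent_refl].
move: F FL; case: (ltP 0 c) => [cpos|cle] F FL.
  by case: (CP_no_lagrangian_foliation n_gt0 cpos FL).
have cneg : c < 0 by rewrite lt_neqAle c0.
right; exists c, F; split=> //; last exact: congruent_refl.
exact: CH_lagrangian_foliation (n_gt1_hyperbolic cneg) cneg FL.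
Qed.
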